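(* Let $M\in\mathbb{Z}_{>0}$ and let $f:\mathbb{Z}\to\mathbb{C}$ be $M$-periodic. Suppose that either $\nu=0$ and $f$ is odd, or $\nu=1$ and $f$ is even. Let $\hat f=U_Mf$ be the Discrete Fourier Transform of $f$. If $f$ is an eigenvector of $U_M$, put $F:=f$ and $J:=\frac{\hat f}{f}=\pm i^{\nu+1}$ (the eigenvalue); otherwise put $$F:=\begin{pmatrix}f\\ \hat f\end{pmatrix},\qquad J:=\begin{pmatrix}0&1\\(-1)^{\nu+1}&0\end{pmatrix}.$$ For $\tau\in\mathbb{H}$ define the ''modular obstruction'' $$G_\pm(\tau):=\Theta(\tau;\nu,F)\pm i^\nu\Big(\frac{\tau}{i}\Big)^{-\frac12-\nu}J\,\Theta(-\tau^{-1};\nu,F)+\frac{M\langle F\rangle}{2\pi i\,\tau}.$$ Then $G_\pm$ can be written as the Borel–Laplace sum $\mathscr{S}^\theta\tilde\Theta(\tau;\nu,F)$, with $\theta=\frac\pi2-\varepsilon$ for $G_+$ and $\theta=\frac\pi2+\varepsilon$ for $G_-$ ($\varepsilon>0$ small), and thus, by varying $\theta$, extends analytically from $\mathbb{H}$ through the real semi-axis $\mathbb{R}_{>0}$ to the sector $-2\pi<\arg\tau<\pi$ for $G_+$, and through $e^{i\pi}\mathbb{R}_{>0}$ to the sector $0<\arg\tau<3\pi$ for $G_-$ (sectors of the Riemann surface of the logarithm), with $1$-Gevrey asymptotic expansion $\tilde\Theta(\tau;\nu,F)$ as $\tau\to0$.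
   Context: $\mathbb{H}=\{\operatorname{Im}\tau>0\}$, $0<\arg\tau<\pi$ on $\mathbb{H}$; powers of $\tau/i$ use $\arg(\tau/i)\in(-\frac\pi2,\frac\pi2)$. For an $M$-periodic $g:\mathbb{Z}\to\mathbb{C}$, $$\Theta(\tau;\nu,g)=\sum_{n\ge1}n^\nu g(n)e^{i\pi n^2\tau/M},\qquad \tilde\Theta(\tau;\nu,g)=\sum_{p\ge0}\frac1{p!}L(-2p-\nu,g)\Big(\frac{\pi i}{M}\Big)^p\tau^p,$$ with $L(s,g)$ the analytic continuation of $\sum_{n\ge1}g(n)n^{-s}$; $\langle g\rangle=\frac1M\sum_{\ell\bmod M}g(\ell)$; $(U_Mg)(n)=\frac1{\sqrt M}\sum_{\ell\bmod M}g(\ell)e^{-2\pi i\ell n/M}$. For vector-valued $F$, all of $\Theta(\tau;\nu,F)$, $\tilde\Theta(\tau;\nu,F)$, $\langle F\rangle$ are defined componentwise. For a formal series $\tilde\psi(\tau)=\sum_{p\ge0}c_p\tau^p$ let $\hat\psi(\xi)=\sum_{p\ge1}c_p\frac{\xi^{p-1}}{(p-1)!}$ and $\mathscr{S}^\theta\tilde\psi(\tau)=c_0+\int_0^{e^{i\theta}\infty}e^{-\xi/\tau}\hat\psi(\xi)\,d\xi$ for $\arg\tau\in(\theta-\frac\pi2,\theta+\frac\pi2)$. For $\tilde\psi=\tilde\Theta(\cdot;\nu,F)$ the function $\hat\psi$ has singular points only among $\frac{i\pi n^2}M$, $n\ge1$, so that the only singular direction is $\frac\pi2$ modulo $2\pi$,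 and the sums $\mathscr{S}^\theta$ for $\theta$ in an interval free of singular directions are analytic continuations of one another; for $\tau\in\mathbb{H}$, $\mathscr{S}^{\frac\pi2\mp\varepsilon}$ is evaluated with any $\varepsilon>0$ small enough that $\tau$ lies in the corresponding half-plane. A function $G$ has $1$-Gevrey asymptotic expansion $\sum c_p\tau^p$ in a sector if for every closed subsector there are $A,B,r>0$ such that $\big|G(\tau)-\sum_{p=0}^{N-1}c_p\tau^p\big|\le A\,B^NN!\,|\tau|^N$ for all $N\ge0$ and all $\tau$ in the subsector with $0<|\tau|<r$. *)

(* Defs.v *)
From Stdlib Require Import Reals ZArith ClassicalEpsilon.
From Coquelicot Require Import Coquelicot.

Open Scope R_scope.
Open Scope C_scope.

Definition cexp (z : C) : C := (exp (Re z) * cos (Im z), exp (Re z) * sin (Im z))%R.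

(* Sum of a k over k < n; Coquelicot's sum_n has one more term. *)
Definition Csum (a : nat -> C) (n : nat) : C :=
  match n with O => 0 | S m => sum_n a m end.

Definition CSeries (a : nat -> C) : C :=
  (Series (fun k => Re (a k)), Series (fun k => Im (a k))).

Definition analytic_at (G : C -> C) (z0 : C) : Prop :=
  exists (a : nat -> C) (r : R), (0 < r)%R /\
    forall z : C, (Cmod (z - z0) < r)%R ->
      is_pseries (K := C_AbsRing) (V := C_NormedModule) a (z - z0) (G z).

Definition periodic (M : nat) (g : Z -> C) : Prop :=
  forall n : Z, g (n + Z.of_nat M)%Z = g n.
Definition odd_fun (g : Z -> C) : Prop := forall n : Z, g (- n)%Z = - g n.
Definition even_fun (g : Z -> C) : Prop := forall n : Z, g (- n)%Z = g n.

Definition mean (M : nat) (g : Z -> C) : C :=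
  Csum (fun l => g (Z.of_nat l)) M / INR M.

Definition DFT (M : nat) (g : Z -> C) (n : Z) : C :=
  / sqrt (INR M) *
  Csum (fun l => g (Z.of_nat l) * cexp (- (2 * PI * Ci * INR l * IZR n / INR M))) M.

Definition is_eigenvector (M : nat) (g : Z -> C) (lam : C) : Prop :=
  (exists n : Z, g n <> 0) /\ forall n : Z, DFT M g n = lam * g n.

(* For M-periodic g the Dirichlet series converges absolutely for Re s > 1 and
   has exactly one continuation to C minus the possible pole s = 1; the value
   of Lfun g at 1 is irrelevant. *)
Definition is_L_continuation (g : Z -> C) (L : C -> C) : Prop :=
  (forall s : C, s <> 1 -> analytic_at L s) /\
  (forall s : C, (1 < Re s)%R ->
    is_series (K := C_AbsRing) (V := C_NormedModule)
      (fun k => g (Z.of_nat (S k)) * cexp (- s * ln (INR (S k)))) (L s)).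

Definition Lfun (g : Z -> C) : C -> C :=
  epsilon (inhabits (fun _ : C => RtoC 0)) (is_L_continuation g).

(* The summation index n >= 1 is n = S k. *)
Definition Theta (M nu : nat) (g : Z -> C) (tau : C) : C :=
  CSeries (fun k =>
    RtoC (INR (S k)) ^ nu * g (Z.of_nat (S k)) *
    cexp (Ci * PI * RtoC (INR (S k)) ^ 2 * tau / INR M)).

Definition Theta_tilde (M nu : nat) (g : Z -> C) (p : nat) : C :=
  / INR (fact p) * Lfun g (- (2 * INR p + INR nu)) * (PI * Ci / INR M) ^ p.

(* A point tau of the Riemann surface of the logarithm is represented by
   zeta = log tau: its projection to C is cexp zeta, its argument is Im zeta,
   and a function is analytic in tau iff it is analytic in zeta. *)

Definition argH (tau : C) : R := acos (Re tau / Cmod tau).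

(* Branch with argument in (0, PI), meaningful for 0 < Im tau only. *)
Definition logH (tau : C) : C := (ln (Cmod tau), argH tau).

(* (tau / i)^s for tau in the upper half-plane, with arg (tau / i) = arg tau - PI/2. *)
Definition powH (tau s : C) : C := cexp (s * (logH tau - Ci * PI / 2)).

Definition obstruction (sgn : C) (M nu d : nat) (F : nat -> Z -> C)
    (J : nat -> nat -> C) (j : nat) (tau : C) : C :=
  Theta M nu (F j) tau
  + sgn * Ci ^ nu * powH tau (- (1 / 2) - INR nu)
    * Csum (fun k => J j k * Theta M nu (F k) (- / tau)) d
  + INR M * mean M (F j) / (2 * PI * Ci * tau).

(* Components of F and entries of J are indexed from 0 to d - 1. *)
Inductive theta_data (M nu : nat) (f : Z -> C) :
    forall (d : nat) (F : nat -> Z -> C) (J : nat -> nat -> C), Prop :=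
| theta_data_eigen (lam : C) :
    is_eigenvector M f lam ->
    theta_data M nu f 1 (fun _ => f) (fun _ _ => lam)
| theta_data_pair :
    ~ (exists lam : C, is_eigenvector M f lam) ->
    theta_data M nu f 2
      (fun j => match j with O => f | _ => DFT M f end)
      (fun j k => match j, k with
                  | O, S O => 1
                  | S O, O => RtoC (- 1) ^ S nu
                  | _, _ => 0
                  end).

(* The Borel-Laplace sum in the direction theta of the formal series with
   coefficients c, at the point zeta = log tau, is defined and equals v. Here
   phi continues the (convergent) Borel transform of the series from 0 along
   the ray of direction theta; it is determined on that ray by its germ at 0. *)
Definition is_borel_laplace (c : nat -> C) (theta : R) (zeta v : C) : Prop :=
  (theta - PI / 2 < Im zeta < theta + PI / 2)%R /\
  exists (phi : C -> C) (I : C),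
    (exists r : R, (0 < r)%R /\
      forall xi : C, (Cmod xi < r)%R ->
        is_pseries (K := C_AbsRing) (V := C_NormedModule)
          (fun q => c (S q) / INR (fact q)) xi (phi xi)) /\
    (forall t : R, (0 <= t)%R -> analytic_at phi (t * cexp (Ci * theta))) /\
    is_RInt_gen (V := C_R_NormedModule)
      (fun t : R => cexp (- (t * cexp (Ci * theta)) / cexp zeta)
                    * phi (t * cexp (Ci * theta)) * cexp (Ci * theta))
      (at_point 0%R) (Rbar_locally p_infty) I /\
    v = c O + I.

Definition analytic_in_sector (alpha beta : R) (G : C -> C) : Prop :=
  forall zeta : C, (alpha < Im zeta < beta)%R -> analytic_at G zeta.

Definition gevrey1_in_sector (alpha beta : R) (G : C -> C) (c : nat -> C) : Prop :=
  forall a b : R, (alpha < a)%R -> (b < beta)%R ->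
  exists A B r : R, (0 < A)%R /\ (0 < B)%R /\ (0 < r)%R /\
    forall (N : nat) (zeta : C),
      (a <= Im zeta <= b)%R -> (Cmod (cexp zeta) < r)%R ->
      (Cmod (G zeta - Csum (fun p => (c p * cexp zeta ^ p)%C) N)
        <= A * B ^ N * INR (fact N) * Cmod (cexp zeta) ^ N)%R.

(* G, given on the upper half-plane, extends analytically to the sector
   alpha < arg tau < beta, where it is given by the Borel-Laplace sums of c in
   the directions theta1 < theta < theta2 and is 1-Gevrey asymptotic to c. *)
Definition borel_laplace_extension (theta1 theta2 alpha beta : R)
    (G : C -> C) (c : nat -> C) : Prop :=
  exists Gext : C -> C,
    analytic_in_sector alpha beta Gext /\
    (forall tau : C, (0 < Im tau)%R -> Gext (logH tau) = G tau) /\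
    (forall (theta : R) (zeta : C),
      (theta1 < theta < theta2)%R ->
      (theta - PI / 2 < Im zeta < theta + PI / 2)%R ->
      is_borel_laplace c theta zeta (Gext zeta)) /\
    gevrey1_in_sector alpha beta Gext c.

(* Main.v *)
(* By Euler-Maclaurin summation over residue classes mod M and the Fourier series of the Bernoulli
   polynomial B_2, Theta(tau; nu, g) plus its pole is L(-nu, g) plus a series over k >= 1 of the Fourier
   coefficients of g times half-line Gaussian integrals V_+(k), V_-(k) with frequencies k and -k. By the
   full-line Gaussian integral, the k-th term of Theta(-1/tau; nu, U_M g) in the modular obstruction is the
   combination of V_+(k) and V_-(k) that leaves only V_+(k) in G_+ and only V_-(k) in G_-. Each V_+-(k)
   solves the same first order inhomogeneous equation in s = pi k^2 / (M tau) as the Laplace transform of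
   (1 + i xi)^(-1/2) along a ray to the right or left of the singular point xi = i, hence equals it. Summing
   over k, G_+ and G_- are the Laplace transforms of
     phi(xi) = sum_k D_k (1 + i xi / alpha_k)^(-nu-3/2),   alpha_k = pi k^2 / M,
   on the two sides of the singular direction; phi is bounded on closed sectors avoiding that direction and its
   Taylor coefficients are identified with the values L(-2p-nu, g), again through the Fourier series of the
   Bernoulli polynomials. *)
Require Import Defs.
From Stdlib Require Import Reals ZArith Lra Lia Psatz Classical ClassicalEpsilon FunctionalExtensionality.
From Coquelicot Require Import Coquelicot.
Open Scope R_scope.
Open Scope C_scope.

(** Two identifications carry the proof: Gaussian integrals with Laplace integrals, and Laplace
    integrals in different directions with each other. Both rest on one uniqueness argument for s L'
    + (1/2 + i s) L = i, in place of contour deformation: for two solutions, s exp(2 i s) times the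
    squared difference is constant, and it tends to 0 along a path to infinity on which the
    exponential stays bounded and each solution is O(1/|s|). Higher exponents follow by a recursion.
    Euler-Maclaurin is taken to second order because the Fourier series of B_2 converges absolutely,
    so that every interchange is dominated. Parity enters twice: it merges the frequencies k and -k,
    and the sign (-1)^(m+1) of B_(m+1) agrees with (-1)^(nu+1) at m = 2p + nu, so that the values
    L(-2p-nu, g) have the matching Fourier form. [Lfun] is known only through [is_L_continuation]:
    an explicit continuation and the identity theorem come before any of its values. G_- is brought
    to the sheet of G_+ by a full turn. *)

Notation is_cseries := (is_series (K := C_AbsRing) (V := C_NormedModule)).

(* The carriers of equations produced by Coquelicot are structure projections, at which [ring] fails. *)
Ltac rring := cbv beta; match goal with |- @eq _ ?a ?b => change (@eq R a b) end; ring.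
Ltac cring := cbv beta; match goal with |- @eq _ ?a ?b => change (@eq C a b) end; ring.

(** * Complex numbers and series *)

Lemma Ceq (z w : C) : Re z = Re w -> Im z = Im w -> z = w.
Proof. destruct z, w; simpl; intros; subst; reflexivity. Qed.

Lemma im_le_Cmod (z : C) : (Rabs (Im z) <= Cmod z)%R.
Proof.
apply Rle_trans with (Rmax (Rabs (fst z)) (Rabs (snd z))); [apply Rmax_r | apply Rmax_Cmod].
Qed.

Lemma Re_mult (z w : C) : Re (z * w) = (Re z * Re w - Im z * Im w)%R.
Proof. destruct z, w; reflexivity. Qed.
Lemma Im_mult (z w : C) : Im (z * w) = (Re z * Im w + Im z * Re w)%R.
Proof. destruct z, w; reflexivity. Qed.
Lemma Re_plus (z w : C) : Re (z + w) = (Re z + Re w)%R.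
Proof. destruct z, w; reflexivity. Qed.
Lemma Im_plus (z w : C) : Im (z + w) = (Im z + Im w)%R.
Proof. destruct z, w; reflexivity. Qed.
Lemma Re_opp (z : C) : Re (- z) = (- Re z)%R.
Proof. destruct z; reflexivity. Qed.
Lemma Im_opp (z : C) : Im (- z) = (- Im z)%R.
Proof. destruct z; reflexivity. Qed.
Lemma Re_RtoC (x : R) : Re (RtoC x) = x. Proof. reflexivity. Qed.
Lemma Im_RtoC (x : R) : Im (RtoC x) = 0%R. Proof. reflexivity. Qed.
Lemma Re_Ci : Re Ci = 0%R. Proof. reflexivity. Qed.
Lemma Im_Ci : Im Ci = 1%R. Proof. reflexivity. Qed.
Lemma Re_minus (z w : C) : Re (z - w) = (Re z - Re w)%R.
Proof. destruct z, w; reflexivity. Qed.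
Lemma Im_minus (z w : C) : Im (z - w) = (Im z - Im w)%R.
Proof. destruct z, w; reflexivity. Qed.

Ltac reim := rewrite ?Re_mult, ?Im_mult, ?Re_plus, ?Im_plus, ?Re_minus, ?Im_minus,
  ?Re_opp, ?Im_opp, ?Re_mult, ?Im_mult, ?Re_plus, ?Im_plus, ?Re_minus, ?Im_minus,
  ?Re_opp, ?Im_opp, ?Re_mult, ?Im_mult, ?Re_plus, ?Im_plus,
  ?Re_RtoC, ?Im_RtoC, ?Re_Ci, ?Im_Ci.

Lemma Cmod_le_ReIm (z : C) : (Cmod z <= Rabs (Re z) + Rabs (Im z))%R.
Proof.
replace z with (RtoC (Re z) + Ci * RtoC (Im z)).
2:{ apply Ceq; reim; ring. }
eapply Rle_trans; [apply Cmod_triangle|].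
rewrite Cmod_mult, Cmod_Ci, !Cmod_R.
replace (Re (RtoC (Re z) + Ci * RtoC (Im z))) with (Re z) by (reim; ring).
replace (Im (RtoC (Re z) + Ci * RtoC (Im z))) with (Im z) by (reim; ring). lra.
Qed.

Lemma Cmod_RtoC_pos (x : R) : (0 <= x)%R -> Cmod (RtoC x) = x.
Proof. intros; rewrite Cmod_R; now apply Rabs_pos_eq. Qed.

Lemma Cmod_minus_sym (z w : C) : Cmod (z - w) = Cmod (w - z).
Proof. replace (z - w) with (- (w - z)) by ring. apply Cmod_opp. Qed.

Lemma Cmod_triangle_minus (z w : C) : (Cmod (z - w) <= Cmod z + Cmod w)%R.
Proof. unfold Cminus. eapply Rle_trans; [apply Cmod_triangle|]. rewrite Cmod_opp; lra. Qed.

Lemma Cmod_triangle_inv (z w : C) : (Cmod z - Cmod w <= Cmod (z + w))%R.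
Proof.
assert (H := Cmod_triangle (z + w) (- w)). rewrite Cmod_opp in H.
replace (z + w + - w) with z in H by ring. lra.
Qed.

Lemma RtoC_neq0 (x : R) : x <> 0%R -> RtoC x <> 0.
Proof. intros H E; apply H. now apply RtoC_inj. Qed.

Lemma Ci_neq0 : Ci <> 0.
Proof. intros E. apply (f_equal Im) in E. simpl in E. lra. Qed.

Lemma Ci2 : Ci * Ci = - (1).
Proof. apply Ceq; simpl; ring. Qed.

Lemma Cmod_sqr (z : C) : (Cmod z * Cmod z = Re z * Re z + Im z * Im z)%R.
Proof. assert (H := Cmod2_alt z). simpl in H. lra. Qed.

Lemma Cmod_inv_le (z : C) (d : R) : (0 < d)%R -> (d <= Cmod z)%R -> (Cmod (/ z) <= / d)%R.
Proof.
intros Hd H. rewrite Cmod_inv. apply Rinv_le_contravar; lra.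
intros E; rewrite E, Cmod_0 in H; lra.
Qed.

Lemma Re_gt0_neq0 (z : C) : (0 < Re z)%R -> z <> 0.
Proof. intros H E. rewrite E in H. simpl in H. lra. Qed.
Lemma Im_gt0_neq0 (z : C) : (0 < Im z)%R -> z <> 0.
Proof. intros H E. rewrite E in H. simpl in H. lra. Qed.

Lemma cexp_add (z w : C) : cexp (z + w) = cexp z * cexp w.
Proof.
unfold cexp. apply Ceq; reim; simpl; rewrite exp_plus, ?cos_plus, ?sin_plus; ring.
Qed.
Lemma cexp_0 : cexp 0 = 1.
Proof. unfold cexp; simpl. rewrite exp_0, cos_0, sin_0. apply Ceq; simpl; ring. Qed.
Lemma Cmod_cexp (z : C) : Cmod (cexp z) = exp (Re z).
Proof.
unfold Cmod, cexp; simpl.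
match goal with |- sqrt ?x = _ => replace x with (exp (Re z) * exp (Re z))%R end.
apply sqrt_square; left; apply exp_pos.
assert (H := sin2_cos2 (Im z)). unfold Rsqr in H.
transitivity (exp (Re z) * exp (Re z) * (sin (Im z) * sin (Im z) + cos (Im z) * cos (Im z)))%R.
rewrite H; ring. ring.
Qed.
Lemma cexp_neq0 (z : C) : cexp z <> 0.
Proof. apply Cmod_gt_0. rewrite Cmod_cexp. apply exp_pos. Qed.
Lemma cexp_opp (z : C) : cexp (- z) = / cexp z.
Proof.
assert (H : cexp z * cexp (- z) = 1) by (rewrite <- cexp_add, <- cexp_0; f_equal; ring).
assert (N := cexp_neq0 z).
replace (cexp (-z)) with (/ cexp z * (cexp z * cexp (- z))) by (field; auto). rewrite H; ring.
Qed.
Lemma cexp_RtoC (x : R) : cexp (RtoC x) = RtoC (exp x).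
Proof. unfold cexp; simpl. rewrite cos_0, sin_0. apply Ceq; simpl; ring. Qed.
Lemma cexp_Ci (x : R) : cexp (Ci * RtoC x) = (cos x, sin x).
Proof.
unfold cexp; simpl. replace (0 * x - 1 * 0)%R with 0%R by ring. replace (0 * 0 + 1 * x)%R with x by ring.
rewrite exp_0. apply Ceq; simpl; ring.
Qed.
Lemma cexp_pow (z : C) (n : nat) : cexp z ^ n = cexp (INR n * z).
Proof.
induction n. simpl. rewrite <- cexp_0. f_equal; ring.
rewrite Cpow_S, IHn, S_INR, <- cexp_add. f_equal. rewrite RtoC_plus. ring.
Qed.
Lemma cexp_2PI (n : Z) : cexp (2 * PI * Ci * IZR n) = 1.
Proof.
assert (P : forall n : nat, cexp (2 * PI * Ci * INR n) = 1).
{ intros k. replace (2 * PI * Ci * INR k) with (INR k * (Ci * RtoC (2 * PI))) by (rewrite RtoC_mult; ring).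
  rewrite <- cexp_pow, cexp_Ci, cos_2PI, sin_2PI. apply Cpow_1_l. }
destruct n as [|p|p]. rewrite <- cexp_0; f_equal; ring.
rewrite <- (P (Pos.to_nat p)). now rewrite INR_IZR_INZ, positive_nat_Z.
replace (2 * PI * Ci * IZR (Z.neg p)) with (- (2 * PI * Ci * INR (Pos.to_nat p))).
rewrite cexp_opp, P. field.
rewrite INR_IZR_INZ, positive_nat_Z, <- Pos2Z.opp_pos, opp_IZR, RtoC_opp. ring.
Qed.

Lemma is_series_C (a : nat -> C) (l : C) :
  is_cseries a l <->
  is_series (fun n => Re (a n)) (Re l) /\ is_series (fun n => Im (a n)) (Im l).
Proof.
assert (SR : forall n, Re (sum_n (G := C_AbelianMonoid) a n) = sum_n (fun k => Re (a k)) n).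
{ induction n. now rewrite !sum_O. rewrite !sum_Sn, <- IHn. reflexivity. }
assert (SI : forall n, Im (sum_n (G := C_AbelianMonoid) a n) = sum_n (fun k => Im (a k)) n).
{ induction n. now rewrite !sum_O. rewrite !sum_Sn, <- IHn. reflexivity. }
unfold is_series. split.
- intros H. split; apply filterlim_locally; intros eps;
  assert (H' := proj1 (filterlim_locally _ _) H eps); revert H'; apply filter_imp; intros n [H1 H2].
  rewrite <- SR; exact H1. rewrite <- SI; exact H2.
- intros [H1 H2]. apply filterlim_locally; intros eps.
  assert (H1' := proj1 (filterlim_locally _ _) H1 eps). assert (H2' := proj1 (filterlim_locally _ _) H2 eps).
  generalize (filter_and _ _ H1' H2'). apply filter_imp. intros n [A B].
  rewrite <- SR in A. rewrite <- SI in B. split; assumption.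
Qed.

Lemma CSeries_unique (a : nat -> C) (l : C) :
  is_cseries a l -> CSeries a = l.
Proof.
intros H. apply is_series_C in H. destruct H as [A B].
unfold CSeries. rewrite (is_series_unique _ _ A), (is_series_unique _ _ B). now destruct l.
Qed.

Definition summ (a : nat -> C) := ex_series (fun n => Cmod (a n)).

Lemma summ_le (a : nat -> C) (w : nat -> R) :
  (forall n, (Cmod (a n) <= w n)%R) -> ex_series w -> summ a.
Proof.
intros H S. apply (@ex_series_le R_AbsRing R_CompleteNormedModule _ w); auto.
intros n. unfold norm; simpl. unfold abs; simpl. rewrite Rabs_pos_eq; auto. apply Cmod_ge_0.
Qed.

Lemma CSeries_correct (a : nat -> C) : summ a ->
  is_cseries a (CSeries a).
Proof.
intros S. apply is_series_C. simpl. split; apply Series_correct;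
(apply (@ex_series_le R_AbsRing R_CompleteNormedModule _ (fun n => Cmod (a n))); auto; intros n;
unfold norm; simpl; unfold abs; simpl). apply re_le_Cmod. apply im_le_Cmod.
Qed.

Lemma CSeries_ext (a b : nat -> C) : (forall n, a n = b n) -> CSeries a = CSeries b.
Proof. intros H. unfold CSeries. f_equal; apply Series_ext; intros n; now rewrite H. Qed.

Lemma CSeries_plus (a b : nat -> C) : summ a -> summ b ->
  CSeries (fun n => a n + b n) = CSeries a + CSeries b.
Proof.
intros A B. apply CSeries_unique. apply (is_series_plus (K := C_AbsRing) (V := C_NormedModule)); now apply CSeries_correct.
Qed.
Lemma CSeries_scal (c : C) (a : nat -> C) : summ a ->
  CSeries (fun n => c * a n) = c * CSeries a.
Proof.
intros A. apply CSeries_unique. apply (is_series_scal (K := C_AbsRing) (V := C_NormedModule)); now apply CSeries_correct.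
Qed.
Lemma summ_plus (a b : nat -> C) : summ a -> summ b -> summ (fun n => a n + b n).
Proof.
intros A B. apply summ_le with (fun n => Cmod (a n) + Cmod (b n))%R.
intros; apply Cmod_triangle. apply (ex_series_plus (K := R_AbsRing) (V := R_NormedModule)); assumption.
Qed.
Lemma summ_ext (a b : nat -> C) : (forall n, a n = b n) -> summ a -> summ b.
Proof. intros H. apply ex_series_ext. intros; now rewrite H. Qed.

Lemma sum_n_Cmod (a : nat -> C) (n : nat) :
  (Cmod (sum_n (G := C_AbelianMonoid) a n) <= sum_n (fun k => Cmod (a k)) n)%R.
Proof.
induction n. rewrite !sum_O; apply Rle_refl. rewrite !sum_Sn.
eapply Rle_trans; [apply Cmod_triangle|]. apply Rplus_le_compat_r, IHn.
Qed.

Lemma Series_ge0 (w : nat -> R) : (forall n, 0 <= w n)%R -> ex_series w -> (0 <= Series w)%R.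
Proof.
intros H E. apply (is_lim_seq_le (fun _ => 0%R) (sum_n w) 0%R (Series w)).
intros n. rewrite sum_n_Reals. now apply cond_pos_sum. apply is_lim_seq_const. apply Series_correct, E.
Qed.

Lemma sum_le_Series (w : nat -> R) : (forall n, 0 <= w n)%R -> ex_series w ->
  forall n, (sum_n w n <= Series w)%R.
Proof.
intros H E n. rewrite (Series_incr_n w (S n)); auto; [|lia]. rewrite sum_n_Reals. simpl.
assert (0 <= Series (fun k => w (S (n + k))))%R; [|lra].
apply Series_ge0. intros; apply H. apply (ex_series_incr_n w (S n)), E.
Qed.

Lemma term_le_Series (w : nat -> R) : (forall n, 0 <= w n)%R -> ex_series w ->
  forall n, (w n <= Series w)%R.
Proof.
intros H E n. eapply Rle_trans; [|apply (sum_le_Series w H E n)].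
destruct n. rewrite sum_O; lra. rewrite sum_Sn. unfold plus; simpl.
assert (0 <= sum_n w n)%R; [|lra]. rewrite sum_n_Reals. apply cond_pos_sum; auto.
Qed.

Lemma ex_series_bounded (w : nat -> R) (B : R) : (forall n, 0 <= w n)%R ->
  (forall n, sum_n w n <= B)%R -> ex_series w /\ (Series w <= B)%R.
Proof.
intros H HB.
assert (E : ex_finite_lim_seq (sum_n w)).
{ apply ex_finite_lim_seq_incr with B; auto. intros n. rewrite sum_Sn. unfold plus; simpl. specialize (H (S n)). lra. }
destruct E as [l Hl]. assert (S : is_series w l) by exact Hl.
split. now exists l. rewrite (is_series_unique _ _ S).
apply (is_lim_seq_le (sum_n w) (fun _ => B) l B); auto. apply is_lim_seq_const.
Qed.

(** Bounding the real and imaginary parts separately would lose a constant factor. A partial sum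
    within [eps] of the limit keeps the constant 1, since the triangle inequality applies to it
    directly. *)
Lemma CSeries_bound (a : nat -> C) (w : nat -> R) :
  (forall n, (Cmod (a n) <= w n)%R) -> ex_series w -> (Cmod (CSeries a) <= Series w)%R.
Proof.
intros H E. assert (S := CSeries_correct a (summ_le a w H E)).
assert (w0 : forall n, (0 <= w n)%R) by (intros n; eapply Rle_trans; [apply Cmod_ge_0 | apply H]).
apply le_epsilon. intros eps He.
unfold is_series in S. assert (S' := proj1 (filterlim_locally _ _) S (mkposreal (eps/2)%R ltac:(simpl; lra))).
destruct S' as [N HN]. specialize (HN N (Nat.le_refl N)).
destruct HN as [H1 H2].
set (z := CSeries a) in *. set (y := sum_n a N) in *.
assert (D : (Cmod (z - y) <= eps)%R).
{ eapply Rle_trans; [apply Cmod_le_ReIm|]. rewrite Re_minus, Im_minus.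
  change (Rabs (Re y - Re z) < eps / 2)%R in H1. change (Rabs (Im y - Im z) < eps / 2)%R in H2.
  rewrite (Rabs_minus_sym (Re z)), (Rabs_minus_sym (Im z)). lra. }
replace z with (y + (z - y)) by ring. eapply Rle_trans; [apply Cmod_triangle|].
apply Rplus_le_compat; auto. eapply Rle_trans; [apply sum_n_Cmod|].
eapply Rle_trans; [|apply (sum_le_Series w w0 E N)]. apply sum_n_m_le; auto.
Qed.

Lemma Csum_S (a : nat -> C) (n : nat) : Csum a (S n) = Csum a n + a n.
Proof. unfold Csum. destruct n. rewrite sum_O. ring. rewrite sum_Sn. reflexivity. Qed.

Lemma Csum_0 (a : nat -> C) : Csum a 0 = 0. Proof. reflexivity. Qed.

Lemma CSeries_split (a : nat -> C) (n : nat) : summ a ->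
  CSeries a = Csum a n + CSeries (fun k => a (n + k)%nat).
Proof.
intros Sa. destruct n. rewrite Csum_0; rewrite Cplus_0_l. now apply CSeries_ext.
assert (S1 : summ (fun k => a (S n + k)%nat)) by (apply (ex_series_incr_n (fun k => Cmod (a k)) (S n)); exact Sa).
apply CSeries_unique. apply (is_series_decr_n (K := C_AbsRing) (V := C_NormedModule) a (S n)). lia.
simpl pred. change (sum_n a n) with (Csum a (S n)).
match goal with |- is_series _ ?l => replace l with (CSeries (fun k => a (S n + k)%nat)) end.
now apply CSeries_correct.
unfold plus, opp; simpl. ring.
Qed.

Lemma Csum_ext (a b : nat -> C) (n : nat) : (forall k, (k < n)%nat -> a k = b k) -> Csum a n = Csum b n.
Proof.
induction n; intros H. reflexivity. rewrite !Csum_S, IHn, H; auto.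
Qed.
Lemma Csum_plus (a b : nat -> C) (n : nat) : Csum (fun k => a k + b k) n = Csum a n + Csum b n.
Proof. induction n. rewrite !Csum_0; ring. rewrite !Csum_S, IHn. ring. Qed.
Lemma Csum_scal (c : C) (a : nat -> C) (n : nat) : Csum (fun k => c * a k) n = c * Csum a n.
Proof. induction n. rewrite !Csum_0; ring. rewrite !Csum_S, IHn. ring. Qed.
Lemma Csum_swap (a : nat -> nat -> C) (n m : nat) :
  Csum (fun i => Csum (a i) m) n = Csum (fun j => Csum (fun i => a i j) n) m.
Proof.
induction n. rewrite Csum_0. induction m. reflexivity. now rewrite Csum_S, <- IHm, Csum_0, Cplus_0_r.
rewrite Csum_S, IHn. rewrite <- Csum_plus. apply Csum_ext; intros; now rewrite Csum_S.
Qed.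
Lemma Csum_split (a : nat -> C) (n m : nat) : Csum a (n + m) = Csum a n + Csum (fun k => a (n + k)%nat) m.
Proof.
induction m. rewrite Nat.add_0_r, Csum_0; ring. rewrite Nat.add_succ_r, !Csum_S, IHm. ring.
Qed.
Fixpoint Rsum (a : nat -> R) (n : nat) : R := match n with O => 0%R | S m => (Rsum a m + a m)%R end.
Lemma Cmod_Csum (a : nat -> C) (w : nat -> R) (n : nat) :
  (forall k, (k < n)%nat -> Cmod (a k) <= w k)%R -> (Cmod (Csum a n) <= Rsum w n)%R.
Proof.
induction n; intros H. rewrite Csum_0, Cmod_0; simpl; lra.
rewrite Csum_S; simpl. eapply Rle_trans; [apply Cmod_triangle|]. apply Rplus_le_compat; auto.
Qed.
Lemma Rsum_sum_n (w : nat -> R) (n : nat) : Rsum w (S n) = sum_n w n.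
Proof. induction n. rewrite sum_O; simpl; ring. rewrite sum_Sn, <- IHn. reflexivity. Qed.
Lemma Rsum_le_Series (w : nat -> R) : (forall n, 0 <= w n)%R -> ex_series w ->
  forall n, (Rsum w n <= Series w)%R.
Proof.
intros H E [|n]. simpl; now apply Series_ge0. rewrite Rsum_sum_n. now apply sum_le_Series.
Qed.

Lemma Series_tail_lim (w : nat -> R) : ex_series w ->
  is_lim_seq (fun n => Series (fun k => w (n + k)%nat)) 0.
Proof.
intros E. apply is_lim_seq_incr_1.
apply is_lim_seq_ext with (fun n => (Series w - sum_n w n)%R).
intros n. rewrite (Series_incr_n w (S n)); auto; [|lia]. rewrite sum_n_Reals. simpl pred. ring.
replace 0%R with (Series w - Series w)%R by ring. apply is_lim_seq_minus'. apply is_lim_seq_const.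
apply Series_correct, E.
Qed.

(** Reduces a complex sum to an explicit estimate of its remainders in modulus. The remainders count
    terms with [Csum], hence the shift by one against [sum_n]. *)
Lemma is_series_tail (a : nat -> C) (l : C) (u : nat -> R) :
  is_lim_seq u 0 -> (forall n, Cmod (l - Csum a n) <= u n)%R ->
  is_cseries a l.
Proof.
intros Hu H. apply filterlim_locally. intros eps.
apply is_lim_seq_spec in Hu. assert (Hu' := Hu eps).
destruct Hu' as [N HN]. exists N. intros n Hn.
specialize (HN (S n) ltac:(lia)). simpl in HN. specialize (H (S n)). change (Csum a (S n)) with (sum_n a n) in H.
rewrite Rminus_0_r in HN.
assert (Q : (Cmod (l - sum_n a n) < eps)%R).
{ eapply Rle_lt_trans; [apply H|]. eapply Rle_lt_trans; [apply Rle_abs|]. exact HN. }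
apply C_NormedModule_mixin_compat1.
change (Cmod (sum_n a n - l) < eps)%R. rewrite Cmod_minus_sym. exact Q.
Qed.

Lemma is_series_scalR (c : R) (a : nat -> R) (l : R) : is_series a l -> is_series (fun n => c * a n)%R (c * l)%R.
Proof. apply (is_series_scal (K := R_AbsRing) (V := R_NormedModule)). Qed.
Lemma is_series_extR (a b : nat -> R) (l : R) : (forall n, a n = b n) -> is_series a l -> is_series b l.
Proof. apply (is_series_ext (K := R_AbsRing) (V := R_NormedModule)). Qed.
Lemma is_series_scalC (c : C) (a : nat -> C) (l : C) :
  is_cseries a l ->
  is_cseries (fun n => c * a n) (c * l).
Proof. apply (is_series_scal (K := C_AbsRing) (V := C_NormedModule)). Qed.
Lemma is_series_extC (a b : nat -> C) (l : C) : (forall n, a n = b n) ->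
  is_cseries a l ->
  is_cseries b l.
Proof. apply (is_series_ext (K := C_AbsRing) (V := C_NormedModule)). Qed.
Lemma ex_series_leR (a b : nat -> R) : (forall n, 0 <= a n <= b n)%R -> ex_series b -> ex_series a.
Proof.
intros H E. apply (@ex_series_le R_AbsRing R_CompleteNormedModule _ b); auto.
intros n. unfold norm; simpl; unfold abs; simpl. rewrite Rabs_pos_eq; apply H.
Qed.
Lemma ex_series_scalR (c : R) (a : nat -> R) : ex_series a -> ex_series (fun n => c * a n)%R.
Proof. apply (ex_series_scal (K := R_AbsRing) (V := R_NormedModule)). Qed.

(** * Interchange of two infinite summations *)

Lemma ex_series_Rsum (b : nat -> nat -> R) (N : nat) :
  (forall j, ex_series (fun i => b i j)) ->
  ex_series (fun i => Rsum (b i) N) /\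
  Series (fun i => Rsum (b i) N) = Rsum (fun j => Series (fun i => b i j)) N.
Proof.
intros H. induction N as [|N [E1 E2]].
- simpl. assert (I : is_series (fun _ : nat => 0%R) 0%R).
  { apply is_series_Reals. intros e He. exists 0%nat. intros n _.
    replace (sum_f_R0 (fun _ => 0%R) n) with 0%R. unfold Rdist. rewrite Rminus_0_r, Rabs_R0. auto.
    induction n; simpl; lra. }
  split. now exists 0%R. now apply is_series_unique.
- simpl. split. now apply (ex_series_plus (K := R_AbsRing) (V := R_NormedModule)).
  rewrite Series_plus; auto. now rewrite E2.
Qed.

(** Tonelli as an inequality, which is enough for norms: a finite sum of columns is a series of
    finite row sums, each at most its row total. *)
Lemma Series_swap_le (b : nat -> nat -> R) :
  (forall i j, 0 <= b i j)%R -> (forall i, ex_series (b i)) -> ex_series (fun i => Series (b i)) ->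
  (forall j, ex_series (fun i => b i j)) /\
  ex_series (fun j => Series (fun i => b i j)) /\
  (Series (fun j => Series (fun i => b i j)) <= Series (fun i => Series (b i)))%R.
Proof.
intros H0 HR HS.
assert (HC : forall j, ex_series (fun i => b i j)).
{ intros j. apply (@ex_series_le R_AbsRing R_CompleteNormedModule _ (fun i => Series (b i))); auto.
  intros i. unfold norm; simpl; unfold abs; simpl. rewrite Rabs_pos_eq by auto. now apply term_le_Series. }
split; auto.
apply ex_series_bounded. intros j; apply Series_ge0; auto.
intros n. rewrite <- Rsum_sum_n. destruct (ex_series_Rsum b (S n) HC) as [E1 E2]. rewrite <- E2.
apply Series_le; auto. intros i; split; [|apply Rsum_le_Series; auto].
assert (G : forall m, (0 <= Rsum (b i) m)%R).
{ induction m; simpl. lra. specialize (H0 i m). lra. } apply G.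
Qed.

Lemma Csum_CSeries (a : nat -> nat -> C) (N : nat) :
  (forall i, summ (a i)) ->
  summ (fun j => Csum (fun i => a i j) N) /\
  CSeries (fun j => Csum (fun i => a i j) N) = Csum (fun i => CSeries (a i)) N.
Proof.
intros H. induction N as [|N [E1 E2]].
- assert (I : is_cseries (fun _ : nat => RtoC 0) (RtoC 0)).
  { apply is_series_tail with (fun _ => 0%R). apply is_lim_seq_const. intros n.
    replace (Csum (fun _ => RtoC 0) n) with (RtoC 0). replace (RtoC 0 - RtoC 0) with (RtoC 0) by ring.
    rewrite Cmod_0; lra.
    induction n. reflexivity. rewrite Csum_S, <- IHn. ring. }
  split. 2: now apply CSeries_unique.
  apply ex_series_ext with (fun _ => 0%R). intros; simpl; now rewrite Cmod_0.
  exists 0%R. apply is_series_C in I. apply I.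
- split. apply summ_ext with (fun j => Csum (fun i => a i j) N + a N j). intros; now rewrite Csum_S.
  now apply summ_plus.
  rewrite Csum_S, <- E2, <- CSeries_plus; auto. apply CSeries_ext. intros; now rewrite Csum_S.
Qed.

(** Fubini. After N rows the remainder of the iterated sum is the column-wise sum of the rows from N
    on, bounded by the tail of the absolute row sums. *)
Lemma CSeries_swap (a : nat -> nat -> C) :
  (forall i, summ (a i)) -> ex_series (fun i => Series (fun j => Cmod (a i j))) ->
  summ (fun i => CSeries (a i)) /\
  (forall j, summ (fun i => a i j)) /\
  ex_series (fun j => Series (fun i => Cmod (a i j))) /\
  (Series (fun j => Series (fun i => Cmod (a i j))) <= Series (fun i => Series (fun j => Cmod (a i j))))%R /\
  CSeries (fun i => CSeries (a i)) = CSeries (fun j => CSeries (fun i => a i j)).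
Proof.
intros H1 H2.
destruct (Series_swap_le (fun i j => Cmod (a i j))) as [A [B D]]; auto.
intros; apply Cmod_ge_0.
split; [|split; [|split; [|split]]]; auto.
apply summ_le with (fun i => Series (fun j => Cmod (a i j))); auto.
intros; apply CSeries_bound; auto. intros; lra. apply H1.
assert (SC : forall N, summ (fun j => CSeries (fun i => a (N + i)%nat j)) /\
  (Cmod (CSeries (fun j => CSeries (fun i => a (N + i)%nat j)))
     <= Series (fun i => Series (fun j => Cmod (a (N + i)%nat j))))%R).
{ intros N. destruct (Series_swap_le (fun i j => Cmod (a (N + i)%nat j))) as [A' [B' D']]; auto.
  intros; apply Cmod_ge_0. intros i; apply H1. apply (ex_series_incr_n (fun i => Series (fun j => Cmod (a i j)))); exact H2.
  assert (Q : forall n, (Cmod (CSeries (fun i => a (N + i)%nat n)) <= Series (fun i => Cmod (a (N + i)%nat n)))%R).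
  { intros n. apply CSeries_bound; auto. intros; lra. }
  split. apply summ_le with (fun j => Series (fun i => Cmod (a (N + i)%nat j))); auto.
  eapply Rle_trans; [|apply D']. apply CSeries_bound; auto. }
apply CSeries_unique. apply is_series_tail with (fun N => Series (fun i => Series (fun j => Cmod (a (N + i)%nat j)))).
apply (Series_tail_lim (fun i => Series (fun j => Cmod (a i j)))), H2.
intros N. destruct (SC N) as [SC1 SC2]. destruct (Csum_CSeries a N H1) as [E1 E2]. rewrite <- E2.
replace (CSeries (fun j => CSeries (fun i => a i j)))
  with (CSeries (fun j => Csum (fun i => a i j) N) + CSeries (fun j => CSeries (fun i => a (N + i)%nat j))).
match goal with |- (Cmod ?x <= _)%R => replace x with (CSeries (fun j => CSeries (fun i => a (N + i)%nat j))) by cring end.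
exact SC2.
rewrite <- CSeries_plus; auto. apply CSeries_ext. intros j. symmetry. apply CSeries_split. apply A.
Qed.

(** * Absolutely convergent power series *)

(* Power series around [z0] converging absolutely on the closed disc of radius [r]; they form a
   Banach algebra for [wnorm], which replaces Cauchy's theory of holomorphic functions below. *)
Definition wnorm (a : nat -> C) (r : R) : R := Series (fun k => Cmod (a k) * r ^ k)%R.
Definition wien (f : C -> C) (z0 : C) (r : R) (a : nat -> C) : Prop :=
  (0 < r)%R /\ ex_series (fun k => Cmod (a k) * r ^ k)%R /\
  forall z, (Cmod (z - z0) <= r)%R -> f z = CSeries (fun k => a k * (z - z0) ^ k).
Definition wien_le (f : C -> C) (z0 : C) (r B : R) : Prop :=
  exists a, wien f z0 r a /\ (wnorm a r <= B)%R.

Lemma wien_term (a : nat -> C) (r : R) (w : C) (k : nat) : (Cmod w <= r)%R ->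
  (Cmod (a k * w ^ k) <= Cmod (a k) * r ^ k)%R.
Proof.
intros H. rewrite Cmod_mult, Cmod_pow. apply Rmult_le_compat_l. apply Cmod_ge_0.
apply pow_incr. split; auto. apply Cmod_ge_0.
Qed.

Lemma wien_summ (f : C -> C) (z0 : C) (r : R) (a : nat -> C) (w : C) :
  wien f z0 r a -> (Cmod w <= r)%R -> summ (fun k => a k * w ^ k).
Proof.
intros [_ [H _]] Hw. apply summ_le with (fun k => Cmod (a k) * r ^ k)%R; auto. intros; now apply wien_term.
Qed.

Lemma wnorm_term_ge0 (a : nat -> C) (r : R) (k : nat) : (0 <= r)%R -> (0 <= Cmod (a k) * r ^ k)%R.
Proof. intros. apply Rmult_le_pos. apply Cmod_ge_0. now apply pow_le. Qed.

Lemma wien_le_bound (f : C -> C) (z0 : C) (r B : R) (z : C) :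
  wien_le f z0 r B -> (Cmod (z - z0) <= r)%R -> (Cmod (f z) <= B)%R.
Proof.
intros [a [[H0 [H1 H2]] H3]] Hz. rewrite H2; auto. eapply Rle_trans; [|apply H3].
apply CSeries_bound; auto. intros; now apply wien_term.
Qed.

Lemma wien_le_weaken (f : C -> C) (z0 : C) (r B B' : R) : (B <= B')%R -> wien_le f z0 r B -> wien_le f z0 r B'.
Proof. intros H [a [H1 H2]]. exists a; split; auto. lra. Qed.

Lemma wien_le_ext (f g : C -> C) (z0 : C) (r B : R) :
  (forall z, (Cmod (z - z0) <= r)%R -> f z = g z) -> wien_le f z0 r B -> wien_le g z0 r B.
Proof.
intros H [a [[H0 [H1 H2]] H3]]. exists a; split; auto. split; auto. split; auto.
intros z Hz. rewrite <- H; auto.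
Qed.

Lemma wien_shrink (f : C -> C) (z0 : C) (r r' : R) (a : nat -> C) :
  (0 < r')%R -> (r' <= r)%R -> wien f z0 r a -> wien f z0 r' a /\ (wnorm a r' <= wnorm a r)%R.
Proof.
intros Hr' Hr [H0 [H1 H2]].
assert (L : forall k, (0 <= Cmod (a k) * r' ^ k <= Cmod (a k) * r ^ k)%R).
{ intros k; split. apply wnorm_term_ge0; lra. apply Rmult_le_compat_l. apply Cmod_ge_0. apply pow_incr; lra. }
assert (E : ex_series (fun k => Cmod (a k) * r' ^ k)%R).
{ apply (@ex_series_le R_AbsRing R_CompleteNormedModule _ (fun k => Cmod (a k) * r ^ k)%R); auto.
  intros n. unfold norm; simpl; unfold abs; simpl. rewrite Rabs_pos_eq; apply L. }
split. split; auto. split; auto. intros z Hz; apply H2; lra.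
apply Series_le; auto.
Qed.

Lemma wien_le_shrink (f : C -> C) (z0 : C) (r r' B : R) :
  (0 < r')%R -> (r' <= r)%R -> wien_le f z0 r B -> wien_le f z0 r' B.
Proof.
intros Hr' Hr [a [H1 H2]]. destruct (wien_shrink f z0 r r' a) as [A B0]; auto.
exists a; split; auto. lra.
Qed.

(** Completeness of the algebra, in the role of Weierstrass's theorem on limits of holomorphic
    functions. Dividing by r^k shows that each coefficient series converges absolutely; Fubini then
    turns the sum of power series into one power series. *)
Lemma wien_sum (F : nat -> C -> C) (f : C -> C) (z0 : C) (r : R) (a : nat -> nat -> C) :
  (forall n, wien (F n) z0 r (a n)) -> ex_series (fun n => wnorm (a n) r) ->
  (forall z, (Cmod (z - z0) <= r)%R -> f z = CSeries (fun n => F n z)) ->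
  wien f z0 r (fun k => CSeries (fun n => a n k)) /\
  (wnorm (fun k => CSeries (fun n => a n k)) r <= Series (fun n => wnorm (a n) r))%R.
Proof.
intros HF HS Hf. destruct (HF 0%nat) as [r0 _].
assert (pr : forall k, (0 < r ^ k)%R) by (intros; now apply pow_lt).
destruct (Series_swap_le (fun n k => Cmod (a n k) * r ^ k)%R) as [A [B D]].
intros; apply wnorm_term_ge0; lra. intros i; apply (HF i). exact HS.
assert (EE : forall k, summ (fun n => a n k)).
{ intros k. unfold summ. apply ex_series_ext with (fun n => scal (/ r ^ k)%R (Cmod (a n k) * r ^ k)%R).
  intros n. unfold scal; simpl; unfold mult; simpl. field. apply Rgt_not_eq, pr.
  apply (ex_series_scal (K := R_AbsRing) (V := R_NormedModule)), A. }
assert (LE : forall k, (Cmod (CSeries (fun n => a n k)) * r ^ k <= Series (fun n => Cmod (a n k) * r ^ k))%R).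
{ intros k. rewrite Series_scal_r. apply Rmult_le_compat_r; [left; apply pr|]. apply CSeries_bound. intros; lra. apply EE. }
assert (E2 : ex_series (fun k => Cmod (CSeries (fun n => a n k)) * r ^ k)%R).
{ apply (@ex_series_le R_AbsRing R_CompleteNormedModule _ (fun k => Series (fun n => Cmod (a n k) * r ^ k)%R)); auto.
  intros n. unfold norm; simpl; unfold abs; simpl. rewrite Rabs_pos_eq; auto. apply (wnorm_term_ge0 (fun k => CSeries (fun n => a n k))); lra. }
split. split; [|split]; auto.
- intros z Hz. rewrite Hf; auto.
  rewrite (CSeries_ext _ (fun n => CSeries (fun k => a n k * (z - z0) ^ k))) by (intros; now apply (HF n)).
  assert (SW := CSeries_swap (fun n k => a n k * (z - z0) ^ k)).
  destruct SW as [_ [_ [_ [_ SW]]]].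
  intros i. apply (wien_summ _ _ _ _ _ (HF i) Hz).
  apply (@ex_series_le R_AbsRing R_CompleteNormedModule _ (fun n => wnorm (a n) r)); auto.
  intros n. unfold norm; simpl; unfold abs; simpl. rewrite Rabs_pos_eq.
  apply Series_le; [|apply HF]. intros k; split. apply Cmod_ge_0. now apply wien_term.
  apply Series_ge0. intros; apply Cmod_ge_0. apply (wien_summ _ _ _ _ _ (HF n) Hz).
  rewrite SW. apply CSeries_ext. intros k. rewrite Cmult_comm, <- CSeries_scal; auto.
  apply CSeries_ext. intros; ring.
- eapply Rle_trans; [|apply D]. apply Series_le; auto. intros k; split; auto. apply (wnorm_term_ge0 (fun k => CSeries (fun n => a n k))); lra.
Qed.

Lemma wien_le_sum (F : nat -> C -> C) (f : C -> C) (z0 : C) (r : R) (B : nat -> R) :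
  (forall n, wien_le (F n) z0 r (B n)) -> ex_series B ->
  (forall z, (Cmod (z - z0) <= r)%R -> f z = CSeries (fun n => F n z)) ->
  wien_le f z0 r (Series B).
Proof.
intros HF HB Hf.
set (a n := proj1_sig (constructive_indefinite_description _ (HF n))).
assert (Ha : forall n, wien (F n) z0 r (a n) /\ (wnorm (a n) r <= B n)%R).
{ intros n. unfold a. apply (proj2_sig (constructive_indefinite_description _ (HF n))). }
assert (P0 : forall n, (0 <= wnorm (a n) r)%R).
{ intros n. destruct (Ha n) as [[? [? ?]] ?]. apply Series_ge0; auto. intros; apply wnorm_term_ge0; lra. }
assert (EX : ex_series (fun n => wnorm (a n) r)).
{ apply (@ex_series_le R_AbsRing R_CompleteNormedModule _ B); auto.
  intros n. unfold norm; simpl; unfold abs; simpl. rewrite Rabs_pos_eq; auto. apply Ha. }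
destruct (wien_sum F f z0 r a) as [W1 W2]; auto. intros; apply Ha.
eexists; split; [apply W1|]. eapply Rle_trans; [apply W2|]. apply Series_le; auto. intros n; split; auto. apply Ha.
Qed.

Lemma is_series_single (x : R) : is_series (fun k => match k with O => x | _ => 0%R end) x.
Proof.
apply is_series_Reals. intros e He. exists 0%nat. intros n _.
assert (Q : sum_f_R0 (fun k => match k with O => x | _ => 0%R end) n = x).
{ induction n; simpl; auto. rewrite IHn. ring. }
refine (eq_ind_r (fun y => (Rdist y x < e)%R) _ Q). unfold Rdist. rewrite Rminus_diag, Rabs_R0. auto.
Qed.

Lemma summ_finite (a : nat -> C) (N : nat) : (forall k, (N <= k)%nat -> a k = 0) ->
  summ a /\ CSeries a = Csum a N.
Proof.
intros H.
assert (S1 : summ a).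
{ apply (ex_series_incr_n (fun k => Cmod (a k)) N).
  apply ex_series_ext with (fun k => match k with O => 0%R | _ => 0%R end).
  intros n; rewrite H by lia. rewrite Cmod_0. now destruct n. eexists; apply is_series_single. }
split; auto. rewrite (CSeries_split a N S1).
replace (CSeries (fun k => a (N + k)%nat)) with (RtoC 0). ring.
symmetry. apply CSeries_unique. apply is_series_tail with (fun _ => 0%R). apply is_lim_seq_const.
intros n. replace (Csum (fun k => a (N + k)%nat) n) with (RtoC 0).
replace (RtoC 0 - RtoC 0) with (RtoC 0) by ring. rewrite Cmod_0; lra.
induction n. reflexivity. rewrite Csum_S, <- IHn, H by lia. ring.
Qed.

Lemma ex_series_finite (w : nat -> R) (N : nat) : (forall k, (N <= k)%nat -> w k = 0%R) ->
  ex_series w /\ Series w = Rsum w N.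
Proof.
intros H. destruct (summ_finite (fun k => RtoC (w k)) N) as [A B].
intros k Hk; now rewrite H.
assert (S0 := CSeries_correct _ A). apply is_series_C in S0. destruct S0 as [S0 _].
split. eexists; apply S0. rewrite (is_series_unique w _ S0), B.
clear. induction N. reflexivity. rewrite Csum_S, Re_plus, IHN. reflexivity.
Qed.

(** The Cauchy product is read as a convergent sum of shifted copies of the second factor: row n
    holds the coefficients of a_n (z - z0)^n g. Its norm is |a_n| r^n times the norm of g, so
    [wien_sum] applies and gives submultiplicativity. *)
Lemma wien_mult (f g : C -> C) (z0 : C) (r : R) (a b : nat -> C) :
  wien f z0 r a -> wien g z0 r b ->
  wien (fun z => f z * g z) z0 r (fun k => Csum (fun n => a n * b (k - n)%nat) (S k)) /\
  (wnorm (fun k => Csum (fun n => a n * b (k - n)%nat)%C (S k)) r <= wnorm a r * wnorm b r)%R.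
Proof.
intros Ha Hb. destruct Ha as [r0 [Ha1 Ha2]]. assert (Hb' := Hb). destruct Hb' as [_ [Hb1 Hb2]].
set (c n k := if (k <? n)%nat then RtoC 0 else a n * b (k - n)%nat).
assert (cs : forall n k, c n (n + k)%nat = a n * b k).
{ intros n k. unfold c. replace (n + k <? n)%nat with false. f_equal. f_equal. lia. symmetry; apply Nat.ltb_ge; lia. }
assert (c0 : forall n k, (k < n)%nat -> c n k = 0).
{ intros n k H. unfold c. now replace (k <? n)%nat with true by (symmetry; now apply Nat.ltb_lt). }
assert (ES : forall n, is_series (fun k => Cmod (c n k) * r ^ k)%R (Cmod (a n) * r ^ n * wnorm b r)%R).
{ intros n.
  assert (T : is_series (fun k => Cmod (c n (n + k)%nat) * r ^ (n + k))%R (Cmod (a n) * r ^ n * wnorm b r)%R).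
  { apply is_series_ext with (fun k => scal (Cmod (a n) * r ^ n)%R (Cmod (b k) * r ^ k)%R).
    intros k. rewrite cs, Cmod_mult, pow_add. unfold scal; simpl; unfold mult; simpl. ring.
    apply (is_series_scal (K := R_AbsRing) (V := R_NormedModule)). apply Series_correct, Hb1. }
  destruct n. exact T.
  apply (is_series_decr_n (K := R_AbsRing) (V := R_NormedModule) _ (S n)). lia.
  simpl pred.
  match goal with |- is_series _ ?l => replace l with (Cmod (a (S n)) * r ^ S n * wnorm b r)%R end. exact T.
  unfold plus, opp; simpl.
  match goal with |- _ = (_ + - ?s)%R => replace s with 0%R end. ring.
  symmetry; rewrite <- Rsum_sum_n. assert (Z : forall m, (m <= S n)%nat -> Rsum (fun k => Cmod (c (S n) k) * r ^ k)%R m = 0%R).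
  { induction m; intros; simpl. reflexivity. rewrite IHm, c0, Cmod_0 by lia. ring. }
  apply Z; lia. }
assert (nb : (0 <= wnorm b r)%R) by (apply Series_ge0; auto; intros; apply wnorm_term_ge0; lra).
assert (WN : forall n, wnorm (c n) r = (Cmod (a n) * r ^ n * wnorm b r)%R) by (intros n; apply is_series_unique, ES).
destruct (wien_sum (fun n z => a n * (z - z0) ^ n * g z) (fun z => f z * g z) z0 r c) as [W1 W2].
- intros n. split; auto. split. eexists; apply ES.
  intros z Hz. rewrite Hb2; auto.
  assert (SB := wien_summ _ _ _ _ _ Hb Hz).
  rewrite <- CSeries_scal; auto.
  assert (SC : summ (fun k => c n k * (z - z0) ^ k)).
  { apply summ_le with (fun k => Cmod (c n k) * r ^ k)%R. intros; now apply wien_term. eexists; apply ES. }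
  rewrite (CSeries_split _ n SC). replace (Csum (fun k => c n k * (z - z0) ^ k) n) with (RtoC 0).
  rewrite Cplus_0_l. apply CSeries_ext; intros k. rewrite cs, Cpow_add_r. ring.
  rewrite (Csum_ext _ (fun _ => 0 * 0) n). 2: intros; rewrite c0 by auto; ring.
  rewrite Csum_scal; ring.
- apply ex_series_ext with (fun n => (Cmod (a n) * r ^ n) * wnorm b r)%R. intros; now rewrite WN.
  apply ex_series_scal_r, Ha1.
- intros z Hz. rewrite Ha2; auto. rewrite Cmult_comm, <- CSeries_scal. apply CSeries_ext; intros; ring.
  apply (wien_summ f z0 r). split; auto. auto.
- assert (EQ : (fun k => CSeries (fun n => c n k)) = (fun k => Csum (fun n => a n * b (k - n)%nat) (S k))).
  { apply functional_extensionality; intros k. destruct (summ_finite (fun n => c n k) (S k)) as [_ E].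
    intros; apply c0; lia. rewrite E. apply Csum_ext. intros n Hn. unfold c.
    now replace (k <? n)%nat with false by (symmetry; apply Nat.ltb_ge; lia). }
  rewrite EQ in W1, W2. split; auto. eapply Rle_trans; [apply W2|].
  rewrite (Series_ext _ (fun n => (Cmod (a n) * r ^ n) * wnorm b r)%R) by (intros; now rewrite WN).
  rewrite Series_scal_r. apply Rle_refl.
Qed.

Lemma wnorm_ge0 (f : C -> C) (z0 : C) (r : R) (a : nat -> C) : wien f z0 r a -> (0 <= wnorm a r)%R.
Proof. intros [? [? _]]. apply Series_ge0; auto. intros; apply wnorm_term_ge0; lra. Qed.

Lemma wien_le_mult (f g : C -> C) (z0 : C) (r A B : R) :
  wien_le f z0 r A -> wien_le g z0 r B -> wien_le (fun z => f z * g z) z0 r (A * B).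
Proof.
intros [a [Ha1 Ha2]] [b [Hb1 Hb2]]. destruct (wien_mult f g z0 r a b) as [W1 W2]; auto.
eexists; split; [apply W1|]. eapply Rle_trans; [apply W2|].
apply Rmult_le_compat; auto; eapply wnorm_ge0; eauto.
Qed.

Lemma wien_plus (f g : C -> C) (z0 : C) (r : R) (a b : nat -> C) :
  wien f z0 r a -> wien g z0 r b ->
  wien (fun z => f z + g z) z0 r (fun k => a k + b k) /\
  (wnorm (fun k => (a k + b k)%C) r <= wnorm a r + wnorm b r)%R.
Proof.
intros Ha Hb. assert (Wa := Ha). assert (Wb := Hb). destruct Ha as [r0 [Ha1 Ha2]], Hb as [_ [Hb1 Hb2]].
assert (P : forall k, (0 <= Cmod (a k + b k) * r ^ k <= Cmod (a k) * r ^ k + Cmod (b k) * r ^ k)%R).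
{ intros k; split. apply Rmult_le_pos. apply Cmod_ge_0. apply pow_le; lra.
  rewrite <- Rmult_plus_distr_r. apply Rmult_le_compat_r. apply pow_le; lra. apply Cmod_triangle. }
assert (E : ex_series (fun k => Cmod (a k) * r ^ k + Cmod (b k) * r ^ k)%R)
  by now apply (ex_series_plus (K := R_AbsRing) (V := R_NormedModule)).
split. split; auto. split.
- apply (@ex_series_le R_AbsRing R_CompleteNormedModule _ (fun k => Cmod (a k) * r ^ k + Cmod (b k) * r ^ k)%R); auto.
  intros n. unfold norm; simpl; unfold abs; simpl. rewrite Rabs_pos_eq; apply P.
- intros z Hz. rewrite Ha2, Hb2, <- CSeries_plus; auto. apply CSeries_ext; intros; ring.
  apply (wien_summ f z0 r); auto. apply (wien_summ g z0 r); auto.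
- unfold wnorm. rewrite <- Series_plus; auto. apply Series_le; auto.
Qed.

Lemma wien_le_plus (f g : C -> C) (z0 : C) (r A B : R) :
  wien_le f z0 r A -> wien_le g z0 r B -> wien_le (fun z => f z + g z) z0 r (A + B).
Proof.
intros [a [Ha1 Ha2]] [b [Hb1 Hb2]]. destruct (wien_plus f g z0 r a b) as [W1 W2]; auto.
eexists; split; [apply W1|]. lra.
Qed.

Lemma wien_poly1 (c d z0 : C) (r : R) : (0 < r)%R ->
  wien (fun z => c + d * (z - z0)) z0 r (fun k => match k with O => c | S O => d | _ => 0 end).
Proof.
intros H. split; auto. split.
- apply (ex_series_finite _ 2). intros [|[|k]] Hk; try lia. rewrite Cmod_0; ring.
- intros z Hz. destruct (summ_finite (fun k => match k with O => c | S O => d | _ => 0 end * (z - z0) ^ k) 2) as [_ E].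
  intros [|[|k]] Hk; try lia. ring. rewrite E, !Csum_S, Csum_0. simpl. ring.
Qed.

Lemma wien_le_poly1 (c d z0 : C) (r : R) : (0 < r)%R ->
  wien_le (fun z => c + d * (z - z0)) z0 r (Cmod c + Cmod d * r).
Proof.
intros H. eexists; split. now apply wien_poly1. unfold wnorm.
destruct (ex_series_finite (fun k => Cmod (match k with O => c | S O => d | _ => 0 end) * r ^ k)%R 2) as [_ E].
intros [|[|k]] Hk; try lia. rewrite Cmod_0; ring. rewrite E. simpl. lra.
Qed.

Lemma wien_le_const (c z0 : C) (r : R) : (0 < r)%R -> wien_le (fun _ => c) z0 r (Cmod c).
Proof.
intros H. eapply wien_le_weaken. 2: eapply wien_le_ext. 3: apply (wien_le_poly1 c 0 z0 r H).
rewrite Cmod_0; lra. intros; simpl; ring.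
Qed.

Lemma wien_le_scal (c : C) (f : C -> C) (z0 : C) (r B : R) :
  wien_le f z0 r B -> wien_le (fun z => c * f z) z0 r (Cmod c * B).
Proof.
intros H. apply (wien_le_mult (fun _ => c)); auto. apply wien_le_const. destruct H as [a [[? _] _]]; auto.
Qed.

Lemma wien_le_pow (f : C -> C) (z0 : C) (r B : R) (n : nat) :
  wien_le f z0 r B -> wien_le (fun z => f z ^ n) z0 r (B ^ n).
Proof.
intros H. assert (r0 : (0 < r)%R) by (destruct H as [a [[? _] _]]; auto).
induction n; simpl. assert (W := wien_le_const 1 z0 r r0). rewrite Cmod_1 in W. exact W. now apply wien_le_mult.
Qed.

(** Substituting u - u(z0), of norm at most rho, into the series of F gives terms of norm at most
    |a_n| rho^n. The outer radius is compared with the norm of the inner function, not only with its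
    supremum. *)
Lemma wien_comp (F : C -> C) (u : C -> C) (z0 : C) (r rho : R) (a : nat -> C) :
  wien F (u z0) rho a -> wien_le (fun z => u z - u z0) z0 r rho ->
  wien_le (fun z => F (u z)) z0 r (wnorm a rho).
Proof.
intros [R0 [H1 H2]] Hu.
apply (wien_le_sum (fun n z => a n * (u z - u z0) ^ n)); auto.
- intros n. apply wien_le_scal. now apply wien_le_pow.
- intros z Hz. apply H2. now apply (wien_le_bound (fun z => u z - u z0) z0 r).
Qed.

(** Without the constant term every coefficient gains at least one factor q = r'/r, so shrinking the
    disc makes the norm small. The denominator B + 1 covers B = 0. *)
Lemma wien_le_small (f : C -> C) (z0 : C) (r B eps : R) :
  (0 < eps)%R -> wien_le f z0 r B -> exists r', (0 < r' <= r)%R /\ wien_le (fun z => f z - f z0) z0 r' eps.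
Proof.
intros He [a [[r0 [H1 H2]] HB]].
assert (B0 : (0 <= B)%R) by (eapply Rle_trans; [apply (wnorm_ge0 f z0 r a); split; auto | auto]).
set (r' := (r * Rmin 1 (eps / (B + 1)))%R).
assert (Q : (0 < Rmin 1 (eps / (B + 1)) <= 1)%R).
{ split. apply Rmin_glb_lt. lra. apply Rdiv_lt_0_compat; lra. apply Rmin_l. }
set (q := Rmin 1 (eps / (B + 1))) in *.
assert (qB : (q * B <= eps)%R).
{ apply Rle_trans with (eps / (B + 1) * B)%R. apply Rmult_le_compat_r; auto. apply Rmin_r.
  apply (Rmult_le_reg_r (B + 1)). lra. replace (eps / (B + 1) * B * (B + 1))%R with (eps * B)%R by (field; lra). nra. }
exists r'. assert (R' : (0 < r' <= r)%R). { unfold r'; split; nra. } split; auto.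
destruct (wien_shrink f z0 r r' a) as [[_ [S1 S2]] _]; try lra. split; auto.
set (b k := match k with O => RtoC 0 | S _ => a k end).
assert (LB : forall k, (0 <= Cmod (b k) * r' ^ k <= q * (Cmod (a k) * r ^ k))%R).
{ intros [|k]. simpl. rewrite Cmod_0. assert (G := Cmod_ge_0 (a 0%nat)). split; [lra|]. rewrite Rmult_0_l. apply Rmult_le_pos; lra.
  simpl b. split. apply wnorm_term_ge0; lra. unfold r'. fold q. rewrite Rpow_mult_distr.
  replace (Cmod (a (S k)) * (r ^ S k * q ^ S k))%R with (q ^ S k * (Cmod (a (S k)) * r ^ S k))%R by ring.
  apply Rmult_le_compat_r. apply wnorm_term_ge0; lra. simpl.
  assert (0 <= q ^ k <= 1)%R. { split. apply pow_le; lra. rewrite <- (pow1 k). apply pow_incr; lra. } nra. }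
assert (EB : ex_series (fun k => q * (Cmod (a k) * r ^ k))%R)
  by apply (ex_series_scal (K := R_AbsRing) (V := R_NormedModule) q), H1.
exists b. split. split; [lra|]. split.
- apply (@ex_series_le R_AbsRing R_CompleteNormedModule _ (fun k => q * (Cmod (a k) * r ^ k))%R); auto.
  intros n. unfold norm; simpl; unfold abs; simpl. rewrite Rabs_pos_eq; apply LB.
- intros z Hz.
  assert (Sz := wien_summ f z0 r' a (z - z0) (conj (proj1 R') (conj S1 S2)) Hz).
  rewrite (S2 z Hz). rewrite (S2 z0). 2: replace (z0 - z0) with (RtoC 0) by ring; rewrite Cmod_0; lra.
  replace (CSeries (fun k => a k * (z0 - z0) ^ k)) with (a 0%nat).
  2:{ destruct (summ_finite (fun k => a k * (z0 - z0) ^ k) 1) as [_ E].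
      intros [|k] Hk; [lia|]. simpl. ring. rewrite E, Csum_S, Csum_0. simpl. ring. }
  rewrite (CSeries_split _ 1 Sz), Csum_S, Csum_0.
  assert (Sb : summ (fun k => b k * (z - z0) ^ k)).
  { apply summ_le with (fun k => Cmod (a k * (z - z0) ^ k)); [|exact Sz]. intros [|k]; simpl b.
    rewrite Cmult_0_l, Cmod_0. apply Cmod_ge_0. lra. }
  rewrite (CSeries_split _ 1 Sb), Csum_S, Csum_0. simpl. ring.
- unfold wnorm. eapply Rle_trans; [apply Series_le; [apply LB | apply EB]|].
  rewrite Series_scal_l. eapply Rle_trans; [|apply qB]. apply Rmult_le_compat_l. lra. exact HB.
Qed.

Lemma wien_analytic (f : C -> C) (z0 : C) (r : R) (a : nat -> C) : wien f z0 r a ->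
  forall z, (Cmod (z - z0) < r)%R -> is_pseries (K := C_AbsRing) (V := C_NormedModule) a (z - z0) (f z).
Proof.
intros W z Hz. assert (W' := W). destruct W' as [r0 [H1 H2]]. unfold is_pseries. rewrite H2 by lra.
apply (is_series_ext (K := C_AbsRing) (V := C_NormedModule) (fun k => a k * (z - z0) ^ k)).
2: apply CSeries_correct; apply (wien_summ _ _ _ _ _ W); lra.
intros n. unfold scal; simpl. unfold mult; simpl. rewrite Cmult_comm. f_equal.
Qed.

Lemma wien_le_analytic (f : C -> C) (z0 : C) (r B : R) : wien_le f z0 r B -> analytic_at f z0.
Proof.
intros [a [W _]]. exists a, r. split. apply W. intros; now apply (wien_analytic f z0 r a).
Qed.

(** Abel's argument: convergence at r/2 bounds |a_k| (r/2)^k from some index on, so at r/4 the terms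
    are dominated by a geometric series of ratio 1/2. *)
Lemma analytic_wien (f : C -> C) (z0 : C) : analytic_at f z0 -> exists r B, wien_le f z0 r B.
Proof.
intros [a [r [r0 H]]].
assert (IS : forall w, (Cmod w < r)%R -> is_cseries (fun k => a k * w ^ k) (f (z0 + w))).
{ intros w Hw. specialize (H (z0 + w)). replace (z0 + w - z0) with w in H by ring.
  apply (is_series_ext (K := C_AbsRing) (V := C_NormedModule) (fun k => scal (pow_n (K := C_Ring) w k) (a k))); [|now apply H].
  intros n. unfold scal; simpl. unfold mult; simpl. rewrite Cmult_comm. f_equal. }
assert (Hh : (Cmod (RtoC (r / 2)) < r)%R) by (rewrite Cmod_RtoC_pos; lra).
assert (I := IS _ Hh). apply is_series_C in I. destruct I as [I1 I2].
assert (L1 := ex_series_lim_0 _ (ex_intro _ _ I1)). assert (L2 := ex_series_lim_0 _ (ex_intro _ _ I2)).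
apply is_lim_seq_spec in L1. apply is_lim_seq_spec in L2.
destruct (L1 (mkposreal 1 Rlt_0_1)) as [N1 HN1]. destruct (L2 (mkposreal 1 Rlt_0_1)) as [N2 HN2].
simpl in HN1, HN2.
assert (BD : forall k, (N1 + N2 <= k)%nat -> (Cmod (a k) * (r / 2) ^ k <= 2)%R).
{ intros k Hk. specialize (HN1 k ltac:(lia)). specialize (HN2 k ltac:(lia)).
  rewrite Rminus_0_r in HN1, HN2.
  rewrite <- (Cmod_RtoC_pos (r / 2)) at 1 by lra. rewrite <- Cmod_pow, <- Cmod_mult.
  eapply Rle_trans; [apply Cmod_le_ReIm|]. simpl in HN1, HN2. unfold Re, Im in *. simpl. lra. }
assert (E : ex_series (fun k => Cmod (a k) * (r / 4) ^ k)%R).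
{ apply (ex_series_incr_n _ (N1 + N2)).
  apply (@ex_series_le R_AbsRing R_CompleteNormedModule _ (fun k => 2 * ((/ 2) ^ (N1 + N2) * (/ 2) ^ k))%R).
  - intros n. unfold norm; simpl; unfold abs; simpl. rewrite Rabs_pos_eq. 2: apply wnorm_term_ge0; lra.
    replace (r / 4)%R with (r / 2 * / 2)%R by field. rewrite Rpow_mult_distr, <- pow_add, <- Rmult_assoc.
    apply Rmult_le_compat_r. apply pow_le; lra. apply BD; lia.
  - apply (ex_series_scal (K := R_AbsRing) (V := R_NormedModule) 2%R).
    apply (ex_series_scal (K := R_AbsRing) (V := R_NormedModule) ((/ 2) ^ (N1 + N2))%R).
    apply ex_series_geom. rewrite Rabs_pos_eq; lra. }
exists (r / 4)%R, (wnorm a (r / 4)), a. split; [|lra]. split; [lra|]. split; auto.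
intros z Hz. symmetry; apply CSeries_unique. replace (f z) with (f (z0 + (z - z0))) by (f_equal; ring).
apply IS; lra.
Qed.

(** * Functions of a real variable *)

Definition ccont (f : R -> C) (t : R) : Prop :=
  continuous (fun s => Re (f s)) t /\ continuous (fun s => Im (f s)) t.
Definition cder (f : R -> C) (t : R) (l : C) : Prop :=
  is_derive (fun s => Re (f s)) t (Re l) /\ is_derive (fun s => Im (f s)) t (Im l).

Lemma ccont_eps (f : R -> C) (t : R) :
  (forall eps, (0 < eps)%R -> exists d, (0 < d)%R /\ forall s, (Rabs (s - t) < d)%R -> (Cmod (f s - f t) <= eps)%R) ->
  ccont f t.
Proof.
intros H. split; apply filterlim_locally; intros eps; destruct (H (eps / 2)%R) as [d [d0 Hd]];
try (destruct eps; simpl; lra); exists (mkposreal d d0); intros s Hs; specialize (Hd s Hs);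
apply Rle_lt_trans with (eps / 2)%R; try (destruct eps; simpl; lra).
eapply Rle_trans; [|apply Hd].
eapply Rle_trans; [|apply re_le_Cmod]. rewrite Re_minus. apply Rle_refl.
eapply Rle_trans; [|apply Hd]. eapply Rle_trans; [|apply im_le_Cmod]. rewrite Im_minus. apply Rle_refl.
Qed.

Lemma ccont_ext (f g : R -> C) (t : R) : (forall s, f s = g s) -> ccont f t -> ccont g t.
Proof. intros H [A B]. split; [revert A | revert B]; apply continuous_ext; intros; now rewrite H. Qed.
Lemma ccont_const (c : C) (t : R) : ccont (fun _ => c) t.
Proof. split; apply continuous_const. Qed.
Lemma ccont_plus (f g : R -> C) (t : R) : ccont f t -> ccont g t -> ccont (fun s => f s + g s) t.
Proof. intros [A B] [D E]. split; apply (continuous_plus (V := R_NormedModule)); assumption. Qed.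
Lemma ccont_mult (f g : R -> C) (t : R) : ccont f t -> ccont g t -> ccont (fun s => f s * g s) t.
Proof.
intros [A B] [D E]. split.
apply (continuous_minus (V := R_NormedModule)); apply (continuous_mult (K := R_AbsRing)); assumption.
apply (continuous_plus (V := R_NormedModule)); apply (continuous_mult (K := R_AbsRing)); assumption.
Qed.
Lemma ccont_pow (f : R -> C) (n : nat) (t : R) : ccont f t -> ccont (fun s => f s ^ n) t.
Proof. intros H. induction n; simpl. apply ccont_const. now apply ccont_mult. Qed.
Lemma ccont_RtoC (f : R -> R) (t : R) : continuous f t -> ccont (fun s => RtoC (f s)) t.
Proof. intros H. split; simpl; auto. apply continuous_const. Qed.
Lemma ccont_id (t : R) : ccont (fun s => RtoC s) t.
Proof. apply ccont_RtoC, continuous_id. Qed.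
Lemma ccont_cexp (f : R -> C) (t : R) : ccont f t -> ccont (fun s => cexp (f s)) t.
Proof.
intros [A B]. split; simpl; apply (continuous_mult (K := R_AbsRing)); unfold Re, Im in *.
apply (continuous_comp (fun s => fst (f s)) exp); auto. apply continuity_pt_filterlim, derivable_continuous_pt, derivable_pt_exp.
apply (continuous_comp (fun s => snd (f s)) cos); auto. apply continuity_pt_filterlim, continuity_cos.
apply (continuous_comp (fun s => fst (f s)) exp); auto. apply continuity_pt_filterlim, derivable_continuous_pt, derivable_pt_exp.
apply (continuous_comp (fun s => snd (f s)) sin); auto. apply continuity_pt_filterlim, continuity_sin.
Qed.
Lemma ccont_sum (f : nat -> R -> C) (n : nat) (t : R) : (forall k, (k < n)%nat -> ccont (f k) t) ->
  ccont (fun s => Csum (fun k => f k s) n) t.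
Proof.
induction n; intros H. apply ccont_const.
apply ccont_ext with (fun s => Csum (fun k => f k s) n + f n s). intros; now rewrite Csum_S.
apply ccont_plus; auto.
Qed.

Lemma cder_ext (f g : R -> C) (t : R) (l : C) : (forall s, f s = g s) -> cder f t l -> cder g t l.
Proof. intros H [A B]. split; [revert A | revert B]; apply is_derive_ext; intros; now rewrite H. Qed.
Lemma cder_eq (f : R -> C) (t : R) (l l' : C) : cder f t l -> l = l' -> cder f t l'.
Proof. intros H <-. exact H. Qed.
Lemma cder_const (c : C) (t : R) : cder (fun _ => c) t 0.
Proof. split; apply (is_derive_const (V := R_NormedModule)). Qed.
Lemma cder_id (t : R) : cder (fun s => RtoC s) t 1.
Proof. split; simpl. apply (is_derive_id (K := R_AbsRing)). apply (is_derive_const (V := R_NormedModule)). Qed.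
Lemma cder_plus (f g : R -> C) (t : R) (l m : C) :
  cder f t l -> cder g t m -> cder (fun s => f s + g s) t (l + m).
Proof. intros [A B] [D E]. split; apply (is_derive_plus (V := R_NormedModule)); assumption. Qed.
Lemma cder_mult (f g : R -> C) (t : R) (l m : C) :
  cder f t l -> cder g t m -> cder (fun s => f s * g s) t (l * g t + f t * m).
Proof.
intros [A B] [D E]. unfold Re, Im in *. split; simpl.
- evar_last. apply (is_derive_minus (V := R_NormedModule)); apply (is_derive_mult (K := R_AbsRing)); eauto; apply Rmult_comm.
  unfold minus, plus, opp, mult; simpl.
  clear A B D E. generalize (f t) (g t). intros [? ?] [? ?]; destruct l, m; simpl. rring.
- evar_last. apply (is_derive_plus (V := R_NormedModule)); apply (is_derive_mult (K := R_AbsRing)); eauto; apply Rmult_comm.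
  unfold minus, plus, opp, mult; simpl.
  clear A B D E. generalize (f t) (g t). intros [? ?] [? ?]; destruct l, m; simpl. rring.
Qed.
Lemma cder_scal (c : C) (f : R -> C) (t : R) (l : C) : cder f t l -> cder (fun s => c * f s) t (c * l).
Proof. intros H. eapply cder_eq. apply cder_mult. apply cder_const. exact H. cring. Qed.
Lemma cder_cexp (f : R -> C) (t : R) (l : C) : cder f t l -> cder (fun s => cexp (f s)) t (l * cexp (f t)).
Proof.
intros [A B]. unfold Re, Im in *. split; simpl.
- evar_last. apply (is_derive_mult (K := R_AbsRing)).
  apply (is_derive_comp exp (fun s => fst (f s))). apply is_derive_exp. exact A.
  apply (is_derive_comp cos (fun s => snd (f s))). apply is_derive_cos. exact B. apply Rmult_comm.
  unfold plus, mult, scal; simpl; unfold mult; simpl.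
  clear A B. generalize (f t). intros [? ?]; destruct l; simpl. rring.
- evar_last. apply (is_derive_mult (K := R_AbsRing)).
  apply (is_derive_comp exp (fun s => fst (f s))). apply is_derive_exp. exact A.
  apply (is_derive_comp sin (fun s => snd (f s))). apply is_derive_sin. exact B. apply Rmult_comm.
  unfold plus, mult, scal; simpl; unfold mult; simpl.
  clear A B. generalize (f t). intros [? ?]; destruct l; simpl. rring.
Qed.
Lemma cder_pow (f : R -> C) (n : nat) (t : R) (l : C) :
  cder f t l -> cder (fun s => f s ^ n) t (INR n * l * f t ^ pred n).
Proof.
intros H. induction n. simpl. eapply cder_eq. apply cder_const. cring.
eapply cder_eq. apply (cder_mult _ _ _ _ _ H IHn).
rewrite S_INR, RtoC_plus. destruct n; simpl. ring. cring.
Qed.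
Lemma cder_ccont (f : R -> C) (t : R) (l : C) : cder f t l -> ccont f t.
Proof.
intros [A B]. split; apply (ex_derive_continuous (V := R_NormedModule)); eexists; eassumption.
Qed.

(** Rotating a complex number onto the positive axis lets real mean value and comparison theorems
    bound moduli with constant 1. *)
Lemma unimodular (z : C) : exists u, Cmod u = 1%R /\ Re (u * z) = Cmod z.
Proof.
destruct (Req_dec (Cmod z) 0) as [E|E].
- exists 1. split. apply Cmod_1. rewrite (Cmod_eq_0 z E). rewrite Cmod_0. simpl. ring.
- exists (Cconj z / Cmod z). assert (N : RtoC (Cmod z) <> 0) by now apply RtoC_neq0. split.
  rewrite Cmod_div by auto. rewrite Cmod_conj, Cmod_R, Rabs_pos_eq by apply Cmod_ge_0. field; auto.
  replace (Cconj z / Cmod z * z) with (RtoC (Cmod z)). reflexivity.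
  assert (H := Cmod2_conj z).
  replace (Cconj z / Cmod z * z) with ((z * Cconj z) / Cmod z) by (field; auto).
  rewrite <- H. simpl. rewrite ?RtoC_mult. field; auto.
Qed.

Lemma Re_le_Cmod' (u z : C) : Cmod u = 1%R -> (Re (u * z) <= Cmod z)%R.
Proof.
intros H. eapply Rle_trans; [apply Rle_abs|]. eapply Rle_trans; [apply re_le_Cmod|]. rewrite Cmod_mult, H. lra.
Qed.

(** Mean value inequality for curves: with u rotating the increment of F onto the positive axis, Re
    (u F) - g has nonpositive derivative. *)
Lemma cder_increment (F f : R -> C) (g g' : R -> R) (a b : R) : (a <= b)%R ->
  (forall s, (a <= s <= b)%R -> cder F s (f s)) ->
  (forall s, (a <= s <= b)%R -> is_derive g s (g' s)) ->
  (forall s, (a <= s <= b)%R -> Cmod (f s) <= g' s)%R ->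
  (Cmod (F b - F a) <= g b - g a)%R.
Proof.
intros Hab HF Hg Hfg. destruct (unimodular (F b - F a)) as [u [u1 Hu]]. rewrite <- Hu.
set (phi s := (Re (u * F s) - g s)%R).
assert (D : forall s, (a <= s <= b)%R -> is_derive phi s (Re (u * f s) - g' s)%R).
{ intros s Hs. apply (is_derive_minus (V := R_NormedModule)); auto.
  apply (cder_scal u F s (f s)); auto. }
destruct (MVT_gen phi a b (fun s => Re (u * f s) - g' s)%R) as [c [Hc E]].
- intros s Hs. apply D. rewrite Rmin_left, Rmax_right in Hs; lra.
- intros s Hs. apply continuity_pt_filterlim. apply (ex_derive_continuous (V := R_NormedModule)).
  eexists; apply D. rewrite Rmin_left, Rmax_right in Hs; lra.
- rewrite Rmin_left, Rmax_right in Hc by lra.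
  assert (L := Re_le_Cmod' u (f c) u1). specialize (Hfg c Hc).
  assert (phi b - phi a <= 0)%R. { rewrite E. nra. }
  unfold phi in H. replace (u * (F b - F a)) with (u * F b - u * F a) by ring. rewrite Re_minus. lra.
Qed.

Lemma cder_constant (F : R -> C) (a b : R) : (a <= b)%R ->
  (forall s, (a <= s <= b)%R -> cder F s 0) -> F b = F a.
Proof.
intros Hab H.
assert (Q := cder_increment F (fun _ => 0) (fun _ => 0%R) (fun _ => 0%R) a b Hab H).
assert (Z : Cmod (F b - F a) = 0%R).
{ apply Rle_antisym; [|apply Cmod_ge_0]. eapply Rle_trans; [apply Q|]. intros; apply (is_derive_const (V := R_NormedModule)).
  intros; rewrite Cmod_0; lra. lra. }
apply Cmod_eq_0 in Z. replace (F b) with (F b - F a + F a) by ring. rewrite Z; ring.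
Qed.

(** * The Taylor series of the exponential *)

Lemma INR_fact_pos (n : nat) : (0 < INR (fact n))%R.
Proof. apply lt_0_INR, lt_O_fact. Qed.
Lemma INR_fact_S (n : nat) : INR (fact (S n)) = ((INR n + 1) * INR (fact n))%R.
Proof. rewrite fact_simpl, mult_INR, S_INR. reflexivity. Qed.
Lemma INR_S_pos (n : nat) : (0 < INR n + 1)%R.
Proof. assert (H := pos_INR n). lra. Qed.

(** The derivative in t of the remainder of order n + 1 is z times the remainder of order n, so each
    induction step integrates the previous bound. The parameter t is there to make this integration
    possible. *)
Lemma cexp_taylor (z : C) (n : nat) (t : R) : (0 <= t <= 1)%R ->
  (Cmod (cexp (t * z) - Csum (fun k => ((t * z) ^ k / INR (fact k))%C) n)
    <= exp (Cmod z) * ((Cmod z * t) ^ n / INR (fact n)))%R.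
Proof.
revert t. induction n; intros t Ht.
- rewrite Csum_0. simpl. unfold Cminus. rewrite Copp_0, Cplus_0_r, Cmod_cexp.
  replace (1 / 1)%R with 1%R by field. rewrite Rmult_1_r.
  assert (L : (Re (t * z) <= Cmod z)%R).
  { eapply Rle_trans; [apply Rle_abs|]. eapply Rle_trans; [apply re_le_Cmod|]. rewrite Cmod_mult, Cmod_RtoC_pos by lra.
    assert (H := Cmod_ge_0 z). nra. }
  destruct (Rle_lt_or_eq_dec _ _ L) as [L'|L']. left; now apply exp_increasing. rewrite L'; lra.
- set (F s := cexp (RtoC s * z) - Csum (fun k => (RtoC s * z) ^ k / INR (fact k)) (S n)).
  set (f s := z * (cexp (RtoC s * z) - Csum (fun k => (RtoC s * z) ^ k / INR (fact k)) n)).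
  set (g s := (exp (Cmod z) * ((Cmod z * s) ^ S n / INR (fact (S n))))%R).
  set (g' s := (Cmod z * (exp (Cmod z) * ((Cmod z * s) ^ n / INR (fact n))))%R).
  assert (P1 := INR_fact_pos n). assert (P2 := INR_S_pos n).
  assert (DS : forall m s, cder (fun s => Csum (fun k => (RtoC s * z) ^ k / INR (fact k)) (S m)) s
                (z * Csum (fun k => (RtoC s * z) ^ k / INR (fact k)) m)).
  { induction m; intros s.
    - apply cder_ext with (fun _ => 1). intros; rewrite Csum_S, Csum_0; simpl. field.
      eapply cder_eq. apply cder_const. rewrite Csum_0; cring.
    - apply cder_ext with (fun s => Csum (fun k => (RtoC s * z) ^ k / INR (fact k)) (S m) + / INR (fact (S m)) * (RtoC s * z) ^ S m).
      intros; rewrite (Csum_S _ (S m)). unfold Cdiv. f_equal. ring.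
      eapply cder_eq. apply cder_plus. apply IHm. apply cder_scal. apply cder_pow. apply cder_mult. apply cder_id. apply cder_const.
      assert (N1 := RtoC_neq0 _ (Rgt_not_eq _ _ (INR_fact_pos m))).
      assert (N2 := RtoC_neq0 _ (Rgt_not_eq _ _ (INR_S_pos m))).
      rewrite Csum_S, INR_fact_S, S_INR, RtoC_mult. simpl pred. rewrite RtoC_plus in *. field. split; auto. }
  assert (Q : (Cmod (F t - F 0) <= g t - g 0)%R).
  { apply cder_increment with f g'. lra.
    - intros s Hs. unfold F, f. eapply cder_eq.
      apply (cder_plus _ (fun s => - Csum (fun k => (RtoC s * z) ^ k / INR (fact k)) (S n))).
      apply cder_cexp. apply cder_mult. apply cder_id. apply cder_const.
      eapply cder_ext; [|apply (cder_scal (-(1))); apply (DS n)]. intros; cring. cring.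
    - intros s Hs. unfold g, g'. auto_derive; auto.
      change (fact n + n * fact n)%nat with (fact (S n)). rewrite INR_fact_S.
      replace (match n with 0%nat => 1%R | S _ => (INR n + 1)%R end) with (INR n + 1)%R.
      2: destruct n; simpl; ring. field. split; lra.
    - intros s Hs. unfold f, g'. rewrite Cmod_mult. apply Rmult_le_compat_l. apply Cmod_ge_0. apply IHn; lra. }
  replace (F 0%R) with (RtoC 0) in Q. replace (g 0%R) with 0%R in Q.
  unfold F in Q. unfold Cminus in Q at 1. rewrite Copp_0, Cplus_0_r, Rminus_0_r in Q. exact Q.
  unfold g. simpl. field. assert (H := INR_fact_pos (S n)). simpl in H. lra.
  unfold F. replace (RtoC 0 * z) with (RtoC 0) by ring. rewrite cexp_0.
  clear. assert (H : Csum (fun k => RtoC 0 ^ k / INR (fact k)) (S n) = 1).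
  { induction n. rewrite Csum_S, Csum_0; simpl; field. rewrite Csum_S, IHn. simpl (RtoC 0 ^ S n).
    unfold Cdiv. ring. } rewrite H. ring.
Qed.

Lemma is_series_exp (x : R) : is_series (fun k => x ^ k / INR (fact k))%R (exp x).
Proof.
apply is_series_extR with (fun k => / INR (fact k) * x ^ k)%R. intros; unfold Rdiv; ring.
apply is_pseries_R. apply is_exp_Reals.
Qed.

Lemma is_series_cexp (z : C) : is_cseries (fun k => z ^ k / INR (fact k)) (cexp z).
Proof.
apply is_series_tail with (fun n => exp (Cmod z) * ((Cmod z) ^ n / INR (fact n)))%R.
- replace (Finite 0) with (Finite (exp (Cmod z) * 0)) by (f_equal; ring).
  apply (is_lim_seq_scal_l _ (exp (Cmod z)) 0%R). apply (ex_series_lim_0 _ (ex_intro _ _ (is_series_exp (Cmod z)))).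
- intros n. assert (H := cexp_taylor z n 1 ltac:(lra)). rewrite Rmult_1_r in H.
  replace (RtoC 1 * z) with z in H by ring. exact H.
Qed.

Lemma wien_cexp (l z0 : C) (r : R) : (0 < r)%R ->
  wien (fun z => cexp (l * z)) z0 r (fun k => cexp (l * z0) * (l ^ k / INR (fact k))) /\
  wnorm (fun k => cexp (l * z0) * (l ^ k / INR (fact k)))%C r = (exp (Re (l * z0)) * exp (Cmod l * r))%R.
Proof.
intros r0.
assert (I : is_series (fun k => Cmod (cexp (l * z0) * (l ^ k / INR (fact k)))%C * r ^ k)%R (exp (Re (l * z0)) * exp (Cmod l * r))%R).
{ apply is_series_extR with (fun k => exp (Re (l * z0)) * ((Cmod l * r) ^ k / INR (fact k)))%R.
  intros k. rewrite Cmod_mult, Cmod_cexp, Cmod_div, Cmod_pow, Cmod_RtoC_pos.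
  rewrite Rpow_mult_distr. field. apply Rgt_not_eq, INR_fact_pos. left; apply INR_fact_pos.
  apply RtoC_neq0, Rgt_not_eq, INR_fact_pos.
  apply is_series_scalR, is_series_exp. }
split. 2: now apply is_series_unique.
split; auto. split. eexists; apply I.
intros z Hz. replace (l * z) with (l * z0 + l * (z - z0)) by ring. rewrite cexp_add.
symmetry. apply CSeries_unique.
apply is_series_extC with (fun k => cexp (l * z0) * ((l * (z - z0)) ^ k / INR (fact k))).
intros k. rewrite Cpow_mult_l. unfold Cdiv. ring.
apply is_series_scalC, is_series_cexp.
Qed.

Lemma wien_le_cexp (l z0 : C) (r : R) : (0 < r)%R ->
  wien_le (fun z => cexp (l * z)) z0 r (exp (Re (l * z0)) * exp (Cmod l * r)).
Proof. intros H. destruct (wien_cexp l z0 r H) as [A B]. eexists; split; [apply A|]. rewrite B. apply Rle_refl. Qed.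

(** * Integrals over the half-line *)

(** [RInt] is total, so integrability on every initial segment is required besides the limit. *)
Definition rInt (f : R -> R) (l : R) : Prop :=
  (forall T, (0 <= T)%R -> ex_RInt f 0 T) /\ is_lim (fun T => RInt f 0 T) p_infty l.
Definition cInt (f : R -> C) (v : C) : Prop :=
  rInt (fun t => Re (f t)) (Re v) /\ rInt (fun t => Im (f t)) (Im v).

Lemma rInt_unique (f : R -> R) (l m : R) : rInt f l -> rInt f m -> l = m.
Proof.
intros [_ A] [_ B]. apply is_lim_unique in A. apply is_lim_unique in B. rewrite A in B. now injection B.
Qed.
Lemma cInt_unique (f : R -> C) (v w : C) : cInt f v -> cInt f w -> v = w.
Proof. intros [A B] [D E]. apply Ceq; eapply rInt_unique; eauto. Qed.

Lemma rInt_ext (f g : R -> R) (l : R) : (forall t, (0 <= t)%R -> f t = g t) -> rInt f l -> rInt g l.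
Proof.
intros H [A B]. split.
- intros T HT. apply (ex_RInt_ext f); auto. intros x Hx. rewrite Rmin_left in Hx by lra. apply H; lra.
- apply is_lim_ext_loc with (fun T => RInt f 0 T); auto. exists 0%R. intros T HT. apply RInt_ext.
  intros x Hx. rewrite Rmin_left in Hx by lra. apply H; lra.
Qed.
Lemma cInt_ext (f g : R -> C) (v : C) : (forall t, (0 <= t)%R -> f t = g t) -> cInt f v -> cInt g v.
Proof. intros H [A B]. split; [revert A | revert B]; apply rInt_ext; intros; now rewrite H. Qed.

Lemma rInt_plus (f g : R -> R) (l m : R) : rInt f l -> rInt g m -> rInt (fun t => f t + g t)%R (l + m)%R.
Proof.
intros [A B] [D E]. split.
- intros T HT. apply (ex_RInt_plus (V := R_NormedModule)); auto.
- apply is_lim_ext_loc with (fun T => RInt f 0 T + RInt g 0 T)%R.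
  exists 0%R. intros T HT. symmetry. apply (RInt_plus (V := R_CompleteNormedModule)); [apply A | apply D]; lra.
  apply (is_lim_plus _ _ _ l m); auto. reflexivity.
Qed.
Lemma rInt_scal (c : R) (f : R -> R) (l : R) : rInt f l -> rInt (fun t => c * f t)%R (c * l)%R.
Proof.
intros [A B]. split.
- intros T HT. apply (ex_RInt_scal (V := R_NormedModule)); auto.
- apply is_lim_ext_loc with (fun T => c * RInt f 0 T)%R.
  exists 0%R. intros T HT. symmetry. apply (RInt_scal (V := R_CompleteNormedModule)); apply A; lra.
  apply (is_lim_scal_l _ c _ l); auto.
Qed.
Lemma cInt_plus (f g : R -> C) (v w : C) : cInt f v -> cInt g w -> cInt (fun t => f t + g t) (v + w).
Proof. intros [A B] [D E]. split; apply rInt_plus; assumption. Qed.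
Lemma cInt_scal (c : C) (f : R -> C) (v : C) : cInt f v -> cInt (fun t => c * f t) (c * v).
Proof.
intros [A B]. split.
- apply rInt_ext with (fun t => Re c * Re (f t) + (- Im c) * Im (f t))%R. intros; reim; ring.
  replace (Re (c * v)) with (Re c * Re v + (- Im c) * Im v)%R by (reim; ring).
  apply rInt_plus; now apply rInt_scal.
- apply rInt_ext with (fun t => Re c * Im (f t) + Im c * Re (f t))%R. intros; reim; ring.
  replace (Im (c * v)) with (Re c * Im v + Im c * Re v)%R by (reim; ring).
  apply rInt_plus; now apply rInt_scal.
Qed.
Lemma cInt_minus (f g : R -> C) (v w : C) : cInt f v -> cInt g w -> cInt (fun t => f t - g t) (v - w).
Proof.
intros A B. apply cInt_ext with (fun t => f t + (- (1)) * g t). intros; ring.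
replace (v - w) with (v + (- (1)) * w) by ring. apply cInt_plus; auto. now apply cInt_scal.
Qed.
Lemma cInt_0 : cInt (fun _ => 0) 0.
Proof.
assert (rInt (fun _ => 0%R) 0%R).
{ split. intros; apply ex_RInt_const. apply is_lim_ext with (fun _ => 0%R).
  intros. rewrite RInt_const. unfold scal; simpl; unfold mult; simpl. ring. apply is_lim_const. }
split; exact H.
Qed.
Lemma cInt_Csum (f : nat -> R -> C) (v : nat -> C) (n : nat) :
  (forall k, (k < n)%nat -> cInt (f k) (v k)) -> cInt (fun t => Csum (fun k => f k t) n) (Csum v n).
Proof.
induction n; intros H. apply cInt_0.
rewrite Csum_S. apply cInt_ext with (fun t => Csum (fun k => f k t) n + f n t).
intros; now rewrite Csum_S. apply cInt_plus; auto.
Qed.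

Lemma rInt_le (f g : R -> R) (l m : R) :
  (forall t, (0 <= t)%R -> f t <= g t)%R -> rInt f l -> rInt g m -> (l <= m)%R.
Proof.
intros H [A B] [D E].
apply (is_lim_le_loc (fun T => RInt f 0 T) (fun T => RInt g 0 T) p_infty l m); auto.
exists 0%R. intros T HT. apply RInt_le; try (auto; lra). apply A; lra. apply D; lra. intros; apply H; lra.
Qed.

Lemma cInt_norm_le (f : R -> C) (g : R -> R) (v : C) (m : R) :
  (forall t, (0 <= t)%R -> Cmod (f t) <= g t)%R -> cInt f v -> rInt g m -> (Cmod v <= m)%R.
Proof.
intros H F G. destruct (unimodular v) as [u [u1 Hu]]. rewrite <- Hu.
apply (rInt_le (fun t => Re (u * f t)) g); auto.
intros t Ht. eapply Rle_trans; [apply Re_le_Cmod'; auto | now apply H].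
apply (cInt_scal u f v F).
Qed.

Lemma exp_neg_lim (d : R) : (0 < d)%R -> is_lim (fun T => exp (- (d * T))) p_infty 0.
Proof.
intros Hd. apply (is_lim_comp exp (fun T => - (d * T))%R p_infty 0 m_infty).
apply is_lim_exp_m.
replace m_infty with (Rbar_opp p_infty) by reflexivity. apply is_lim_opp.
replace p_infty with (Rbar_mult d p_infty) at 2. apply is_lim_scal_l, is_lim_id.
simpl. destruct (Rle_dec 0 d) as [r|]; [destruct (Rle_lt_or_eq_dec 0 d r)|]; auto; lra.
exists 0%R. intros; discriminate.
Qed.

Lemma exp_deriv_RInt (d a b : R) : (d <> 0)%R ->
  is_RInt (fun t => exp (- (d * t))) a b ((exp (- (d * a)) - exp (- (d * b))) / d)%R.
Proof.
intros Hd.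
replace ((exp (- (d * a)) - exp (- (d * b))) / d)%R
  with (minus (- / d * exp (- (d * b))) (- / d * exp (- (d * a))))%R.
2: unfold minus, plus, opp; simpl; field; auto.
apply (is_RInt_derive (V := R_CompleteNormedModule) (fun t => - / d * exp (- (d * t)))%R).
intros x _. auto_derive; auto. field; auto.
intros x _. apply (ex_derive_continuous (V := R_NormedModule)). auto_derive; auto.
Qed.

Lemma rInt_exp (d K : R) : (0 < d)%R -> rInt (fun t => K * exp (- (d * t)))%R (K / d)%R.
Proof.
intros Hd. apply (rInt_scal K (fun t => exp (- (d * t))) (/ d)%R). split.
- intros T _. eexists. apply exp_deriv_RInt; lra.
- apply is_lim_ext with (fun T => / d - / d * exp (- (d * T)))%R.
  intros T. rewrite (is_RInt_unique _ _ _ _ (exp_deriv_RInt d 0 T ltac:(lra))).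
  rewrite Rmult_0_r, Ropp_0, exp_0. field; lra.
  replace (Finite (/ d)) with (Finite (/ d - / d * 0)) by (f_equal; ring).
  apply is_lim_minus'. apply is_lim_const. apply (is_lim_scal_l _ (/ d)%R _ 0%R), exp_neg_lim, Hd.
Qed.

Definition expdom (f : R -> C) (K d : R) : Prop :=
  (0 < d)%R /\ (forall t, (0 <= t)%R -> ccont f t) /\
  forall t, (0 <= t)%R -> (Cmod (f t) <= K * exp (- (d * t)))%R.

Lemma rInt_exists (f : R -> R) (K d : R) : (0 < d)%R ->
  (forall t, (0 <= t)%R -> continuous f t) ->
  (forall t, (0 <= t)%R -> Rabs (f t) <= K * exp (- (d * t)))%R -> exists l, rInt f l.
Proof.
intros Hd Hc Hb.
assert (EI : forall a b, (0 <= a)%R -> (0 <= b)%R -> ex_RInt f a b).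
{ intros a b Ha Hb'. apply (ex_RInt_continuous (V := R_CompleteNormedModule)). intros z Hz. apply Hc.
  eapply Rle_trans; [|apply Hz]. now apply Rmin_glb. }
assert (K0 : (0 <= K)%R).
{ specialize (Hb 0%R ltac:(lra)). rewrite Rmult_0_r, Ropp_0, exp_0 in Hb. assert (H := Rabs_pos (f 0%R)). lra. }
assert (BD : forall a b, (0 <= a <= b)%R -> (Rabs (RInt f a b) <= K / d * exp (- (d * a)))%R).
{ intros a b Hab.
  assert (I := exp_deriv_RInt d a b ltac:(lra)).
  apply (is_RInt_scal (V := R_NormedModule) _ _ _ K) in I.
  eapply Rle_trans. apply (norm_RInt_le (V := R_CompleteNormedModule) f (fun t => scal K (exp (- (d * t)))) a b). lra.
  intros x Hx. apply Hb; lra. apply (RInt_correct (V := R_CompleteNormedModule)). apply EI; lra. exact I.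
  unfold scal; simpl; unfold mult; simpl.
  replace (K * ((exp (- (d * a)) - exp (- (d * b))) / d))%R with (K / d * exp (- (d * a)) - K / d * exp (- (d * b)))%R by (field; lra).
  assert (0 <= K / d * exp (- (d * b)))%R. apply Rmult_le_pos. apply Rmult_le_pos; auto. left; apply Rinv_0_lt_compat; lra. left; apply exp_pos.
  lra. }
destruct (proj1 (filterlim_locally_cauchy (U := R_CompleteSpace) (F := Rbar_locally p_infty) (fun T => RInt f 0 T))) as [l Hl].
- intros eps.
  assert (L := is_lim_scal_l _ (K / d) _ _ (exp_neg_lim d Hd)). simpl in L. rewrite Rmult_0_r in L.
  assert (L2 := proj1 (filterlim_locally _ _) L eps). destruct L2 as [T0 HT0].
  assert (core : forall u v, (Rmax T0 0 < u)%R -> (u <= v)%R -> (Rabs (RInt f 0 v - RInt f 0 u) < eps)%R).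
  { intros u v Hu Huv.
    assert (u0 : (0 <= u)%R) by (assert (H := Rmax_r T0 0); lra). assert (uT : (T0 < u)%R) by (assert (H := Rmax_l T0 0); lra).
    assert (CH : (RInt f 0 u + RInt f u v)%R = RInt f 0 v).
    { apply (RInt_Chasles (V := R_CompleteNormedModule) f 0 u v); apply EI; lra. }
    replace (RInt f 0 v - RInt f 0 u)%R with (RInt f u v) by (rewrite <- CH; lra).
    eapply Rle_lt_trans; [apply BD; lra|]. specialize (HT0 u uT).
    change (Rabs (K / d * exp (- (d * u)) - 0) < eps)%R in HT0. rewrite Rminus_0_r in HT0.
    eapply Rle_lt_trans; [apply Rle_abs | exact HT0]. }
  exists (fun T => (Rmax T0 0 < T)%R). split. exists (Rmax T0 0). auto.
  intros u v Hu Hv. change (Rabs (RInt f 0 v - RInt f 0 u) < eps)%R.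
  destruct (Rle_lt_dec u v). now apply core. rewrite Rabs_minus_sym. apply core; lra.
- exists l. split. intros; apply EI; lra. exact Hl.
Qed.

(** An arbitrary value if the improper integral diverges; convergence is supplied separately, for
    instance by [expdom_cInt]. *)
Definition Int (f : R -> C) : C := epsilon (inhabits (RtoC 0)) (cInt f).

Lemma cInt_Int (f : R -> C) (v : C) : cInt f v -> Int f = v.
Proof.
intros H. apply (cInt_unique f); auto. unfold Int. apply epsilon_spec. now exists v.
Qed.

Lemma expdom_cInt (f : R -> C) (K d : R) : expdom f K d -> cInt f (Int f).
Proof.
intros [d0 [Hc Hb]]. unfold Int. apply epsilon_spec.
destruct (rInt_exists (fun t => Re (f t)) K d) as [x Hx]; auto. intros t Ht; exact (proj1 (Hc t Ht)).
intros t Ht. eapply Rle_trans; [apply re_le_Cmod | auto].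
destruct (rInt_exists (fun t => Im (f t)) K d) as [y Hy]; auto. intros t Ht; exact (proj2 (Hc t Ht)).
intros t Ht. eapply Rle_trans; [apply im_le_Cmod | auto].
exists (x, y). split; assumption.
Qed.

Lemma expdom_bound (f : R -> C) (v : C) (K d : R) : (0 < d)%R ->
  (forall t, (0 <= t)%R -> Cmod (f t) <= K * exp (- (d * t)))%R -> cInt f v -> (Cmod v <= K / d)%R.
Proof. intros d0 Hb HI. apply (cInt_norm_le f (fun t => K * exp (- (d * t)))%R); auto. now apply rInt_exp. Qed.

Lemma rInt_FTC (F f : R -> R) : (forall t, (0 <= t)%R -> is_derive F t (f t)) ->
  (forall t, (0 <= t)%R -> continuous f t) -> is_lim F p_infty 0 -> rInt f (- F 0%R)%R.
Proof.
intros HF Hc HL.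
assert (I : forall T, (0 <= T)%R -> is_RInt f 0 T (F T - F 0)%R).
{ intros T HT. apply (is_RInt_derive (V := R_CompleteNormedModule)); intros x Hx; rewrite Rmin_left in Hx by lra.
  apply HF; lra. apply Hc; lra. }
split. intros T HT; eexists; now apply I.
apply is_lim_ext_loc with (fun T => F T - F 0)%R.
exists 0%R. intros T HT. symmetry. apply is_RInt_unique, I. lra.
replace (Finite (- F 0%R)) with (Finite (0 - F 0%R)) by (f_equal; ring).
apply is_lim_minus'; auto. apply is_lim_const.
Qed.

Lemma is_lim_squeeze0 (f g : R -> R) : (forall t, (0 <= t)%R -> Rabs (f t) <= g t)%R ->
  is_lim g p_infty 0 -> is_lim f p_infty 0.
Proof.
intros H L. apply (is_lim_le_le_loc (fun t => - g t)%R g); auto.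
exists 0%R. intros t Ht. specialize (H t ltac:(lra)). apply Rabs_le_between in H. lra.
replace (Finite 0) with (Rbar_opp 0) by (simpl; f_equal; ring). now apply is_lim_opp.
Qed.

Lemma cInt_FTC (F f : R -> C) (g : R -> R) : (forall t, (0 <= t)%R -> cder F t (f t)) ->
  (forall t, (0 <= t)%R -> ccont f t) ->
  (forall t, (0 <= t)%R -> Cmod (F t) <= g t)%R -> is_lim g p_infty 0 -> cInt f (- F 0%R).
Proof.
intros HF Hc HL Hg. split.
- rewrite Re_opp. apply (rInt_FTC (fun t => Re (F t)) (fun t => Re (f t))). intros t Ht; exact (proj1 (HF t Ht)). intros t Ht; exact (proj1 (Hc t Ht)).
  apply is_lim_squeeze0 with g; auto. intros; eapply Rle_trans; [apply re_le_Cmod | auto].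
- rewrite Im_opp. apply (rInt_FTC (fun t => Im (F t)) (fun t => Im (f t))). intros t Ht; exact (proj2 (HF t Ht)). intros t Ht; exact (proj2 (Hc t Ht)).
  apply is_lim_squeeze0 with g; auto. intros; eapply Rle_trans; [apply im_le_Cmod | auto].
Qed.

Lemma rInt_comp_lin (f : R -> R) (l c : R) : (0 < c)%R -> rInt f l -> rInt (fun t => f (c * t))%R (l / c)%R.
Proof.
intros Hc [A B].
assert (I : forall T, (0 <= T)%R -> is_RInt (fun t => f (c * t))%R 0 T (/ c * RInt f 0 (c * T))%R).
{ intros T HT. assert (cT : (0 <= c * T)%R) by nra.
  assert (Q := is_RInt_comp_lin (V := R_NormedModule) f c 0 0 T (RInt f 0 (c * T))).
  rewrite Rmult_0_r, !Rplus_0_r in Q. specialize (Q (RInt_correct (V := R_CompleteNormedModule) _ _ _ (A _ cT))).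
  apply (is_RInt_scal (V := R_NormedModule) _ _ _ (/ c)%R) in Q.
  eapply (is_RInt_ext (V := R_NormedModule)); [|exact Q].
  intros x _. unfold scal; simpl; unfold mult; simpl. rewrite Rplus_0_r. field; lra. }
split. intros; eexists; now apply I.
apply is_lim_ext_loc with (fun T => / c * RInt f 0 (c * T))%R.
exists 0%R. intros; symmetry; apply is_RInt_unique, I; lra.
unfold Rdiv; rewrite Rmult_comm. apply (is_lim_scal_l _ (/ c)%R _ l).
apply (is_lim_comp (fun T => RInt f 0 T) (fun T => c * T)%R p_infty l p_infty); auto.
replace p_infty with (Rbar_mult c p_infty) at 2. apply is_lim_scal_l, is_lim_id.
simpl. destruct (Rle_dec 0 c) as [r|]; [destruct (Rle_lt_or_eq_dec 0 c r)|]; auto; lra.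
exists 0%R; intros; discriminate.
Qed.

Lemma cInt_comp_lin (f : R -> C) (v : C) (c : R) : (0 < c)%R -> cInt f v -> cInt (fun t => f (c * t)%R) (v / c).
Proof.
intros Hc [A B]. replace (v / c) with (v * RtoC (/ c)%R) by (rewrite RtoC_inv by lra; reflexivity).
split; reim; rewrite ?Rmult_0_r, ?Rminus_0_r, ?Rplus_0_l.
now apply (rInt_comp_lin (fun t => Re (f t))). now apply (rInt_comp_lin (fun t => Im (f t))).
Qed.

Lemma cInt_is_RInt_gen (f : R -> C) (v : C) : cInt f v ->
  is_RInt_gen (V := C_R_NormedModule) f (at_point 0%R) (Rbar_locally p_infty) v.
Proof.
intros [[A B] [D E]].
intros P HP. destruct HP as [eps HP].
assert (B' := proj1 (filterlim_locally _ _) B eps). assert (E' := proj1 (filterlim_locally _ _) E eps).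
destruct B' as [T1 H1], E' as [T2 H2].
apply Filter_prod with (fun x => x = 0%R) (fun T => Rmax 0 (Rmax T1 T2) < T)%R.
- reflexivity.
- exists (Rmax 0 (Rmax T1 T2)). auto.
- intros a T -> HT. simpl.
  assert (M0 := Rmax_l 0 (Rmax T1 T2)). assert (M1 := Rmax_r 0 (Rmax T1 T2)).
  assert (M2 := Rmax_l T1 T2). assert (M3 := Rmax_r T1 T2).
  exists (RInt (fun t => Re (f t)) 0 T, RInt (fun t => Im (f t)) 0 T). split.
  + apply (is_RInt_fct_extend_pair (U := R_NormedModule) (V := R_NormedModule)); apply (RInt_correct (V := R_CompleteNormedModule)); [apply A | apply D]; lra.
  + apply HP. split. apply H1; lra. apply H2; lra.
Qed.

(** Dominated convergence with the product majorant w_k exp (-d t): the remainder of the integrand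
    is at most the tail of w times exp (-d t), and integrating it costs a factor 1/d. *)
Lemma cInt_series (f : nat -> R -> C) (v : nat -> C) (F : R -> C) (V : C) (w : nat -> R) (d : R) :
  (0 < d)%R -> (forall k, cInt (f k) (v k)) -> cInt F V -> ex_series w ->
  (forall k t, (0 <= t)%R -> Cmod (f k t) <= w k * exp (- (d * t)))%R ->
  (forall t, (0 <= t)%R -> F t = CSeries (fun k => f k t)) ->
  is_cseries v V.
Proof.
intros d0 Hf HF Hw Hb HS.
apply is_series_tail with (fun n => Series (fun k => w (n + k)%nat) * / d)%R.
replace (Finite 0) with (Finite (0 * / d)) by (f_equal; ring).
apply (is_lim_seq_scal_r _ (/ d)%R 0%R), Series_tail_lim, Hw.
intros n. apply (expdom_bound (fun t => F t - Csum (fun k => f k t) n)); auto.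
2: apply cInt_minus; auto; apply cInt_Csum; intros; auto.
intros t Ht. rewrite HS by auto.
assert (ES : forall m, ex_series (fun k => w (m + k)%nat * exp (- (d * t)))%R).
{ intros m. apply ex_series_scal_r. apply (ex_series_incr_n w m), Hw. }
assert (SM : summ (fun k => f k t)).
{ apply summ_le with (fun k => w k * exp (- (d * t)))%R; auto. apply (ES 0%nat). }
rewrite (CSeries_split _ n SM).
match goal with |- (Cmod ?x <= _)%R => replace x with (CSeries (fun k => f (n + k)%nat t)) by ring end.
rewrite <- Series_scal_r. apply CSeries_bound; auto.
Qed.

Lemma ccont_series (f : nat -> R -> C) (w : nat -> R) (t d : R) : (0 < d)%R ->
  (forall k, ccont (f k) t) -> ex_series w ->
  (forall k s, (Rabs (s - t) < d)%R -> Cmod (f k s) <= w k)%R -> ccont (fun s => CSeries (fun k => f k s)) t.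
Proof.
intros d0 Hc Hw Hb.
assert (SM : forall s, (Rabs (s - t) < d)%R -> summ (fun k => f k s)).
{ intros s Hs. apply summ_le with w; auto. }
apply ccont_eps. intros eps He.
assert (L := Series_tail_lim w Hw). apply is_lim_seq_spec in L.
(* Of the four quarters of [eps], two go to the tails at s and t and two to the components of the
   finite sum. *)
destruct (L (mkposreal (eps / 4) ltac:(lra))) as [N HN]. specialize (HN N (Nat.le_refl N)). simpl in HN. rewrite Rminus_0_r in HN.
assert (TL : forall s, (Rabs (s - t) < d)%R -> (Cmod (CSeries (fun k => f (N + k)%nat s)) <= eps / 4)%R).
{ intros s Hs. eapply Rle_trans. apply (CSeries_bound _ (fun k => w (N + k)%nat)). intros; now apply Hb.
  apply (ex_series_incr_n w N), Hw. left. eapply Rle_lt_trans; [apply Rle_abs|exact HN]. }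
destruct (ccont_sum f N t) as [C1 C2]; auto.
assert (C1' := proj1 (filterlim_locally _ _) C1 (mkposreal (eps / 4) ltac:(lra))).
assert (C2' := proj1 (filterlim_locally _ _) C2 (mkposreal (eps / 4) ltac:(lra))).
destruct C1' as [d1 H1], C2' as [d2 H2].
exists (Rmin d (Rmin d1 d2)). split. apply Rmin_glb_lt; auto. apply Rmin_glb_lt; [apply d1 | apply d2].
intros s Hs.
assert (s0 : (Rabs (s - t) < d)%R) by (eapply Rlt_le_trans; [apply Hs | apply Rmin_l]).
assert (s1 : (Rabs (s - t) < d1)%R) by (eapply Rlt_le_trans; [apply Hs | eapply Rle_trans; [apply Rmin_r | apply Rmin_l]]).
assert (s2 : (Rabs (s - t) < d2)%R) by (eapply Rlt_le_trans; [apply Hs | eapply Rle_trans; [apply Rmin_r | apply Rmin_r]]).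
specialize (H1 s s1). specialize (H2 s s2).
rewrite (CSeries_split _ N (SM s s0)), (CSeries_split _ N (SM t ltac:(rewrite Rminus_diag, Rabs_R0; auto))).
match goal with |- (Cmod ?x <= _)%R => replace x with
 ((Csum (fun k => f k s) N - Csum (fun k => f k t) N) + (CSeries (fun k => f (N + k)%nat s) - CSeries (fun k => f (N + k)%nat t))) by ring end.
assert (T1 := TL s s0). assert (T2 := TL t ltac:(rewrite Rminus_diag, Rabs_R0; auto)).
eapply Rle_trans; [apply Cmod_triangle|].
assert (A1 : (Cmod (Csum (fun k => f k s) N - Csum (fun k => f k t) N) <= eps / 4 + eps / 4)%R).
{ eapply Rle_trans; [apply Cmod_le_ReIm|]. rewrite Re_minus, Im_minus. left. apply Rplus_lt_compat; [exact H1 | exact H2]. }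
assert (A2 := Cmod_triangle_minus (CSeries (fun k => f (N + k)%nat s)) (CSeries (fun k => f (N + k)%nat t))).
lra.
Qed.

(** * The kernel z^(-n-1/2) *)

Definition slit (z : C) : Prop := (0 < Cmod z + Re z)%R.
(* The principal square root on the plane slit along the negative half-axis. *)
Definition csqrt (z : C) : C :=
  (sqrt ((Cmod z + Re z) / 2), Im z / (2 * sqrt ((Cmod z + Re z) / 2)))%R.

Lemma csqrt_Re (z : C) : slit z -> (0 < Re (csqrt z))%R.
Proof. intros H. unfold csqrt; simpl. apply sqrt_lt_R0. unfold slit in H. lra. Qed.

Lemma csqrt_sqr (z : C) : slit z -> csqrt z * csqrt z = z.
Proof.
intros H. assert (P := csqrt_Re z H). unfold csqrt in *; simpl in P.
set (s := sqrt ((Cmod z + Re z) / 2)) in *.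
assert (S2 : (s * s = (Cmod z + Re z) / 2)%R) by (apply sqrt_sqrt; unfold slit in H; lra).
apply Ceq; reim; simpl.
- assert (Q := Cmod_sqr z).
  replace (Im z / (2 * s) * (Im z / (2 * s)))%R with (Im z * Im z / (4 * (s * s)))%R by (field; lra).
  rewrite S2. replace (Im z * Im z)%R with (Cmod z * Cmod z - Re z * Re z)%R by lra.
  unfold slit in H. field. lra.
- field. lra.
Qed.

Lemma csqrt_neq0 (z : C) : slit z -> csqrt z <> 0.
Proof. intros H. apply Re_gt0_neq0, csqrt_Re, H. Qed.

Lemma slit_neq0 (z : C) : slit z -> z <> 0.
Proof. intros H E. unfold slit in H. rewrite E, Cmod_0 in H. simpl in H. lra. Qed.

Lemma Cmod_csqrt (z : C) : slit z -> (Cmod (csqrt z) * Cmod (csqrt z) = Cmod z)%R.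
Proof. intros H. rewrite <- Cmod_mult, csqrt_sqr; auto. Qed.

Lemma Cmult_eq0 (z w : C) : z * w = 0 -> z = 0 \/ w = 0.
Proof.
intros H. destruct (classic (z = 0)) as [|N]; auto. right.
replace w with (/ z * (z * w)) by (field; auto). rewrite H; ring.
Qed.

(** The principal root is the root with positive real part, since the only other root is its
    opposite. The slit condition follows from |u|^2 + Re (u^2) = 2 (Re u)^2. *)
Lemma csqrt_unique (u z : C) : u * u = z -> (0 < Re u)%R -> slit z /\ csqrt z = u.
Proof.
intros H P.
assert (SL : slit z).
{ unfold slit. rewrite <- H, Cmod_mult, Cmod_sqr. reim. nra. }
split; auto.
assert (E : (csqrt z - u) * (csqrt z + u) = 0).
{ replace ((csqrt z - u) * (csqrt z + u)) with (csqrt z * csqrt z - u * u) by ring.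
  rewrite csqrt_sqr, H by auto. ring. }
destruct (Cmult_eq0 _ _ E) as [E'|E'].
- replace (csqrt z) with (csqrt z - u + u) by ring. rewrite E'; ring.
- exfalso. apply (f_equal Re) in E'. rewrite Re_plus in E'. assert (Q := csqrt_Re z SL). simpl in E'. simpl in Q. lra.
Qed.

(* [sb k] are the Taylor coefficients of (1 - w)^(-1/2), [kc n k] those of (1 - w)^(-n-1/2). *)
Fixpoint sb (n : nat) : R := match n with O => 1%R | S m => (sb m * (2 * INR m + 1) / (2 * INR m + 2))%R end.
Fixpoint kc (n : nat) : nat -> R := match n with O => sb | S m => fun k => Rsum (kc m) (S k) end.

Lemma sb_bounds (n : nat) : (0 < sb n <= 1)%R.
Proof.
induction n; simpl. lra. assert (P := pos_INR n).
assert (Q : (0 < (2 * INR n + 1) / (2 * INR n + 2) <= 1)%R).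
{ split. apply Rdiv_lt_0_compat; lra. apply (Rmult_le_reg_r (2 * INR n + 2)). lra. unfold Rdiv.
  rewrite Rmult_assoc, Rinv_l by lra. lra. }
unfold Rdiv in *. rewrite Rmult_assoc. nra.
Qed.

Lemma sb_rec (n : nat) : (2 * (INR n + 1) * sb (S n) = (2 * INR n + 1) * sb n)%R.
Proof. simpl. field. assert (P := pos_INR n). lra. Qed.

Lemma Rsum_ext (a b : nat -> R) (n : nat) : (forall k, (k < n)%nat -> a k = b k) -> Rsum a n = Rsum b n.
Proof. induction n; intros H; simpl; auto. rewrite IHn, H; auto. Qed.
Lemma Rsum_plus (a b : nat -> R) (n : nat) : Rsum (fun k => a k + b k)%R n = (Rsum a n + Rsum b n)%R.
Proof. induction n; simpl. ring. rewrite IHn; ring. Qed.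
Lemma Rsum_scal (c : R) (a : nat -> R) (n : nat) : Rsum (fun k => c * a k)%R n = (c * Rsum a n)%R.
Proof. induction n; simpl. ring. rewrite IHn; ring. Qed.
Lemma Rsum_shift (a : nat -> R) (n : nat) : Rsum a (S n) = (a 0%nat + Rsum (fun k => a (S k)) n)%R.
Proof. induction n. simpl; ring. simpl in *. rewrite IHn; ring. Qed.
Lemma Rsum_rev (a : nat -> R) (n : nat) : Rsum a (S n) = Rsum (fun k => a (n - k)%nat) (S n).
Proof.
induction n. reflexivity.
rewrite (Rsum_shift (fun k => a (S n - k)%nat)). change (Rsum a (S (S n))) with (Rsum a (S n) + a (S n))%R.
rewrite IHn. replace (S n - 0)%nat with (S n) by lia. rewrite Rplus_comm. f_equal.
Qed.

(* Multiply by [i] and symmetrize: both sides of [sb_rec] give n + 1 times consecutive convolutions. *)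
Lemma sb_conv (n : nat) : Rsum (fun i => sb i * sb (n - i))%R (S n) = 1%R.
Proof.
set (t n := Rsum (fun i => sb i * sb (n - i))%R (S n)).
assert (W : forall m, (2 * Rsum (fun i => INR i * (sb i * sb (m - i))) (S m) = INR m * t m)%R).
{ intros m. unfold t.
  assert (E : Rsum (fun i => INR i * (sb i * sb (m - i)))%R (S m) = Rsum (fun i => (INR m - INR i) * (sb i * sb (m - i)))%R (S m)).
  { rewrite Rsum_rev. apply Rsum_ext. intros k Hk. rewrite minus_INR by lia. replace (m - (m - k))%nat with k by lia. ring. }
  assert (E2 : (Rsum (fun i => INR i * (sb i * sb (m - i))) (S m) + Rsum (fun i => (INR m - INR i) * (sb i * sb (m - i))) (S m) = INR m * Rsum (fun i => sb i * sb (m - i)) (S m))%R).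
  { rewrite <- Rsum_plus, <- Rsum_scal. apply Rsum_ext. intros; ring. }
  lra. }
change (t n = 1%R). induction n. unfold t; simpl; ring.
assert (H := W (S n)). rewrite Rsum_shift, S_INR in H. simpl (INR 0) in H.
assert (E : (2 * Rsum (fun k => INR (S k) * (sb (S k) * sb (S n - S k))) (S n) = INR n * t n + t n)%R).
{ rewrite <- W. unfold t. rewrite <- !Rsum_scal, <- Rsum_plus. apply Rsum_ext. intros k _.
  rewrite S_INR. simpl (S n - S k)%nat. assert (R1 := sb_rec k).
  replace (2 * ((INR k + 1) * (sb (S k) * sb (n - k))))%R with ((2 * (INR k + 1) * sb (S k)) * sb (n - k))%R by ring.
  rewrite R1. ring. }
rewrite IHn in E. assert (P := pos_INR n). nra.
Qed.

(** The partial sums telescope by [sb_rec]. The closed forms here and in [kc_2] belong to the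
    exponents 3/2 and 5/2, and are matched with factorials in [coef_identity]. *)
Lemma kc_1 (k : nat) : kc 1 k = ((2 * INR k + 1) * sb k)%R.
Proof.
induction k. simpl; ring. change (kc 1 (S k)) with (kc 1 k + sb (S k))%R. rewrite IHk.
rewrite S_INR. rewrite <- sb_rec. ring.
Qed.
Lemma kc_2 (k : nat) : kc 2 k = ((2 * INR k + 1) * (2 * INR k + 3) / 3 * sb k)%R.
Proof.
induction k. simpl; field. change (kc 2 (S k)) with (kc 2 k + kc 1 (S k))%R. rewrite IHk, kc_1.
rewrite S_INR. replace ((2 * INR k + 1) * (2 * INR k + 3) / 3 * sb k)%R with ((2 * INR k + 3) / 3 * ((2 * INR k + 1) * sb k))%R by field.
rewrite <- sb_rec. field.
Qed.

(** [sb k] is the central binomial coefficient divided by 4^k; this makes it comparable with the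
    factorials in the values L(-2p-nu, g). *)
Lemma sb_fact (k : nat) : (sb k * (INR (fact k) * INR (fact k) * 4 ^ k) = INR (fact (2 * k)))%R.
Proof.
induction k. simpl; ring.
replace (2 * S k)%nat with (S (S (2 * k))) by lia.
rewrite !INR_fact_S, !S_INR, mult_INR, <- IHk. simpl (4 ^ S k)%R. simpl (INR 2).
transitivity (2 * (INR k + 1) * sb (S k) * (INR k + 1) * 2 * (INR (fact k) * INR (fact k) * 4 ^ k))%R. ring.
rewrite sb_rec. ring.
Qed.

Definition Sfun (w : C) : C := CSeries (fun k => RtoC (sb k) * w ^ k).

Lemma is_series_geomC (w : C) : (Cmod w < 1)%R ->
  is_cseries (fun k => w ^ k) (/ (1 - w)).
Proof.
intros H. assert (N : 1 - w <> 0).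
{ intros E. assert (w = 1) by (replace w with (1 - (1 - w)) by ring; rewrite E; ring). rewrite H0, Cmod_1 in H. lra. }
apply is_series_tail with (fun n => Cmod w ^ n * Cmod (/ (1 - w)))%R.
- replace (Finite 0) with (Finite (0 * Cmod (/ (1 - w)))) by (f_equal; ring).
  apply (is_lim_seq_scal_r _ _ 0%R). apply is_lim_seq_geom. rewrite Rabs_pos_eq; auto. apply Cmod_ge_0.
- intros n. replace (/ (1 - w) - Csum (fun k => w ^ k) n) with (w ^ n * / (1 - w)).
  rewrite Cmod_mult, Cmod_pow. apply Rle_refl.
  induction n. rewrite Csum_0. simpl. ring.
  rewrite Csum_S. replace (/ (1 - w) - (Csum (fun k => w ^ k) n + w ^ n)) with ((/ (1 - w) - Csum (fun k => w ^ k) n) - w ^ n) by ring.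
  rewrite <- IHn. simpl. field. auto.
Qed.

Lemma ex_series_geomR (r : R) : (0 <= r < 1)%R -> ex_series (fun k => r ^ k)%R.
Proof. intros H. apply ex_series_geom. rewrite Rabs_pos_eq; lra. Qed.

Lemma wien_Sfun (r : R) : (0 < r < 1)%R ->
  wien Sfun 0 r (fun k => RtoC (sb k)) /\ (wnorm (fun k => RtoC (sb k)) r <= / (1 - r))%R.
Proof.
intros Hr.
assert (L : forall k, (0 <= Cmod (RtoC (sb k)) * r ^ k <= r ^ k)%R).
{ intros k. destruct (sb_bounds k) as [s0 s1]. rewrite Cmod_RtoC_pos by lra. assert (P := pow_lt r k ltac:(lra)). nra. }
split. split. lra. split. apply ex_series_leR with (fun k => r ^ k)%R; auto. apply ex_series_geomR; lra.
intros z _. unfold Sfun. apply CSeries_ext; intros. f_equal. f_equal. ring.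
rewrite <- (is_series_unique _ _ (is_series_geom r ltac:(rewrite Rabs_pos_eq; lra))).
apply Series_le; auto. apply ex_series_geomR; lra.
Qed.

Lemma wien_geom (r : R) : (0 < r < 1)%R ->
  wien (fun w => / (1 - w)) 0 r (fun _ => 1) /\ wnorm (fun _ => 1%C) r = (/ (1 - r))%R.
Proof.
intros Hr.
assert (I : is_series (fun k => Cmod 1 * r ^ k)%R (/ (1 - r))%R).
{ apply is_series_extR with (fun k => r ^ k)%R. intros; rewrite Cmod_1; ring.
  apply is_series_geom. rewrite Rabs_pos_eq; lra. }
split. 2: now apply is_series_unique. split. lra. split. eexists; apply I.
intros z Hz. replace (z - 0) with z in * by ring. symmetry. apply CSeries_unique.
apply is_series_extC with (fun k => z ^ k). intros; ring. apply is_series_geomC. lra.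
Qed.

(** By [sb_conv] the Cauchy square of the series has all coefficients 1. Only the square is
    identified here; the sign of the root is settled in [kap_local]. *)
Lemma Sfun_sqr (w : C) : (Cmod w < 1)%R -> Sfun w * Sfun w = / (1 - w).
Proof.
intros H. assert (H0 := Cmod_ge_0 w).
set (r := ((Cmod w + 1) / 2)%R).
destruct (wien_Sfun r ltac:(unfold r; lra)) as [A _].
destruct (wien_mult _ _ _ _ _ _ A A) as [[_ [_ E]] _].
assert (Hw : (Cmod (w - 0) <= r)%R) by (replace (w - 0) with w by ring; unfold r; lra).
rewrite (E w Hw). apply CSeries_unique. apply is_series_extC with (fun k => w ^ k).
2: now apply is_series_geomC.
intros n. replace (w - 0) with w by ring.
assert (Q : Csum (fun n0 => RtoC (sb n0) * RtoC (sb (n - n0))) (S n) = RtoC (Rsum (fun i => sb i * sb (n - i))%R (S n))).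
{ generalize (S n). intros m. induction m. reflexivity. rewrite Csum_S, IHm. simpl. rewrite RtoC_plus, RtoC_mult. reflexivity. }
rewrite Q, sb_conv. ring.
Qed.

Lemma Sfun_near1 (w : C) : (Cmod w <= / 4)%R -> (Cmod (Sfun w - 1) <= 4 / 3 * Cmod w)%R.
Proof.
intros H. assert (P := Cmod_ge_0 w).
assert (LE : forall k, (Cmod (RtoC (sb (S k)) * w ^ S k) <= Cmod w * Cmod w ^ k)%R).
{ intros k. destruct (sb_bounds (S k)) as [s0 s1]. rewrite Cmod_mult, Cmod_pow, Cmod_RtoC_pos by lra.
  assert (P1 := pow_le (Cmod w) (S k) P). simpl in P1. simpl pow. nra. }
assert (EX : ex_series (fun k => Cmod w * Cmod w ^ k)%R) by (apply ex_series_scalR, ex_series_geomR; lra).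
assert (SM : summ (fun k => RtoC (sb k) * w ^ k)).
{ apply (ex_series_incr_1 (fun k => Cmod (RtoC (sb k) * w ^ k))).
  apply ex_series_leR with (fun k => Cmod w * Cmod w ^ k)%R; auto. intros; split; auto. apply Cmod_ge_0. }
unfold Sfun. rewrite (CSeries_split _ 1 SM), Csum_S, Csum_0.
match goal with |- (Cmod ?x <= _)%R => replace x with (CSeries (fun k => RtoC (sb (1 + k)) * w ^ (1 + k))) end.
2: simpl; ring.
eapply Rle_trans. apply (CSeries_bound _ _ LE EX).
rewrite Series_scal_l. match goal with |- context [Series ?s] => replace (Series s) with (/ (1 - Cmod w))%R end.
2: symmetry; apply is_series_unique, is_series_geom; rewrite Rabs_pos_eq; lra.
rewrite Rmult_comm. apply Rmult_le_compat_r; auto.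
replace (4 / 3)%R with (/ (3 / 4))%R by field. apply Rinv_le_contravar; lra.
Qed.

Definition kap (n : nat) (z : C) : C := / (z ^ n * csqrt z).

Lemma Cmod_lt1_neq (w : C) : (Cmod w < 1)%R -> 1 - w <> 0.
Proof.
intros H E. assert (w = 1) by (replace w with (1 - (1 - w)) by ring; rewrite E; ring). rewrite H0, Cmod_1 in H. lra.
Qed.

(* The two square roots of z0 (1 - w) are told apart by the sign of the real part, which needs [w] small
   compared with the opening [d] of the sector containing [csqrt z0]. *)
Lemma kap_local (n : nat) (z0 w : C) (d : R) : slit z0 -> (0 < d <= 1)%R ->
  (d * Cmod (csqrt z0) <= Re (csqrt z0))%R -> (Cmod w <= d / 4)%R ->
  slit (z0 * (1 - w)) /\ kap n (z0 * (1 - w)) = kap n z0 * ((/ (1 - w)) ^ n * Sfun w).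
Proof.
intros SL Hd Hs Hw. assert (w1 : (Cmod w < 1)%R) by lra. assert (w4 : (Cmod w <= / 4)%R) by lra.
assert (N1 := Cmod_lt1_neq w w1). assert (SQ := Sfun_sqr w w1).
assert (NS : Sfun w <> 0). { intros E. rewrite E in SQ. assert (F : (1 - w) * (0 * 0) = 1) by (rewrite SQ; field; auto).
  replace ((1 - w) * (0 * 0)) with (RtoC 0) in F by ring. apply RtoC_inj in F. lra. }
assert (N2 := csqrt_neq0 z0 SL). assert (N3 := slit_neq0 z0 SL).
(* The candidate for the square root of 1 - w: its square is right by [Sfun_sqr], and being closer
   to 1 than [d] it cannot move [csqrt z0] out of the right half-plane. *)
set (T := (1 - w) * Sfun w).
assert (T1 : (Cmod (T - 1) < d)%R).
{ assert (H := Sfun_near1 w w4). assert (P := Cmod_ge_0 w).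
  replace (T - 1) with ((1 - w) * (Sfun w - 1) - w) by (unfold T; ring).
  eapply Rle_lt_trans; [apply Cmod_triangle_minus|]. rewrite Cmod_mult.
  assert (Cmod (1 - w) <= 5 / 4)%R. { eapply Rle_trans; [apply Cmod_triangle_minus|]. rewrite Cmod_1; lra. }
  assert (P2 := Cmod_ge_0 (Sfun w - 1)). nra. }
destruct (csqrt_unique (csqrt z0 * T) (z0 * (1 - w))) as [S1 S2].
- unfold T. transitivity ((csqrt z0 * csqrt z0) * ((1 - w) * (1 - w) * (Sfun w * Sfun w))). ring.
  rewrite SQ, csqrt_sqr by auto. field; auto.
- replace (csqrt z0 * T) with (csqrt z0 + csqrt z0 * (T - 1)) by ring. rewrite Re_plus.
  assert (L := re_le_Cmod (csqrt z0 * (T - 1))). rewrite Cmod_mult in L. apply Rabs_le_between in L.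
  assert (P := proj1 (Cmod_gt_0 _) N2). nra.
- split; auto. unfold kap. rewrite S2. unfold T.
  rewrite Cpow_mult_l, Cpow_inv by auto.
  replace (Sfun w) with (/ ((1 - w) * Sfun w)) at 2.
  assert (N4 := Cpow_nz z0 n N3). assert (N5 := Cpow_nz (1 - w) n N1). field. repeat split; auto.
  replace (/ ((1 - w) * Sfun w)) with (/ (1 - w) * / Sfun w) by (field; auto). rewrite <- SQ. field; auto.
Qed.

(** Each induction step multiplies by 1/(1 - w), whose norm at radius 1/4 is 4/3, rounded up to 2.
    Its coefficients are all 1, so the product takes partial sums, as in the recursion of [kc]. *)
Lemma wien_le_kap_poly (n : nat) : exists a, wien (fun w => (/ (1 - w)) ^ n * Sfun w) 0 (/ 4) a /\
  (wnorm a (/ 4) <= 2 ^ S n)%R /\ forall k, a k = RtoC (kc n k).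
Proof.
induction n.
- destruct (wien_Sfun (/ 4) ltac:(lra)) as [A B]. exists (fun k => RtoC (sb k)). split; [|split; auto; simpl; lra].
  destruct A as [A1 [A2 A3]]. split; auto. split; auto. intros z Hz. rewrite <- A3; auto. simpl; ring.
- destruct IHn as [a [A1 [A2 A3]]]. destruct (wien_geom (/ 4) ltac:(lra)) as [G1 G2].
  destruct (wien_mult _ _ _ _ _ _ A1 G1) as [W1 W2].
  eexists. split; [|split].
  + destruct W1 as [W0 [W3 W4]]. split; [exact W0|]. split; [exact W3|]. intros z Hz. rewrite <- W4; auto. simpl; ring.
  + eapply Rle_trans; [apply W2|]. rewrite G2. assert (P := wnorm_ge0 _ _ _ _ A1). change (2 ^ S (S n))%R with (2 * 2 ^ S n)%R. lra.
  + intros k. change (Csum (fun n => a n * 1) (S k) = RtoC (Rsum (kc n) (S k))). generalize (S k). intros m.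
    induction m. reflexivity. rewrite Csum_S, IHm, A3. simpl. rewrite RtoC_plus. ring.
Qed.

(** The base 1 + i xi of the kernel along the ray xi = t e. For unit e and t >= 0 it vanishes only
    at e = i, t = 1: i is the singular direction. *)
Definition zray (e : C) (t : R) : C := 1 + Ci * (RtoC t * e).

(** [eps] measures how far the direction e stays from i. All constants depend on [eps] alone, which
    gives bounds uniform on closed sectors: linear growth of |z|, and for the square root the
    opening that [kap_local] asks for. *)
Lemma zray_bounds (e : C) (t eps : R) : Cmod e = 1%R -> (Im e <= 1 - eps)%R -> (0 < eps <= 1)%R -> (0 <= t)%R ->
  (sqrt (eps / 2) * (1 + t) <= Cmod (zray e t))%R /\ slit (zray e t) /\
  (sqrt (eps / 16) * Cmod (csqrt (zray e t)) <= Re (csqrt (zray e t)))%R.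
Proof.
intros He Hi Hep Ht.
set (z := zray e t).
assert (E1 : (Re e * Re e + Im e * Im e = 1)%R). { rewrite <- Cmod_sqr, He; ring. }
assert (Rz : Re z = (1 - t * Im e)%R) by (unfold z, zray; reim; ring).
assert (Iz : Im z = (t * Re e)%R) by (unfold z, zray; reim; ring).
set (q := Re e) in *. set (p := Im e) in *. assert (M := Cmod_ge_0 z). assert (M2 := Cmod_sqr z).
rewrite Rz, Iz in M2.
assert (p1 : (-1 <= p)%R) by nra.
(* Twice |z|^2 = 1 - 2 t p + t^2 equals (1 - p)(1 + t)^2 + (1 + p)(1 - t)^2, and 1 - p is at least
   [eps]. *)
assert (B1 : (eps / 2 * (1 + t) * (1 + t) <= Cmod z * Cmod z)%R).
{ rewrite M2. replace ((1 - t * p) * (1 - t * p) + t * q * (t * q))%R with (1 - 2 * t * p + t * t * (q * q + p * p))%R by ring.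
  rewrite E1. assert (0 <= (1 - p - eps) * ((1 + t) * (1 + t)))%R by (apply Rmult_le_pos; [lra|apply Rle_0_sqr]).
  assert (0 <= (1 + p) * ((1 - t) * (1 - t)))%R by (apply Rmult_le_pos; [lra|apply Rle_0_sqr]). lra. }
assert (S1 := sqrt_lt_R0 (eps / 2) ltac:(lra)). assert (S2 := sqrt_sqrt (eps / 2) ltac:(lra)).
assert (LB : (sqrt (eps / 2) * (1 + t) <= Cmod z)%R).
{ apply Rsqr_incr_0_var; auto. unfold Rsqr. nra. }
assert (z0 : (0 < Cmod z)%R) by nra.
assert (LS : (eps / 8 * Cmod z <= Cmod z + Re z)%R).
{ destruct (Rle_lt_dec 0 (Re z)) as [H|H]. nra.
  rewrite Rz in *.
  assert (p0 : (0 < p)%R) by nra.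
  assert (t1 : (1 <= t)%R) by nra.
  assert (zt : (Cmod z <= 2 * t)%R).
  { unfold z, zray. eapply Rle_trans; [apply Cmod_triangle|]. rewrite Cmod_1, !Cmod_mult, Cmod_Ci, Cmod_RtoC_pos, He by auto. lra. }
  assert (qe : (eps <= q * q)%R) by nra.
  (* When Re z < 0 the sum |z| + Re z suffers cancellation. Its product with |z| - Re z is (t q)^2,
     where q^2 = 1 - p^2 is at least [eps] because p > 0. *)
  assert (F : ((Cmod z + (1 - t * p)) * (Cmod z - (1 - t * p)) = t * q * (t * q))%R) by (ring_simplify; nra).
  assert (U : (Cmod z - (1 - t * p) <= 2 * Cmod z)%R).
  { assert (G := re_le_Cmod z). rewrite Rz in G. apply Rabs_le_between in G. lra. }
  assert (V : (0 < Cmod z - (1 - t * p))%R) by lra.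
  apply (Rmult_le_reg_r _ _ _ V). rewrite F.
  apply Rle_trans with (eps / 8 * Cmod z * (2 * Cmod z))%R. apply Rmult_le_compat_l; nra.
  apply Rle_trans with (eps * (t * t))%R. 2: nra.
  replace (eps / 8 * Cmod z * (2 * Cmod z))%R with (eps * (Cmod z * Cmod z / 4))%R by field.
  apply Rmult_le_compat_l; nra. }
split; auto.
assert (SL : slit z) by (unfold slit; nra). split; auto.
assert (PR := csqrt_Re z SL). assert (CM := Cmod_csqrt z SL). assert (PM := Cmod_ge_0 (csqrt z)).
apply Rsqr_incr_0_var; [|lra]. unfold Rsqr.
replace (Re (csqrt z) * Re (csqrt z))%R with ((Cmod z + Re z) / 2)%R.
2:{ change (Re (csqrt z)) with (sqrt ((Cmod z + Re z) / 2)). symmetry; apply sqrt_sqrt. unfold slit in SL. lra. }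
assert (S3 := sqrt_sqrt (eps / 16) ltac:(lra)).
replace (sqrt (eps / 16) * Cmod (csqrt z) * (sqrt (eps / 16) * Cmod (csqrt z)))%R
 with ((sqrt (eps / 16) * sqrt (eps / 16)) * (Cmod (csqrt z) * Cmod (csqrt z)))%R by ring.
rewrite S3, CM. lra.
Qed.

Definition kapK (n : nat) (eps : R) : R := (/ (sqrt (eps / 2) ^ n * sqrt (sqrt (eps / 2))))%R.

Lemma kap_ray_bound (n : nat) (e : C) (t eps : R) : Cmod e = 1%R -> (Im e <= 1 - eps)%R -> (0 < eps <= 1)%R -> (0 <= t)%R ->
  (Cmod (kap n (zray e t)) <= kapK n eps)%R.
Proof.
intros He Hi Hep Ht. destruct (zray_bounds e t eps He Hi Hep Ht) as [B1 [SL _]].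
assert (S1 := sqrt_lt_R0 (eps / 2) ltac:(lra)). set (m := sqrt (eps / 2)) in *.
assert (B2 : (m <= Cmod (zray e t))%R) by nra.
unfold kap, kapK. apply Cmod_inv_le. apply Rmult_lt_0_compat. now apply pow_lt. now apply sqrt_lt_R0.
fold m. rewrite Cmod_mult, Cmod_pow. apply Rmult_le_compat. apply pow_le; lra. apply sqrt_pos. apply pow_incr; lra.
replace (Cmod (csqrt (zray e t))) with (sqrt (Cmod (zray e t))). now apply sqrt_le_1_alt.
rewrite <- Cmod_csqrt by auto. apply sqrt_square, Cmod_ge_0.
Qed.

(* [al] scales the singular point to i * al. *)
Lemma wien_le_kap_scaled (n : nat) (al r eps : R) (e : C) (t : R) :
  Cmod e = 1%R -> (Im e <= 1 - eps)%R -> (0 < eps <= 1)%R -> (0 <= t)%R -> (0 < al)%R ->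
  (0 < r)%R -> (r <= al * (sqrt (eps / 2) * (sqrt (eps / 16) / 4)))%R ->
  wien_le (fun xi => kap n (1 + Ci * (xi / al))) (t * e) r (2 ^ S n * kapK n eps).
Proof.
intros He Hi Hep Ht Hal Hr Hra.
assert (ta : (0 <= t / al)%R) by (apply Rmult_le_pos; auto; left; now apply Rinv_0_lt_compat).
destruct (zray_bounds e (t / al) eps He Hi Hep ta) as [B1 [SL B3]].
assert (KB := kap_ray_bound n e (t / al) eps He Hi Hep ta).
set (z0 := zray e (t / al)) in *. set (d := sqrt (eps / 16)) in *.
assert (d0 : (0 < d)%R) by (apply sqrt_lt_R0; lra).
assert (d1 : (d <= 1)%R). { unfold d. rewrite <- sqrt_1. apply sqrt_le_1_alt. lra. }
assert (S1 := sqrt_lt_R0 (eps / 2) ltac:(lra)). set (m := sqrt (eps / 2)) in *.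
assert (zm : (m <= Cmod z0)%R) by nra.
assert (alN : RtoC al <> 0) by (apply RtoC_neq0; lra). assert (zN := slit_neq0 z0 SL).
(* The variable w of [kap_local] at the base point [z0], affine in xi. The bound on [r] keeps it
   below d / 4, hence within the radius 1/4 of the series. *)
set (u := fun xi : C => - (Ci * (xi - t * e) / (al * z0))).
assert (u0 : u (t * e) = 0) by (unfold u; field; auto).
assert (UE : forall xi, 1 + Ci * (xi / al) = z0 * (1 - u xi)).
{ intros xi. unfold u. replace (z0 * (1 - - (Ci * (xi - t * e) / (al * z0)))) with (z0 + Ci * (xi - t * e) / al) by (field; auto).
  unfold z0, zray. rewrite RtoC_div by lra. field; auto. }
assert (UB : forall xi, (Cmod (xi - t * e) <= r)%R -> (Cmod (u xi) <= d / 4)%R).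
{ intros xi Hxi. unfold u. rewrite Cmod_opp, Cmod_div by (apply Cmult_neq_0; auto).
  rewrite !Cmod_mult, Cmod_Ci, Cmod_RtoC_pos, Rmult_1_l by lra.
  apply (Rmult_le_reg_r (al * Cmod z0)). nra. unfold Rdiv at 1. rewrite Rmult_assoc, Rinv_l by nra. rewrite Rmult_1_r.
  apply Rle_trans with r; auto. eapply Rle_trans; [apply Hra|].
  replace (al * (m * (d / 4)))%R with (d / 4 * (al * m))%R by ring. apply Rmult_le_compat_l; nra. }
destruct (wien_le_kap_poly n) as [a [A1 [A2 _]]].
rewrite Rmult_comm.
apply wien_le_weaken with (Cmod (kap n z0) * wnorm a (/ 4))%R.
{ apply Rmult_le_compat; auto. apply Cmod_ge_0. eapply wnorm_ge0; eauto. }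
apply wien_le_ext with (fun xi => kap n z0 * ((/ (1 - u xi)) ^ n * Sfun (u xi))).
{ intros xi Hxi. rewrite UE. destruct (kap_local n z0 (u xi) d) as [_ E]; auto. }
apply wien_le_scal. rewrite <- u0 in A1. apply (wien_comp _ u (t * e) r (/ 4) a A1).
eapply wien_le_weaken. 2: eapply wien_le_ext. 3: apply (wien_le_poly1 0 (- (Ci / (al * z0))) (t * e) r Hr).
- rewrite Cmod_0, Cmod_opp, Rplus_0_l.
  (* An affine function vanishing at the centre has its norm attained on the boundary of the disc,
     so the pointwise bound at t e + r bounds the norm. *)
  assert (UR := UB (t * e + r)). replace (t * e + r - t * e) with (RtoC r) in UR by ring.
  rewrite Cmod_RtoC_pos in UR by lra. specialize (UR ltac:(lra)). unfold u in UR.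
  rewrite Cmod_opp in UR. replace (Ci * (t * e + r - t * e) / (al * z0)) with (Ci / (al * z0) * r) in UR by (field; auto).
  rewrite Cmod_mult, (Cmod_RtoC_pos r) in UR by lra. lra.
- intros xi _. rewrite u0. unfold u. field; auto.
Qed.

(** * Complex differentiability and parameter integrals *)

(** The quadratic error is available for every function given by a power series ([wien_cd]), and it
    turns the product and chain rules into computations with constants. *)
Definition cd (f : C -> C) (z l : C) : Prop := exists K r, (0 < r)%R /\
  forall w, (Cmod w <= r)%R -> (Cmod (f (z + w)%C - f z - l * w) <= K * (Cmod w * Cmod w))%R.

Lemma cd_lip (f : C -> C) (z l : C) : cd f z l -> exists K r, (0 < r)%R /\ (0 <= K)%R /\
  forall w, (Cmod w <= r)%R -> (Cmod (f (z + w)%C - f z) <= K * Cmod w)%R.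
Proof.
intros [K [r [r0 H]]]. exists (Rabs K * r + Cmod l)%R, r. split; auto.
assert (P := Cmod_ge_0 l). assert (P2 := Rabs_pos K). split. nra.
intros w Hw. replace (f (z + w) - f z) with ((f (z + w) - f z - l * w) + l * w) by ring.
eapply Rle_trans; [apply Cmod_triangle|]. rewrite Cmod_mult. specialize (H w Hw).
assert (P3 := Cmod_ge_0 w). assert (P4 := Rle_abs K).
assert (K * (Cmod w * Cmod w) <= Rabs K * r * Cmod w)%R. { apply Rle_trans with (Rabs K * (Cmod w * Cmod w))%R; [nra|].
  rewrite Rmult_assoc. apply Rmult_le_compat_l; auto. nra. } lra.
Qed.

Lemma cd_eq (f : C -> C) (z l l' : C) : cd f z l -> l = l' -> cd f z l'.
Proof. intros H <-; exact H. Qed.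
Lemma cd_ext_loc (f g : C -> C) (z l : C) (r : R) : (0 < r)%R ->
  (forall w, (Cmod w <= r)%R -> f (z + w) = g (z + w)) -> cd f z l -> cd g z l.
Proof.
intros r0 H [K [r' [r0' Hf]]]. exists K, (Rmin r r'). split. now apply Rmin_glb_lt.
intros w Hw. assert (w1 : (Cmod w <= r)%R) by (eapply Rle_trans; [apply Hw | apply Rmin_l]).
assert (w2 : (Cmod w <= r')%R) by (eapply Rle_trans; [apply Hw | apply Rmin_r]).
assert (E0 : f z = g z). { assert (Q := H 0). rewrite Cplus_0_r in Q. apply Q. rewrite Cmod_0; lra. }
rewrite <- H, <- E0 by auto. now apply Hf.
Qed.
Lemma cd_const (c z : C) : cd (fun _ => c) z 0.
Proof.
exists 0%R, 1%R. split. lra. intros w _. replace (c - c - 0 * w) with (RtoC 0) by ring. rewrite Cmod_0. lra.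
Qed.
Lemma cd_id (z : C) : cd (fun z => z) z 1.
Proof.
exists 0%R, 1%R. split. lra. intros w _. replace (z + w - z - 1 * w) with (RtoC 0) by ring. rewrite Cmod_0. lra.
Qed.
Lemma cd_plus (f g : C -> C) (z l m : C) : cd f z l -> cd g z m -> cd (fun z => f z + g z) z (l + m).
Proof.
intros [K [r [r0 H]]] [K' [r' [r0' H']]]. exists (K + K')%R, (Rmin r r'). split. now apply Rmin_glb_lt.
intros w Hw. assert (w1 : (Cmod w <= r)%R) by (eapply Rle_trans; [apply Hw | apply Rmin_l]).
assert (w2 : (Cmod w <= r')%R) by (eapply Rle_trans; [apply Hw | apply Rmin_r]).
replace (f (z + w) + g (z + w) - (f z + g z) - (l + m) * w) with ((f (z + w) - f z - l * w) + (g (z + w) - g z - m * w)) by ring.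
eapply Rle_trans; [apply Cmod_triangle|]. specialize (H w w1). specialize (H' w w2). lra.
Qed.
Lemma cd_mult (f g : C -> C) (z l m : C) : cd f z l -> cd g z m -> cd (fun z => f z * g z) z (l * g z + f z * m).
Proof.
intros F G. destruct (cd_lip _ _ _ F) as [Kf [rf [rf0 [Kf0 Lf]]]]. destruct (cd_lip _ _ _ G) as [Kg [rg [rg0 [Kg0 L_ext]]]].
destruct F as [K [r [r0 H]]], G as [K' [r' [r0' H']]].
exists (Kf * Kg + K * Cmod (g z) + Cmod (f z) * K')%R, (Rmin (Rmin r r') (Rmin rf rg)). split. repeat apply Rmin_glb_lt; auto.
intros w Hw. assert (Q1 := Rmin_l (Rmin r r') (Rmin rf rg)). assert (Q2 := Rmin_r (Rmin r r') (Rmin rf rg)).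
assert (Q3 := Rmin_l r r'). assert (Q4 := Rmin_r r r'). assert (Q5 := Rmin_l rf rg). assert (Q6 := Rmin_r rf rg).
specialize (H w ltac:(lra)). specialize (H' w ltac:(lra)). specialize (Lf w ltac:(lra)). specialize (L_ext w ltac:(lra)).
replace (f (z + w) * g (z + w) - f z * g z - (l * g z + f z * m) * w) with
 ((f (z + w) - f z) * (g (z + w) - g z) + ((f (z + w) - f z - l * w) * g z + f z * (g (z + w) - g z - m * w))) by ring.
eapply Rle_trans; [apply Cmod_triangle|]. eapply Rle_trans; [apply Rplus_le_compat_l, Cmod_triangle|]. rewrite !Cmod_mult.
assert (P1 := Cmod_ge_0 (g z)). assert (P2 := Cmod_ge_0 (f z)). assert (P3 := Cmod_ge_0 w).
assert (P4 := Cmod_ge_0 (f (z + w) - f z)). assert (P5 := Cmod_ge_0 (g (z + w) - g z)).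
assert (A1 : (Cmod (f (z + w)%C - f z) * Cmod (g (z + w)%C - g z) <= (Kf * Cmod w) * (Kg * Cmod w))%R) by (apply Rmult_le_compat; auto).
assert (A2 : (Cmod (f (z + w)%C - f z - l * w) * Cmod (g z) <= K * (Cmod w * Cmod w) * Cmod (g z))%R) by (apply Rmult_le_compat_r; auto).
assert (A3 : (Cmod (f z) * Cmod (g (z + w)%C - g z - m * w) <= Cmod (f z) * (K' * (Cmod w * Cmod w)))%R) by (apply Rmult_le_compat_l; auto).
lra.
Qed.
Lemma cd_scal (c : C) (f : C -> C) (z l : C) : cd f z l -> cd (fun z => c * f z) z (c * l).
Proof. intros H. eapply cd_eq. apply (cd_mult (fun _ => c)). apply cd_const. exact H. cring. Qed.
Lemma cd_comp (f g : C -> C) (z l m : C) : cd f (g z) l -> cd g z m -> cd (fun z => f (g z)) z (l * m).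
Proof.
intros [K [r [r0 H]]] G. destruct (cd_lip _ _ _ G) as [Kg [rg [rg0 [Kg0 L_ext]]]]. destruct G as [K' [r' [r0' H']]].
exists (Rabs K * (Kg * Kg) + Cmod l * K')%R, (Rmin (r / (Kg + 1)) (Rmin r' rg)).
split. repeat apply Rmin_glb_lt; auto. apply Rdiv_lt_0_compat; lra.
intros w Hw. assert (Q1 := Rmin_l (r / (Kg + 1)) (Rmin r' rg)). assert (Q2 := Rmin_r (r / (Kg + 1)) (Rmin r' rg)).
assert (Q3 := Rmin_l r' rg). assert (Q4 := Rmin_r r' rg).
specialize (H' w ltac:(lra)). specialize (L_ext w ltac:(lra)).
assert (P3 := Cmod_ge_0 w). set (v := g (z + w) - g z) in *.
assert (Hv : (Cmod v <= r)%R).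
{ eapply Rle_trans; [apply L_ext|]. apply Rle_trans with (Kg * (r / (Kg + 1)))%R. apply Rmult_le_compat_l; lra.
  apply (Rmult_le_reg_r (Kg + 1)). lra. replace (Kg * (r / (Kg + 1)) * (Kg + 1))%R with (Kg * r)%R by (field; lra). nra. }
specialize (H v Hv). replace (g z + v) with (g (z + w)) in H by (unfold v; ring).
replace (f (g (z + w)) - f (g z) - l * m * w) with ((f (g (z + w)) - f (g z) - l * v) + l * (g (z + w) - g z - m * w)) by (unfold v; ring).
eapply Rle_trans; [apply Cmod_triangle|]. rewrite Cmod_mult.
assert (P5 := Cmod_ge_0 v). assert (P6 := Rle_abs K). assert (P7 := Rabs_pos K). assert (P8 := Cmod_ge_0 l).
assert (A1 : (K * (Cmod v * Cmod v) <= Rabs K * ((Kg * Cmod w) * (Kg * Cmod w)))%R).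
{ apply Rle_trans with (Rabs K * (Cmod v * Cmod v))%R. apply Rmult_le_compat_r; nra. apply Rmult_le_compat_l; auto. apply Rmult_le_compat; auto. }
assert (A2 : (Cmod l * Cmod (g (z + w)%C - g z - m * w) <= Cmod l * (K' * (Cmod w * Cmod w)))%R) by (apply Rmult_le_compat_l; auto).
lra.
Qed.

Lemma wien_cd (f : C -> C) (z0 : C) (r : R) (a : nat -> C) : wien f z0 r a -> cd f z0 (a 1%nat).
Proof.
intros W. assert (W' := W). destruct W' as [r0 [H1 H2]].
exists (wnorm a r / (r * r))%R, r. split; auto. intros w Hw.
assert (Hz : (Cmod (z0 + w - z0) <= r)%R) by (replace (z0 + w - z0) with w by ring; auto).
rewrite (H2 _ Hz), (H2 z0) by (replace (z0 - z0) with (RtoC 0) by ring; rewrite Cmod_0; lra).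
replace (z0 + w - z0) with w by ring.
assert (Sw := wien_summ f z0 r a w W Hw).
replace (CSeries (fun k => a k * (z0 - z0) ^ k)) with (a 0%nat).
2:{ destruct (summ_finite (fun k => a k * (z0 - z0) ^ k) 1) as [_ E].
    intros [|k] Hk; [lia|]. simpl. ring. rewrite E, Csum_S, Csum_0. simpl. ring. }
rewrite (CSeries_split _ 2 Sw), !Csum_S, Csum_0.
match goal with |- (Cmod ?x <= _)%R => replace x with (CSeries (fun k => a (2 + k)%nat * w ^ (2 + k))) by (simpl; ring) end.
assert (P := Cmod_ge_0 w).
assert (EX : ex_series (fun k => Cmod (a (2 + k)%nat) * r ^ (2 + k))%R) by (apply (ex_series_incr_n (fun k => Cmod (a k) * r ^ k)%R 2); auto).
apply Rle_trans with (Series (fun k => (Cmod w * Cmod w / (r * r)) * (Cmod (a (2 + k)%nat) * r ^ (2 + k)))%R).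
- apply CSeries_bound. 2: now apply ex_series_scalR.
  intros k. rewrite Cmod_mult, Cmod_pow. simpl.
  replace (Cmod w * Cmod w / (r * r) * (Cmod (a (S (S k))) * (r * (r * r ^ k))))%R with (Cmod (a (S (S k))) * (Cmod w * (Cmod w * r ^ k)))%R by (field; lra).
  apply Rmult_le_compat_l. apply Cmod_ge_0. repeat apply Rmult_le_compat_l; auto. apply pow_incr; auto.
- rewrite Series_scal_l.
  assert (LE : (Series (fun k => Cmod (a (2 + k)%nat) * r ^ (2 + k))%R <= wnorm a r)%R).
  { unfold wnorm. rewrite (Series_incr_n (fun k => Cmod (a k) * r ^ k)%R 2); auto. simpl sum_f_R0.
    assert (A0 := wnorm_term_ge0 a r 0 ltac:(lra)). assert (A1 := wnorm_term_ge0 a r 1 ltac:(lra)). simpl in *. lra. }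
  replace (wnorm a r / (r * r) * (Cmod w * Cmod w))%R with (Cmod w * Cmod w / (r * r) * wnorm a r)%R by (field; lra).
  apply Rmult_le_compat_l; auto. apply Rmult_le_pos. nra. left; apply Rinv_0_lt_compat. nra.
Qed.

Lemma cd_cexp (z : C) : cd cexp z (cexp z).
Proof.
destruct (wien_cexp 1 z 1 Rlt_0_1) as [W _]. apply wien_cd in W.
eapply cd_eq. eapply cd_ext_loc; [apply Rlt_0_1| |exact W]. intros; simpl; f_equal; ring.
simpl. replace (1 * z) with z by ring. field.
Qed.

Lemma cd_inv (z : C) : z <> 0 -> cd (fun z => / z) z (- / (z * z)).
Proof.
intros H. assert (P := proj1 (Cmod_gt_0 z) H).
exists (2 / (Cmod z * Cmod z * Cmod z))%R, (Cmod z / 2)%R. split. lra.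
intros w Hw. assert (L : (Cmod z / 2 <= Cmod (z + w))%R) by (assert (T := Cmod_triangle_inv z w); lra).
assert (N : z + w <> 0). { intros E; rewrite E, Cmod_0 in L; lra. }
replace (/ (z + w) - / z - - / (z * z) * w) with (w * w * / ((z + w) * (z * z))) by (field; auto).
rewrite !Cmod_mult, Cmod_inv, !Cmod_mult by (repeat apply Cmult_neq_0; auto).
rewrite (Rmult_comm (2 / _)). apply Rmult_le_compat_l. assert (G := Cmod_ge_0 w); nra.
replace (2 / (Cmod z * Cmod z * Cmod z))%R with (/ (Cmod z / 2 * (Cmod z * Cmod z)))%R by (field; lra).
apply Rinv_le_contravar. repeat apply Rmult_lt_0_compat; lra. apply Rmult_le_compat_r; nra.
Qed.

Lemma cd_cder (f : C -> C) (z d l : C) (t : R) : cd f (z + t * d) l ->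
  cder (fun s => f (z + RtoC s * d)) t (l * d).
Proof.
intros [K [r [r0 H]]].
(* [g] stands for the real or the imaginary part; only additivity, real homogeneity and the bound by
   the modulus are used. *)
assert (core : forall g : C -> R, (forall x y, g (x - y)%C = g x - g y)%R -> (forall (c : R) x, g (RtoC c * x)%C = c * g x)%R ->
  (forall x, Rabs (g x) <= Cmod x)%R -> is_derive (fun s => g (f (z + RtoC s * d))) t (g (l * d))).
{ intros g g1 g2 g3. apply is_derive_Reals. intros eps He.
  set (M := (Rabs K * (Cmod d * Cmod d) + 1)%R). assert (P1 := Rabs_pos K). assert (P2 := Cmod_ge_0 d).
  assert (M0 : (0 < M)%R) by (unfold M; nra).
  assert (dl : (0 < Rmin (r / (Cmod d + 1)) (eps / M))%R) by (apply Rmin_glb_lt; apply Rdiv_lt_0_compat; lra).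
  exists (mkposreal _ dl). intros h h0 Hh. simpl in Hh.
  assert (h1 : (Rabs h < r / (Cmod d + 1))%R) by (eapply Rlt_le_trans; [apply Hh | apply Rmin_l]).
  assert (h2 : (Rabs h < eps / M)%R) by (eapply Rlt_le_trans; [apply Hh | apply Rmin_r]).
  assert (P3 := Rabs_pos h).
  assert (hd : (Cmod (h * d) <= r)%R).
  { rewrite Cmod_mult, Cmod_R. apply Rle_trans with (r / (Cmod d + 1) * Cmod d)%R. apply Rmult_le_compat_r; lra.
    apply (Rmult_le_reg_r (Cmod d + 1)). lra. replace (r / (Cmod d + 1) * Cmod d * (Cmod d + 1))%R with (r * Cmod d)%R by (field; lra). nra. }
  specialize (H (h * d) hd). rewrite Cmod_mult, Cmod_R in H.
  replace (z + t * d + h * d) with (z + RtoC (t + h) * d) in H by (rewrite RtoC_plus; ring).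
  set (A := f (z + RtoC (t + h) * d)) in *. set (B := f (z + RtoC t * d)) in *.
  assert (E : (g A - g B - h * g (l * d)%C)%R = g (A - B - l * (h * d))).
  { rewrite !g1. f_equal. rewrite <- g2. f_equal. ring. }
  replace ((g A - g B) / h - g (l * d)%C)%R with ((g A - g B - h * g (l * d)%C) / h)%R by (field; auto).
  rewrite E. unfold Rdiv. rewrite Rabs_mult, Rabs_inv.
  apply Rle_lt_trans with (Rabs K * (Cmod d * Cmod d) * Rabs h)%R.
  - assert (h3 : (0 < Rabs h)%R) by (now apply Rabs_pos_lt). apply (Rmult_le_reg_r (Rabs h)); auto.
    rewrite Rmult_assoc, Rinv_l, Rmult_1_r by lra. eapply Rle_trans; [apply g3|]. eapply Rle_trans; [apply H|].
    assert (KA := Rle_abs K). replace (Rabs K * (Cmod d * Cmod d) * Rabs h * Rabs h)%R with (Rabs K * (Rabs h * Cmod d * (Rabs h * Cmod d)))%R by ring.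
    apply Rmult_le_compat_r; auto. nra.
  - apply Rle_lt_trans with (M * Rabs h)%R. unfold M; nra.
    apply (Rmult_lt_compat_l M) in h2; auto. replace (M * (eps / M))%R with eps in h2 by (field; lra). exact h2. }
split; apply core; intros.
- apply Re_minus.
- reim; ring.
- apply re_le_Cmod.
- apply Im_minus.
- reim; ring.
- apply im_le_Cmod.
Qed.

Lemma cd_constant (f : C -> C) (z0 z1 : C) :
  (forall t, (0 <= t <= 1)%R -> cd f (z0 + t * (z1 - z0)) 0) -> f z1 = f z0.
Proof.
intros H. replace z1 with (z0 + RtoC 1 * (z1 - z0)) at 1 by ring. replace z0 with (z0 + RtoC 0 * (z1 - z0)) at 3 by ring.
apply (cder_constant (fun s => f (z0 + RtoC s * (z1 - z0))) 0 1). lra.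
intros s Hs. eapply cder_eq. apply cd_cder. now apply H. ring.
Qed.

Lemma wien_le_ccont_ray (f : C -> C) (e : C) (t r B : R) : wien_le f (t * e) r B -> ccont (fun t => f (RtoC t * e)) t.
Proof.
intros W. apply ccont_eps. intros eps He.
destruct (wien_le_small f (t * e) r B eps He W) as [r' [Hr' W']].
exists (r' / (Cmod e + 1))%R. assert (P := Cmod_ge_0 e). split. apply Rdiv_lt_0_compat; lra.
intros s Hs. apply (wien_le_bound (fun z => f z - f (t * e)) (t * e) r'); auto.
replace (s * e - t * e) with (RtoC (s - t) * e) by (rewrite RtoC_minus; ring). rewrite Cmod_mult, Cmod_R.
apply Rle_trans with (r' / (Cmod e + 1) * Cmod e)%R. apply Rmult_le_compat_r; lra.
apply (Rmult_le_reg_r (Cmod e + 1)). lra. replace (r' / (Cmod e + 1) * Cmod e * (Cmod e + 1))%R with (r' * Cmod e)%R by (field; lra). nra.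
Qed.

Lemma pow_fact_le_exp (x : R) (j : nat) : (0 <= x)%R -> (x ^ j / INR (fact j) <= exp x)%R.
Proof.
intros Hx. rewrite <- (is_series_unique _ _ (is_series_exp x)).
apply (term_le_Series (fun k => x ^ k / INR (fact k))%R). intros k. apply Rmult_le_pos. now apply pow_le.
left; apply Rinv_0_lt_compat, INR_fact_pos. eexists; apply is_series_exp.
Qed.

Lemma exp_le (x y : R) : (x <= y)%R -> (exp x <= exp y)%R.
Proof. intros [H|H]. left; now apply exp_increasing. rewrite H; lra. Qed.

(** Expanding exp ((s - s0) X) gives the moments of X as coefficients. The factor exp (rho |X|) in
    the hypothesis dominates (rho |X|)^j / j! for every j, so the coefficients are O(rho^(-j)); at
    radius rho / 2 the series is geometric and exchanges with the integral. Analyticity in s and a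
    formula for the derivative come out together. *)
Lemma param_wien (f X : R -> C) (s0 : C) (rho K d : R) : (0 < rho)%R -> (0 < d)%R ->
  (forall t, (0 <= t)%R -> ccont f t) -> (forall t, (0 <= t)%R -> ccont X t) ->
  (forall t, (0 <= t)%R -> (Cmod (f t) * exp (Re (s0 * X t) + rho * Cmod (X t)) <= K * exp (- (d * t)))%R) ->
  wien (fun s => Int (fun t => f t * cexp (s * X t))) s0 (rho / 2)
    (fun j => Int (fun t => f t * X t ^ j / INR (fact j) * cexp (s0 * X t))) /\
  forall j, cInt (fun t => f t * X t ^ j / INR (fact j) * cexp (s0 * X t)) (Int (fun t => f t * X t ^ j / INR (fact j) * cexp (s0 * X t))).
Proof.
intros Hr Hd Cf CX HB.
assert (K0 : (0 <= K)%R).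
{ specialize (HB 0%R ltac:(lra)). rewrite Rmult_0_r, Ropp_0, exp_0, Rmult_1_r in HB. eapply Rle_trans; [|apply HB].
  apply Rmult_le_pos. apply Cmod_ge_0. left; apply exp_pos. }
assert (FP : forall j, (0 < INR (fact j))%R) by (intros; apply INR_fact_pos).
assert (TB : forall j t, (0 <= t)%R -> (Cmod (f t * X t ^ j / INR (fact j) * cexp (s0 * X t)) * rho ^ j <= K * exp (- (d * t)))%R).
{ intros j t Ht. eapply Rle_trans; [|apply HB; auto].
  rewrite !Cmod_mult, Cmod_div, Cmod_mult, Cmod_pow, Cmod_cexp, Cmod_RtoC_pos.
  2: left; auto. 2: apply RtoC_neq0, Rgt_not_eq, FP.
  rewrite exp_plus. replace (Cmod (f t) * Cmod (X t) ^ j / INR (fact j) * exp (Re (s0 * X t)) * rho ^ j)%R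
   with (Cmod (f t) * (exp (Re (s0 * X t)) * ((rho * Cmod (X t)) ^ j / INR (fact j))))%R.
  2: rewrite Rpow_mult_distr; field; apply Rgt_not_eq, FP.
  apply Rmult_le_compat_l. apply Cmod_ge_0. apply Rmult_le_compat_l. left; apply exp_pos.
  apply pow_fact_le_exp. apply Rmult_le_pos. lra. apply Cmod_ge_0. }
assert (CI : forall s, (Cmod (s - s0) <= rho / 2)%R -> cInt (fun t => f t * cexp (s * X t)) (Int (fun t => f t * cexp (s * X t)))).
{ intros s Hs. apply expdom_cInt with K d. split; auto. split.
  intros t Ht. apply ccont_mult; auto. apply ccont_cexp, ccont_mult; auto. apply ccont_const.
  intros t Ht. eapply Rle_trans; [|apply HB; auto]. rewrite Cmod_mult, Cmod_cexp. apply Rmult_le_compat_l. apply Cmod_ge_0.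
  apply exp_le. replace (s * X t) with (s0 * X t + (s - s0) * X t) by ring. rewrite Re_plus. apply Rplus_le_compat_l.
  eapply Rle_trans; [apply Rle_abs|]. eapply Rle_trans; [apply re_le_Cmod|]. rewrite Cmod_mult.
  apply Rmult_le_compat_r. apply Cmod_ge_0. lra. }
assert (TI : forall j, cInt (fun t => f t * X t ^ j / INR (fact j) * cexp (s0 * X t)) (Int (fun t => f t * X t ^ j / INR (fact j) * cexp (s0 * X t)))).
{ intros j. apply expdom_cInt with (K / rho ^ j)%R d. split; auto. split.
  intros t Ht. apply ccont_mult. apply ccont_mult; [|apply ccont_const]. apply ccont_mult; auto. apply ccont_pow; auto.
  apply ccont_cexp, ccont_mult; auto. apply ccont_const.
  intros t Ht. assert (Q := pow_lt rho j Hr). apply (Rmult_le_reg_r (rho ^ j)); auto.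
  replace (K / rho ^ j * exp (- (d * t)) * rho ^ j)%R with (K * exp (- (d * t)))%R by (field; lra). now apply TB. }
set (a := fun j => Int (fun t => f t * X t ^ j / INR (fact j) * cexp (s0 * X t))) in *.
assert (AB : forall j, (Cmod (a j) * (rho / 2) ^ j <= K / d * (/ 2) ^ j)%R).
{ intros j. assert (Q := pow_lt rho j Hr).
  assert (L : (Cmod (a j) <= (K / rho ^ j) / d)%R).
  { apply (expdom_bound (fun t => f t * X t ^ j / INR (fact j) * cexp (s0 * X t))); auto.
    intros t Ht. apply (Rmult_le_reg_r (rho ^ j)); auto.
    replace (K / rho ^ j * exp (- (d * t)) * rho ^ j)%R with (K * exp (- (d * t)))%R by (field; lra). now apply TB. }
  unfold Rdiv at 1. rewrite Rpow_mult_distr. assert (Q2 := pow_lt (/ 2) j ltac:(lra)).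
  apply (Rmult_le_compat_r (rho ^ j * (/ 2) ^ j)) in L. 2: nra.
  eapply Rle_trans; [apply L|]. right; field; split; lra. }
assert (EX : ex_series (fun j => K / d * (/ 2) ^ j)%R) by (apply ex_series_scalR, ex_series_geomR; lra).
split; auto. split. lra. split.
- apply ex_series_leR with (fun j => K / d * (/ 2) ^ j)%R; auto. intros j. split; auto. apply wnorm_term_ge0; lra.
- intros s Hs. symmetry. apply CSeries_unique.
  apply (cInt_series (fun j t => f t * X t ^ j / INR (fact j) * cexp (s0 * X t) * (s - s0) ^ j) _
          (fun t => f t * cexp (s * X t)) _ (fun j => K * (/ 2) ^ j)%R d); auto.
  + intros j. eapply cInt_ext. 2: rewrite Cmult_comm; apply cInt_scal, TI. intros; simpl; ring.
  + apply ex_series_scalR, ex_series_geomR; lra.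
  + intros j t Ht. rewrite Cmod_mult, Cmod_pow.
    assert (Q := TB j t Ht). set (m := Cmod (f t * X t ^ j / INR (fact j) * cexp (s0 * X t))) in *.
    assert (m0 : (0 <= m)%R) by apply Cmod_ge_0.
    apply Rle_trans with (m * (rho / 2) ^ j)%R. apply Rmult_le_compat_l; auto. apply pow_incr. split; auto. apply Cmod_ge_0.
    unfold Rdiv. rewrite Rpow_mult_distr. assert (Q2 := pow_lt (/ 2) j ltac:(lra)). nra.
  + intros t Ht. replace (s * X t) with (s0 * X t + (s - s0) * X t) by ring. rewrite cexp_add.
    symmetry. apply CSeries_unique.
    apply is_series_extC with (fun j => (f t * cexp (s0 * X t)) * (((s - s0) * X t) ^ j / INR (fact j))).
    intros j. rewrite Cpow_mult_l. field. apply RtoC_neq0, Rgt_not_eq, FP.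
    replace (f t * (cexp (s0 * X t) * cexp ((s - s0) * X t))) with ((f t * cexp (s0 * X t)) * cexp ((s - s0) * X t)) by ring.
    apply is_series_scalC, is_series_cexp.
Qed.

(** * Laplace transforms of the kernel *)

(** Unit directions other than i, the single singular direction of the kernel. *)
Definition dir (e : C) : Prop := Cmod e = 1%R /\ (Im e < 1)%R.

Lemma dir_eps (e : C) : dir e -> exists eps, (0 < eps <= 1)%R /\ (Im e <= 1 - eps)%R.
Proof.
intros [_ H]. exists (Rmin 1 (1 - Im e)). split. split. apply Rmin_glb_lt; lra. apply Rmin_l.
assert (Q := Rmin_r 1 (1 - Im e)). lra.
Qed.

Lemma kc_at1 (n : nat) : kc n 1 = (INR n + / 2)%R.
Proof.
assert (Z : forall m, kc m 0 = 1%R).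
{ induction m. reflexivity. simpl. rewrite IHm. ring. }
induction n. simpl. field. change (kc (S n) 1) with (0 + kc n 0 + kc n 1)%R. rewrite Z, IHn, S_INR. ring.
Qed.

Lemma kap_S (n : nat) (z : C) : slit z -> z * kap (S n) z = kap n z.
Proof.
intros H. assert (N := slit_neq0 z H). assert (N2 := csqrt_neq0 z H). assert (N3 := Cpow_nz z n N).
unfold kap. simpl. field. auto.
Qed.

(** In the variable w = -(z - z0) / z0 of the factorisation [kap_local], the derivative is read off
    the first coefficient n + 1/2 of the series. *)
Lemma cd_kap (n : nat) (z0 : C) : slit z0 -> cd (kap n) z0 (- (INR n + / 2) * kap (S n) z0).
Proof.
intros SL. assert (N := slit_neq0 z0 SL). assert (N2 := csqrt_neq0 z0 SL).
assert (P := proj1 (Cmod_gt_0 _) N2). assert (R0 := csqrt_Re z0 SL). assert (P0 := proj1 (Cmod_gt_0 _) N).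
set (d := Rmin 1 (Re (csqrt z0) / Cmod (csqrt z0))).
assert (d0 : (0 < d <= 1)%R). { split. apply Rmin_glb_lt. lra. apply Rdiv_lt_0_compat; lra. apply Rmin_l. }
assert (dR : (d * Cmod (csqrt z0) <= Re (csqrt z0))%R).
{ apply Rle_trans with (Re (csqrt z0) / Cmod (csqrt z0) * Cmod (csqrt z0))%R. apply Rmult_le_compat_r. lra. apply Rmin_r. right; field; lra. }
destruct (wien_le_kap_poly n) as [a [A1 [_ A3]]].
set (g z := - / z0 * (z - z0)).
assert (g0 : g z0 = 0) by (unfold g; ring).
eapply cd_eq.
- eapply cd_ext_loc with (f := fun z => kap n z0 * ((fun w => (/ (1 - w)) ^ n * Sfun w) (g z))) (r := (Cmod z0 * (d / 4))%R).
  nra.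
  + intros h Hh. cbv beta.
    assert (Hg : (Cmod (g (z0 + h)%C) <= d / 4)%R).
    { unfold g. replace (- / z0 * (z0 + h - z0)) with (- (h / z0)) by (field; auto). rewrite Cmod_opp, Cmod_div by auto.
      apply (Rmult_le_reg_r (Cmod z0)); auto. unfold Rdiv at 1. rewrite Rmult_assoc, Rinv_l by lra. lra. }
    destruct (kap_local n z0 (g (z0 + h)) d SL d0 dR Hg) as [_ E].
    replace (z0 + h) with (z0 * (1 - g (z0 + h))) at 3 by (unfold g; field; auto). now rewrite E.
  + apply cd_scal. apply (cd_comp (fun w => (/ (1 - w)) ^ n * Sfun w) g z0).
    rewrite g0. apply (wien_cd _ _ _ _ A1).
    unfold g. apply cd_scal. apply cd_plus. apply cd_id. apply cd_const.
- rewrite A3, kc_at1, RtoC_plus, RtoC_inv by lra. rewrite <- (kap_S n z0 SL). field. auto.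
Qed.

Lemma zray_slit (e : C) (t : R) : dir e -> (0 <= t)%R -> slit (zray e t).
Proof. intros D Ht. destruct (dir_eps e D) as [eps [H1 H2]]. destruct D. now apply (zray_bounds e t eps). Qed.

Lemma zray_le (e : C) (t : R) : dir e -> (0 <= t)%R -> (Cmod (zray e t) <= 1 + t)%R.
Proof.
intros [D _] Ht. unfold zray. eapply Rle_trans; [apply Cmod_triangle|].
rewrite Cmod_1, !Cmod_mult, Cmod_Ci, Cmod_RtoC_pos, D by auto. lra.
Qed.

Lemma kap_ray_cder (n : nat) (e : C) (t : R) : dir e -> (0 <= t)%R ->
  cder (fun t => kap n (zray e t)) t (- (INR n + / 2) * kap (S n) (zray e t) * (Ci * e)).
Proof.
intros D Ht. apply cder_ext with (fun s => kap n (1 + RtoC s * (Ci * e))). intros; unfold zray; f_equal; ring.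
apply cd_cder. replace (1 + t * (Ci * e)) with (zray e t) by (unfold zray; ring). now apply cd_kap, zray_slit.
Qed.

Lemma zray_cder (e : C) (t : R) : cder (zray e) t (Ci * e).
Proof.
eapply cder_eq. unfold zray. apply cder_plus. apply cder_const. apply cder_scal. apply cder_mult. apply cder_id. apply cder_const.
cring.
Qed.

Lemma Cmod_lap_exp (s e : C) (t : R) : Cmod (cexp (s * (- (t * e)))) = exp (- (Re (e * s) * t)).
Proof. rewrite Cmod_cexp. f_equal. reim. ring. Qed.

(** The Laplace integral of (1 + i xi)^(-n-1/2) along the ray of direction e; [Lap'] is its
    derivative in s. The exponent is written as s times a function of t to fit [param_wien]. *)
Definition Lap (n : nat) (e s : C) : C := Int (fun t => kap n (zray e t) * e * cexp (s * (- (t * e)))).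
Definition Lap' (n : nat) (e s : C) : C := Int (fun t => kap n (zray e t) * e * (- (t * e)) * cexp (s * (- (t * e)))).

Lemma kap_ray_bounded (n : nat) (e : C) : dir e -> exists K, (0 < K)%R /\ forall t, (0 <= t)%R -> (Cmod (kap n (zray e t)) <= K)%R.
Proof.
intros D. destruct (dir_eps e D) as [eps [H1 H2]]. exists (kapK n eps). split.
- unfold kapK. apply Rinv_0_lt_compat. assert (Q := sqrt_lt_R0 (eps / 2) ltac:(lra)).
  apply Rmult_lt_0_compat. now apply pow_lt. now apply sqrt_lt_R0.
- intros t Ht. apply kap_ray_bound; auto. apply D.
Qed.

Lemma ccont_lap_exp (s e : C) (t : R) : ccont (fun t => cexp (s * (- (RtoC t * e)))) t.
Proof.
apply ccont_cexp. apply ccont_mult. apply ccont_const.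
apply ccont_ext with (fun t => - (1) * (RtoC t * e)). intros; ring.
apply ccont_mult. apply ccont_const. apply ccont_mult. apply ccont_id. apply ccont_const.
Qed.

Lemma Lap_spec (n : nat) (e s : C) : dir e -> (0 < Re (e * s))%R ->
  cInt (fun t => kap n (zray e t) * e * cexp (s * (- (t * e)))) (Lap n e s) /\
  cInt (fun t => kap n (zray e t) * e * (- (t * e)) * cexp (s * (- (t * e)))) (Lap' n e s) /\
  cd (Lap n e) s (Lap' n e s).
Proof.
intros D H. destruct (kap_ray_bounded n e D) as [K [K0 HK]].
(* Half of the exponential rate Re (e s) pays for rho |X|, the other half is kept for
   convergence. *)
destruct (param_wien (fun t => kap n (zray e t) * e) (fun t => - (t * e)) s (Re (e * s) / 2) K (Re (e * s) / 2)) as [A B]; try lra.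
- intros t Ht. apply ccont_mult. eapply cder_ccont. now apply kap_ray_cder. apply ccont_const.
- intros t Ht. apply ccont_ext with (fun t => - (1) * (RtoC t * e)). intros; ring.
  apply ccont_mult. apply ccont_const. apply ccont_mult. apply ccont_id. apply ccont_const.
- intros t Ht. assert (De : Cmod e = 1%R) by apply D. rewrite Cmod_opp, !Cmod_mult, De, Cmod_RtoC_pos, !Rmult_1_r by auto.
  apply Rmult_le_compat; auto. apply Cmod_ge_0. left; apply exp_pos. right. f_equal. reim. field.
- assert (B0 := B 0%nat). assert (B1 := B 1%nat).
  assert (E0 : (fun t : R => kap n (zray e t) * e * (- (t * e)) ^ 0 / INR (fact 0) * cexp (s * - (t * e)))
     = (fun t : R => kap n (zray e t) * e * cexp (s * (- (t * e))))).
  { apply functional_extensionality; intros t. simpl. field. }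
  assert (E1 : (fun t : R => kap n (zray e t) * e * (- (t * e)) ^ 1 / INR (fact 1) * cexp (s * - (t * e)))
     = (fun t : R => kap n (zray e t) * e * (- (t * e)) * cexp (s * (- (t * e))))).
  { apply functional_extensionality; intros t. simpl. field. }
  apply wien_cd in A. cbv beta in A. rewrite E0 in B0. rewrite E1 in B1, A. auto.
Qed.

Lemma Lap_bound (n : nat) (e : C) : dir e -> exists K, (0 < K)%R /\ forall s, (0 < Re (e * s))%R -> (Cmod (Lap n e s) <= K / Re (e * s))%R.
Proof.
intros D. destruct (kap_ray_bounded n e D) as [K [K0 HK]]. exists K. split; auto. intros s Hs.
destruct (Lap_spec n e s D Hs) as [A _]. refine (expdom_bound _ _ K _ Hs _ A).
intros t Ht. rewrite !Cmod_mult, Cmod_lap_exp. assert (De : Cmod e = 1%R) by apply D. rewrite De, Rmult_1_r.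
apply Rmult_le_compat_r; auto. left; apply exp_pos.
Qed.

Lemma lin_exp_lim (d : R) : (0 < d)%R -> is_lim (fun t => (1 + t) * exp (- (d * t)))%R p_infty 0.
Proof.
intros Hd. apply is_lim_squeeze0 with (fun t => (1 + 2 / d) * exp (- (d / 2 * t)))%R.
- intros t Ht. rewrite Rabs_pos_eq. 2: apply Rmult_le_pos; [lra | left; apply exp_pos].
  replace (exp (- (d * t))) with (exp (- (d / 2 * t)) * exp (- (d / 2 * t)))%R by (rewrite <- exp_plus; f_equal; field).
  rewrite <- Rmult_assoc. apply Rmult_le_compat_r. left; apply exp_pos.
  rewrite exp_Ropp. assert (Q := exp_ineq1_le (d / 2 * t)). assert (Q2 := exp_pos (d / 2 * t)).
  apply (Rmult_le_reg_r (exp (d / 2 * t))); auto. rewrite Rmult_assoc, Rinv_l by lra.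
  assert (0 < / d)%R by (now apply Rinv_0_lt_compat).
  assert ((1 + 2 / d) * (1 + d / 2 * t) = 1 + t + 2 / d + d / 2 * t)%R by (field; lra).
  assert (0 <= 2 / d)%R by (unfold Rdiv; nra). assert (0 <= d / 2 * t)%R by nra. nra.
- replace (Finite 0) with (Rbar_mult (1 + 2 / d)%R 0) by (simpl; f_equal; ring). apply is_lim_scal_l. apply exp_neg_lim. lra.
Qed.

Lemma lap_exp_cder (s e : C) (t : R) : cder (fun t => cexp (s * (- (RtoC t * e)))) t (- s * e * cexp (s * (- (t * e)))).
Proof.
eapply cder_eq. apply cder_cexp. eapply cder_ext with (f := fun t => - s * e * RtoC t). intros; ring.
apply cder_scal, cder_id. cring.
Qed.

Lemma Cpow_0 (z : C) : z ^ 0 = 1. Proof. reflexivity. Qed.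
Lemma kap_1 (n : nat) : kap n 1 = 1.
Proof.
assert (E : csqrt 1 = 1) by (apply csqrt_unique; [ring | simpl; lra]).
unfold kap. rewrite E, Cpow_1_l. field.
Qed.
Lemma zray_0 (e : C) : zray e 0 = 1. Proof. unfold zray; ring. Qed.

(** Integrates the derivative of (1 + i xi)^(-n-1/2) exp (-s xi) along the ray; the right-hand side
    1 is the value of this function at xi = 0. *)
Lemma Lap_rec (n : nat) (e s : C) : dir e -> (0 < Re (e * s))%R ->
  (INR n + / 2) * Ci * Lap (S n) e s + s * Lap n e s = 1.
Proof.
intros D H. destruct (Lap_spec n e s D H) as [A _]. destruct (Lap_spec (S n) e s D H) as [B _].
destruct (kap_ray_bounded n e D) as [K [K0 HK]].
assert (I := cInt_FTC (fun t => kap n (zray e t) * cexp (s * (- (RtoC t * e))))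
  (fun t => - (INR n + / 2) * Ci * (kap (S n) (zray e t) * e * cexp (s * (- (RtoC t * e)))) + - s * (kap n (zray e t) * e * cexp (s * (- (RtoC t * e)))))
  (fun t => K * exp (- (Re (e * s) * t)))%R).
assert (I' : cInt (fun t => - (INR n + / 2) * Ci * (kap (S n) (zray e t) * e * cexp (s * (- (RtoC t * e)))) + - s * (kap n (zray e t) * e * cexp (s * (- (RtoC t * e)))))
   (- (INR n + / 2) * Ci * Lap (S n) e s + - s * Lap n e s)).
{ apply cInt_plus; apply cInt_scal; assumption. }
assert (E : - (kap n (zray e 0) * cexp (s * (- (RtoC 0 * e)))) = - (INR n + / 2) * Ci * Lap (S n) e s + - s * Lap n e s).
{ refine (cInt_unique _ _ _ (I _ _ _ _) I').
  - intros t Ht. eapply cder_eq. apply cder_mult. now apply kap_ray_cder. apply lap_exp_cder. cring.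
  - intros t Ht. apply ccont_plus; apply ccont_mult; try simple apply ccont_const; apply ccont_mult; try simple apply ccont_lap_exp;
    apply ccont_mult; try simple apply ccont_const; eapply cder_ccont; now apply kap_ray_cder.
  - intros t Ht. rewrite Cmod_mult, Cmod_lap_exp. apply Rmult_le_compat_r; [left; apply exp_pos | now apply HK].
  - replace (Finite 0) with (Rbar_mult K 0) by (simpl; f_equal; ring). apply is_lim_scal_l, exp_neg_lim, H. }
rewrite zray_0, kap_1 in E. replace (s * - (RtoC 0 * e)) with (RtoC 0) in E by ring. rewrite cexp_0 in E.
transitivity (- (- (INR n + / 2) * Ci * Lap (S n) e s + - s * Lap n e s)). ring. rewrite <- E. ring.
Qed.

(** Integrates the derivative of (1 + i xi)^(1/2) exp (-s xi). That derivative involves only (1 + i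
    xi)^(-1/2) and xi times it, that is the integrands of [Lap 0] and [Lap' 0], which closes the
    equation. *)
Lemma Lap_ode (e s : C) : dir e -> (0 < Re (e * s))%R ->
  / 2 * Lap 0 e s + Ci * s * Lap 0 e s + s * Lap' 0 e s = Ci.
Proof.
intros D H. destruct (Lap_spec 0 e s D H) as [A [B _]].
destruct (kap_ray_bounded 0 e D) as [K [K0 HK]].
assert (I := cInt_FTC (fun t => zray e t * kap 0 (zray e t) * cexp (s * (- (RtoC t * e))))
  (fun t => (Ci / 2 - s) * (kap 0 (zray e t) * e * cexp (s * (- (RtoC t * e)))) + Ci * s * (kap 0 (zray e t) * e * (- (RtoC t * e)) * cexp (s * (- (RtoC t * e)))))
  (fun t => K * ((1 + t) * exp (- (Re (e * s) * t))))%R).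
assert (I' : cInt (fun t => (Ci / 2 - s) * (kap 0 (zray e t) * e * cexp (s * (- (RtoC t * e)))) + Ci * s * (kap 0 (zray e t) * e * (- (RtoC t * e)) * cexp (s * (- (RtoC t * e)))))
   ((Ci / 2 - s) * Lap 0 e s + Ci * s * Lap' 0 e s)).
{ apply cInt_plus; apply cInt_scal; assumption. }
assert (E : - (zray e 0 * kap 0 (zray e 0) * cexp (s * (- (RtoC 0 * e)))) = (Ci / 2 - s) * Lap 0 e s + Ci * s * Lap' 0 e s).
{ refine (cInt_unique _ _ _ (I _ _ _ _) I').
  - intros t Ht. eapply cder_eq. apply cder_mult. apply cder_mult. apply zray_cder. now apply kap_ray_cder. apply lap_exp_cder.
    (* Expressing [kap 0] as z times [kap 1] leaves an identity between polynomials, in which only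
       the powers of i remain to be reduced. *)
    cbv beta. rewrite <- (kap_S 0 (zray e t)) by now apply zray_slit.
    set (k1 := kap 1 (zray e t)). set (E := cexp (s * - (t * e))). unfold zray. simpl (INR 0). field_simplify.
    replace (Ci ^ 2) with (- (1)) by (simpl; rewrite <- Ci2; ring).
    replace (Ci ^ 3) with (- Ci) by (simpl; transitivity ((Ci * Ci) * Ci); [rewrite Ci2; ring | ring]). field.
  - intros t Ht. assert (Ck : ccont (fun t => kap 0 (zray e t)) t) by (eapply cder_ccont; now apply kap_ray_cder).
    apply ccont_plus; apply ccont_mult; try simple apply ccont_const; apply ccont_mult; try simple apply ccont_lap_exp.
    apply ccont_mult; auto. apply ccont_const. apply ccont_mult. apply ccont_mult; auto. apply ccont_const.
    apply ccont_ext with (fun t => - (1) * (RtoC t * e)). intros; ring.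
    apply ccont_mult. apply ccont_const. apply ccont_mult. apply ccont_id. apply ccont_const.
  - intros t Ht. rewrite !Cmod_mult, Cmod_lap_exp. assert (Q := zray_le e t D Ht). specialize (HK t Ht).
    rewrite <- Rmult_assoc. apply Rmult_le_compat_r. left; apply exp_pos. rewrite Rmult_comm.
    apply Rmult_le_compat; auto; apply Cmod_ge_0.
  - replace (Finite 0) with (Rbar_mult K 0) by (simpl; f_equal; ring). apply is_lim_scal_l, lin_exp_lim, H. }
rewrite zray_0, kap_1 in E. replace (s * - (RtoC 0 * e)) with (RtoC 0) in E by ring. rewrite cexp_0 in E.
transitivity (- Ci * ((Ci / 2 - s) * Lap 0 e s + Ci * s * Lap' 0 e s)).
transitivity (- (Ci * Ci) * (Lap 0 e s / 2) + Ci * s * Lap 0 e s + - (Ci * Ci) * s * Lap' 0 e s). rewrite Ci2. field.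
field. rewrite <- E. ring.
Qed.

Definition solves (L : C -> C) (s l : C) : Prop := cd L s l /\ / 2 * L s + Ci * s * L s + s * l = Ci.

(* Any two solutions of s L' + (1/2 + i s) L = i differ by a multiple of s^(-1/2) exp(- i s); squaring
   avoids choosing a branch. *)
Lemma solves_invariant (L1 L2 L1' L2' : C -> C) (s0 s1 : C) :
  (forall t, (0 <= t <= 1)%R -> let s := s0 + t * (s1 - s0) in solves L1 s (L1' s) /\ solves L2 s (L2' s)) ->
  s1 * cexp (2 * Ci * s1) * ((L1 s1 - L2 s1) * (L1 s1 - L2 s1)) =
  s0 * cexp (2 * Ci * s0) * ((L1 s0 - L2 s0) * (L1 s0 - L2 s0)).
Proof.
intros H. apply (cd_constant (fun s => s * cexp (2 * Ci * s) * ((L1 s - L2 s) * (L1 s - L2 s)))).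
intros t Ht. destruct (H t Ht) as [[D1 E1] [D2 E2]]. set (s := s0 + t * (s1 - s0)) in *.
assert (DD : cd (fun s => L1 s - L2 s) s (L1' s - L2' s)).
{ eapply cd_eq. apply cd_plus. apply D1. eapply cd_ext_loc with (f := fun s => - (1) * L2 s) (r := 1%R). lra. intros; ring.
  apply cd_scal. apply D2. cring. }
assert (DE : cd (fun s => cexp (2 * Ci * s)) s (cexp (2 * Ci * s) * (2 * Ci * 1))).
{ apply (cd_comp cexp (fun s => 2 * Ci * s)). apply cd_cexp. apply cd_scal, cd_id. }
eapply cd_eq. apply cd_mult. apply cd_mult. apply cd_id. apply DE. apply cd_mult; apply DD.
cbv beta. set (l := L1 s - L2 s). set (l' := L1' s - L2' s).
assert (E : s * l' = - (/ 2 + Ci * s) * l).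
{ unfold l, l'. transitivity ((/ 2 * L1 s + Ci * s * L1 s + s * L1' s) - (/ 2 * L2 s + Ci * s * L2 s + s * L2' s) - (/ 2 + Ci * s) * (L1 s - L2 s)).
  ring. rewrite E1, E2. ring. }
transitivity (cexp (2 * Ci * s) * (l * l + 2 * Ci * s * l * l + 2 * l * (s * l'))). ring. rewrite E. field.
Qed.

Lemma Lap_solves (e s : C) : dir e -> (0 < Re (e * s))%R -> solves (Lap 0 e) s (Lap' 0 e s).
Proof. intros D H. split. now apply Lap_spec. now apply Lap_ode. Qed.

(** A quantity independent of r that is O(1/r) vanishes. This converts the decay of an invariant at
    infinity into an equality at a finite point. *)
Lemma sqr_zero_limit (X : C) (u : R -> C) (K R0 : R) :
  (forall r, (R0 < r)%R -> u r = X) -> (forall r, (R0 < r)%R -> (Cmod (u r) <= K / r)%R) -> X = 0.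
Proof.
intros H1 H2. apply Cmod_eq_0. apply Rle_antisym; [|apply Cmod_ge_0].
apply le_epsilon. intros eps He. rewrite Rplus_0_l.
set (r := (Rabs R0 + 1 + Rabs K / eps)%R).
assert (P := Rabs_pos R0). assert (P1 := Rle_abs R0). assert (P2 := Rabs_pos K). assert (P3 := Rle_abs K).
assert (Q : (0 <= Rabs K / eps)%R) by (apply Rmult_le_pos; auto; left; now apply Rinv_0_lt_compat).
assert (hr : (R0 < r)%R) by (unfold r; lra). rewrite <- (H1 r hr). eapply Rle_trans; [now apply H2|].
assert (r0 : (0 < r)%R) by (unfold r; lra).
apply (Rmult_le_reg_r r); auto. unfold Rdiv. rewrite Rmult_assoc, Rinv_l by lra.
replace (eps * r)%R with (eps * Rabs R0 + eps + Rabs K)%R by (unfold r; field; lra). nra.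
Qed.

Lemma solves_eq (L1 L2 : C -> C) (s0 : C) : s0 <> 0 ->
  s0 * cexp (2 * Ci * s0) * ((L1 s0 - L2 s0) * (L1 s0 - L2 s0)) = 0 -> L1 s0 = L2 s0.
Proof.
intros N H. assert (NE := cexp_neq0 (2 * Ci * s0)).
destruct (Cmult_eq0 _ _ H) as [A|A].
- destruct (Cmult_eq0 _ _ A); contradiction.
- assert (B : L1 s0 - L2 s0 = 0) by (destruct (Cmult_eq0 _ _ A); auto).
  replace (L1 s0) with (L1 s0 - L2 s0 + L2 s0) by ring. rewrite B; ring.
Qed.

Lemma cone_convex (e s0 s1 : C) (t : R) : (0 <= t <= 1)%R -> (0 < Re (e * s0))%R -> (0 < Re (e * s1))%R ->
  (0 < Re (e * (s0 + t * (s1 - s0))))%R.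
Proof.
intros Ht H0 H1. replace (e * (s0 + t * (s1 - s0))) with (RtoC (1 - t) * (e * s0) + RtoC t * (e * s1)) by (rewrite RtoC_minus; ring).
rewrite Re_plus. replace (Re (RtoC (1 - t) * (e * s0))) with ((1 - t) * Re (e * s0))%R by (rewrite (Re_mult (RtoC (1 - t))), Re_RtoC, Im_RtoC; ring).
replace (Re (RtoC t * (e * s1))) with (t * Re (e * s1))%R by (rewrite (Re_mult (RtoC t)), Re_RtoC, Im_RtoC; ring).
destruct (Req_dec t 0) as [->|]; nra.
Qed.

(** Takes the place of a rotation of the contour. Along s = r u both transforms are O(1/r), and Im u
    >= 0 gives |exp (2 i s)| <= 1, so the invariant of the pair is O(1/r) and hence 0. The segment
    from [s0] to r u stays in the intersection of two half-planes, where both transforms solve the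
    equation. *)
Lemma Lap_rotate0 (e1 e2 s0 u : C) : dir e1 -> dir e2 -> (0 < Re (e1 * s0))%R -> (0 < Re (e2 * s0))%R ->
  (0 < Re (e1 * u))%R -> (0 < Re (e2 * u))%R -> (0 <= Im u)%R -> Lap 0 e1 s0 = Lap 0 e2 s0.
Proof.
intros D1 D2 A1 A2 B1 B2 Hu.
assert (N0 : s0 <> 0). { intros E. rewrite E in A1. replace (e1 * 0) with (RtoC 0) in A1 by ring. simpl in A1. lra. }
apply (solves_eq (Lap 0 e1) (Lap 0 e2)); auto.
destruct (Lap_bound 0 e1 D1) as [K1 [K10 HK1]]. destruct (Lap_bound 0 e2 D2) as [K2 [K20 HK2]].
set (k := (K1 / Re (e1 * u) + K2 / Re (e2 * u))%R).
assert (SC : forall r e, Re (e * (RtoC r * u)) = (r * Re (e * u))%R) by (intros; reim; ring).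
apply (sqr_zero_limit _ (fun r => (RtoC r * u) * cexp (2 * Ci * (RtoC r * u)) * ((Lap 0 e1 (RtoC r * u) - Lap 0 e2 (RtoC r * u)) * (Lap 0 e1 (RtoC r * u) - Lap 0 e2 (RtoC r * u)))) (Cmod u * (k * k)) 0).
- intros r Hr. apply (solves_invariant (Lap 0 e1) (Lap 0 e2) (Lap' 0 e1) (Lap' 0 e2)).
  intros t Ht s. split; apply Lap_solves; auto; apply cone_convex; auto; rewrite SC; nra.
- intros r Hr. rewrite !Cmod_mult, Cmod_RtoC_pos, Cmod_cexp by lra.
  assert (E1 : (exp (Re (2 * Ci * (r * u))) <= 1)%R).
  { rewrite <- exp_0. apply exp_le. reim. nra. }
  assert (LB : (Cmod (Lap 0 e1 (r * u) - Lap 0 e2 (r * u)) <= k / r)%R).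
  { eapply Rle_trans; [apply Cmod_triangle_minus|]. unfold k. unfold Rdiv at 1. rewrite Rmult_plus_distr_r.
    apply Rplus_le_compat; [eapply Rle_trans; [apply HK1|] | eapply Rle_trans; [apply HK2|]]; rewrite SC; try nra; right; field; lra. }
  set (x := Cmod (Lap 0 e1 (r * u) - Lap 0 e2 (r * u))) in *. assert (x0 : (0 <= x)%R) by apply Cmod_ge_0.
  assert (P := Cmod_ge_0 u). assert (P2 := exp_pos (Re (2 * Ci * (r * u)))).
  apply Rle_trans with (r * Cmod u * 1 * ((k / r) * (k / r)))%R.
  apply Rmult_le_compat. apply Rmult_le_pos; [nra | lra]. nra. apply Rmult_le_compat_l; [nra | exact E1]. apply Rmult_le_compat; auto.
  right; field; lra.
Qed.

(** * Half-line Gaussian integrals *)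

(** Moment j of the Gaussian on the half-line, with frequency parameter [ep] and quadratic
    coefficient [sg] in the upper half-plane. The last factor isolates [sg], the parameter to which
    [param_wien] is applied. *)
Definition Jf (j : nat) (ep : R) (sg : C) (u : R) : C :=
  RtoC u ^ j * cexp (2 * Ci * ep * u) * cexp (sg * (Ci * RtoC u ^ 2)).
Definition J (j : nat) (ep : R) (sg : C) : C := Int (Jf j ep sg).

(** u^j <= j! exp u, and completing the square gives 2 u - b u^2 <= 1/b. *)
Lemma gauss_exp_bound (b : R) (j : nat) : (0 < b)%R -> exists K, (0 < K)%R /\
  forall u, (0 <= u)%R -> (u ^ j * exp (- (b * u ^ 2)) <= K * exp (- u))%R.
Proof.
intros Hb. exists (INR (fact j) * exp (/ b))%R. assert (P := INR_fact_pos j). split.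
apply Rmult_lt_0_compat; auto; apply exp_pos.
intros u Hu. apply Rle_trans with (INR (fact j) * exp u * exp (- (b * u ^ 2)))%R.
apply Rmult_le_compat_r. left; apply exp_pos. assert (Q := pow_fact_le_exp u j Hu).
apply (Rmult_le_compat_l (INR (fact j))) in Q; [|lra]. replace (INR (fact j) * (u ^ j / INR (fact j)))%R with (u ^ j)%R in Q by (field; lra). exact Q.
rewrite !Rmult_assoc, <- !exp_plus. apply Rmult_le_compat_l. lra. apply exp_le.
assert (E : (/ b + - u - (u + - (b * u ^ 2)) = b * ((u - / b) * (u - / b)))%R) by (field; lra).
assert (0 <= (u - / b) * (u - / b))%R by apply Rle_0_sqr. nra.
Qed.

Lemma Cmod_Jf (j : nat) (ep : R) (sg : C) (u : R) : (0 <= u)%R -> Cmod (Jf j ep sg u) = (u ^ j * exp (- (Im sg * u ^ 2)))%R.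
Proof.
intros Hu. unfold Jf. rewrite !Cmod_mult, Cmod_pow, !Cmod_cexp, Cmod_RtoC_pos by auto. rewrite Rmult_assoc, <- exp_plus.
f_equal. f_equal. rewrite <- RtoC_pow. reim. simpl. ring.
Qed.

Lemma ccont_Jf (j : nat) (ep : R) (sg : C) (u : R) : ccont (Jf j ep sg) u.
Proof.
unfold Jf. apply ccont_mult. apply ccont_mult. apply ccont_pow, ccont_id. apply ccont_cexp, ccont_mult. apply ccont_const. apply ccont_id.
apply ccont_cexp, ccont_mult. apply ccont_const. apply ccont_mult. apply ccont_const. apply ccont_pow, ccont_id.
Qed.

Lemma J_spec (j : nat) (ep : R) (sg : C) : (0 < Im sg)%R -> cInt (Jf j ep sg) (J j ep sg).
Proof.
intros H. destruct (gauss_exp_bound (Im sg) j H) as [K [K0 HK]]. apply expdom_cInt with K 1%R. split. lra. split.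
intros; apply ccont_Jf. intros t Ht. rewrite Cmod_Jf, Rmult_1_l by auto. now apply HK.
Qed.

Lemma J_cd (j : nat) (ep : R) (sg : C) : (0 < Im sg)%R -> cd (J j ep) sg (Ci * J (S (S j)) ep sg).
Proof.
intros H. destruct (gauss_exp_bound (Im sg / 2) j ltac:(lra)) as [K [K0 HK]].
destruct (param_wien (fun u => RtoC u ^ j * cexp (2 * Ci * ep * u)) (fun u => Ci * RtoC u ^ 2) sg (Im sg / 2) K 1) as [A B]; try lra.
- intros t Ht. apply ccont_mult. apply ccont_pow, ccont_id. apply ccont_cexp, ccont_mult. apply ccont_const. apply ccont_id.
- intros t Ht. apply ccont_mult. apply ccont_const. apply ccont_pow, ccont_id.
- intros t Ht. rewrite Rmult_1_l. eapply Rle_trans; [|now apply HK].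
  rewrite !Cmod_mult, !Cmod_pow, Cmod_cexp, Cmod_Ci, Cmod_RtoC_pos by auto. rewrite Rmult_assoc, <- exp_plus.
  apply Rmult_le_compat_l. now apply pow_le. apply exp_le. rewrite <- RtoC_pow. reim. simpl. right; field.
- apply wien_cd in A. cbv beta in A. eapply cd_eq. exact A.
  apply (cInt_unique _ _ _ (B 1%nat)). eapply cInt_ext; [|apply cInt_scal, (J_spec (S (S j)) ep sg H)].
  intros t Ht. unfold Jf. simpl. field.
Qed.

Lemma Jexp_cder (ep : R) (sg : C) (u : R) : cder (Jf 0 ep sg) u ((2 * Ci * ep + 2 * Ci * sg * u) * Jf 0 ep sg u).
Proof.
apply cder_ext with (fun u => cexp (2 * Ci * ep * RtoC u) * cexp (sg * (Ci * RtoC u ^ 2))). intros; unfold Jf; simpl; ring.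
eapply cder_eq. apply cder_mult; apply cder_cexp. apply cder_scal, cder_id. apply cder_scal. apply cder_scal. apply cder_pow, cder_id.
unfold Jf. simpl. rewrite ?RtoC_plus. ring.
Qed.

Lemma J_bound_lim (j : nat) (ep : R) (sg : C) : (0 < Im sg)%R -> exists g, is_lim g p_infty 0 /\
  forall t, (0 <= t)%R -> (Cmod (Jf j ep sg t) <= g t)%R.
Proof.
intros H. destruct (gauss_exp_bound (Im sg) j H) as [K [K0 HK]]. exists (fun t => K * exp (- (1 * t)))%R. split.
replace (Finite 0) with (Rbar_mult K 0) by (simpl; f_equal; ring). apply is_lim_scal_l, exp_neg_lim. lra.
intros t Ht. rewrite Cmod_Jf, Rmult_1_l by auto. now apply HK.
Qed.

(** The derivative of the integrand integrates to minus its value 1 at 0. With [J_ibp1] this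
    expresses the moments 1 and 2 through the moment 0, hence also the derivative in [sg]. *)
Lemma J_ibp0 (ep : R) (sg : C) : (0 < Im sg)%R -> 2 * Ci * ep * J 0 ep sg + 2 * Ci * sg * J 1 ep sg = - (1).
Proof.
intros H. destruct (J_bound_lim 0 ep sg H) as [g [g1 g2]].
assert (I : cInt (fun u => (2 * Ci * ep + 2 * Ci * sg * RtoC u) * Jf 0 ep sg u) (- Jf 0 ep sg 0)).
{ apply cInt_FTC with g; auto; intros t Ht. apply Jexp_cder.
  apply ccont_mult; [|apply ccont_Jf]. apply ccont_plus. apply ccont_const. apply ccont_mult. apply ccont_const. apply ccont_id. }
assert (I' : cInt (fun u => (2 * Ci * ep + 2 * Ci * sg * RtoC u) * Jf 0 ep sg u) (2 * Ci * ep * J 0 ep sg + 2 * Ci * sg * J 1 ep sg)).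
{ eapply cInt_ext. 2: apply cInt_plus; apply cInt_scal; apply J_spec; exact H. intros; unfold Jf; simpl; ring. }
rewrite <- (cInt_unique _ _ _ I I'). unfold Jf. simpl. rewrite Cmult_0_r, !Cmult_0_l, !Cmult_0_r, cexp_0. ring.
Qed.

Lemma J_ibp1 (ep : R) (sg : C) : (0 < Im sg)%R -> J 0 ep sg + 2 * Ci * ep * J 1 ep sg + 2 * Ci * sg * J 2 ep sg = 0.
Proof.
intros H. destruct (J_bound_lim 1 ep sg H) as [g [g1 g2]].
assert (EQ : forall u, Jf 1 ep sg u = RtoC u * Jf 0 ep sg u) by (intros; unfold Jf; simpl; ring).
assert (I : cInt (fun u => (1 + 2 * Ci * ep * RtoC u + 2 * Ci * sg * RtoC u * RtoC u) * Jf 0 ep sg u) (- Jf 1 ep sg 0)).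
{ apply cInt_FTC with g; auto; intros t Ht.
  eapply cder_ext. intros; symmetry; apply EQ. eapply cder_eq. apply cder_mult. apply cder_id. apply Jexp_cder. cring.
  apply ccont_mult; [|apply ccont_Jf]. apply ccont_plus. apply ccont_plus. apply ccont_const. apply ccont_mult. apply ccont_const. apply ccont_id.
  apply ccont_mult. apply ccont_mult. apply ccont_const. apply ccont_id. apply ccont_id. }
assert (I' : cInt (fun u => (1 + 2 * Ci * ep * RtoC u + 2 * Ci * sg * RtoC u * RtoC u) * Jf 0 ep sg u) (J 0 ep sg + 2 * Ci * ep * J 1 ep sg + 2 * Ci * sg * J 2 ep sg)).
{ eapply cInt_ext. 2: apply cInt_plus; [apply cInt_plus; [|apply cInt_scal] | apply cInt_scal]; apply J_spec; exact H.
  intros; unfold Jf; simpl; ring. }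
rewrite <- (cInt_unique _ _ _ I I'). unfold Jf. simpl. ring.
Qed.

Lemma atan_lim (m : R) : (0 < m)%R -> is_lim (fun u => atan (m * u) - PI / 2)%R p_infty 0.
Proof.
intros Hm. apply is_lim_ext_loc with (fun u => - atan (/ (m * u)))%R.
exists 0%R. intros u Hu. rewrite atan_inv by nra. ring.
replace (Finite 0) with (Rbar_opp (atan 0)) by (rewrite atan_0; simpl; f_equal; ring).
apply is_lim_opp. apply is_lim_comp_continuous.
- replace (Finite 0) with (Rbar_inv p_infty) by reflexivity. apply is_lim_inv; [|discriminate].
  replace p_infty with (Rbar_mult m p_infty) at 2. apply is_lim_scal_l, is_lim_id.
  simpl. destruct (Rle_dec 0 m) as [r|]; [destruct (Rle_lt_or_eq_dec 0 m r)|]; auto; lra.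
- apply continuity_pt_filterlim. apply derivable_continuous_pt. eexists. apply derivable_pt_lim_atan.
Qed.

(* Away from the stationary point u = - ep / sg one integration by parts makes the integral bounded. *)
Lemma J0_bounded (ep : R) (sg : C) : (ep * ep = 1)%R -> (0 < Im sg)%R -> (0 < ep * Re sg)%R -> (Cmod (J 0 ep sg) <= 2)%R.
Proof.
intros He H1 H2.
assert (Ns : sg <> 0) by (apply Im_gt0_neq0; auto). assert (m0 := proj1 (Cmod_gt_0 _) Ns). set (m := Cmod sg) in *.
(* Since ep Re sg > 0, the mixed term 2 u ep Re sg of the squared modulus is nonnegative. *)
assert (LB : forall u, (0 <= u)%R -> (1 + m * m * (u * u) <= Cmod (sg * u + ep) * Cmod (sg * u + ep))%R).
{ intros u Hu. unfold m. rewrite !Cmod_sqr. reim. nra. }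
assert (NN : forall u, (0 <= u)%R -> sg * RtoC u + RtoC ep <> 0).
{ intros u Hu E. specialize (LB u Hu). rewrite E, Cmod_0 in LB. nra. }
set (q u := / (2 * Ci * (sg * RtoC u + RtoC ep))).
assert (N2 : RtoC 2 <> 0) by (apply RtoC_neq0; lra). assert (NC := Ci_neq0).
assert (Dq : forall u, (0 <= u)%R -> cder q u (- (2 * Ci * sg) * (q u * q u))).
{ intros u Hu. apply cder_ext with (fun s => / ((2 * Ci * ep) + RtoC s * (2 * Ci * sg))). intros; unfold q; f_equal; ring.
  eapply cder_eq. apply (cd_cder (fun z => / z)). apply cd_inv.
  replace (2 * Ci * ep + u * (2 * Ci * sg)) with (2 * Ci * (sg * u + ep)) by ring. repeat apply Cmult_neq_0; auto.
  unfold q. replace (2 * Ci * ep + u * (2 * Ci * sg)) with (2 * Ci * (sg * u + ep)) by ring. field. auto. }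
destruct (J_bound_lim 0 ep sg H1) as [g [g1 g2]].
assert (qb : forall u, (0 <= u)%R -> (Cmod (q u) * Cmod (q u) <= / (4 * (1 + m * m * (u * u))))%R).
{ intros u Hu. unfold q. rewrite Cmod_inv by (repeat apply Cmult_neq_0; auto). rewrite !Cmod_mult, Cmod_Ci, Cmod_RtoC_pos by lra.
  rewrite <- Rinv_mult. specialize (LB u Hu). apply Rinv_le_contravar; nra. }
assert (qb1 : forall u, (0 <= u)%R -> (Cmod (q u) <= 1)%R).
{ intros u Hu. assert (P := Cmod_ge_0 (q u)). specialize (qb u Hu).
  assert (/ (4 * (1 + m * m * (u * u))) <= 1)%R. { rewrite <- Rinv_1. apply Rinv_le_contravar; nra. } nra. }
set (h u := - (2 * Ci * sg) * (q u * q u) * Jf 0 ep sg u).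
assert (Ch : forall u, (0 <= u)%R -> ccont h u).
{ intros u Hu. unfold h. assert (ccont q u) by (eapply cder_ccont; now apply Dq).
  apply ccont_mult; [|apply ccont_Jf]. apply ccont_mult. apply ccont_const. apply ccont_mult; auto. }
assert (I : cInt (fun u => Jf 0 ep sg u + h u) (- (q 0%R * Jf 0 ep sg 0))).
{ apply (cInt_FTC (fun u => q u * Jf 0 ep sg u)) with g; auto; intros t Ht.
  - eapply cder_eq. apply cder_mult. now apply Dq. apply Jexp_cder. unfold h. rewrite Cplus_comm. f_equal.
    unfold q. field. auto.
  - apply ccont_plus; auto. apply ccont_Jf.
  - rewrite Cmod_mult. specialize (qb1 t Ht). specialize (g2 t Ht). assert (P := Cmod_ge_0 (q t)). assert (P2 := Cmod_ge_0 (Jf 0 ep sg t)). nra. }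
assert (Ih := cInt_minus _ _ _ _ I (J_spec 0 ep sg H1)).
assert (Ih' : cInt h (- (q 0%R * Jf 0 ep sg 0) - J 0 ep sg)) by (eapply cInt_ext; [|exact Ih]; intros; simpl; ring).
(* The majorant has integral PI / 4 whatever [m] is, which is why the final bound does not depend on
   [sg]. *)
assert (RA : rInt (fun u => m / (2 * (1 + m * m * (u * u))))%R (- ((atan (m * 0) - PI / 2) / 2))%R).
{ apply (rInt_FTC (fun u => (atan (m * u) - PI / 2) / 2)%R).
  - intros t Ht. auto_derive; auto. field. repeat split; nra.
  - intros t Ht. apply (ex_derive_continuous (V := R_NormedModule)). auto_derive. nra.
  - replace (Finite 0) with (Rbar_mult (/ 2)%R 0) by (simpl; f_equal; ring).
    apply is_lim_ext with (fun u => / 2 * (atan (m * u) - PI / 2))%R. intros; field.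
    apply is_lim_scal_l, atan_lim, m0. }
assert (BH : (Cmod (- (q 0%R * Jf 0 ep sg 0) - J 0 ep sg) <= - ((atan (m * 0) - PI / 2) / 2))%R).
{ apply (cInt_norm_le h (fun u => m / (2 * (1 + m * m * (u * u))))%R); auto.
  intros u Hu. unfold h. rewrite !Cmod_mult, Cmod_opp, !Cmod_mult, Cmod_Ci, Cmod_RtoC_pos, Cmod_Jf by lra. fold m.
  assert (E1 : (u ^ 0 * exp (- (Im sg * u ^ 2)) <= 1)%R). { simpl pow at 1. rewrite Rmult_1_l, <- exp_0. apply exp_le. nra. }
  assert (E0 := exp_pos (- (Im sg * u ^ 2))). specialize (qb u Hu).
  assert (P : (0 <= Cmod (q u) * Cmod (q u))%R) by (assert (Z := Cmod_ge_0 (q u)); nra).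
  replace (m / (2 * (1 + m * m * (u * u))))%R with (2 * 1 * m * / (4 * (1 + m * m * (u * u))) * 1)%R by (field; nra).
  apply Rmult_le_compat; auto. apply Rmult_le_pos; auto. lra. simpl pow at 1. lra.
  apply Rmult_le_compat_l; lra. }
rewrite Rmult_0_r, atan_0 in BH. assert (P4 := PI_4).
assert (Bq : (Cmod (- (q 0%R * Jf 0 ep sg 0)) <= 1)%R).
{ rewrite Cmod_opp, Cmod_mult, Cmod_Jf by lra. simpl pow. rewrite Rmult_0_l, Rmult_0_r, Ropp_0, exp_0.
  specialize (qb1 0%R ltac:(lra)). lra. }
replace (J 0 ep sg) with (- (q 0%R * Jf 0 ep sg 0) - (- (q 0%R * Jf 0 ep sg 0) - J 0 ep sg)) by ring.
eapply Rle_trans; [apply Cmod_triangle_minus|]. lra.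
Qed.

Lemma Im_inv_pos (s : C) : (Im s < 0)%R -> (0 < Im (/ s))%R.
Proof.
intros H. unfold Cinv; simpl. unfold Im in H. apply Rdiv_lt_0_compat. lra. nra.
Qed.
Lemma Im_lt0_neq0 (z : C) : (Im z < 0)%R -> z <> 0.
Proof. intros H E. rewrite E in H. simpl in H. lra. Qed.

(** The Gaussian integral in the variable s = 1 / sg, scaled so as to satisfy exactly the equation
    of [Lap 0]. *)
Definition Om (ep : R) (s : C) : C := - 2 * Ci * ep * (/ s * J 0 ep (/ s)).

(** The two integrations by parts eliminate the moments 1 and 2 from the derivative; ep^2 = 1 makes
    the resulting equation the same for both signs of the frequency. *)
Lemma Om_solves (ep : R) (s : C) : (ep * ep = 1)%R -> (Im s < 0)%R ->
  solves (Om ep) s ((Ci - / 2 * Om ep s - Ci * s * Om ep s) / s).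
Proof.
intros He H. assert (N := Im_lt0_neq0 s H). split. 2: field; auto.
assert (IS := Im_inv_pos s H).
assert (B0 := J_ibp0 ep (/ s) IS). assert (B1 := J_ibp1 ep (/ s) IS).
eapply cd_eq. apply cd_scal. apply cd_mult. apply cd_inv, N. apply (cd_comp (J 0 ep) (fun s => / s)). apply J_cd, IS. apply cd_inv, N.
cbv beta. unfold Om. set (J0 := J 0 ep (/ s)) in *. set (J1 := J 1 ep (/ s)) in *. set (J2 := J 2 ep (/ s)) in *.
assert (He' : RtoC ep * RtoC ep = 1) by (rewrite <- RtoC_mult, He; reflexivity).
assert (E1 : J1 = - (1 + 2 * Ci * ep * J0) * s / (2 * Ci)).
{ transitivity ((2 * Ci * / s * J1) * s / (2 * Ci)). field; split; auto; apply Ci_neq0.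
  replace (2 * Ci * / s * J1) with (2 * Ci * ep * J0 + 2 * Ci * / s * J1 - 2 * Ci * ep * J0) by ring. rewrite B0. field. apply Ci_neq0. }
assert (E2 : Ci * J2 = - (J0 + 2 * Ci * ep * J1) * s / 2).
{ transitivity ((2 * Ci * / s * J2) * s / 2). field; auto.
  replace (2 * Ci * / s * J2) with (J0 + 2 * Ci * ep * J1 + 2 * Ci * / s * J2 - J0 - 2 * Ci * ep * J1) by ring. rewrite B1. field. }
rewrite E2, E1.
assert (Ci2' := Ci2).
transitivity ((Ci * (ep * ep) / s + Ci * ep * J0 / (s * s) + 2 * (Ci * Ci) * ep * (ep * ep) * J0 / s)).
field. split; auto. apply Ci_neq0. rewrite He', Ci2.
transitivity (Ci / s + Ci * ep * J0 / (s * s) + 2 * (Ci * Ci) * ep * J0 / s). rewrite Ci2. field; auto. field; auto.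
Qed.

(** The condition 0 < ep Re e pairs the sign of the frequency with a side of the singular direction.
    The invariant is followed to infinity along s = ep r - i: there the Gaussian integral converges,
    exp (2 i s) has the constant modulus exp 2, and both solutions are O(1/r), by [J0_bounded] and
    [Lap_bound]. *)
Lemma Om_eq_Lap (ep : R) (e s0 : C) : (ep * ep = 1)%R -> dir e -> (0 < ep * Re e)%R -> (Im s0 < 0)%R -> (0 < Re (e * s0))%R ->
  Om ep s0 = Lap 0 e s0.
Proof.
intros He D Hep H0 H1. apply solves_eq. now apply Im_lt0_neq0.
destruct (Lap_bound 0 e D) as [K [K0 HK]]. set (c := (ep * Re e)%R) in *.
assert (Ie : (-1 <= Im e)%R). { assert (Q := im_le_Cmod e). destruct D as [D1 _]. rewrite D1 in Q. apply Rabs_le_between in Q. lra. }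
set (sr := fun r : R => RtoC (ep * r) - Ci).
assert (Res : forall r, Re (e * sr r) = (c * r + Im e)%R) by (intros; unfold sr, c; reim; ring).
assert (Ims : forall r, Im (sr r) = (-1)%R) by (intros; unfold sr; reim; ring).
assert (Ri : (0 < 2 / c)%R) by (apply Rdiv_lt_0_compat; lra).
(* Beyond 1 + 2 / c the product c r exceeds 2, so the term Im e >= -1 costs at most half of it. *)
assert (big : forall r, (1 + 2 / c < r)%R -> (c * r / 2 <= Re (e * sr r))%R).
{ intros r Hr. rewrite Res. apply (Rmult_lt_compat_l c) in Hr; auto. replace (c * (1 + 2 / c))%R with (c + 2)%R in Hr by (field; lra). nra. }
apply (sqr_zero_limit _ (fun r => sr r * cexp (2 * Ci * sr r) * ((Om ep (sr r) - Lap 0 e (sr r)) * (Om ep (sr r) - Lap 0 e (sr r))))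
  (2 * exp 2 * ((4 + 2 * K / c) * (4 + 2 * K / c))) (1 + 2 / c)).
- intros r Hr. assert (B := big r Hr).
  apply (solves_invariant (Om ep) (Lap 0 e) (fun s => (Ci - / 2 * Om ep s - Ci * s * Om ep s) / s) (Lap' 0 e)).
  intros t Ht s. assert (cr : (0 < c * r / 2)%R) by nra. split.
  + apply Om_solves; auto. unfold s. rewrite Im_plus, Im_mult, Re_RtoC, Im_RtoC, Im_minus, Ims.
    destruct (Req_dec t 0) as [->|]; nra.
  + apply Lap_solves; auto. apply cone_convex; auto. lra.
- intros r Hr. assert (B := big r Hr). assert (r1 : (1 < r)%R) by lra.
  assert (Rr : Re (sr r) = (ep * r)%R) by (unfold sr; reim; ring).
  assert (M2 := Cmod_sqr (sr r)). rewrite Rr, Ims in M2. replace (ep * r * (ep * r) + -1 * -1)%R with (r * r * (ep * ep) + 1)%R in M2 by ring.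
  rewrite He in M2. assert (M0 := Cmod_ge_0 (sr r)).
  assert (Mr : (r <= Cmod (sr r) <= 2 * r)%R). { split; nra. }
  assert (SI := Ims r).
  assert (J2 : (Cmod (J 0 ep (/ sr r)) <= 2)%R).
  { apply J0_bounded; auto. apply Im_inv_pos. lra.
    replace (Re (/ sr r)) with (Re (sr r) / (Re (sr r) ^ 2 + Im (sr r) ^ 2))%R by reflexivity. rewrite Rr, SI.
    replace (ep * (ep * r / ((ep * r) ^ 2 + (-1) ^ 2)))%R with ((ep * ep) * r / ((ep * ep) * (r * r) + 1))%R by (field; nra).
    rewrite He. apply Rdiv_lt_0_compat; nra. }
  assert (OB : (Cmod (Om ep (sr r)) <= 4 / r)%R).
  { unfold Om. rewrite !Cmod_mult, Cmod_Ci, !Cmod_R. replace (Rabs (-2)) with 2%R by (rewrite Rabs_left; lra).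
    assert (A : (Rabs ep = 1)%R). { assert (Q := Rsqr_abs ep). unfold Rsqr in Q. rewrite He in Q. assert (P := Rabs_pos ep). nra. }
    rewrite A. assert (I := Cmod_inv_le (sr r) r ltac:(lra) (proj1 Mr)).
    assert (P1 := Cmod_ge_0 (/ sr r)). assert (P2 := Cmod_ge_0 (J 0 ep (/ sr r))).
    apply Rle_trans with (2 * 1 * 1 * (/ r * 2))%R. apply Rmult_le_compat_l. lra. apply Rmult_le_compat; auto. right; field; lra. }
  assert (LB : (Cmod (Lap 0 e (sr r)) <= 2 * K / c / r)%R).
  { eapply Rle_trans; [apply HK; nra|]. replace (2 * K / c / r)%R with (K * / (c * r / 2))%R by (field; split; lra).
    apply Rmult_le_compat_l. lra. apply Rinv_le_contravar; nra. }
  assert (DB : (Cmod (Om ep (sr r) - Lap 0 e (sr r)) <= (4 + 2 * K / c) / r)%R).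
  { eapply Rle_trans; [apply Cmod_triangle_minus|]. replace ((4 + 2 * K / c) / r)%R with (4 / r + 2 * K / c / r)%R by (field; split; lra). lra. }
  rewrite !Cmod_mult, Cmod_cexp. replace (Re (2 * Ci * sr r)) with 2%R by (unfold sr; reim; ring).
  set (x := Cmod (Om ep (sr r) - Lap 0 e (sr r))) in *. assert (x0 : (0 <= x)%R) by apply Cmod_ge_0. set (k := (4 + 2 * K / c)%R) in *.
  assert (P2 := exp_pos 2).
  apply Rle_trans with (2 * r * exp 2 * ((k / r) * (k / r)))%R.
  apply Rmult_le_compat. apply Rmult_le_pos; lra. nra. apply Rmult_le_compat_r; lra. apply Rmult_le_compat; auto.
  right; field; lra.
Qed.

(** * The full Gaussian integral *)

Definition gI (x : R) : R := RInt (fun t => exp (- t ^ 2)) 0 x.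
Definition gH (x : R) : R := RInt (fun t => exp (- (x ^ 2 * (1 + t ^ 2))) / (1 + t ^ 2))%R 0 1.

Lemma continuous_gauss (x : R) : continuous (fun t => exp (- t ^ 2))%R x.
Proof. apply (ex_derive_continuous (V := R_NormedModule)). auto_derive; auto. Qed.

Lemma gI_derive (x : R) : is_derive gI x (exp (- x ^ 2))%R.
Proof.
apply (is_derive_RInt (V := R_CompleteNormedModule) (fun t => exp (- t ^ 2))%R gI 0 x).
exists (mkposreal 1 Rlt_0_1). intros y _. apply (RInt_correct (V := R_CompleteNormedModule)).
apply (ex_RInt_continuous (V := R_CompleteNormedModule)). intros; apply continuous_gauss. apply continuous_gauss.
Qed.

Lemma gH_integrand_derive (x t : R) :
  is_derive (fun x => exp (- (x ^ 2 * (1 + t ^ 2))) / (1 + t ^ 2))%R x (- (2 * x) * exp (- (x ^ 2 * (1 + t ^ 2))))%R.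
Proof. auto_derive; [nra|]. simpl. field. nra. Qed.

Lemma gH_derive (x : R) : is_derive gH x (RInt (fun t => - (2 * x) * exp (- (x ^ 2 * (1 + t ^ 2))))%R 0 1).
Proof.
evar_last.
- apply (is_derive_RInt_param (fun x t => exp (- (x ^ 2 * (1 + t ^ 2))) / (1 + t ^ 2))%R 0 1 x).
  + exists (mkposreal 1 Rlt_0_1). intros y _ t _. eexists. apply gH_integrand_derive.
  + intros t _. apply continuity_2d_pt_ext with (fun u v => (- (2 * u) * exp (- (u ^ 2 * (1 + v ^ 2))))%R).
    intros u v. symmetry. apply is_derive_unique, gH_integrand_derive.
    apply continuity_2d_pt_mult.
    apply (continuity_1d_2d_pt_comp (fun a => - (2 * a))%R (fun u _ => u)). apply derivable_continuous_pt.
    apply ex_derive_Reals_0. auto_derive; auto. apply continuity_2d_pt_id1.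
    apply (continuity_1d_2d_pt_comp (fun a => exp (- a)) (fun u v => u ^ 2 * (1 + v ^ 2))%R). apply derivable_continuous_pt.
    apply ex_derive_Reals_0. auto_derive; auto.
    apply continuity_2d_pt_mult.
    apply (continuity_1d_2d_pt_comp (fun a => a ^ 2)%R (fun u _ => u)). apply derivable_continuous_pt.
    apply ex_derive_Reals_0. auto_derive; auto. apply continuity_2d_pt_id1.
    apply (continuity_1d_2d_pt_comp (fun a => 1 + a ^ 2)%R (fun _ v => v)). apply derivable_continuous_pt.
    apply ex_derive_Reals_0. auto_derive; auto. apply continuity_2d_pt_id2.
  + exists (mkposreal 1 Rlt_0_1). intros y _. apply (ex_RInt_continuous (V := R_CompleteNormedModule)). intros z _.
    apply (ex_derive_continuous (V := R_NormedModule)). auto_derive; nra.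
- apply RInt_ext. intros t _. apply is_derive_unique, gH_integrand_derive.
Qed.

(** The substitution u = x t turns the derivative of [gH] into the opposite of the derivative of the
    square of [gI]. The sum therefore keeps its value at 0, where [gH] integrates 1 / (1 + t^2). *)
Lemma gI_gH (x : R) : (0 <= x)%R -> (gI x * gI x + gH x = PI / 4)%R.
Proof.
intros Hx.
set (F x := (gI x * gI x + gH x)%R).
assert (D : forall x, is_derive F x 0%R).
{ intros y. unfold F. evar_last. apply (is_derive_plus (V := R_NormedModule)). apply (is_derive_mult (K := R_AbsRing)). apply gI_derive. apply gI_derive. apply Rmult_comm.
  apply gH_derive. unfold plus, mult; simpl.
  assert (E : (RInt (fun t => - (2 * y) * exp (- (y ^ 2 * (1 + t ^ 2))))%R 0 1 = - 2 * exp (- y ^ 2) * gI y)%R).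
  { transitivity (RInt (fun t => scal (- 2 * exp (- y ^ 2))%R (scal y (exp (- (y * t + 0) ^ 2))))%R 0 1).
    apply RInt_ext. intros t _. unfold scal; simpl; unfold mult; simpl.
    replace (- (y * (y * 1) * (1 + t * (t * 1))))%R with (- (y * (y * 1)) + - ((y * t + 0) * ((y * t + 0) * 1)))%R by ring. rewrite exp_plus. ring.
    rewrite (RInt_scal (V := R_CompleteNormedModule)). rewrite (RInt_comp_lin (V := R_CompleteNormedModule) (fun u => exp (- u ^ 2)%R)).
    rewrite Rmult_0_r, Rmult_1_r, !Rplus_0_r. reflexivity.
    apply (ex_RInt_continuous (V := R_CompleteNormedModule)). intros; apply continuous_gauss.
    apply (ex_RInt_continuous (V := R_CompleteNormedModule)). intros. apply (ex_derive_continuous (V := R_NormedModule)).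
    unfold scal; simpl; unfold mult; simpl. auto_derive; auto. }
  simpl in E. rewrite E. ring. }
assert (E : F x = F 0%R).
{ destruct (MVT_gen F 0 x (fun _ => 0%R)) as [c [_ E]].
  intros; apply D. intros; apply continuity_pt_filterlim. apply (ex_derive_continuous (V := R_NormedModule)). eexists; apply D. lra. }
unfold F in E. rewrite E. unfold gI, gH. rewrite RInt_point. unfold zero; simpl.
assert (I : is_RInt (fun t => / (1 + t ^ 2))%R 0 1 (atan 1 - atan 0)%R).
{ apply (is_RInt_derive (V := R_CompleteNormedModule) atan). intros t _. auto_derive; auto. field. nra.
  intros t _. apply (ex_derive_continuous (V := R_NormedModule)). auto_derive. nra. }
rewrite atan_1, atan_0 in I. rewrite <- (Rminus_0_r (PI / 4)), <- (is_RInt_unique _ _ _ _ I).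
rewrite Rmult_0_l, Rplus_0_l. apply RInt_ext. intros t _. replace (- (0 * (0 * 1) * (1 + t * (t * 1))))%R with 0%R by ring. rewrite exp_0. simpl. unfold Rdiv; ring.
Qed.

Lemma gauss_integral : rInt (fun t => exp (- t ^ 2))%R (sqrt PI / 2).
Proof.
split. intros T _. apply (ex_RInt_continuous (V := R_CompleteNormedModule)). intros; apply continuous_gauss.
change (is_lim gI p_infty (sqrt PI / 2)%R).
assert (P := PI_RGT_0).
assert (G0 : forall x, (0 <= x)%R -> (0 <= gI x)%R).
{ intros x Hx. apply RInt_ge_0; auto. apply (ex_RInt_continuous (V := R_CompleteNormedModule)). intros; apply continuous_gauss. intros; left; apply exp_pos. }
assert (HB : forall x, (0 <= x)%R -> (0 <= gH x <= exp (- (x ^ 2)))%R).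
{ intros x Hx.
  assert (EI : ex_RInt (fun t => exp (- (x ^ 2 * (1 + t ^ 2))) / (1 + t ^ 2))%R 0 1).
  { apply (ex_RInt_continuous (V := R_CompleteNormedModule)). intros z _. apply (ex_derive_continuous (V := R_NormedModule)). auto_derive; nra. }
  split. apply RInt_ge_0; auto. lra. intros t _. apply Rmult_le_pos. left; apply exp_pos. left; apply Rinv_0_lt_compat; nra.
  replace (exp (- x ^ 2)) with (RInt (fun _ => exp (- x ^ 2)) 0 1). 2: rewrite RInt_const; unfold scal; simpl; unfold mult; simpl; ring.
  apply RInt_le; auto. lra. apply ex_RInt_const. intros t Ht.
  apply Rle_trans with (exp (- (x ^ 2 * (1 + t ^ 2))) * 1)%R. apply Rmult_le_compat_l. left; apply exp_pos.
  rewrite <- Rinv_1. apply Rinv_le_contravar; nra. rewrite Rmult_1_r. apply exp_le. nra. }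
assert (SP := sqrt_sqrt PI ltac:(lra)). assert (SP0 := sqrt_lt_R0 PI P).
set (c := (sqrt PI / 2)%R) in *.
assert (c0 : (0 < c)%R) by (unfold c; lra).
replace (Finite c) with (Finite (0 + c)) by (f_equal; ring).
apply is_lim_ext with (fun x => (gI x - c) + c)%R. intros; ring.
apply (is_lim_plus _ _ _ 0%R c); [|apply is_lim_const|reflexivity].
destruct (gauss_exp_bound 1 0 Rlt_0_1) as [K [K0 HK]].
apply is_lim_squeeze0 with (fun x => / c * K * exp (- (1 * x)))%R.
- intros x Hx. assert (E := gI_gH x Hx). destruct (HB x Hx) as [H1 H2]. specialize (G0 x Hx).
  specialize (HK x Hx). rewrite pow_O, !Rmult_1_l in HK. rewrite Rmult_1_l.
  assert (E2 : ((gI x - c) * (gI x + c) = - gH x)%R). { assert (c * c = PI / 4)%R by (unfold c; lra). nra. }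
  assert (B : (Rabs (gI x - c) * c <= K * exp (- x))%R).
  { apply Rle_trans with (Rabs (gI x - c) * (gI x + c))%R. apply Rmult_le_compat_l. apply Rabs_pos. lra.
    rewrite <- (Rabs_pos_eq (gI x + c)) by lra. rewrite <- Rabs_mult, E2, Rabs_Ropp, Rabs_pos_eq; lra. }
  apply (Rmult_le_reg_r c); auto. replace (/ c * K * exp (- x) * c)%R with (K * exp (- x))%R by (field; lra). exact B.
- replace (Finite 0) with (Rbar_mult (/ c * K)%R 0) by (simpl; f_equal; ring). apply is_lim_scal_l, exp_neg_lim. lra.
Qed.

Lemma cexp_Ci_lip (y : R) : (0 <= y)%R -> forall c, (Cmod c = 1)%R -> (Cmod (cexp (Ci * y) - 1) <= y)%R /\ (Cmod (cexp (- (Ci * y)) - 1) <= y)%R.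
Proof.
intros Hy c _.
assert (G : forall l, (Cmod l = 1)%R -> Re l = 0%R -> (Cmod (cexp (l * y) - 1) <= y)%R).
{ intros l Hl Hl0. assert (Q := cder_increment (fun s => cexp (l * RtoC s)) (fun s => l * cexp (l * RtoC s)) (fun s => s) (fun _ => 1%R) 0 y Hy).
  cbv beta in Q. rewrite Cmult_0_r, cexp_0, Rminus_0_r in Q. apply Q.
  intros s _. eapply cder_eq. apply cder_cexp. apply cder_scal, cder_id. cring.
  intros; apply (is_derive_id (K := R_AbsRing)).
  intros s _. rewrite Cmod_mult, Hl, Cmod_cexp, Re_mult, Hl0, Im_RtoC, Rmult_0_l, Rmult_0_r, Rminus_0_r, exp_0. lra. }
split. apply G. apply Cmod_Ci. reflexivity.
replace (- (Ci * y)) with (- Ci * y) by ring. apply G. rewrite Cmod_opp; apply Cmod_Ci. simpl; ring.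
Qed.

(** On the ray sg = i x^2 the substitution u = v / x leaves exp (-v^2) times a phase that differs
    from 1 by at most 2 v / x. This limit fixes the constant in [gauss_full]. *)
Lemma J0_scaled_limit (ep : R) : (ep * ep = 1)%R -> exists K, (0 < K)%R /\
  forall x, (0 < x)%R -> (Cmod (x * J 0 ep (Ci * (x * x)%R) - (sqrt PI / 2)%R) <= K / x)%R.
Proof.
intros He. destruct (gauss_exp_bound 1 1 Rlt_0_1) as [K [K0 HK]].
assert (Hg : cInt (fun v => RtoC (exp (- v ^ 2))) (RtoC (sqrt PI / 2))).
{ split. apply gauss_integral. apply cInt_0. }
exists (2 * K)%R. split. lra. intros x Hx.
assert (xN : RtoC x <> 0) by (apply RtoC_neq0; lra).
assert (IS : (0 < Im (Ci * (x * x)%R))%R) by (reim; nra).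
assert (A := J_spec 0 ep (Ci * (x * x)%R) IS).
apply (cInt_comp_lin _ _ (/ x)) in A; [|now apply Rinv_0_lt_compat].
assert (A' : cInt (fun v => cexp (2 * Ci * ep * (v / x)%R) * RtoC (exp (- v ^ 2))) (x * J 0 ep (Ci * (x * x)%R))).
{ replace (x * J 0 ep (Ci * (x * x)%R)) with (J 0 ep (Ci * (x * x)%R) / RtoC (/ x)%R) by (rewrite RtoC_inv by lra; field; auto).
  eapply cInt_ext; [|exact A]. intros v _. unfold Jf. rewrite Cpow_0, Cmult_1_l. f_equal. f_equal. f_equal. f_equal. field; lra.
  rewrite <- cexp_RtoC. f_equal. rewrite <- RtoC_pow. replace (Ci * (x * x)%R * (Ci * RtoC ((/ x * v) ^ 2))) with ((Ci * Ci) * RtoC (x * x * ((/ x * v) ^ 2))) by (rewrite !RtoC_mult; ring).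
  rewrite Ci2. replace (x * x * (/ x * v) ^ 2)%R with (v ^ 2)%R by (field; lra). rewrite RtoC_opp. ring. }
assert (D := cInt_minus _ _ _ _ A' Hg).
replace (2 * K / x)%R with (2 * K / x / 1)%R by (field; lra).
refine (expdom_bound _ _ _ 1 Rlt_0_1 _ D).
intros v Hv. cbv beta. replace (cexp (2 * Ci * ep * (v / x)%R) * exp (- v ^ 2) - exp (- v ^ 2)) with ((cexp (2 * Ci * ep * (v / x)%R) - 1) * exp (- v ^ 2)) by ring.
rewrite Cmod_mult, (Cmod_RtoC_pos (exp _)) by (left; apply exp_pos).
assert (vx : (0 <= 2 * (v / x))%R). { apply Rmult_le_pos. lra. apply Rmult_le_pos; auto. left; now apply Rinv_0_lt_compat. }
assert (C1 : (Cmod (cexp (2 * Ci * ep * (v / x)%R) - 1) <= 2 * (v / x))%R).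
{ destruct (cexp_Ci_lip (2 * (v / x)) vx 1 Cmod_1) as [L1 L2].
  assert (E : (ep = 1 \/ ep = -1)%R). { assert ((ep - 1) * (ep + 1) = 0)%R by lra. apply Rmult_integral in H. destruct H; [left|right]; lra. }
  destruct E as [-> | ->]. replace (2 * Ci * 1 * (v / x)%R) with (Ci * (2 * (v / x))%R) by (rewrite RtoC_mult; ring). exact L1.
  replace (2 * Ci * (-1) * (v / x)%R) with (- (Ci * (2 * (v / x))%R)) by (rewrite RtoC_mult; ring). exact L2. }
specialize (HK v Hv). rewrite !Rmult_1_l, pow_1 in HK. rewrite Rmult_1_l.
apply Rle_trans with (2 * (v / x) * exp (- v ^ 2))%R. apply Rmult_le_compat_r; auto. left; apply exp_pos.
replace (2 * (v / x) * exp (- v ^ 2))%R with (2 / x * (v * exp (- v ^ 2)))%R by (field; lra).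
replace (2 * K / x * exp (- v))%R with (2 / x * (K * exp (- v)))%R by (field; lra).
apply Rmult_le_compat_l; auto. apply Rmult_le_pos. lra. left; now apply Rinv_0_lt_compat.
Qed.

Lemma Im_cexp_pos (z : C) : (0 < Im z < PI)%R -> (0 < Im (cexp z))%R.
Proof. intros H. unfold cexp; simpl. apply Rmult_lt_0_compat. apply exp_pos. apply sin_gt_0; lra. Qed.

(* sqrt(sigma) exp(i / sigma) times the full Gaussian integral is constant in log sigma. *)
Lemma gauss_invariant (z0 z1 : C) : (0 < Im z0 < PI)%R -> (0 < Im z1 < PI)%R ->
  (J 0 1 (cexp z1) + J 0 (-1) (cexp z1)) * cexp (/ 2 * z1 + Ci * cexp (- z1)) =
  (J 0 1 (cexp z0) + J 0 (-1) (cexp z0)) * cexp (/ 2 * z0 + Ci * cexp (- z0)).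
Proof.
intros H0 H1. apply (cd_constant (fun z => (J 0 1 (cexp z) + J 0 (-1) (cexp z)) * cexp (/ 2 * z + Ci * cexp (- z)))).
intros t Ht. set (z := z0 + t * (z1 - z0)).
assert (Hz : (0 < Im z < PI)%R). { unfold z. rewrite Im_plus, Im_mult, Re_RtoC, Im_RtoC, Im_minus. destruct (Req_dec t 0) as [->|]; [lra|]. nra. }
assert (IS := Im_cexp_pos z Hz).
assert (DJ : forall ep, cd (fun z => J 0 ep (cexp z)) z (Ci * J 2 ep (cexp z) * cexp z)).
{ intros ep. apply (cd_comp (J 0 ep) cexp). now apply J_cd. apply cd_cexp. }
assert (DE : cd (fun z => cexp (- z)) z (cexp (- z) * (- (1) * 1))).
{ apply (cd_comp cexp (fun z => - z)). apply cd_cexp. eapply cd_ext_loc with (f := fun z => - (1) * z) (r := 1%R). lra. intros; ring. apply cd_scal, cd_id. }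
eapply cd_eq. apply cd_mult. apply cd_plus. apply (DJ 1%R). apply (DJ (-1)%R).
apply (cd_comp cexp (fun z => / 2 * z + Ci * cexp (- z))). apply cd_cexp. apply cd_plus. apply cd_scal, cd_id. apply cd_scal, DE.
cbv beta. rewrite cexp_opp. set (sg := cexp z) in *. assert (N : sg <> 0) by apply cexp_neq0.
assert (E0 : forall ep, (ep * ep = 1)%R -> Ci * J 2 ep sg * sg = - / 2 * J 0 ep sg + Ci / sg * J 0 ep sg + ep / (2 * sg)).
{ intros ep He. assert (B0 := J_ibp0 ep sg IS). assert (B1 := J_ibp1 ep sg IS).
  transitivity (/ 2 * (J 0 ep sg + 2 * Ci * ep * J 1 ep sg + 2 * Ci * sg * J 2 ep sg) - / 2 * J 0 ep sg - ep / (2 * sg) * (2 * Ci * ep * J 0 ep sg + 2 * Ci * sg * J 1 ep sg) + (ep * ep) * Ci / sg * J 0 ep sg).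
  field; auto. rewrite B1, B0. rewrite <- RtoC_mult, He. field; auto. }
rewrite (E0 1%R), (E0 (-1)%R) by ring. field. auto.
Qed.

(** The constant of [gauss_invariant] is evaluated at sigma = i x^2 as x grows. There each half-line
    integral is close to sqrt PI / (2 x), and the exponential factor equals x exp (i PI / 4) exp (1
    / x^2). *)
Lemma gauss_full (z : C) : (0 < Im z < PI)%R ->
  J 0 1 (cexp z) + J 0 (-1) (cexp z) = sqrt PI * cexp (Ci * PI / 4) * cexp (- (/ 2 * z + Ci * cexp (- z))).
Proof.
intros Hz. set (D := (J 0 1 (cexp z) + J 0 (-1) (cexp z)) * cexp (/ 2 * z + Ci * cexp (- z))).
assert (P := PI_RGT_0).
cut (D - sqrt PI * cexp (Ci * PI / 4) = 0).
{ intros E. rewrite cexp_opp. assert (N := cexp_neq0 (/ 2 * z + Ci * cexp (- z))).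
  transitivity (D / cexp (/ 2 * z + Ci * cexp (- z))). unfold D. field; auto.
  replace D with (D - sqrt PI * cexp (Ci * PI / 4) + sqrt PI * cexp (Ci * PI / 4)) by ring. rewrite E. field; auto. }
destruct (J0_scaled_limit 1 ltac:(ring)) as [K1 [K10 HK1]]. destruct (J0_scaled_limit (-1) ltac:(ring)) as [K2 [K20 HK2]].
assert (SP := sqrt_pos PI).
apply (sqr_zero_limit _ (fun _ => D - sqrt PI * cexp (Ci * PI / 4)) ((K1 + K2) * 3 + sqrt PI * 3) 1). auto.
intros x Hx.
set (zx := RtoC (2 * ln x) + Ci * RtoC (PI / 2)).
assert (ex : cexp zx = Ci * (x * x)%R).
{ unfold zx. rewrite cexp_add, cexp_RtoC, cexp_Ci, cos_PI2, sin_PI2. replace (2 * ln x)%R with (ln x + ln x)%R by ring.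
  rewrite exp_plus, exp_ln by lra. apply Ceq; simpl; ring. }
assert (ID := gauss_invariant zx z ltac:(unfold zx; reim; lra) Hz). fold D in ID. rewrite ID, ex, cexp_opp, ex.
assert (xx : RtoC (x * x) <> 0) by (apply RtoC_neq0; nra).
replace (/ 2 * zx + Ci * / (Ci * (x * x)%R)) with (Ci * PI / 4 + RtoC (ln x) + RtoC (/ (x * x))).
2:{ unfold zx. rewrite RtoC_inv by nra. rewrite !RtoC_mult, RtoC_div. field. repeat split; auto. apply RtoC_neq0; lra. apply Ci_neq0. lra. }
rewrite !cexp_add, !cexp_RtoC, exp_ln by lra.
set (w := cexp (Ci * PI / 4)).
assert (Hw : Cmod w = 1%R). { unfold w. rewrite Cmod_cexp. replace (Re (Ci * PI / 4)) with 0%R by (simpl; field). apply exp_0. }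
set (A := J 0 1 (Ci * (x * x)%R)) in *. set (B := J 0 (-1) (Ci * (x * x)%R)) in *. set (E := exp (/ (x * x))).
replace ((A + B) * (w * x * E) - sqrt PI * w) with (w * (((x * A - (sqrt PI / 2)%R) + (x * B - (sqrt PI / 2)%R)) * E + sqrt PI * (E - 1)%R)).
2:{ rewrite RtoC_div, RtoC_minus by lra. field. }
rewrite Cmod_mult, Hw, Rmult_1_l.
assert (ix : (0 < / (x * x) <= / x)%R). { split. apply Rinv_0_lt_compat; nra. apply Rinv_le_contravar; nra. }
assert (ix1 : (/ x <= 1)%R). { rewrite <- Rinv_1. apply Rinv_le_contravar; lra. }
assert (E3 : (1 <= E <= 3)%R).
{ unfold E. split. rewrite <- exp_0. apply exp_le; lra. eapply Rle_trans; [|apply exp_le_3]. apply exp_le; lra. }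
assert (EM : (E - 1 <= 3 * / x)%R).
{ assert (Q := exp_ineq1_le (- / (x * x))). fold E in Q. rewrite exp_Ropp in Q. fold E in Q.
  assert (Q2 : (E * / E = 1)%R) by (field; lra). assert (0 < / E)%R by (apply Rinv_0_lt_compat; lra). nra. }
eapply Rle_trans; [apply Cmod_triangle|]. rewrite !Cmod_mult, !(Cmod_RtoC_pos E), (Cmod_RtoC_pos (sqrt PI)), (Cmod_RtoC_pos (E - 1)) by lra.
assert (T := Cmod_triangle (x * A - (sqrt PI / 2)%R) (x * B - (sqrt PI / 2)%R)).
specialize (HK1 x ltac:(lra)). specialize (HK2 x ltac:(lra)). fold A in HK1. fold B in HK2.
assert (T2 : (Cmod (x * A - (sqrt PI / 2)%R + (x * B - (sqrt PI / 2)%R)) <= (K1 + K2) / x)%R) by (replace ((K1 + K2) / x)%R with (K1 / x + K2 / x)%R by (field; lra); lra).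
assert (T0 := Cmod_ge_0 (x * A - (sqrt PI / 2)%R + (x * B - (sqrt PI / 2)%R))).
apply Rle_trans with ((K1 + K2) / x * 3 + sqrt PI * (3 * / x))%R.
apply Rplus_le_compat. apply Rmult_le_compat; lra. apply Rmult_le_compat_l; lra.
right; field; lra.
Qed.

(** * Analytic continuation of the L-function *)

(** A ratio test whose bound falls to th only in the limit: from the index [J] on, th c / (j + 1) is
    at most (1 - th) / 2, so the ratio is at most (1 + th) / 2. *)
Lemma ex_series_ratio (u : nat -> R) (th c : R) : (forall j, 0 <= u j)%R -> (0 <= th < 1)%R -> (0 <= c)%R ->
  (forall j, u (S j) <= th * (1 + c / (INR j + 1)) * u j)%R -> ex_series u.
Proof.
intros U0 Hth Hc H.
destruct (archimed (2 * th * c / (1 - th))) as [AR _].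
set (J := Z.to_nat (up (2 * th * c / (1 - th)))).
assert (J0 : (2 * th * c / (1 - th) <= INR J)%R).
{ assert (Q : (0 <= 2 * th * c / (1 - th))%R) by (apply Rmult_le_pos; [nra | left; apply Rinv_0_lt_compat; lra]).
  unfold J. rewrite INR_IZR_INZ, Z2Nat.id. lra. apply le_IZR. lra. }
set (q := ((1 + th) / 2)%R).
assert (ST : forall i, (u (J + i)%nat <= u J * q ^ i)%R).
{ induction i. rewrite Nat.add_0_r; simpl; lra.
  rewrite Nat.add_succ_r. eapply Rle_trans; [apply H|].
  assert (P : (0 <= u (J + i)%nat)%R) by auto.
  assert (L : (th * (1 + c / (INR (J + i) + 1)) <= q)%R).
  { assert (J1 : (INR J <= INR (J + i))%R) by (apply le_INR; lia). assert (J2 := pos_INR (J + i)).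
    assert (th * c / (INR (J + i) + 1) <= (1 - th) / 2)%R.
    { apply (Rmult_le_reg_r (INR (J + i) + 1)). lra. unfold Rdiv at 1. rewrite Rmult_assoc, Rinv_l by lra.
      apply (Rmult_le_compat_r (1 - th)) in J0; [|lra]. replace (2 * th * c / (1 - th) * (1 - th))%R with (2 * th * c)%R in J0 by (field; lra). nra. }
    unfold q. replace (th * (1 + c / (INR (J + i) + 1)))%R with (th + th * c / (INR (J + i) + 1))%R by (field; lra). lra. }
  simpl. assert (0 <= q)%R by (unfold q; lra). apply Rle_trans with (q * u (J + i)%nat)%R. apply Rmult_le_compat_r; auto.
  apply (Rmult_le_compat_l q) in IHi; auto. lra. }
apply (ex_series_incr_n u J). apply ex_series_leR with (fun i => u J * q ^ i)%R. intros i; split; auto.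
apply ex_series_scalR, ex_series_geomR. unfold q; lra.
Qed.

(* [bc s k] is the binomial coefficient C(-s, k). *)
Fixpoint bc (s : C) (k : nat) : C := match k with O => 1 | S j => bc s j * (- s - INR j) / (INR j + 1) end.

Lemma RtoC_S_neq0 (j : nat) : RtoC (INR j) + 1 <> 0.
Proof. rewrite <- RtoC_plus. apply RtoC_neq0. assert (H := pos_INR j). lra. Qed.

Lemma Cmod_INR_1 (j : nat) : Cmod (RtoC (INR j) + 1) = (INR j + 1)%R.
Proof. rewrite <- RtoC_plus. apply Cmod_RtoC_pos. assert (H := pos_INR j). lra. Qed.

Lemma bc_ratio (s : C) (j : nat) : (Cmod (bc s (S j)) <= (1 + Cmod s / (INR j + 1)) * Cmod (bc s j))%R.
Proof.
simpl. rewrite Cmod_div, Cmod_mult, Cmod_INR_1 by apply RtoC_S_neq0. assert (P := pos_INR j).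
assert (L : (Cmod (- s - INR j) <= Cmod s + INR j)%R).
{ eapply Rle_trans; [apply Cmod_triangle_minus|]. rewrite Cmod_opp, Cmod_RtoC_pos; lra. }
assert (Q := Cmod_ge_0 (bc s j)). assert (Qs := Cmod_ge_0 s).
apply (Rmult_le_reg_r (INR j + 1)). lra. unfold Rdiv at 1. rewrite Rmult_assoc, Rinv_l, Rmult_1_r by lra.
replace ((1 + Cmod s / (INR j + 1)) * Cmod (bc s j) * (INR j + 1))%R with (Cmod (bc s j) * (Cmod s + INR j + 1))%R by (field; lra).
apply Rmult_le_compat_l; lra.
Qed.

Lemma bc_summ (s : C) (u : R) : (0 <= u < 1)%R -> ex_series (fun k => Cmod (bc s k) * u ^ k)%R.
Proof.
intros Hu. apply ex_series_ratio with u (Cmod s); auto. intros; apply Rmult_le_pos. apply Cmod_ge_0. apply pow_le; lra.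
apply Cmod_ge_0. intros j. assert (B := bc_ratio s j). assert (P := pow_le u j (proj1 Hu)).
simpl pow. apply Rle_trans with ((1 + Cmod s / (INR j + 1)) * Cmod (bc s j) * (u * u ^ j))%R. apply Rmult_le_compat_r; nra. right; ring.
Qed.

(** * Complex powers x^(-s) and the binomial series *)

Definition pw (x : R) (s : C) : C := cexp (- s * ln x).

Lemma Cmod_pw (x : R) (s : C) : Cmod (pw x s) = exp (- Re s * ln x).
Proof. unfold pw. rewrite Cmod_cexp. f_equal. reim. ring. Qed.
Lemma pw_plus (x : R) (s w : C) : pw x (s + w) = pw x s * pw x w.
Proof. unfold pw. rewrite <- cexp_add. f_equal. ring. Qed.
Lemma pw_nat (x : R) (k : nat) : (0 < x)%R -> pw x (INR k) = RtoC (/ x ^ k).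
Proof.
intros Hx. unfold pw. rewrite <- RtoC_opp, <- RtoC_mult, cexp_RtoC. f_equal.
rewrite <- Rpower_pow by auto. unfold Rpower. rewrite <- exp_Ropp. f_equal; ring.
Qed.
Lemma pw_opp_nat (x : R) (k : nat) : (0 < x)%R -> pw x (- INR k) = RtoC (x ^ k).
Proof.
intros Hx. unfold pw. rewrite <- !RtoC_opp, <- RtoC_mult, cexp_RtoC. f_equal.
rewrite <- Rpower_pow by auto. unfold Rpower. f_equal; ring.
Qed.
Lemma pw_mult (x y : R) (s : C) : (0 < x)%R -> (0 < y)%R -> pw (x * y) s = pw x s * pw y s.
Proof. intros Hx Hy. unfold pw. rewrite <- cexp_add, ln_mult, RtoC_plus by auto. f_equal. ring. Qed.

Lemma cder_RtoC (f : R -> R) (t l : R) : is_derive f t l -> cder (fun s => RtoC (f s)) t (RtoC l).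
Proof. intros H. split; simpl; auto. apply (is_derive_const (V := R_NormedModule)). Qed.

Lemma pw_cder (s : C) (x : R) : (0 < x)%R -> cder (fun x => pw x s) x (- s * pw x (s + 1)).
Proof.
intros Hx. unfold pw. eapply cder_eq. apply cder_cexp. apply cder_scal.
apply (cder_RtoC ln x (/ x)). auto_derive; auto. field; lra.
replace (- (s + 1) * ln x) with (- s * ln x + RtoC (- ln x)) by (rewrite RtoC_opp; ring).
rewrite cexp_add, cexp_RtoC, exp_Ropp, exp_ln by auto. ring.
Qed.

Lemma bc_shift (s : C) (k : nat) : bc s (S k) * (INR k + 1) = - s * bc (s + 1) k.
Proof.
induction k. simpl. field. all: try (apply (RtoC_S_neq0 0)).
change (bc s (S (S k))) with (bc s (S k) * (- s - INR (S k)) / (INR (S k) + 1)).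
change (bc (s + 1) (S k)) with (bc (s + 1) k * (- (s + 1) - INR k) / (INR k + 1)).
transitivity (bc s (S k) * (- s - INR (S k))). field. apply RtoC_S_neq0.
transitivity ((bc s (S k) * (INR k + 1)) * (- s - INR (S k)) / (INR k + 1)). field. apply RtoC_S_neq0.
rewrite IHk, S_INR, RtoC_plus. field. apply RtoC_S_neq0.
Qed.

(* Taylor's formula for (1 + v)^(-s) at the moving base point v, evaluated at u. *)
Lemma bc_taylor_cder (s : C) (u v : R) (n : nat) : (0 <= v <= u)%R ->
  cder (fun v => Csum (fun k => bc s k * pw (1 + v) (s + INR k) * RtoC ((u - v) ^ k)) (S n)) v
    (bc s (S n) * (INR n + 1) * pw (1 + v) (s + INR (S n)) * RtoC ((u - v) ^ n)).
Proof.
intros Hv.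
assert (TD : forall k, cder (fun v => bc s k * pw (1 + v) (s + INR k) * RtoC ((u - v) ^ k)) v
  (bc s (S k) * (INR k + 1) * pw (1 + v) (s + INR (S k)) * RtoC ((u - v) ^ k)
    + bc s k * pw (1 + v) (s + INR k) * RtoC (- (INR k * (u - v) ^ pred k)))).
{ intros k. eapply cder_eq. apply cder_mult. apply cder_scal.
  assert (Q := pw_cder (s + INR k) (1 + v) ltac:(lra)).
  assert (Q' : cder (fun v => pw (1 + v) (s + INR k)) v (- (s + INR k) * pw (1 + v) (s + INR k + 1))).
  { destruct Q as [Q1 Q2]. split.
    - replace (Re (- (s + INR k) * pw (1 + v) (s + INR k + 1))) with (scal 1 (Re (- (s + INR k) * pw (1 + v) (s + INR k + 1)))) by (unfold scal; simpl; unfold mult; simpl; ring).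
      apply (is_derive_comp (fun x => Re (pw x (s + INR k))) (fun v => 1 + v)%R). exact Q1. auto_derive; auto.
    - replace (Im (- (s + INR k) * pw (1 + v) (s + INR k + 1))) with (scal 1 (Im (- (s + INR k) * pw (1 + v) (s + INR k + 1)))) by (unfold scal; simpl; unfold mult; simpl; ring).
      apply (is_derive_comp (fun x => Im (pw x (s + INR k))) (fun v => 1 + v)%R). exact Q2. auto_derive; auto. }
  exact Q'. apply (cder_RtoC (fun v => (u - v) ^ k)%R v (- (INR k * (u - v) ^ pred k))%R). auto_derive; auto. unfold Rminus; ring.
  cbv beta. replace (s + INR k + 1) with (s + INR (S k)) by (rewrite S_INR, RtoC_plus; ring).
  simpl bc. unfold Cdiv. rewrite S_INR, RtoC_plus. field. apply RtoC_S_neq0. }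
induction n.
- apply cder_ext with (fun v => bc s 0 * pw (1 + v) (s + INR 0) * RtoC ((u - v) ^ 0)).
  intros; rewrite Csum_S, Csum_0. ring.
  eapply cder_eq. apply TD. simpl (INR 0). replace (RtoC (- (0 * (u - v) ^ pred 0))) with (RtoC 0) by (f_equal; ring). ring.
- apply cder_ext with (fun v => Csum (fun k => bc s k * pw (1 + v) (s + INR k) * RtoC ((u - v) ^ k)) (S n) + bc s (S n) * pw (1 + v) (s + INR (S n)) * RtoC ((u - v) ^ S n)).
  intros; now rewrite (Csum_S _ (S n)).
  eapply cder_eq. apply cder_plus. apply IHn. apply TD.
  simpl pred. rewrite RtoC_opp, (RtoC_mult (INR (S n))), (S_INR n), (RtoC_plus (INR n)). ring.
Qed.

Lemma pw_1 (s : C) : pw 1 s = 1.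
Proof. unfold pw. rewrite ln_1, Cmult_0_r. apply cexp_0. Qed.

(** The base point of Taylor's formula moves from 0, where the polynomial is the partial sum, to u,
    where it is the exact value. Since (u - v) / (1 + v) <= u, the derivative along the way is
    bounded by a multiple of a term of the convergent series of [bc (s + 1)]. *)
Lemma binomial_series (s : C) (u : R) : (0 <= u < 1)%R ->
  is_cseries (fun k => bc s k * RtoC (u ^ k)) (pw (1 + u) s).
Proof.
intros Hu. set (B := exp (Rabs (Re s) + 0)).
assert (ES := bc_summ s u Hu).
assert (ES2 := bc_summ (s + 1) u Hu).
apply is_series_tail with (fun n => match n with O => Cmod (pw (1 + u) s) | S m => (Cmod s * B) * (Cmod (bc (s + 1) m) * u ^ m) end)%R.
- apply is_lim_seq_incr_1. replace (Finite 0) with (Finite ((Cmod s * B) * 0)) by (f_equal; ring).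
  apply (is_lim_seq_scal_l _ _ 0%R). apply ex_series_lim_0, ES2.
- intros [|m]. rewrite Csum_0. unfold Cminus. rewrite Copp_0, Cplus_0_r. lra.
  set (T v := Csum (fun k => bc s k * pw (1 + v) (s + INR k) * RtoC ((u - v) ^ k)) (S m)).
  assert (Tu : T u = pw (1 + u) s).
  { unfold T. clear. induction m. rewrite Csum_S, Csum_0. simpl. replace (s + 0) with s by ring. ring.
    rewrite Csum_S, IHm. replace (u - u)%R with 0%R by ring. rewrite pow_i by lia. ring. }
  assert (T0 : T 0%R = Csum (fun k => bc s k * RtoC (u ^ k)) (S m)).
  { unfold T. apply Csum_ext. intros k _. rewrite Rplus_0_r, pw_1, Rminus_0_r. ring. }
  rewrite <- Tu, <- T0.
  set (c := (Cmod s * B * (Cmod (bc (s + 1) m) * u ^ m))%R).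
  assert (c0 : (0 <= c)%R).
  { unfold c, B. apply Rmult_le_pos. apply Rmult_le_pos. apply Cmod_ge_0. left; apply exp_pos. apply Rmult_le_pos. apply Cmod_ge_0. apply pow_le; lra. }
  assert (I := cder_increment T (fun v => bc s (S m) * (INR m + 1) * pw (1 + v) (s + INR (S m)) * RtoC ((u - v) ^ m)) (fun v => c * v)%R (fun _ => c) 0 u (proj1 Hu)).
  apply Rle_trans with (c * u - c * 0)%R; [apply I|nra].
  + intros v Hv. now apply bc_taylor_cder.
  + intros v Hv. auto_derive; auto. ring.
  + intros v Hv. rewrite bc_shift, !Cmod_mult, Cmod_opp, Cmod_pw, Cmod_RtoC_pos by (apply pow_le; lra).
    assert (lnv : (0 <= ln (1 + v) <= 1)%R).
    { split. rewrite <- ln_1. destruct (Req_dec v 0) as [->|]. rewrite Rplus_0_r; lra. left; apply ln_increasing; lra.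
      assert (Q := exp_ineq1_le v). assert (ln (1 + v) <= ln (exp v))%R by (destruct Q as [Q|Q]; [left; apply ln_increasing; lra | rewrite Q; lra]).
      rewrite ln_exp in H. lra. }
    assert (EX : (exp (- Re (s + INR (S m)) * ln (1 + v)) <= B * / (1 + v) ^ m)%R).
    { rewrite <- (Rpower_pow m (1 + v)) by lra. unfold Rpower. rewrite <- exp_Ropp. unfold B. rewrite <- exp_plus. apply exp_le.
      rewrite Re_plus, Re_RtoC, S_INR. assert (A := Rabs_pos (Re s)). assert (A1 := Rle_abs (- Re s)). rewrite Rabs_Ropp in A1. nra. }
    assert (UV : (/ (1 + v) ^ m * (u - v) ^ m <= u ^ m)%R).
    { rewrite <- pow_inv, <- Rpow_mult_distr. assert (i0 : (0 < / (1 + v))%R) by (apply Rinv_0_lt_compat; lra). apply pow_incr. split.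
      apply Rmult_le_pos; lra. apply (Rmult_le_reg_l (1 + v)). lra. rewrite <- Rmult_assoc, Rinv_r by lra. nra. }
    assert (P1 : (0 <= (u - v) ^ m)%R) by (apply pow_le; lra).
    assert (P2 := Cmod_ge_0 s). assert (P3 := Cmod_ge_0 (bc (s + 1) m)). assert (B0 : (0 < B)%R) by apply exp_pos.
    unfold c. replace (Cmod s * B * (Cmod (bc (s + 1) m) * u ^ m))%R with (Cmod s * Cmod (bc (s + 1) m) * (B * u ^ m))%R by ring.
    rewrite Rmult_assoc. apply Rmult_le_compat_l. nra.
    apply Rle_trans with (B * / (1 + v) ^ m * (u - v) ^ m)%R. apply Rmult_le_compat_r; auto. rewrite Rmult_assoc. apply Rmult_le_compat_l; lra.
Qed.

(** The progression starts at Mr + A and leaves out A itself, so that the ratio Mr / x stays below 1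
    in the binomial series; [L_ext] restores the omitted term. *)
Definition xs (Mr A : R) (m : nat) : R := (Mr * (INR m + 1) + A)%R.

Lemma xs_pos (Mr A : R) (m : nat) : (1 <= Mr)%R -> (0 < A)%R -> (1 < xs Mr A m)%R /\ (Mr < xs Mr A 0 <= xs Mr A m)%R.
Proof. intros H1 H2. unfold xs. assert (P := pos_INR m). simpl. nra. Qed.

Lemma ln_ge0 (x : R) : (1 <= x)%R -> (0 <= ln x)%R.
Proof. intros [H|H]. rewrite <- ln_1. left; apply ln_increasing; lra. rewrite <- H, ln_1; lra. Qed.
Lemma ln_le_ (x y : R) : (0 < x)%R -> (x <= y)%R -> (ln x <= ln y)%R.
Proof. intros H0 [H|H]. left; now apply ln_increasing. rewrite H; lra. Qed.

(** Comparison with the integral of x^(-p): by the mean value theorem and Mr >= 1, each term is at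
    most a difference of consecutive values of x^(1-p) / (p - 1), and these telescope. *)
Lemma xs_series (Mr A p : R) : (1 <= Mr)%R -> (0 < A)%R -> (1 < p)%R -> ex_series (fun m => exp (- p * ln (xs Mr A m))).
Proof.
intros HM HA Hp. set (d := (p - 1)%R).
assert (d0 : (0 < d)%R) by (unfold d; lra).
set (f x := (exp (- d * ln x) / d)%R).
assert (ST : forall x, (0 < x)%R -> (Mr * exp (- p * ln (x + Mr)) <= f x - f (x + Mr))%R).
{ intros x Hx. destruct (MVT_gen f x (x + Mr) (fun y => - exp (- p * ln y))%R) as [c [Hc E]].
  - intros y Hy. rewrite Rmin_left in Hy by lra. unfold f. auto_derive. lra.
    replace (- p * ln y)%R with (- d * ln y + - ln y)%R by (unfold d; ring). rewrite exp_plus, (exp_Ropp (ln y)), exp_ln by lra. field. split; lra.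
  - intros y Hy. rewrite Rmin_left in Hy by lra. apply continuity_pt_filterlim. apply (ex_derive_continuous (V := R_NormedModule)). unfold f. auto_derive; lra.
  - rewrite Rmin_left, Rmax_right in Hc by lra.
    assert (L : (exp (- p * ln (x + Mr)) <= exp (- p * ln c))%R). { apply exp_le. assert (Q := ln_le_ c (x + Mr) ltac:(lra) ltac:(lra)). nra. }
    nra. }
assert (S0 : forall n, (Rsum (fun m => exp (- p * ln (xs Mr A m))) n <= f A - f (A + Mr * INR n))%R).
{ induction n. simpl. rewrite Rmult_0_r, Rplus_0_r. lra.
  change (Rsum (fun m => exp (- p * ln (xs Mr A m))) (S n)) with (Rsum (fun m => exp (- p * ln (xs Mr A m))) n + exp (- p * ln (xs Mr A n)))%R.
  assert (P := pos_INR n). assert (Q := ST (A + Mr * INR n)%R ltac:(nra)).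
  replace (A + Mr * INR n + Mr)%R with (A + Mr * INR (S n))%R in Q by (rewrite S_INR; ring).
  replace (A + Mr * INR (S n))%R with (xs Mr A n) in * by (unfold xs; rewrite S_INR; ring).
  assert (E := exp_pos (- p * ln (xs Mr A n))). nra. }
apply (ex_series_bounded _ (f A)). intros; left; apply exp_pos.
intros n. rewrite <- Rsum_sum_n. eapply Rle_trans; [apply S0|].
assert (0 < f (A + Mr * INR (S n)))%R. { unfold f. apply Rmult_lt_0_compat. apply exp_pos. now apply Rinv_0_lt_compat. } lra.
Qed.

Definition Zf (Mr A : R) (s : C) : C := CSeries (fun m => pw (xs Mr A m) s).

Lemma Zf_summ (Mr A : R) (s : C) : (1 <= Mr)%R -> (0 < A)%R -> (1 < Re s)%R -> summ (fun m => pw (xs Mr A m) s).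
Proof.
intros HM HA Hs. apply ex_series_ext with (fun m => exp (- Re s * ln (xs Mr A m))). intros; now rewrite Cmod_pw. now apply xs_series.
Qed.

Lemma Zf_wien (Mr A p r : R) (s0 : C) : (1 <= Mr)%R -> (0 < A)%R -> (1 < p)%R -> (0 < r)%R -> (p <= Re s0 - r)%R ->
  wien_le (Zf Mr A) s0 r (exp (- (Re s0 - r - p) * ln (xs Mr A 0)) * Series (fun m => exp (- p * ln (xs Mr A m)))).
Proof.
intros HM HA Hp Hr Hs.
rewrite <- Series_scal_l.
apply (wien_le_sum (fun m s => pw (xs Mr A m) s)).
- intros m. destruct (xs_pos Mr A m HM HA) as [X1 X2].
  assert (L0 := ln_ge0 _ (Rlt_le _ _ X1)). assert (L1 := ln_le_ (xs Mr A 0) (xs Mr A m) ltac:(lra) ltac:(lra)).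
  eapply wien_le_weaken. 2: eapply wien_le_ext. 3: apply (wien_le_cexp (RtoC (- ln (xs Mr A m))) s0 r Hr).
  + rewrite <- !exp_plus. apply exp_le. rewrite Cmod_R, Rabs_Ropp, Rabs_pos_eq by auto.
    replace (Re (RtoC (- ln (xs Mr A m)) * s0)) with (- ln (xs Mr A m) * Re s0)%R by (reim; ring). nra.
  + intros z _. unfold pw. f_equal. rewrite RtoC_opp. ring.
- apply ex_series_scalR, xs_series; auto.
- reflexivity.
Qed.

(* [Ef Mr A n] is (s - 1) times the Dirichlet series over [xs Mr A], continued to Re s > 1 - n: the
   telescoping sum of x^(1-s) - (x + Mr)^(1-s), expanded by the binomial series, expresses its value at s
   through the values at s + 1, s + 2, ... *)
Definition Eop (Mr A : R) (E : C -> C) (s : C) : C :=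
  / Mr * (pw (xs Mr A 0) (s - 1) - CSeries (fun j => bc (s - 1) (S j) / (INR j + 2) * RtoC (Mr ^ (j + 2)) * E (s + (INR j + 1)))).
Fixpoint Ef (Mr A : R) (n : nat) : C -> C :=
  match n with O => fun s => (s - 1) * Zf Mr A s | S m => Eop Mr A (Ef Mr A m) end.

Lemma xs_step (Mr A : R) (m : nat) : xs Mr A (S m) = (xs Mr A m + Mr)%R.
Proof. unfold xs. rewrite S_INR. ring. Qed.

Lemma is_series_telescope (y : nat -> C) : is_lim_seq (fun n => Cmod (y n)) 0 ->
  is_cseries (fun n => y (S n) - y n) (- y 0%nat).
Proof.
intros H. apply is_series_tail with (fun n => Cmod (y n)); auto. intros n.
replace (- y 0%nat - Csum (fun n => y (S n) - y n) n) with (- y n). rewrite Cmod_opp; lra.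
induction n. rewrite Csum_0; ring. rewrite Csum_S.
replace (- y 0%nat - (Csum (fun n0 => y (S n0) - y n0) n + (y (S n) - y n))) with ((- y 0%nat - Csum (fun n0 => y (S n0) - y n0) n) - (y (S n) - y n)) by ring.
rewrite <- IHn. ring.
Qed.

Lemma ln_INR_unbounded (Mr A K : R) : (1 <= Mr)%R -> (0 < A)%R -> exists N, forall n, (N <= n)%nat -> (K <= ln (xs Mr A n))%R.
Proof.
intros HM HA. destruct (archimed (exp K)) as [H _].
assert (P := exp_pos K).
exists (Z.to_nat (up (exp K))). intros n Hn. rewrite <- (ln_exp K). apply ln_le_; auto.
apply le_INR in Hn. rewrite INR_IZR_INZ, Z2Nat.id in Hn. unfold xs. assert (Q := pos_INR n). nra.
apply le_IZR. lra.
Qed.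

Lemma pw_lim (Mr A : R) (s : C) : (1 <= Mr)%R -> (0 < A)%R -> (0 < Re s)%R -> is_lim_seq (fun n => Cmod (pw (xs Mr A n) s)) 0.
Proof.
intros HM HA Hs. apply is_lim_seq_spec. intros eps.
destruct (ln_INR_unbounded Mr A ((1 - ln eps) / Re s) HM HA) as [N HN].
exists N. intros n Hn. rewrite Rminus_0_r, Rabs_pos_eq by apply Cmod_ge_0. rewrite Cmod_pw.
rewrite <- (exp_ln eps) at 1 by apply eps. apply exp_increasing. specialize (HN n Hn).
apply (Rmult_le_compat_l (Re s)) in HN; [|lra]. replace (Re s * ((1 - ln eps) / Re s))%R with (1 - ln eps)%R in HN by (field; lra). lra.
Qed.

(** Each difference (x + Mr)^(1-s) - x^(1-s) is expanded by the binomial series. Summed over x it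
    telescopes to minus the first x^(1-s); summed by powers of Mr it gives (1 - s) Mr Z(s) plus
    multiples of the Dirichlet series at s + 1, s + 2, and so on. *)
Lemma Ef_1 (Mr A : R) (s : C) : (1 <= Mr)%R -> (0 < A)%R -> (1 < Re s)%R -> Ef Mr A 1 s = Ef Mr A 0 s.
Proof.
intros HM HA Hs.
set (x := xs Mr A). assert (X := fun m => xs_pos Mr A m HM HA). fold x in X.
(* Indices start at 2: the binomial term 0 cancels in the difference, and the term 1 yields the
   factor s - 1 of Z(s). *)
set (a := fun k m => bc (s - 1) (k + 2) * RtoC (Mr ^ (k + 2)) * pw (x m) (s - 1 + INR (k + 2))).
assert (Aeq : forall k m, a k m = pw (x m) (s - 1) * (bc (s - 1) (k + 2) * RtoC ((Mr / x m) ^ (k + 2)))).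
{ intros k m. destruct (X m) as [X1 X2]. unfold a. rewrite pw_plus, pw_nat by lra. unfold Rdiv. rewrite Rpow_mult_distr, pow_inv, !RtoC_mult. ring. }
assert (X0 : (Mr < x 0%nat)%R) by apply (X 0%nat).
set (th := (Mr / x 0%nat)%R). assert (Hth : (0 <= th < 1)%R).
{ unfold th. split. apply Rmult_le_pos. lra. left; apply Rinv_0_lt_compat; lra. apply (Rmult_lt_reg_r (x 0%nat)). lra.
  unfold Rdiv; rewrite Rmult_assoc, Rinv_l; lra. }
assert (Abd : forall k m, (Cmod (a k m) <= Cmod (bc (s - 1) (k + 2)) * th ^ (k + 2) * x 0%nat * exp (- Re s * ln (x m)))%R).
{ intros k m. destruct (X m) as [X1 X2].
  rewrite Aeq, !Cmod_mult, Cmod_pw. assert (q0 : (0 <= Mr / x m)%R) by (apply Rmult_le_pos; [lra | left; apply Rinv_0_lt_compat; lra]).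
  rewrite Cmod_RtoC_pos by (now apply pow_le).
  replace (- Re (s - 1) * ln (x m))%R with (- Re s * ln (x m) + ln (x m))%R by (rewrite Re_minus, Re_RtoC; ring).
  rewrite exp_plus, (exp_ln (x m)) by lra.
  assert (L : ((Mr / x m) ^ (k + 2) * x m <= th ^ (k + 2) * x 0%nat)%R).
  { replace (k + 2)%nat with (S (k + 1)) by lia. simpl pow.
    replace (Mr / x m * (Mr / x m) ^ (k + 1) * x m)%R with (Mr * (Mr / x m) ^ (k + 1))%R by (field; lra).
    unfold th at 1. replace (Mr / x 0%nat * th ^ (k + 1) * x 0%nat)%R with (Mr * th ^ (k + 1))%R by (field; lra).
    apply Rmult_le_compat_l. lra. apply pow_incr. split; auto. unfold th. apply Rmult_le_compat_l. lra. apply Rinv_le_contravar; lra. }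
  assert (P := exp_pos (- Re s * ln (x m))). assert (P2 := Cmod_ge_0 (bc (s - 1) (k + 2))).
  replace (exp (- Re s * ln (x m)) * x m * (Cmod (bc (s - 1) (k + 2)) * (Mr / x m) ^ (k + 2)))%R
   with ((exp (- Re s * ln (x m)) * Cmod (bc (s - 1) (k + 2))) * ((Mr / x m) ^ (k + 2) * x m))%R by ring.
  replace (Cmod (bc (s - 1) (k + 2)) * th ^ (k + 2) * x 0%nat * exp (- Re s * ln (x m)))%R
   with ((exp (- Re s * ln (x m)) * Cmod (bc (s - 1) (k + 2))) * (th ^ (k + 2) * x 0%nat))%R by ring.
  apply Rmult_le_compat_l; auto. nra. }
assert (XS := xs_series Mr A (Re s) HM HA Hs). fold x in XS.
assert (EXR : forall k, ex_series (fun m => Cmod (bc (s - 1) (k + 2)) * th ^ (k + 2) * x 0%nat * exp (- Re s * ln (x m)))%R) by (intros; now apply ex_series_scalR).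
assert (SA : forall k, summ (a k)) by (intros k; eapply summ_le; [apply Abd | apply EXR]).
destruct (CSeries_swap a SA) as [S1 [S2 [S3 [_ SW]]]].
{ apply ex_series_leR with (fun k => (Cmod (bc (s - 1) (2 + k)) * th ^ (2 + k)) * (x 0%nat * Series (fun m => exp (- Re s * ln (x m)))))%R.
  - intros k. split. apply Series_ge0. intros; apply Cmod_ge_0. apply SA.
    replace (2 + k)%nat with (k + 2)%nat by lia. rewrite <- Rmult_assoc, <- Series_scal_l. apply Series_le; auto. intros; split; auto. apply Cmod_ge_0.
  - apply ex_series_scal_r. apply (ex_series_incr_n (fun k => Cmod (bc (s - 1) k) * th ^ k)%R 2). now apply bc_summ. }
assert (Rs1 : (0 < Re (s - 1))%R) by (rewrite Re_minus, Re_RtoC; lra).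
assert (COL : CSeries (fun m => CSeries (fun k => a k m)) = - pw (x 0%nat) (s - 1) + (s - 1) * Mr * Zf Mr A s).
{ apply CSeries_unique. apply is_series_extC with (fun m => (pw (x (S m)) (s - 1) - pw (x m) (s - 1)) + ((s - 1) * Mr * pw (x m) s)).
  - intros m. destruct (X m) as [X1 X2].
    assert (u1 : (0 <= Mr / x m < 1)%R). { split. apply Rmult_le_pos; [lra | left; apply Rinv_0_lt_compat; lra]. apply (Rmult_lt_reg_r (x m)). lra.
      unfold Rdiv; rewrite Rmult_assoc, Rinv_l; lra. }
    assert (BS := CSeries_unique _ _ (binomial_series (s - 1) (Mr / x m) u1)).
    assert (SB : summ (fun k => bc (s - 1) k * RtoC ((Mr / x m) ^ k))).
    { apply summ_le with (fun k => Cmod (bc (s - 1) k) * (Mr / x m) ^ k)%R. intros. rewrite Cmod_mult, Cmod_RtoC_pos; [lra | apply pow_le; lra]. now apply bc_summ. }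
    rewrite (CSeries_split _ 2 SB), !Csum_S, Csum_0 in BS.
    rewrite (CSeries_ext _ (fun k => pw (x m) (s - 1) * (bc (s - 1) (2 + k) * RtoC ((Mr / x m) ^ (2 + k))))).
    2: intros k; rewrite Aeq; replace (k + 2)%nat with (2 + k)%nat by lia; reflexivity.
    rewrite CSeries_scal. 2: apply (ex_series_incr_n (fun k => Cmod (bc (s - 1) k * RtoC ((Mr / x m) ^ k))) 2); exact SB.
    match type of BS with ?l + ?S2 = ?r => replace S2 with (r - l) by (rewrite <- BS; ring) end.
    assert (E2 : pw (x (S m)) (s - 1) = pw (x m) (s - 1) * pw (1 + Mr / x m) (s - 1)).
    { rewrite <- pw_mult by lra. f_equal. unfold x at 1. rewrite xs_step. fold x. field; lra. }
    assert (E3 : pw (x m) s = pw (x m) (s - 1) / x m).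
    { replace s with (s - 1 + INR 1) at 1 by (simpl; ring). rewrite pw_plus, pw_nat, RtoC_inv by (try apply pow_nonzero; lra). rewrite pow_1. reflexivity. }
    rewrite E2, E3. simpl. rewrite !Rmult_1_r, RtoC_div. field; try (apply RtoC_neq0); lra. lra.
  - apply (is_series_plus (K := C_AbsRing) (V := C_NormedModule)).
    apply (is_series_telescope (fun m => pw (x m) (s - 1))). now apply pw_lim.
    apply is_series_scalC. apply CSeries_correct, Zf_summ; auto. }
change (Eop Mr A (Ef Mr A 0) s = (s - 1) * Zf Mr A s). unfold Eop.
assert (TE : CSeries (fun j => bc (s - 1) (S j) / (INR j + 2) * RtoC (Mr ^ (j + 2)) * Ef Mr A 0 (s + (INR j + 1))) = - CSeries (fun k => CSeries (a k))).
{ transitivity (CSeries (fun k => - (1) * CSeries (a k))). 2: rewrite CSeries_scal by exact S1; ring.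
  apply CSeries_ext. intros k. unfold a. simpl (Ef Mr A 0).
  rewrite (CSeries_ext (fun m => bc (s - 1) (k + 2) * RtoC (Mr ^ (k + 2)) * pw (x m) (s - 1 + INR (k + 2))) (fun m => (bc (s - 1) (k + 2) * RtoC (Mr ^ (k + 2))) * pw (x m) (s + (INR k + 1)))).
  2: intros m; do 2 f_equal; rewrite plus_INR, RtoC_plus; simpl; rewrite ?RtoC_plus; ring.
  rewrite CSeries_scal. 2: apply Zf_summ; auto; rewrite !Re_plus, !Re_RtoC; assert (P := pos_INR k); lra.
  change (CSeries (fun m => pw (x m) (s + (INR k + 1)))) with (Zf Mr A (s + (INR k + 1))). replace (k + 2)%nat with (S (S k)) by lia.
  (* The last factor of this binomial coefficient is -(s + k), the opposite of the factor that [Ef]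
     at level 0 carries at s + k + 1. This is why s - 1 times the Dirichlet series, and not the
     series itself, obeys a closed recursion. *)
  change (bc (s - 1) (S (S k))) with (bc (s - 1) (S k) * (- (s - 1) - INR (S k)) / (INR (S k) + 1)).
  rewrite S_INR, RtoC_plus. field.
  all: cbv beta; rewrite <- ?RtoC_plus; apply RtoC_neq0; assert (P := pos_INR k); lra. }
rewrite TE, SW, COL. fold x. field. apply RtoC_neq0; lra.
Qed.

(** [Eop] evaluates its argument only at s + 1, s + 2 and so on, so agreement on a half-plane
    propagates one unit to the left. *)
Lemma Ef_coherent (Mr A : R) (n : nat) (s : C) : (1 <= Mr)%R -> (0 < A)%R -> (1 - INR n < Re s)%R -> Ef Mr A (S n) s = Ef Mr A n s.
Proof.
intros HM HA. revert s. induction n; intros s Hs. apply Ef_1; auto. simpl in Hs. lra.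
change (Eop Mr A (Ef Mr A (S n)) s = Eop Mr A (Ef Mr A n) s). unfold Eop. do 2 f_equal. apply CSeries_ext. intros j.
f_equal. apply IHn. rewrite S_INR in Hs. rewrite !Re_plus, !Re_RtoC. assert (P := pos_INR j). lra.
Qed.

Lemma Ef_stable (Mr A : R) (n k : nat) (s : C) : (1 <= Mr)%R -> (0 < A)%R -> (1 - INR n < Re s)%R -> Ef Mr A (n + k) s = Ef Mr A n s.
Proof.
intros HM HA Hs. induction k. now rewrite Nat.add_0_r. rewrite Nat.add_succ_r, Ef_coherent; auto.
rewrite plus_INR. assert (P := pos_INR k). lra.
Qed.

(** The number of continuation steps follows the distance of s from the half-plane of convergence;
    [Z.to_nat] makes it 0 when the integer is negative. *)
Definition Ent (Mr A : R) (s : C) : C := Ef Mr A (Z.to_nat (up (1 - Re s))) s.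

Lemma Ent_eq (Mr A : R) (n : nat) (s : C) : (1 <= Mr)%R -> (0 < A)%R -> (1 - INR n < Re s)%R -> Ent Mr A s = Ef Mr A n s.
Proof.
intros HM HA Hs. unfold Ent. set (N := Z.to_nat (up (1 - Re s))).
assert (HN : (1 - INR N < Re s)%R).
{ destruct (archimed (1 - Re s)) as [H _]. destruct (Z_le_gt_dec 0 (up (1 - Re s))) as [Z0|Z0].
  unfold N. rewrite INR_IZR_INZ, Z2Nat.id by auto. lra.
  assert (Q := pos_INR N). apply Z.gt_lt, IZR_lt in Z0. lra. }
rewrite <- (Ef_stable Mr A N n s), <- (Ef_stable Mr A n N s) by auto. now rewrite Nat.add_comm.
Qed.

Lemma Ent_rec (Mr A : R) (s : C) : (1 <= Mr)%R -> (0 < A)%R -> Ent Mr A s = Eop Mr A (Ent Mr A) s.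
Proof.
intros HM HA. destruct (archimed (1 - Re s)) as [H _]. set (N := Z.to_nat (up (1 - Re s))).
assert (HN : (1 - INR N < Re s)%R).
{ destruct (Z_le_gt_dec 0 (up (1 - Re s))) as [Z0|Z0].
  unfold N. rewrite INR_IZR_INZ, Z2Nat.id by auto. lra.
  assert (Q := pos_INR N). apply Z.gt_lt, IZR_lt in Z0. lra. }
rewrite (Ent_eq Mr A (S N)) by (auto; rewrite S_INR; lra).
change (Eop Mr A (Ef Mr A N) s = Eop Mr A (Ent Mr A) s). unfold Eop. do 2 f_equal. apply CSeries_ext. intros j. f_equal.
symmetry. apply Ent_eq; auto. rewrite !Re_plus, !Re_RtoC. assert (P := pos_INR j). lra.
Qed.

Definition loc (f : C -> C) (z : C) : Prop := exists r B, wien_le f z r B.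

Lemma loc_mult (f g : C -> C) (z : C) : loc f z -> loc g z -> loc (fun s => f s * g s) z.
Proof.
intros [r [B H]] [r' [B' H']]. assert (r0 : (0 < r)%R) by (destruct H as [? [[? _] _]]; auto). assert (r0' : (0 < r')%R) by (destruct H' as [? [[? _] _]]; auto).
assert (m : (0 < Rmin r r')%R) by now apply Rmin_glb_lt.
exists (Rmin r r'), (B * B')%R. apply wien_le_mult. apply wien_le_shrink with r; auto. apply Rmin_l. apply wien_le_shrink with r'; auto. apply Rmin_r.
Qed.
Lemma loc_plus (f g : C -> C) (z : C) : loc f z -> loc g z -> loc (fun s => f s + g s) z.
Proof.
intros [r [B H]] [r' [B' H']]. assert (r0 : (0 < r)%R) by (destruct H as [? [[? _] _]]; auto). assert (r0' : (0 < r')%R) by (destruct H' as [? [[? _] _]]; auto).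
assert (m : (0 < Rmin r r')%R) by now apply Rmin_glb_lt.
exists (Rmin r r'), (B + B')%R. apply wien_le_plus. apply wien_le_shrink with r; auto. apply Rmin_l. apply wien_le_shrink with r'; auto. apply Rmin_r.
Qed.
Lemma loc_const (c z : C) : loc (fun _ => c) z.
Proof. exists 1%R, (Cmod c). apply wien_le_const; lra. Qed.
Lemma loc_scal (c : C) (f : C -> C) (z : C) : loc f z -> loc (fun s => c * f s) z.
Proof. intros H. apply loc_mult; auto. apply loc_const. Qed.
Lemma loc_ext (f g : C -> C) (z : C) (d : R) : (0 < d)%R -> (forall s, (Cmod (s - z) <= d)%R -> f s = g s) -> loc f z -> loc g z.
Proof.
intros Hd E [r [B H]]. assert (r0 : (0 < r)%R) by (destruct H as [? [[? _] _]]; auto).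
exists (Rmin r d), B. apply wien_le_ext with f. intros s Hs. apply E. eapply Rle_trans; [apply Hs | apply Rmin_r].
apply wien_le_shrink with r; auto. now apply Rmin_glb_lt. apply Rmin_l.
Qed.
Lemma loc_affine (c z : C) : loc (fun s => s + c) z.
Proof.
apply loc_ext with (fun s => (z + c) + 1 * (s - z)) 1%R. lra. intros; ring. eexists 1%R, _. apply wien_le_poly1. lra.
Qed.
Lemma loc_pw (x : R) (c z : C) : loc (fun s => pw x (s + c)) z.
Proof.
apply loc_ext with (fun s => pw x c * cexp (- ln x * s)) 1%R. lra. intros s _. rewrite pw_plus. unfold pw. rewrite Cmult_comm. f_equal. f_equal. ring.
apply loc_scal. eexists 1%R, _. apply wien_le_cexp. lra.
Qed.
Lemma loc_shift (f : C -> C) (z c : C) : loc f (z + c) -> loc (fun s => f (s + c)) z.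
Proof.
intros [r [B [a [[H0 [H1 H2]] H3]]]]. exists r, B, a. split; auto. split; auto. split; auto.
intros s Hs. rewrite H2. 2: replace (s + c - (z + c)) with (s - z) by ring; auto.
apply CSeries_ext; intros. do 2 f_equal. ring.
Qed.
Lemma loc_bc (z c : C) (k : nat) : loc (fun s => bc (s + c) k) z.
Proof.
induction k. exact (loc_const 1 z). simpl.
apply loc_ext with (fun s => bc (s + c) k * (- / (INR k + 1) * (s + (c + INR k)))) 1%R. lra. intros; field. apply RtoC_S_neq0.
apply loc_mult; auto. apply loc_scal, loc_affine.
Qed.
Lemma loc_finite (F : nat -> C -> C) (z : C) (n : nat) : (forall j, loc (F j) z) ->
  exists r, (0 < r <= / 2)%R /\ exists B, forall j, (j < n)%nat -> wien_le (F j) z r (B j).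
Proof.
intros H. induction n. exists (/ 2)%R. split. lra. exists (fun _ => 0%R). intros; lia.
destruct IHn as [r [Hr [B HB]]]. destruct (H n) as [r' [B' H']]. assert (r0' : (0 < r')%R) by (destruct H' as [? [[? _] _]]; auto).
exists (Rmin r r'). assert (Q := Rmin_l r r'). split. split. apply Rmin_glb_lt; lra. lra.
exists (fun j => if Nat.eq_dec j n then B' else B j). intros j Hj. destruct (Nat.eq_dec j n) as [->|N].
apply wien_le_shrink with r'; auto. apply Rmin_glb_lt; lra. apply Rmin_r.
apply wien_le_shrink with r; auto. apply Rmin_glb_lt; lra. apply HB; lia.
Qed.

(** The rising factorial of c divided by k!, a majorant for the norm of the binomial coefficients as
    functions of s. *)
Fixpoint nb (c : R) (k : nat) : R := match k with O => 1%R | S j => (nb c j * ((c + INR j) / (INR j + 1)))%R end.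
Lemma nb_ge0 (c : R) (k : nat) : (0 <= c)%R -> (0 <= nb c k)%R.
Proof.
intros Hc. induction k; simpl. lra. assert (P := pos_INR k). apply Rmult_le_pos; auto. apply Rmult_le_pos. lra. left; apply Rinv_0_lt_compat; lra.
Qed.
Lemma wien_le_bc (z c : C) (r : R) (k : nat) : (0 < r)%R -> wien_le (fun s => bc (s + c) k) z r (nb (Cmod (z + c) + r) k).
Proof.
intros Hr. induction k. simpl. assert (W := wien_le_const 1 z r Hr). rewrite Cmod_1 in W. exact W.
assert (P := pos_INR k). simpl.
apply wien_le_ext with (fun s => bc (s + c) k * (/ (INR k + 1) * (- (z + c) - INR k + - (1) * (s - z)))). intros; field. apply RtoC_S_neq0.
apply wien_le_mult; auto. unfold Rdiv. rewrite (Rmult_comm (_ + _)). rewrite <- (Cmod_INR_1 k). rewrite <- Cmod_inv by apply RtoC_S_neq0.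
apply wien_le_scal. eapply wien_le_weaken; [|now apply wien_le_poly1].
rewrite Cmod_opp, Cmod_1. assert (T := Cmod_triangle_minus (- (z + c)) (INR k)). rewrite Cmod_opp, Cmod_RtoC_pos in T by auto. lra.
Qed.

Lemma wien_le_shift (f : C -> C) (z c : C) (r B : R) : wien_le f (z + c) r B -> wien_le (fun s => f (s + c)) z r B.
Proof.
intros [a [[H0 [H1 H2]] H3]]. exists a. split; auto. split; auto. split; auto.
intros s Hs. rewrite H2. 2: replace (s + c - (z + c)) with (s - z) by ring; auto.
apply CSeries_ext; intros. do 2 f_equal. ring.
Qed.

(** Finitely many shifts fall outside the half-plane of convergence and are covered by [loc_finite].
    From [j0] on, the Dirichlet series bounds the norm of the j-th term by a constant times nb c (j
    + 1) (Mr / X0)^j, and Mr < X0 makes these bounds summable. *)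
Lemma Eop_loc (Mr A : R) (E : C -> C) (s0 : C) : (1 <= Mr)%R -> (0 < A)%R ->
  (forall j, loc E (s0 + (INR j + 1))) -> (forall s, (1 < Re s)%R -> E s = (s - 1) * Zf Mr A s) -> loc (Eop Mr A E) s0.
Proof.
intros HM HA HL HE.
set (F := fun j s => bc (s + - (1)) (S j) * (/ (INR j + 2) * RtoC (Mr ^ (j + 2)) * E (s + (INR j + 1)))).
assert (LF : forall j, loc (F j) s0).
{ intros j. apply loc_mult. apply loc_bc. apply loc_scal. apply loc_shift, HL. }
destruct (xs_pos Mr A 0 HM HA) as [X1 [X2 _]]. set (X0 := xs Mr A 0) in *.
assert (XI : exists j0, (3 - Re s0 <= INR j0)%R).
{ destruct (archimed (Rabs (3 - Re s0))) as [Q _]. exists (Z.to_nat (up (Rabs (3 - Re s0)))). assert (P := Rabs_pos (3 - Re s0)). assert (P2 := Rle_abs (3 - Re s0)).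
  rewrite INR_IZR_INZ, Z2Nat.id. lra. apply le_IZR. lra. }
destruct XI as [j0 Hj0].
destruct (loc_finite F s0 j0 LF) as [r [Hr [B HB]]].
set (c := (Cmod (s0 + - (1)) + r)%R). assert (c0 : (0 <= c)%R) by (unfold c; assert (P := Cmod_ge_0 (s0 + - (1))); lra).
set (Z2 := Series (fun m => exp (- (2) * ln (xs Mr A m)))%R).
assert (Z20 : (0 <= Z2)%R) by (apply Series_ge0; [intros; left; apply exp_pos | apply (xs_series Mr A 2); auto; lra]).
set (K := ((Cmod s0 + 1) * Mr ^ 2 * (X0 ^ j0 * Z2))%R).
set (Bq := fun j => (nb c (S j) * (K * (Mr / X0) ^ j))%R).
assert (th1 : (0 <= Mr / X0 < 1)%R). { split. apply Rmult_le_pos; [lra | left; apply Rinv_0_lt_compat; lra]. apply (Rmult_lt_reg_r X0). lra. unfold Rdiv; rewrite Rmult_assoc, Rinv_l; lra. }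
assert (QB : forall j, (j0 <= j)%nat -> wien_le (F j) s0 r (Bq j)).
{ intros j Hj. assert (P := pos_INR j). apply wien_le_mult. apply wien_le_bc; lra.
  assert (JJ : (INR j0 <= INR j)%R) by now apply le_INR.
  assert (W : wien_le E (s0 + (INR j + 1)) r ((Cmod s0 + INR j + r) * (exp (- (Re (s0 + (INR j + 1)) - r - 2) * ln X0) * Z2))).
  { apply wien_le_ext with (fun s => (s - 1) * Zf Mr A s).
    - intros s Hs. symmetry. apply HE. assert (T := re_le_Cmod (s - (s0 + (INR j + 1)))). rewrite Re_minus, !Re_plus, !Re_RtoC in T.
      apply Rabs_le_between in T. lra.
    - apply wien_le_mult. eapply wien_le_weaken. 2: eapply wien_le_ext. 3: apply (wien_le_poly1 (s0 + INR j) 1 (s0 + (INR j + 1)) r); lra.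
      rewrite Cmod_1. assert (T := Cmod_triangle s0 (INR j)). rewrite (Cmod_RtoC_pos (INR j)) in T by auto. lra. intros; simpl; ring.
      apply Zf_wien; auto; try lra. rewrite !Re_plus, !Re_RtoC. lra. }
  apply wien_le_shift in W.
  eapply wien_le_weaken. 2: apply wien_le_scal; exact W.
  rewrite Cmod_mult. replace (RtoC (INR j) + 2) with (RtoC (INR j + 2)) by (rewrite RtoC_plus; ring).
  rewrite <- RtoC_inv, !Cmod_RtoC_pos by (try apply pow_le; try (left; apply Rinv_0_lt_compat); lra).
  assert (E1 : (exp (- (Re (s0 + (INR j + 1)) - r - 2) * ln X0) <= / X0 ^ j * X0 ^ j0)%R).
  { rewrite <- !Rpower_pow by lra. unfold Rpower. rewrite <- exp_Ropp, <- exp_plus. apply exp_le. rewrite !Re_plus, !Re_RtoC.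
    assert (L := ln_ge0 X0 ltac:(lra)). nra. }
  assert (E2 : ((Cmod s0 + INR j + r) * / (INR j + 2) <= Cmod s0 + 1)%R).
  { assert (Q := Cmod_ge_0 s0). apply (Rmult_le_reg_r (INR j + 2)). lra. rewrite Rmult_assoc, Rinv_l by lra. nra. }
  assert (Q0 := Cmod_ge_0 s0). assert (PX := pow_lt X0 j ltac:(lra)). assert (PX0 := pow_lt X0 j0 ltac:(lra)). assert (PM := pow_lt Mr (j + 2) ltac:(lra)).
  assert (I0 : (0 < / (INR j + 2))%R) by (apply Rinv_0_lt_compat; lra).
  apply Rle_trans with ((Cmod s0 + 1) * (Mr ^ (j + 2) * ((/ X0 ^ j * X0 ^ j0) * Z2)))%R.
  - replace (/ (INR j + 2) * Mr ^ (j + 2) * ((Cmod s0 + INR j + r) * (exp (- (Re (s0 + (INR j + 1)) - r - 2) * ln X0) * Z2)))%R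
     with (((Cmod s0 + INR j + r) * / (INR j + 2)) * (Mr ^ (j + 2) * (exp (- (Re (s0 + (INR j + 1)) - r - 2) * ln X0) * Z2)))%R by ring.
    assert (E0 := exp_pos (- (Re (s0 + (INR j + 1)) - r - 2) * ln X0)).
    apply Rmult_le_compat; auto. apply Rmult_le_pos; lra. apply Rmult_le_pos. lra. apply Rmult_le_pos; lra.
    apply Rmult_le_compat_l. lra. apply Rmult_le_compat_r; auto.
  - right. unfold K, Rdiv. rewrite Rpow_mult_distr, pow_inv, pow_add. ring. }
assert (K0 : (0 <= K)%R).
{ unfold K. assert (Q0 := Cmod_ge_0 s0). apply Rmult_le_pos. apply Rmult_le_pos. lra. apply pow_le; lra. apply Rmult_le_pos; auto. apply pow_le; lra. }
assert (EB : ex_series Bq).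
{ apply ex_series_ratio with (Mr / X0)%R c; auto.
  - intros j. unfold Bq. apply Rmult_le_pos. now apply nb_ge0. apply Rmult_le_pos; auto. apply pow_le; lra.
  - intros j. unfold Bq. change (nb c (S (S j))) with (nb c (S j) * ((c + INR (S j)) / (INR (S j) + 1)))%R. simpl pow.
    assert (N0 := nb_ge0 c (S j) c0). assert (P := pos_INR j). assert (P2 := pow_le (Mr / X0) j (proj1 th1)).
    assert (L : ((c + INR (S j)) / (INR (S j) + 1) <= 1 + c / (INR j + 1))%R).
    { rewrite S_INR. apply (Rmult_le_reg_r ((INR j + 1 + 1) * (INR j + 1))). nra.
      replace ((c + (INR j + 1)) / (INR j + 1 + 1) * ((INR j + 1 + 1) * (INR j + 1)))%R with ((c + (INR j + 1)) * (INR j + 1))%R by (field; lra).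
      replace ((1 + c / (INR j + 1)) * ((INR j + 1 + 1) * (INR j + 1)))%R with ((INR j + 1 + c) * (INR j + 1 + 1))%R by (field; lra). nra. }
    set (T := (nb c (S j) * (K * (Mr / X0) ^ j))%R). assert (T0 : (0 <= T)%R) by (unfold T; apply Rmult_le_pos; auto; nra).
    replace (nb c (S j) * ((c + INR (S j)) / (INR (S j) + 1)) * (K * (Mr / X0 * (Mr / X0) ^ j)))%R with (((c + INR (S j)) / (INR (S j) + 1)) * (Mr / X0 * T))%R by (unfold T; ring).
    replace (Mr / X0 * (1 + c / (INR j + 1)) * T)%R with ((1 + c / (INR j + 1)) * (Mr / X0 * T))%R by ring.
    apply Rmult_le_compat_r; auto. apply Rmult_le_pos; lra. }
set (BB := fun j => if (j <? j0)%nat then B j else Bq j).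
assert (WS : wien_le (fun s => CSeries (fun j => F j s)) s0 r (Series BB)).
{ apply (wien_le_sum F); auto.
  - intros j. unfold BB. destruct (j <? j0)%nat eqn:Q. apply HB. now apply Nat.ltb_lt. apply QB. now apply Nat.ltb_ge.
  - apply (ex_series_incr_n BB j0). apply ex_series_ext with (fun k => Bq (j0 + k)%nat).
    intros n. unfold BB. now replace (j0 + n <? j0)%nat with false by (symmetry; apply Nat.ltb_ge; lia).
    apply (ex_series_incr_n Bq j0), EB. }
apply loc_ext with (fun s => / Mr * (pw X0 (s + - (1)) + - (1) * CSeries (fun j => F j s))) 1%R. lra.
- intros s _. unfold Eop. fold X0. replace (s - 1) with (s + - (1)) by ring.
  replace (CSeries (fun j => bc (s + - (1)) (S j) / (INR j + 2) * RtoC (Mr ^ (j + 2)) * E (s + (INR j + 1)))) with (CSeries (fun j => F j s)).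
  ring. apply CSeries_ext. intros j. unfold F, Cdiv. ring.
- apply loc_scal. apply loc_plus. apply loc_pw. apply loc_scal. now exists r, (Series BB).
Qed.

Lemma Ef_loc (Mr A : R) (n : nat) (s0 : C) : (1 <= Mr)%R -> (0 < A)%R -> (1 - INR n < Re s0)%R -> loc (Ef Mr A n) s0.
Proof.
intros HM HA. revert s0. induction n; intros s0 Hs.
- simpl in *. apply loc_ext with (fun s => (s + - (1)) * Zf Mr A s) 1%R. lra. intros; ring.
  apply loc_mult. apply loc_affine. set (p := ((1 + Re s0) / 2)%R). exists ((Re s0 - 1) / 2)%R. eexists. apply (Zf_wien Mr A p); unfold p; auto; lra.
- apply Eop_loc; auto. intros j. apply IHn. rewrite S_INR in Hs. rewrite !Re_plus, !Re_RtoC. assert (P := pos_INR j). lra.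
  intros s H. apply (Ef_stable Mr A 0 n s); auto. simpl. lra.
Qed.

Lemma Ent_loc (Mr A : R) (s0 : C) : (1 <= Mr)%R -> (0 < A)%R -> loc (Ent Mr A) s0.
Proof.
intros HM HA.
assert (XI : exists n, (2 - Re s0 < INR n)%R).
{ destruct (archimed (Rabs (2 - Re s0))) as [Q _]. exists (Z.to_nat (up (Rabs (2 - Re s0)))). assert (P := Rabs_pos (2 - Re s0)). assert (P2 := Rle_abs (2 - Re s0)).
  rewrite INR_IZR_INZ, Z2Nat.id. lra. apply le_IZR. lra. }
destruct XI as [n Hn]. apply loc_ext with (Ef Mr A n) (/ 2)%R. lra.
intros s Hs. symmetry. apply Ent_eq; auto. assert (T := re_le_Cmod (s - s0)). rewrite Re_minus in T. apply Rabs_le_between in T. lra.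
apply Ef_loc; auto. lra.
Qed.

(** * Residue classes and the continuation of the L-function *)

Lemma is_series_Csum_lim (a : nat -> C) (l : C) :
  is_cseries a l ->
  forall eps, (0 < eps)%R -> exists N, forall n, (N <= n)%nat -> (Cmod (l - Csum a n) < eps)%R.
Proof.
intros H eps He. assert (He2 : (0 < eps / 2)%R) by lra.
destruct (proj1 (filterlim_locally _ _) H (mkposreal _ He2)) as [N HN].
exists (S N). intros [|n] Hn. lia. specialize (HN n ltac:(lia)). destruct HN as [H1 H2].
change (Rabs (Re (Csum a (S n)) - Re l) < eps / 2)%R in H1. change (Rabs (Im (Csum a (S n)) - Im l) < eps / 2)%R in H2.
eapply Rle_lt_trans; [apply Cmod_le_ReIm|]. rewrite Re_minus, Im_minus, (Rabs_minus_sym (Re l)), (Rabs_minus_sym (Im l)). lra.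
Qed.

Lemma Csum_regroup (f : nat -> C) (M n : nat) :
  Csum f (n * M) = Csum (fun a => Csum (fun m => f (m * M + a)%nat) n) M.
Proof.
induction n. simpl (0 * M)%nat. rewrite Csum_0. rewrite (Csum_ext _ (fun _ => 0 * 0) M). rewrite Csum_scal; ring. intros; rewrite Csum_0; ring.
replace (S n * M)%nat with (n * M + M)%nat by lia. rewrite Csum_split, IHn.
rewrite (Csum_ext (fun a => Csum (fun m => f (m * M + a)%nat) (S n)) (fun a => Csum (fun m => f (m * M + a)%nat) n + f (n * M + a)%nat)).
now rewrite Csum_plus. intros; now rewrite Csum_S.
Qed.

Lemma Csum_zero (f : nat -> C) (n : nat) : (forall k, (k < n)%nat -> f k = 0) -> Csum f n = 0.
Proof. intros H. induction n. reflexivity. rewrite Csum_S, IHn, H; auto. ring. Qed.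

Lemma Cmod_small_eq (x y : C) : (forall eps, (0 < eps)%R -> Cmod (x - y) <= eps)%R -> x = y.
Proof.
intros H. assert (E : Cmod (x - y) = 0%R).
{ apply Rle_antisym; [|apply Cmod_ge_0]. apply le_epsilon. intros e He. rewrite Rplus_0_l. auto. }
apply Cmod_eq_0 in E. replace x with (x - y + y) by ring. rewrite E; ring.
Qed.

(** At length n M the partial sum of f consists of n terms from every residue class, so the two
    limits can be compared along these lengths. *)
Lemma series_regroup (f : nat -> C) (M : nat) (l : C) (v : nat -> C) : (0 < M)%nat ->
  is_cseries f l ->
  (forall a, (a < M)%nat -> is_cseries (fun m => f (m * M + a)%nat) (v a)) ->
  l = Csum v M.
Proof.
intros HM Hf Hv. apply Cmod_small_eq. intros eps He.
assert (U : forall K, (K <= M)%nat -> exists N, forall n, (N <= n)%nat -> (Cmod (Csum v K - Csum (fun a => Csum (fun m => f (m * M + a)%nat) n) K) <= INR K * (eps / (2 * INR M)))%R).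
{ assert (M0 : (0 < INR M)%R) by (now apply lt_0_INR).
  induction K; intros HK. exists 0%nat. intros. rewrite !Csum_0. replace (0 - 0) with (RtoC 0) by ring. rewrite Cmod_0. simpl. lra.
  destruct (IHK ltac:(lia)) as [N1 H1].
  destruct (is_series_Csum_lim _ _ (Hv K ltac:(lia)) (eps / (2 * INR M))) as [N2 H2]. apply Rdiv_lt_0_compat; lra.
  exists (N1 + N2)%nat. intros n Hn. specialize (H1 n ltac:(lia)). specialize (H2 n ltac:(lia)). rewrite !Csum_S, S_INR.
  match goal with |- (Cmod ?x <= _)%R => replace x with ((Csum v K - Csum (fun a => Csum (fun m => f (m * M + a)%nat) n) K) + (v K - Csum (fun m => f (m * M + K)%nat) n)) by ring end.
  eapply Rle_trans; [apply Cmod_triangle|]. lra. }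
destruct (U M (Nat.le_refl M)) as [N1 H1].
destruct (is_series_Csum_lim _ _ Hf (eps / 2) ltac:(lra)) as [N2 H2].
set (n := (N1 + N2)%nat). specialize (H1 n ltac:(lia)). specialize (H2 (n * M)%nat ltac:(nia)).
rewrite Csum_regroup in H2. assert (M0 : (0 < INR M)%R) by (now apply lt_0_INR).
replace (INR M * (eps / (2 * INR M)))%R with (eps / 2)%R in H1 by (field; lra).
set (Q := Csum (fun a => Csum (fun m => f (m * M + a)%nat) n) M) in *.
replace (l - Csum v M) with ((l - Q) - (Csum v M - Q)) by ring. eapply Rle_trans; [apply Cmod_triangle_minus|]. lra.
Qed.

Lemma periodic_mul (M : nat) (g : Z -> C) (n : Z) (k : nat) : periodic M g -> g (n + Z.of_nat (k * M))%Z = g n.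
Proof.
intros H. induction k. simpl. f_equal; lia.
replace (n + Z.of_nat (S k * M))%Z with ((n + Z.of_nat (k * M)) + Z.of_nat M)%Z by lia. now rewrite H.
Qed.
Lemma periodic_mulZ (M : nat) (g : Z -> C) (n k : Z) : periodic M g -> g (n + k * Z.of_nat M)%Z = g n.
Proof.
intros H. destruct (Z_le_gt_dec 0 k) as [K0|K0].
- rewrite <- (Z2Nat.id k) by auto. rewrite <- Nat2Z.inj_mul. now apply periodic_mul.
- rewrite <- (periodic_mul M g (n + k * Z.of_nat M) (Z.to_nat (- k)) H). f_equal. rewrite Nat2Z.inj_mul, Z2Nat.id by lia. ring.
Qed.

Lemma periodic_bounded (M : nat) (g : Z -> C) : (0 < M)%nat -> periodic M g -> exists B, (0 <= B)%R /\ forall n, (Cmod (g n) <= B)%R.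
Proof.
intros HM H. exists (Rsum (fun l => Cmod (g (Z.of_nat l))) M).
assert (Q : forall K l, (l < K)%nat -> (Cmod (g (Z.of_nat l)) <= Rsum (fun l => Cmod (g (Z.of_nat l))) K)%R).
{ assert (P : forall K, (0 <= Rsum (fun l => Cmod (g (Z.of_nat l))) K)%R).
  { induction K; simpl. lra. assert (G := Cmod_ge_0 (g (Z.of_nat K))). lra. }
  induction K; intros l Hl. lia. simpl. destruct (Nat.eq_dec l K) as [->|]. specialize (P K). lra.
  assert (G := Cmod_ge_0 (g (Z.of_nat K))). assert (T := IHK l ltac:(lia)). lra. }
split. eapply Rle_trans; [apply Cmod_ge_0 | apply (Q M 0%nat); auto].
intros n. assert (E := Z.div_mod n (Z.of_nat M) ltac:(lia)). assert (B := Z.mod_pos_bound n (Z.of_nat M) ltac:(lia)).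
replace (g n) with (g (Z.of_nat (Z.to_nat (n mod Z.of_nat M)))). apply Q. lia.
rewrite Z2Nat.id by lia. rewrite <- (periodic_mulZ M g (n mod Z.of_nat M) (n / Z.of_nat M) H). f_equal. lia.
Qed.

(** The decomposition into Hurwitz zeta functions, over the residues 1, ..., M. [Ent] carries the
    factor s - 1, so the only possible pole is at 1. *)
Definition L_ext (M : nat) (g : Z -> C) (s : C) : C :=
  Csum (fun a => g (Z.of_nat (S a)) * (pw (INR (S a)) s + Ent (INR M) (INR (S a)) s / (s - 1))) M.

Lemma INR_S_gt0 (a : nat) : (0 < INR (S a))%R. Proof. apply lt_0_INR; lia. Qed.
Lemma INR_ge1 (M : nat) : (0 < M)%nat -> (1 <= INR M)%R. Proof. intros H. apply (le_INR 1) in H. exact H. Qed.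

Lemma L_ext_series (M : nat) (g : Z -> C) (s : C) : (0 < M)%nat -> periodic M g -> (1 < Re s)%R ->
  is_cseries (fun k => g (Z.of_nat (S k)) * cexp (- s * ln (INR (S k)))) (L_ext M g s).
Proof.
intros HM Hg Hs. destruct (periodic_bounded M g HM Hg) as [B [B0 HB]].
set (f := fun k => g (Z.of_nat (S k)) * cexp (- s * ln (INR (S k)))).
assert (SM : summ f).
{ apply summ_le with (fun k => B * exp (- Re s * ln (INR (S k))))%R.
  intros k. unfold f. rewrite Cmod_mult. fold (pw (INR (S k)) s). rewrite Cmod_pw. apply Rmult_le_compat_r; auto. left; apply exp_pos.
  apply ex_series_scalR. apply (ex_series_incr_1 (fun k => exp (- Re s * ln (INR (S k))))).
  apply ex_series_ext with (fun m => exp (- Re s * ln (xs 1 1 m))). intros n. do 3 f_equal. unfold xs. rewrite !S_INR. ring.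
  apply xs_series; lra. }
assert (IS := CSeries_correct f SM).
replace (L_ext M g s) with (CSeries f); auto.
apply (series_regroup f M); auto.
intros a Ha. assert (Ms := INR_ge1 M HM).
assert (S1 : s - 1 <> 0). { intros E. apply (f_equal Re) in E. rewrite Re_minus, !Re_RtoC in E. lra. }
assert (EN : Ent (INR M) (INR (S a)) s / (s - 1) = Zf (INR M) (INR (S a)) s).
{ rewrite (Ent_eq (INR M) (INR (S a)) 0) by (try apply INR_S_gt0; auto; simpl INR; lra). change (Ef (INR M) (INR (S a)) 0 s) with ((s - 1) * Zf (INR M) (INR (S a)) s). field; auto. }
rewrite EN. apply is_series_extC with (fun m => g (Z.of_nat (S a)) * match m with O => pw (INR (S a)) s | S m => pw (xs (INR M) (INR (S a)) m) s end).
- intros m. unfold f. replace (Z.of_nat (S (m * M + a))) with (Z.of_nat (S a) + Z.of_nat (m * M))%Z by lia.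
  rewrite (periodic_mul M g _ m Hg). f_equal. destruct m. reflexivity. unfold pw. do 4 f_equal. unfold xs.
  rewrite <- S_INR, <- mult_INR, <- plus_INR. f_equal. lia.
- apply is_series_scalC. apply (is_series_decr_1 (K := C_AbsRing) (V := C_NormedModule)).
  match goal with |- is_series _ ?l => replace l with (Zf (INR M) (INR (S a)) s) end.
  apply CSeries_correct, Zf_summ; auto. apply INR_S_gt0. unfold plus, opp; simpl. ring.
Qed.

Lemma loc_inv_minus1 (s0 : C) : s0 <> 1 -> loc (fun s => / (s - 1)) s0.
Proof.
intros H. assert (N : s0 - 1 <> 0). { intros E. apply H. replace s0 with (s0 - 1 + 1) by ring. rewrite E; ring. }
assert (P := proj1 (Cmod_gt_0 _) N). set (d := (Cmod (s0 - 1) / 4)%R).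
destruct (wien_geom (/ 4) ltac:(lra)) as [W _].
set (u := fun s : C => - (s - s0) / (s0 - 1)).
assert (u0 : u s0 = 0) by (unfold u; field; auto).
rewrite <- u0 in W.
assert (HU : wien_le (fun s => u s - u s0) s0 d (/ 4)).
{ eapply wien_le_weaken. 2: eapply wien_le_ext. 3: apply (wien_le_poly1 0 (- / (s0 - 1)) s0 d). 3: unfold d; lra.
  rewrite Cmod_0, Cmod_opp, Cmod_inv by auto. unfold d. right; field; lra. intros s _. rewrite u0. unfold u. field; auto. }
assert (WC := wien_comp _ u s0 d (/ 4) _ W HU).
apply loc_ext with (fun s => / (s0 - 1) * / (1 - u s)) d. unfold d; lra.
- intros s Hs. assert (Nu : (Cmod (u s) < 1)%R).
  { unfold u. rewrite Cmod_div, Cmod_opp by auto. apply (Rmult_lt_reg_r (Cmod (s0 - 1))); auto. unfold Rdiv; rewrite Rmult_assoc, Rinv_l by lra. unfold d in Hs. lra. }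
  assert (N1 := Cmod_lt1_neq _ Nu).
  assert (E : (s0 - 1) * (1 - u s) = s - 1) by (unfold u; field; auto). rewrite <- E. field; auto.
- apply loc_scal. eexists _, _. exact WC.
Qed.

Lemma L_ext_loc (M : nat) (g : Z -> C) (s0 : C) : (0 < M)%nat -> s0 <> 1 -> loc (L_ext M g) s0.
Proof.
intros HM H. unfold L_ext. generalize M at 2. intros K. induction K. exact (loc_const 0 s0).
apply loc_ext with (fun s => Csum (fun a => g (Z.of_nat (S a)) * (pw (INR (S a)) s + Ent (INR M) (INR (S a)) s / (s - 1))) K + g (Z.of_nat (S K)) * (pw (INR (S K)) s + Ent (INR M) (INR (S K)) s * / (s - 1))) 1%R. lra.
intros; now rewrite Csum_S.
apply loc_plus; auto. apply loc_scal. apply loc_plus. apply loc_ext with (fun s => pw (INR (S K)) (s + 0)) 1%R. lra. intros; f_equal; ring. apply loc_pw.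
apply loc_mult. apply Ent_loc. now apply INR_ge1. apply INR_S_gt0. now apply loc_inv_minus1.
Qed.

Lemma L_ext_continuation (M : nat) (g : Z -> C) : (0 < M)%nat -> periodic M g -> is_L_continuation g (L_ext M g).
Proof.
intros HM Hg. split. intros s Hs. destruct (L_ext_loc M g s HM Hs) as [r [B W]]. now apply wien_le_analytic with r B.
intros s Hs. now apply L_ext_series.
Qed.

(** Strong induction on the coefficients: once those before m vanish, a_m w^m equals a remainder
    O(|w|^(m+1)) at zeros z0 + w arbitrarily close to the centre, which forces a_m = 0. *)
Lemma wien_zero (f : C -> C) (z0 d : C) (r h0 : R) (a : nat -> C) : wien f z0 r a -> d <> 0 -> (0 < h0)%R ->
  (forall h, (0 < h < h0)%R -> f (z0 + h * d) = 0) -> forall z, (Cmod (z - z0) <= r)%R -> f z = 0.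
Proof.
intros W Nd Hh Hf. assert (W' := W). destruct W' as [r0 [H1 H2]].
assert (dp := proj1 (Cmod_gt_0 _) Nd).
assert (Z : forall m, a m = 0).
{ intros m. induction m as [m IH] using lt_wf_ind. apply Cmod_eq_0. apply Rle_antisym; [|apply Cmod_ge_0].
  apply le_epsilon. intros eps He. rewrite Rplus_0_l.
  set (Bn := (wnorm a r / r ^ (S m))%R).
  assert (W0 := wnorm_ge0 _ _ _ _ W). assert (rp := pow_lt r (S m) r0).
  assert (Bn0 : (0 <= Bn)%R) by (apply Rmult_le_pos; auto; left; now apply Rinv_0_lt_compat).
  set (h := Rmin (h0 / 2) (Rmin (r / Cmod d) (eps / ((Bn + 1) * Cmod d)))).
  assert (hp : (0 < h)%R). { unfold h. repeat apply Rmin_glb_lt. lra. apply Rdiv_lt_0_compat; lra. apply Rdiv_lt_0_compat; auto. nra. }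
  assert (h1 : (h <= h0 / 2)%R) by apply Rmin_l.
  assert (h2 : (h <= r / Cmod d)%R) by (eapply Rle_trans; [apply Rmin_r | apply Rmin_l]).
  assert (h3 : (h <= eps / ((Bn + 1) * Cmod d))%R) by (eapply Rle_trans; [apply Rmin_r | apply Rmin_r]).
  set (w := RtoC h * d).
  assert (mw : Cmod w = (h * Cmod d)%R) by (unfold w; rewrite Cmod_mult, Cmod_RtoC_pos; lra).
  assert (wr : (0 < Cmod w <= r)%R). { rewrite mw. split. nra. apply (Rmult_le_compat_r (Cmod d)) in h2; [|lra]. replace (r / Cmod d * Cmod d)%R with r in h2 by (field; lra). exact h2. }
  assert (we : (Cmod w * (Bn + 1) <= eps)%R). { rewrite mw. apply (Rmult_le_compat_r ((Bn + 1) * Cmod d)) in h3; [|nra]. replace (eps / ((Bn + 1) * Cmod d) * ((Bn + 1) * Cmod d))%R with eps in h3 by (field; split; lra). lra. }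
  assert (F0 : f (z0 + w) = 0) by (apply Hf; lra).
  rewrite H2 in F0. 2: replace (z0 + w - z0) with w by ring; apply wr.
  replace (z0 + w - z0) with w in F0 by ring.
  rewrite (CSeries_split _ (S m) (wien_summ _ _ _ _ _ W (proj2 wr))), Csum_S, Csum_zero in F0.
  2: intros k Hk; rewrite (IH k Hk); ring.
  assert (E : a m * w ^ m = - CSeries (fun k => a (S m + k)%nat * w ^ (S m + k))).
  { replace (a m * w ^ m) with (0 + a m * w ^ m + CSeries (fun k => a (S m + k)%nat * w ^ (S m + k)) - CSeries (fun k => a (S m + k)%nat * w ^ (S m + k))) by ring. rewrite F0. ring. }
  assert (EXT : ex_series (fun k => Cmod (a (S m + k)%nat) * r ^ (S m + k))%R) by (apply (ex_series_incr_n (fun k => Cmod (a k) * r ^ k)%R (S m)); auto).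
  assert (TB : (Cmod (CSeries (fun k => (a (S m + k)%nat * w ^ (S m + k))%C)) <= (Cmod w / r) ^ S m * wnorm a r)%R).
  { apply Rle_trans with (Series (fun k => (Cmod w / r) ^ S m * (Cmod (a (S m + k)%nat) * r ^ (S m + k)))%R).
    - apply CSeries_bound. 2: now apply ex_series_scalR. intros k. rewrite Cmod_mult, Cmod_pow.
      rewrite !pow_add. unfold Rdiv. rewrite Rpow_mult_distr, pow_inv.
      replace (Cmod w ^ S m * / r ^ S m * (Cmod (a (S m + k)%nat) * (r ^ S m * r ^ k)))%R with (Cmod (a (S m + k)%nat) * (Cmod w ^ S m * r ^ k))%R by (field; lra).
      apply Rmult_le_compat_l. apply Cmod_ge_0. apply Rmult_le_compat_l. apply pow_le; lra. apply pow_incr; lra.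
    - rewrite Series_scal_l. apply Rmult_le_compat_l. apply pow_le. apply Rmult_le_pos. lra. left; now apply Rinv_0_lt_compat.
      unfold wnorm. rewrite (Series_incr_n (fun k => Cmod (a k) * r ^ k)%R (S m)); auto; [|lia].
      assert (0 <= sum_f_R0 (fun k => Cmod (a k) * r ^ k) (pred (S m)))%R; [|lra]. apply cond_pos_sum. intros; apply wnorm_term_ge0; lra. }
  assert (Q : (Cmod (a m) * Cmod w ^ m <= (Cmod w / r) ^ S m * wnorm a r)%R) by (rewrite <- Cmod_pow, <- Cmod_mult, E, Cmod_opp; exact TB).
  assert (wm := pow_lt (Cmod w) m (proj1 wr)).
  apply (Rmult_le_reg_r (Cmod w ^ m)); auto. eapply Rle_trans; [apply Q|].
  replace ((Cmod w / r) ^ S m * wnorm a r)%R with (Cmod w * Bn * Cmod w ^ m)%R.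
  2: unfold Bn, Rdiv; rewrite Rpow_mult_distr, pow_inv; simpl; field; split; [apply pow_nonzero|]; lra.
  apply Rmult_le_compat_r. lra. nra. }
intros z Hz. rewrite H2 by auto. destruct (summ_finite (fun k => a k * (z - z0) ^ k) 0) as [_ E]. intros k _; rewrite Z; ring. exact E.
Qed.

(** At the supremum [T] of the parameters up to which f vanishes, the zeros just before [T], seen in
    the backward direction z0 - z1, make f vanish on a whole disc by [wien_zero]; hence [T] cannot
    be below 1. *)
Lemma identity_segment (f : C -> C) (z0 z1 : C) (d0 : R) : (0 < d0)%R ->
  (forall t, (0 <= t <= 1)%R -> loc f (z0 + t * (z1 - z0))) ->
  (forall z, (Cmod (z - z0) < d0)%R -> f z = 0) -> f z1 = 0.
Proof.
intros Hd HL H0.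
destruct (classic (z1 - z0 = 0)) as [E|N].
{ apply H0. rewrite E, Cmod_0; auto. }
assert (Np := proj1 (Cmod_gt_0 _) N).
set (gm := fun t : R => z0 + t * (z1 - z0)).
set (S0 := fun t => (0 <= t <= 1)%R /\ forall t', (0 <= t' <= t)%R -> f (gm t') = 0).
assert (S00 : S0 0%R). { split. lra. intros t' Ht'. replace t' with 0%R by lra. unfold gm. apply H0. replace (z0 + 0 * (z1 - z0) - z0) with (RtoC 0) by ring. rewrite Cmod_0; auto. }
destruct (completeness S0) as [T [T1 T2]].
{ exists 1%R. intros t [Ht _]. lra. } { exists 0%R. exact S00. }
assert (T01 : (0 <= T <= 1)%R). { split. now apply T1. apply T2. intros t [Ht _]; lra. }
assert (HT : forall t, (0 <= t < T)%R -> f (gm t) = 0).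
{ intros t Ht. destruct (classic (exists t', S0 t' /\ (t < t')%R)) as [[t' [[_ A] B]]|NE]. apply A; lra.
  exfalso. assert (is_upper_bound S0 t). { intros x Hx. destruct (Rle_lt_dec x t); auto. exfalso; apply NE; eauto. }
  specialize (T2 t H). lra. }
assert (Tpos : (0 < T)%R).
{ set (q := Rmin 1 (d0 / (2 * Cmod (z1 - z0)))). assert (q0 : (0 < q)%R) by (apply Rmin_glb_lt; [lra | apply Rdiv_lt_0_compat; lra]).
  apply Rlt_le_trans with q; auto. apply T1. split. split. lra. apply Rmin_l. intros t' Ht'. apply H0. unfold gm.
  replace (z0 + t' * (z1 - z0) - z0) with (t' * (z1 - z0)) by ring. rewrite Cmod_mult, Cmod_RtoC_pos by lra.
  assert (t' <= d0 / (2 * Cmod (z1 - z0)))%R by (eapply Rle_trans; [apply Ht' | apply Rmin_r]).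
  apply (Rmult_le_compat_r (Cmod (z1 - z0))) in H; [|lra]. replace (d0 / (2 * Cmod (z1 - z0)) * Cmod (z1 - z0))%R with (d0 / 2)%R in H by (field; lra). lra. }
destruct (HL T T01) as [r [B [a [W _]]]]. assert (r0 : (0 < r)%R) by apply W. fold (gm T) in W.
assert (ZZ := wien_zero f (gm T) (z0 - z1) r T a W).
assert (Nz : z0 - z1 <> 0) by (intros E; apply N; replace (z1 - z0) with (- (z0 - z1)) by ring; rewrite E; ring).
assert (ZB : forall z, (Cmod (z - gm T) <= r)%R -> f z = 0).
{ apply ZZ; auto. intros h Hh. replace (gm T + h * (z0 - z1)) with (gm (T - h)%R) by (unfold gm; rewrite RtoC_minus; ring). apply HT; lra. }
assert (T = 1%R).
{ destruct (Rle_lt_or_eq_dec T 1) as [L|]; [lra| |auto]. exfalso.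
  set (q := Rmin 1 (T + r / Cmod (z1 - z0))). assert (S0 q).
  { split. split. apply Rmin_glb; [lra|]. assert (0 < r / Cmod (z1 - z0))%R by (apply Rdiv_lt_0_compat; lra). lra. apply Rmin_l.
    intros t' Ht'. destruct (Rlt_le_dec t' T). apply HT; lra. apply ZB. unfold gm.
    replace (z0 + t' * (z1 - z0) - (z0 + T * (z1 - z0))) with (RtoC (t' - T) * (z1 - z0)) by (rewrite RtoC_minus; ring).
    rewrite Cmod_mult, Cmod_RtoC_pos by lra. assert (t' <= T + r / Cmod (z1 - z0))%R by (eapply Rle_trans; [apply Ht' | apply Rmin_r]).
    assert (t' - T <= r / Cmod (z1 - z0))%R by lra. apply (Rmult_le_compat_r (Cmod (z1 - z0))) in H1; [|lra].
    replace (r / Cmod (z1 - z0) * Cmod (z1 - z0))%R with r in H1 by (field; lra). exact H1. }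
  assert (q <= T)%R by now apply T1. assert (T < q)%R. { apply Rmin_glb_lt; auto. assert (0 < r / Cmod (z1 - z0))%R by (apply Rdiv_lt_0_compat; lra). lra. } lra. }
subst T. replace z1 with (gm 1%R) by (unfold gm; ring). apply ZB. replace (gm 1%R - gm 1%R) with (RtoC 0) by ring. rewrite Cmod_0; lra.
Qed.

Lemma L_unique (g : Z -> C) (L1 L2 : C -> C) (s : C) :
  is_L_continuation g L1 -> is_L_continuation g L2 -> s <> 1 -> L1 s = L2 s.
Proof.
intros [A1 B1] [A2 B2] Hs.
assert (LL : forall z : C, z <> 1 -> loc (fun z => L1 z + - (1) * L2 z) z).
{ intros z Hz. apply (loc_plus L1 (fun z => - (1) * L2 z)). apply analytic_wien, A1, Hz. apply loc_scal. apply analytic_wien, A2, Hz. }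
(* The base point has real part 2 and an imaginary part pushed away from 0 on the side of s, so the
   segment to s can meet the real axis only at s itself and avoids 1. *)
set (sg := if Rle_dec 0 (Im s) then 1%R else (-1)%R).
set (b := (2%R, Im s + sg)%R : C).
assert (E : (fun z => L1 z + - (1) * L2 z) s = 0).
{ apply (identity_segment (fun z => L1 z + - (1) * L2 z) b s 1 Rlt_0_1).
  - intros t Ht. apply LL. intros E. destruct (Req_dec t 1) as [->|Nt].
    apply Hs. rewrite <- E. ring.
    apply (f_equal Im) in E. rewrite Im_plus, Im_mult, Re_RtoC, Im_RtoC, Im_minus in E. unfold b in E. simpl in E.
    unfold sg in E. unfold Im in E. destruct (Rle_dec 0 (snd s)) as [H|H]; unfold Im in *; [nra|].
    apply Rnot_le_lt in H. nra.
  - intros z Hz. assert (Rz : (1 < Re z)%R). { assert (T := re_le_Cmod (z - b)). rewrite Re_minus in T. unfold b in T at 1. simpl (Re (2%R, _)) in T. apply Rabs_le_between in T. lra. }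
    rewrite <- (CSeries_unique _ _ (B1 z Rz)), <- (CSeries_unique _ _ (B2 z Rz)). ring. }
cbv beta in E. replace (L1 s) with (L1 s + - (1) * L2 s + L2 s) by ring. rewrite E. ring.
Qed.

(** [Lfun] is a choice among continuations: the explicit one shows that the choice succeeds, and
    uniqueness identifies the values off s = 1. *)
Lemma Lfun_eq (M : nat) (g : Z -> C) (s : C) : (0 < M)%nat -> periodic M g -> s <> 1 -> Lfun g s = L_ext M g s.
Proof.
intros HM Hg Hs. assert (C0 := L_ext_continuation M g HM Hg). apply (L_unique g); auto.
unfold Lfun. apply epsilon_spec. eexists; apply C0.
Qed.

(** * Bernoulli polynomials and values of the L-function *)

(* [nbern n] is the Bernoulli polynomial B_n divided by n!. *)
Fixpoint nbern (n : nat) : R -> R :=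
  match n with
  | O => fun _ => 1%R
  | S m => fun x => (RInt (nbern m) 0 x - RInt (fun y => RInt (nbern m) 0 y) 0 1)%R
  end.

Lemma nbern_derive_cont (n : nat) : (forall x, continuous (nbern n) x) /\ (forall x, is_derive (nbern (S n)) x (nbern n x)).
Proof.
assert (ST : forall n, (forall x, continuous (nbern n) x) -> forall x, is_derive (nbern (S n)) x (nbern n x)).
{ intros m H x. simpl. evar_last. apply (is_derive_minus (V := R_NormedModule)).
  apply (is_derive_RInt (V := R_CompleteNormedModule) (nbern m) (fun x => RInt (nbern m) 0 x) 0 x).
  exists (mkposreal 1 Rlt_0_1). intros y _. apply (RInt_correct (V := R_CompleteNormedModule)).
  apply (ex_RInt_continuous (V := R_CompleteNormedModule)). intros; apply H. apply H. apply (is_derive_const (V := R_NormedModule)).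
  unfold minus, plus, opp, zero; simpl. ring. }
assert (CT : forall n x, continuous (nbern n) x).
{ induction n0. intros; apply continuous_const. intros x. apply (ex_derive_continuous (V := R_NormedModule)). eexists. now apply ST. }
split; auto.
Qed.
Lemma nbern_cont (n : nat) (x : R) : continuous (nbern n) x. Proof. apply nbern_derive_cont. Qed.
Lemma nbern_derive (n : nat) (x : R) : is_derive (nbern (S n)) x (nbern n x). Proof. apply nbern_derive_cont. Qed.

Lemma deriv_eq_const (f g h : R -> R) : (forall x, is_derive f x (h x)) -> (forall x, is_derive g x (h x)) ->
  forall a x, (f x - f a = g x - g a)%R.
Proof.
intros Hf Hg a x. destruct (MVT_gen (fun x => f x - g x)%R a x (fun _ => 0%R)) as [c [_ E]].
- intros y _. replace 0%R with (minus (h y) (h y)) by (unfold minus, plus, opp; simpl; ring).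
  apply (is_derive_minus (V := R_NormedModule) f g y _ _ (Hf y) (Hg y)).
- intros y _. apply continuity_pt_filterlim. apply (ex_derive_continuous (V := R_NormedModule) (fun x => f x - g x)%R).
  eexists. apply (is_derive_minus (V := R_NormedModule) f g y _ _ (Hf y) (Hg y)).
- lra.
Qed.

Lemma nbern_RInt (n : nat) (a b : R) : is_RInt (nbern n) a b (nbern (S n) b - nbern (S n) a)%R.
Proof. apply (is_RInt_derive (V := R_CompleteNormedModule)); intros; [apply nbern_derive | apply nbern_cont]. Qed.

(** By construction [nbern (S n)] has mean 0 on [0, 1], and this mean is the increment of the next
    polynomial. *)
Lemma nbern_mean (n : nat) : nbern (S (S n)) 1 = nbern (S (S n)) 0.
Proof.
assert (H := is_RInt_unique _ _ _ _ (nbern_RInt (S n) 0 1)).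
assert (Z : RInt (nbern (S n)) 0 1 = 0%R).
{ set (c := RInt (fun y => RInt (nbern n) 0 y) 0 1).
  assert (CC : forall z : R, continuous (fun x => RInt (nbern n) 0 x) z).
  { intros z. apply (ex_derive_continuous (V := R_NormedModule)).
    exists (nbern n z). apply (is_derive_RInt (V := R_CompleteNormedModule) (nbern n) (fun x => RInt (nbern n) 0 x) 0 z).
    exists (mkposreal 1 Rlt_0_1). intros y _. apply (RInt_correct (V := R_CompleteNormedModule)).
    apply (ex_RInt_continuous (V := R_CompleteNormedModule)). intros; apply nbern_cont. apply nbern_cont. }
  assert (Hc : is_RInt (fun y => RInt (nbern n) 0 y) 0 1 c).
  { apply (RInt_correct (V := R_CompleteNormedModule)).
    apply (ex_RInt_continuous (V := R_CompleteNormedModule)). intros; apply CC. }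
  apply is_RInt_unique.
  apply (is_RInt_ext (V := R_NormedModule) (fun x => minus (RInt (nbern n) 0 x) c)). reflexivity.
  evar_last. apply (is_RInt_minus (V := R_NormedModule)). exact Hc. apply (is_RInt_const (V := R_NormedModule)).
  unfold minus, plus, opp, scal; simpl; unfold mult; simpl. ring. }
rewrite Z in H. lra.
Qed.

(** Among the antiderivatives of [nbern n] exactly one has mean 0; this identifies B_1 and B_2
    explicitly. *)
Lemma nbern_antideriv (n : nat) (h : R -> R) (c : R) : (forall x, is_derive h x (nbern n x)) -> is_RInt h 0 1 c ->
  forall x, (nbern (S n) x = h x - c)%R.
Proof.
intros Hh Hc x. assert (E := deriv_eq_const (nbern (S n)) h (nbern n) (nbern_derive n) Hh 0).
assert (M := nbern_mean n). assert (I := nbern_RInt (S n) 0 1). rewrite M, Rminus_diag in I.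
assert (I2 : is_RInt (nbern (S n)) 0 1 (c + (nbern (S n) 0 - h 0))%R).
{ apply (is_RInt_ext (V := R_NormedModule) (fun x => h x + (nbern (S n) 0 - h 0))%R). intros y _. specialize (E y). lra.
  apply (is_RInt_plus (V := R_NormedModule)); auto. evar_last. apply (is_RInt_const (V := R_NormedModule)). unfold scal; simpl; unfold mult; simpl; ring. }
assert (U := is_RInt_unique _ _ _ _ I). rewrite (is_RInt_unique _ _ _ _ I2) in U. specialize (E x). lra.
Qed.

Lemma nbern_1 (x : R) : nbern 1 x = (x - / 2)%R.
Proof.
apply (nbern_antideriv 0 (fun x => x)%R). intros y. apply (is_derive_id (K := R_AbsRing)).
evar_last. apply (is_RInt_derive (V := R_CompleteNormedModule) (fun x => x ^ 2 / 2)%R). intros; auto_derive; auto; field.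
intros; apply continuous_id. unfold minus, plus, opp; simpl; field.
Qed.
Lemma nbern_2 (x : R) : nbern 2 x = (x ^ 2 / 2 - x / 2 + / 12)%R.
Proof.
replace (x ^ 2 / 2 - x / 2 + / 12)%R with ((x ^ 2 / 2 - x / 2) - - / 12)%R by ring.
apply (nbern_antideriv 1 (fun x => x ^ 2 / 2 - x / 2)%R). intros y. rewrite nbern_1. auto_derive; auto. field.
evar_last. apply (is_RInt_derive (V := R_CompleteNormedModule) (fun x => x ^ 3 / 6 - x ^ 2 / 4)%R). intros; auto_derive; auto; field.
intros. apply (ex_derive_continuous (V := R_NormedModule)). auto_derive; auto. unfold minus, plus, opp; simpl; field.
Qed.

(** By induction both sides have the same derivative, and the constant is fixed at x = 0 by
    [nbern_mean]. *)
Lemma nbern_diff (n : nat) (x : R) : (nbern (S n) (x + 1) - nbern (S n) x = x ^ n / INR (fact n))%R.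
Proof.
revert x. induction n; intros x. rewrite !nbern_1. simpl. field.
assert (E := deriv_eq_const (fun x => nbern (S (S n)) (x + 1) - nbern (S (S n)) x)%R (fun x => x ^ S n / INR (fact (S n)))%R (fun x => x ^ n / INR (fact n))%R).
assert (N := Rgt_not_eq _ _ (INR_fact_pos n)). assert (N2 := pos_INR n).
specialize (E ltac:(intros y; cbv beta; rewrite <- IHn; evar_last; [apply (is_derive_minus (V := R_NormedModule)); [apply (is_derive_comp (nbern (S (S n))) (fun x => x + 1)%R); [apply nbern_derive | auto_derive; auto] | apply nbern_derive] | unfold minus, plus, opp, scal; simpl; unfold mult; simpl; ring])).
assert (E2 := E ltac:(intros y; cbv beta; rewrite INR_fact_S; auto_derive; auto; simpl pred; change (match n with 0%nat => 1%R | S _ => (INR n + 1)%R end) with (INR (S n)); rewrite S_INR; field; split; lra) 0%R x).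
cbv beta in E2. rewrite Rplus_0_l, nbern_mean, Rminus_diag, Rminus_0_r in E2. rewrite E2. simpl. unfold Rdiv; ring.
Qed.

Lemma nbern_taylor (n : nat) (x h : R) : nbern n (x + h) = Rsum (fun i => nbern (n - i) x * (h ^ i / INR (fact i)))%R (S n).
Proof.
revert h. induction n; intros h. simpl. field.
assert (E := deriv_eq_const (fun h => nbern (S n) (x + h)) (fun h => Rsum (fun i => nbern (S n - i) x * (h ^ i / INR (fact i)))%R (S (S n))) (fun h => nbern n (x + h))).
assert (D1 : forall y, is_derive (fun h => nbern (S n) (x + h)) y (nbern n (x + y))).
{ intros y. evar_last. apply (is_derive_comp (nbern (S n)) (fun h => x + h)%R). apply nbern_derive. auto_derive; auto. unfold scal; simpl; unfold mult; simpl; ring. }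
assert (D2 : forall K y, is_derive (fun h => Rsum (fun i => nbern (S n - i) x * (h ^ i / INR (fact i)))%R (S K)) y (Rsum (fun i => nbern (n - i) x * (y ^ i / INR (fact i)))%R K)).
{ induction K; intros y. simpl. auto_derive; auto. ring.
  apply is_derive_ext with (fun h => Rsum (fun i => nbern (S n - i) x * (h ^ i / INR (fact i)))%R (S K) + nbern (S n - S K) x * (h ^ S K / INR (fact (S K))))%R.
  reflexivity. apply (is_derive_plus (V := R_NormedModule)). apply IHK.
  assert (N := INR_fact_pos K). assert (N2 := pos_INR K). rewrite INR_fact_S. auto_derive; auto. simpl pred.
  change (match K with 0%nat => 1%R | S _ => (INR K + 1)%R end) with (INR (S K)). rewrite S_INR. simpl (S n - S K)%nat. field. split; lra. }
specialize (E D1 ltac:(intros y; cbv beta; rewrite IHn; apply D2) 0%R h). cbv beta in E. rewrite Rplus_0_r in E.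
rewrite (Rsum_shift (fun i => nbern (S n - i) x * (0 ^ i / INR (fact i)))%R) in E.
rewrite (Rsum_ext (fun k => nbern (S n - S k) x * (0 ^ S k / INR (fact (S k))))%R (fun k => 0 * 0)%R) in E. 2: intros; simpl; unfold Rdiv; ring.
rewrite Rsum_scal in E. change (0 ^ 0)%R with 1%R in E. change (INR (fact 0)) with 1%R in E. replace (S n - 0)%nat with (S n) in E by lia.
replace (nbern (S n) x * (1 / 1) + 0 * Rsum (fun _ => 0) (S n))%R with (nbern (S n) x) in E by field. lra.
Qed.

(** [nbern_diff] with its first term expanded by Taylor's formula at step 1. In this form it is the
    recursion that [Ent_rec] becomes at s = 1 - n. *)
Lemma nbern_rec (n : nat) (x : R) : Rsum (fun i => nbern (n - i) x / INR (fact (S i)))%R (S n) = (x ^ n / INR (fact n))%R.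
Proof.
rewrite <- nbern_diff, nbern_taylor, (Rsum_shift (fun i => nbern (S n - i) x * (1 ^ i / INR (fact i)))%R). cbv beta. replace (S n - 0)%nat with (S n) by lia. simpl (1 ^ 0)%R. simpl (INR (fact 0)).
rewrite (Rsum_ext (fun k => nbern (S n - S k) x * (1 ^ S k / INR (fact (S k))))%R (fun i => nbern (n - i) x / INR (fact (S i)))%R).
field. intros k _. rewrite pow1. simpl (S n - S k)%nat. unfold Rdiv; ring.
Qed.

Lemma bc_neg_nat (n k : nat) : (k <= n)%nat -> bc (- INR n) k * RtoC (INR (fact k) * INR (fact (n - k))) = RtoC (INR (fact n)).
Proof.
induction k; intros Hk. simpl bc. rewrite Nat.sub_0_r. simpl (INR (fact 0)). rewrite Rmult_1_l. ring.
rewrite <- IHk by lia. replace (n - k)%nat with (S (n - S k)) by lia. rewrite !INR_fact_S.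
simpl bc. assert (E : RtoC (INR n) = RtoC (INR (n - S k)) + 1 + RtoC (INR k)).
{ rewrite <- !RtoC_plus. f_equal. rewrite minus_INR, S_INR by lia. ring. }
rewrite E, !RtoC_mult, !RtoC_plus. field. apply RtoC_S_neq0.
Qed.
Lemma bc_neg_nat0 (n k : nat) : (n < k)%nat -> bc (- INR n) k = 0.
Proof.
intros H. replace k with (S n + (k - S n))%nat by lia. generalize (k - S n)%nat. intros j. induction j.
rewrite Nat.add_0_r. simpl. replace (- - INR n - INR n) with (RtoC 0) by ring. unfold Cdiv; ring.
rewrite Nat.add_succ_r. simpl in *. rewrite IHj. unfold Cdiv; ring.
Qed.

Lemma RtoC_Rsum (a : nat -> R) (n : nat) : RtoC (Rsum a n) = Csum (fun k => RtoC (a k)) n.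
Proof. induction n. reflexivity. rewrite Csum_S, <- IHn. simpl. apply RtoC_plus. Qed.

(** At s = 1 - n the binomial coefficients vanish from j = n on, so [Ent_rec] is a finite recursion
    over smaller n; it coincides with [nbern_rec] at the first point divided by Mr. *)
Lemma Ent_value (Mr A : R) (n : nat) : (1 <= Mr)%R -> (0 < A)%R ->
  Mr * Ent Mr A (1 - INR n) = RtoC (Mr ^ n * INR (fact n) * nbern n (xs Mr A 0 / Mr)).
Proof.
intros HM HA. induction n as [n IH] using lt_wf_ind.
assert (MN : RtoC Mr <> 0) by (apply RtoC_neq0; lra).
destruct (xs_pos Mr A 0 HM HA) as [X1 _]. set (X0 := xs Mr A 0) in *.
rewrite Ent_rec by auto. unfold Eop. fold X0.
replace (1 - INR n - 1) with (- INR n) by ring. rewrite pw_opp_nat by lra.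
match goal with |- context [CSeries ?f] => destruct (summ_finite f n) as [_ E] end.
{ intros k Hk. rewrite bc_neg_nat0 by lia. unfold Cdiv; ring. }
rewrite E. clear E.
rewrite (Csum_ext _ (fun j => RtoC (Mr ^ n * INR (fact n)) * RtoC (nbern (n - S j) (X0 / Mr) / INR (fact (S (S j)))))).
- rewrite Csum_scal, <- RtoC_Rsum.
  assert (BR := nbern_rec n (X0 / Mr)). rewrite Rsum_shift in BR. cbv beta in BR. replace (n - 0)%nat with n in BR by lia. simpl (INR (fact 1)) in BR.
  assert (E : Rsum (fun k => nbern (n - S k) (X0 / Mr) / INR (fact (S (S k))))%R n = ((X0 / Mr) ^ n / INR (fact n) - nbern n (X0 / Mr))%R) by lra.
  rewrite E. replace (RtoC Mr * (/ Mr * (RtoC (X0 ^ n) - RtoC (Mr ^ n * INR (fact n)) * RtoC ((X0 / Mr) ^ n / INR (fact n) - nbern n (X0 / Mr))%R)))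
   with (RtoC (X0 ^ n) - RtoC (Mr ^ n * INR (fact n)) * RtoC ((X0 / Mr) ^ n / INR (fact n) - nbern n (X0 / Mr))%R) by (field; auto).
  rewrite <- RtoC_mult, <- RtoC_minus. f_equal. unfold Rdiv. rewrite Rpow_mult_distr, pow_inv. field. split. apply Rgt_not_eq, INR_fact_pos. apply pow_nonzero; lra.
- intros j Hj. replace (1 - INR n + (INR j + 1)) with (1 - RtoC (INR (n - S j))).
  2:{ rewrite minus_INR, S_INR, RtoC_minus, RtoC_plus by lia. ring. }
  assert (I := IH (n - S j)%nat ltac:(lia)). fold X0 in I.
  assert (BN := bc_neg_nat n (S j) ltac:(lia)).
  set (B := bc (- INR n) (S j)) in *. set (Ev := Ent Mr A (1 - INR (n - S j))) in *.
  assert (F1 := INR_fact_pos (S j)). assert (F2 := INR_fact_pos (n - S j)). assert (P := pos_INR j).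
  rewrite RtoC_mult, <- BN. transitivity (B * RtoC (Mr ^ (j + 1)) / (INR j + 2) * (Mr * Ev)).
  replace (j + 2)%nat with (S (j + 1)) by lia. simpl pow. rewrite RtoC_mult. unfold Cdiv. ring.
  rewrite I. replace (RtoC (INR j) + 2) with (RtoC (INR j + 2)) by (rewrite RtoC_plus; ring).
  replace (Mr ^ n)%R with (Mr ^ (j + 1) * Mr ^ (n - S j))%R by (rewrite <- pow_add; f_equal; lia).
  rewrite (INR_fact_S (S j)), S_INR. replace (INR j + 1 + 1)%R with (INR j + 2)%R by ring.
  rewrite RtoC_div, !RtoC_mult by nra. field. split; apply RtoC_neq0; lra.
Qed.

(** Hurwitz's formula zeta(-m, x) = -B_(m+1)(x) / (m + 1). [Ent_value] supplies the polynomial at x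
    + 1, and the restored term x^m moves it to x by [nbern_diff]. *)
Lemma L_ext_value (M m : nat) (g : Z -> C) : (0 < M)%nat ->
  L_ext M g (- INR m) = - RtoC (INR M ^ m * INR (fact m)) * Csum (fun a => g (Z.of_nat (S a)) * RtoC (nbern (S m) (INR (S a) / INR M))) M.
Proof.
intros HM. unfold L_ext. rewrite <- Csum_scal. apply Csum_ext. intros a _.
assert (M1 := INR_ge1 M HM). assert (Pm := pos_INR m).
assert (V := Ent_value (INR M) (INR (S a)) (S m) M1 (INR_S_gt0 a)).
replace (1 - INR (S m)) with (- INR m) in V by (rewrite S_INR, RtoC_plus; ring).
rewrite pw_opp_nat by apply INR_S_gt0.
assert (MN : RtoC (INR M) <> 0) by (apply RtoC_neq0; lra).
set (Ev := Ent (INR M) (INR (S a)) (- INR m)) in *.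
replace Ev with (RtoC (INR M) * Ev / RtoC (INR M)) by (field; auto). rewrite V.
replace (xs (INR M) (INR (S a)) 0 / INR M)%R with (INR (S a) / INR M + 1)%R by (unfold xs; simpl (INR 0); field; lra).
assert (D := nbern_diff m (INR (S a) / INR M)). set (x := (INR (S a) / INR M)%R) in *.
replace (nbern (S m) (x + 1)) with (nbern (S m) x + x ^ m / INR (fact m))%R by lra.
assert (FP := INR_fact_pos m).
replace (INR (S a) ^ m)%R with (INR M ^ m * x ^ m)%R. 2: unfold x; rewrite <- Rpow_mult_distr; f_equal; field; lra.
replace (- INR m - 1) with (- RtoC (INR m + 1)) by (rewrite RtoC_plus; ring).
rewrite INR_fact_S. simpl (INR M ^ S m)%R. rewrite !RtoC_mult, !RtoC_plus, RtoC_div by lra. field.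
repeat split; auto; first [apply RtoC_S_neq0 | apply RtoC_neq0; lra].
Qed.

Definition sqw (k : nat) : R := (/ (INR k + 1) ^ 2)%R.
Lemma sqw_series : ex_series sqw.
Proof.
apply (ex_series_bounded sqw 2). intros n. unfold sqw. assert (P := pos_INR n). left. apply Rinv_0_lt_compat. nra.
assert (H : forall n, (sum_n sqw n <= 2 - / (INR n + 1))%R).
{ induction n. rewrite sum_O. unfold sqw; simpl. lra.
  rewrite sum_Sn. eapply Rle_trans. apply Rplus_le_compat_r, IHn.
  unfold sqw. rewrite S_INR. assert (P := pos_INR n). set (x := INR n) in *.
  assert (/ (x + 1 + 1) ^ 2 <= / (x + 1) - / (x + 1 + 1))%R; [|lra].
  replace (/ (x + 1) - / (x + 1 + 1))%R with (/ ((x + 1) * (x + 1 + 1)))%R by (field; lra).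
  apply Rinv_le_contravar; nra. }
intros n. specialize (H n). assert (0 < / (INR n + 1))%R by (apply Rinv_0_lt_compat; assert (P := pos_INR n); lra). lra.
Qed.

(** * Fourier series of the Bernoulli polynomials *)

Lemma dirichlet_kernel (N : nat) (x : R) :
  (sin (PI * x) * (1 + Rsum (fun k => 2 * cos (2 * PI * (INR k + 1) * x)) N) = sin ((2 * INR N + 1) * (PI * x)))%R.
Proof.
induction N. simpl. replace ((2 * 0 + 1) * (PI * x))%R with (PI * x)%R by ring. ring.
simpl Rsum. rewrite <- Rplus_assoc, Rmult_plus_distr_l, IHN, S_INR.
replace ((2 * (INR N + 1) + 1) * (PI * x))%R with (2 * PI * (INR N + 1) * x + PI * x)%R by ring.
replace ((2 * INR N + 1) * (PI * x))%R with (2 * PI * (INR N + 1) * x - PI * x)%R by ring.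
rewrite sin_plus, sin_minus. ring.
Qed.

(** The error of the partial Fourier series of x - 1/2. It vanishes at 1/2, and its derivative is
    the Dirichlet kernel. *)
Definition saw (N : nat) (x : R) : R := (x - / 2 + Rsum (fun k => sin (2 * PI * (INR k + 1) * x) / (PI * (INR k + 1))) N)%R.
Lemma saw_derive (N : nat) (x : R) : is_derive (saw N) x (1 + Rsum (fun k => 2 * cos (2 * PI * (INR k + 1) * x)) N)%R.
Proof.
unfold saw. assert (PP := PI_RGT_0). induction N. simpl. auto_derive; auto. ring.
apply (is_derive_ext (fun x => (x - / 2 + Rsum (fun k => sin (2 * PI * (INR k + 1) * x) / (PI * (INR k + 1))) N) + sin (2 * PI * (INR N + 1) * x) / (PI * (INR N + 1)))%R).
intros; simpl; ring. simpl Rsum. rewrite <- Rplus_assoc.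
apply (is_derive_plus (V := R_NormedModule)). apply IHN. assert (P := pos_INR N). auto_derive; auto. field. lra.
Qed.

Lemma saw_half (N : nat) : saw N (/ 2) = 0%R.
Proof.
unfold saw. rewrite (Rsum_ext _ (fun k => 0 * 0)%R). rewrite Rsum_scal. ring.
intros k _. replace (2 * PI * (INR k + 1) * / 2)%R with (IZR (Z.of_nat (S k)) * PI)%R.
rewrite sin_eq_0_1. unfold Rdiv; ring. now exists (Z.of_nat (S k)). rewrite <- INR_IZR_INZ, S_INR. field.
Qed.

Lemma sin_PI_lower (x y : R) : (Rabs (x - / 2) < / 2)%R -> (Rabs (y - / 2) <= Rabs (x - / 2))%R ->
  (0 < cos (PI * Rabs (x - / 2)) <= sin (PI * y))%R.
Proof.
intros Hx Hy. assert (PP := PI_RGT_0). assert (A := Rabs_pos (y - / 2)). split.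
apply cos_gt_0; nra.
replace (sin (PI * y)) with (cos (PI * Rabs (y - / 2))). apply cos_decr_1; nra.
unfold Rabs; destruct (Rcase_abs (y - / 2)).
- replace (PI * - (y - / 2))%R with (PI / 2 - PI * y)%R by field. apply cos_shift.
- replace (PI * (y - / 2))%R with (- (PI / 2 - PI * y))%R by field. rewrite cos_neg. apply cos_shift.
Qed.

(** The derivative sin (q PI y) / sin (PI y) oscillates. One integration by parts, done by adding
    cos (q PI y) / (PI q sin (PI y)), leaves a derivative of size O(1/q) between y and 1/2, where
    sin (PI y) is bounded below. The constant depends on x only, so the estimate is uniform in y. *)
Lemma saw_bound (x : R) : (Rabs (x - / 2) < / 2)%R -> exists c, forall N y, (Rabs (y - / 2) <= Rabs (x - / 2))%R ->
  (Rabs (saw N y) <= c / (INR N + 1))%R.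
Proof.
intros Hx. assert (PP := PI_RGT_0). set (s := cos (PI * Rabs (x - / 2))).
assert (S0 : (0 < s)%R) by (apply (sin_PI_lower x x Hx); lra).
exists (/ s ^ 2 + / s)%R. intros N y Hy. assert (PN := pos_INR N). set (q := (2 * INR N + 1)%R). assert (Q1 : (1 <= q)%R) by (unfold q; lra).
set (Q := fun y => (saw N y + cos (q * (PI * y)) / (PI * q * sin (PI * y)))%R).
assert (QH : Q (/ 2)%R = 0%R).
{ unfold Q. rewrite saw_half. replace (cos (q * (PI * / 2)))%R with 0%R. unfold Rdiv; ring. symmetry. apply cos_eq_0_1.
  exists (Z.of_nat N). unfold q. rewrite <- INR_IZR_INZ. field. }
assert (B : (Rabs (Q y - Q (/ 2)) <= / q * / s ^ 2 * Rabs (y - / 2))%R).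
{ apply (bounded_variation Q (fun t => 0 - cos (q * (PI * t)) * cos (PI * t) / (q * sin (PI * t) ^ 2))%R). intros t Ht.
  assert (ST := sin_PI_lower x t Hx ltac:(lra)). fold s in ST.
  split.
  - assert (E := dirichlet_kernel N t). fold q in E.
    set (D := (1 + Rsum (fun k => 2 * cos (2 * PI * (INR k + 1) * t)) N)%R) in *.
    replace (0 - cos (q * (PI * t)) * cos (PI * t) / (q * sin (PI * t) ^ 2))%R with
      (D + (- sin (q * (PI * t)) / sin (PI * t) - cos (q * (PI * t)) * cos (PI * t) / (q * sin (PI * t) ^ 2)))%R.
    2:{ rewrite <- E. field. lra. }
    apply (is_derive_plus (V := R_NormedModule)). apply saw_derive. auto_derive. intros E0. apply Rmult_integral in E0. destruct E0 as [E0|E0]; [apply Rmult_integral in E0|]; lra. field. split; lra.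
  - replace (0 - cos (q * (PI * t)) * cos (PI * t) / (q * sin (PI * t) ^ 2))%R with
      (/ q * (- (cos (q * (PI * t)) * cos (PI * t)) * / sin (PI * t) ^ 2))%R by (field; lra).
    assert (IQ : (0 < / q)%R) by (apply Rinv_0_lt_compat; lra).
    rewrite Rabs_mult, (Rabs_pos_eq (/ q)) by lra. apply Rmult_le_compat_l; [lra|].
    assert (SP : (0 < sin (PI * t) ^ 2)%R) by nra.
    rewrite Rabs_mult, (Rabs_pos_eq (/ _)). 2: left; apply Rinv_0_lt_compat; lra.
    rewrite Rabs_Ropp, Rabs_mult. rewrite <- (Rmult_1_l (/ s ^ 2)). apply Rmult_le_compat.
    apply Rmult_le_pos; apply Rabs_pos. left; apply Rinv_0_lt_compat; lra.
    rewrite <- (Rmult_1_l 1). apply Rmult_le_compat; try apply Rabs_pos; apply Rabs_le, COS_bound.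
    apply Rinv_le_contravar; nra. }
rewrite QH, Rminus_0_r in B. unfold Q in B.
assert (ST := sin_PI_lower x y Hx Hy). fold s in ST.
assert (B2 : (Rabs (cos (q * (PI * y)) / (PI * q * sin (PI * y))) <= / q * / s)%R).
{ replace (cos (q * (PI * y)) / (PI * q * sin (PI * y)))%R with (/ q * (cos (q * (PI * y)) * (/ PI * / sin (PI * y))))%R by (field; lra).
  assert (IQ : (0 < / q)%R) by (apply Rinv_0_lt_compat; lra).
  rewrite Rabs_mult, (Rabs_pos_eq (/ q)) by lra. apply Rmult_le_compat_l; [lra|].
  assert (I1 : (0 < / PI)%R) by (apply Rinv_0_lt_compat; lra). assert (I2 : (0 < / sin (PI * y))%R) by (apply Rinv_0_lt_compat; lra).
  rewrite Rabs_mult, (Rabs_pos_eq (/ PI * _)) by nra. rewrite <- (Rmult_1_l (/ s)). apply Rmult_le_compat. apply Rabs_pos. nra.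
  apply Rabs_le, COS_bound. rewrite <- (Rmult_1_l (/ s)). apply Rmult_le_compat; try lra.
  rewrite <- Rinv_1. apply Rinv_le_contravar; [lra|]. assert (T := PI2_1). lra. apply Rinv_le_contravar; lra. }
assert (IS2 : (0 < / s ^ 2)%R) by (apply Rinv_0_lt_compat; nra). assert (IS : (0 < / s)%R) by (apply Rinv_0_lt_compat; nra).
assert (IQ : (0 < / q)%R) by (apply Rinv_0_lt_compat; lra).
assert (T := Rabs_triang (saw N y + cos (q * (PI * y)) / (PI * q * sin (PI * y))) (- (cos (q * (PI * y)) / (PI * q * sin (PI * y))))).
rewrite Rabs_Ropp in T. replace (saw N y + cos (q * (PI * y)) / (PI * q * sin (PI * y)) + - (cos (q * (PI * y)) / (PI * q * sin (PI * y))))%R with (saw N y) in T by ring.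
assert (/ q <= / (INR N + 1))%R by (apply Rinv_le_contravar; unfold q; lra).
assert (/ q * / s ^ 2 * Rabs (y - / 2) <= / q * / s ^ 2)%R by (rewrite <- (Rmult_1_r (/ q * / s ^ 2)) at 2; apply Rmult_le_compat_l; nra).
unfold Rdiv. assert (/ q * (/ s ^ 2 + / s) <= (/ s ^ 2 + / s) * / (INR N + 1))%R by (rewrite Rmult_comm; apply Rmult_le_compat_l; lra).
nra.
Qed.

(* By [nbern_fourier] below, [Pf n] is the Fourier series of [- nbern n] on the unit interval. *)
Definition om (k : nat) : C := 2 * PI * Ci * (INR k + 1).
Definition pf (n k : nat) (x : R) : C := / om k ^ n * cexp (om k * x) + / (- om k) ^ n * cexp (- om k * x).
Definition Pf (n : nat) (x : R) : C := CSeries (fun k => pf n k x).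

Lemma om_neq0 (k : nat) : om k <> 0.
Proof.
unfold om. assert (PP := PI_RGT_0).
repeat apply Cmult_neq_0; first [apply RtoC_S_neq0 | apply Ci_neq0 | apply RtoC_neq0; lra].
Qed.
Lemma om_im (k : nat) : om k = Ci * RtoC (2 * PI * (INR k + 1)).
Proof. unfold om. rewrite !RtoC_mult, RtoC_plus. ring. Qed.
Lemma Cmod_om (k : nat) : (INR k + 1 <= Cmod (om k))%R.
Proof.
rewrite om_im, Cmod_mult. assert (PP := PI2_1). assert (P := pos_INR k).
replace (Cmod Ci) with 1%R. rewrite Rmult_1_l, Cmod_RtoC_pos; nra.
unfold Cmod; simpl. rewrite <- sqrt_1 at 1. f_equal; ring.
Qed.
Lemma Cmod_cexp_om (k : nat) (x : R) : Cmod (cexp (om k * x)) = 1%R /\ Cmod (cexp (- om k * x)) = 1%R.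
Proof.
rewrite !Cmod_cexp, om_im. split; rewrite <- exp_0; f_equal; reim; rewrite ?Re_Ci, ?Im_Ci, ?Re_RtoC, ?Im_RtoC; ring.
Qed.
Lemma Cmod_inv_om_pow (n k : nat) (u : C) : (2 <= n)%nat -> Cmod u = Cmod (om k) -> (Cmod (/ u ^ n) <= sqw k)%R.
Proof.
intros Hn Hu. unfold sqw. assert (P := pos_INR k). assert (O := Cmod_om k). rewrite <- Hu in O.
apply Cmod_inv_le. nra. rewrite Cmod_pow. replace n with (2 + (n - 2))%nat by lia. rewrite pow_add.
assert (1 <= Cmod u ^ (n - 2))%R by (apply pow_R1_Rle; lra).
assert ((INR k + 1) ^ 2 <= Cmod u ^ 2)%R by (apply pow_incr; lra). nra.
Qed.
Lemma pf_bound (n k : nat) (x : R) : (2 <= n)%nat -> (Cmod (pf n k x) <= 2 * sqw k)%R.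
Proof.
intros Hn. unfold pf. eapply Rle_trans; [apply Cmod_triangle|]. rewrite !Cmod_mult. destruct (Cmod_cexp_om k x) as [-> ->].
assert (A := Cmod_inv_om_pow n k (om k) Hn eq_refl). assert (B := Cmod_inv_om_pow n k (- om k) Hn ltac:(now rewrite Cmod_opp)). lra.
Qed.
Lemma pf_summ (n : nat) (x : R) : (2 <= n)%nat -> summ (fun k => pf n k x).
Proof. intros Hn. apply summ_le with (fun k => 2 * sqw k)%R. intros; now apply pf_bound. apply ex_series_scalR, sqw_series. Qed.
Lemma cder_exp_lin (c : C) (t : R) : cder (fun x => cexp (c * RtoC x)) t (c * cexp (c * t)).
Proof. apply (cder_cexp (fun x => c * RtoC x)). eapply cder_eq. apply cder_scal, cder_id. ring. Qed.
Lemma pf_cder (n k : nat) (x : R) : cder (pf (S n) k) x (pf n k x).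
Proof.
unfold pf. eapply cder_eq. apply cder_plus; apply cder_scal, cder_exp_lin. assert (H := om_neq0 k). cbv beta. simpl (_ ^ S n).
field. repeat split; auto; try apply Cpow_nz; auto. intros E; apply H; replace (om k) with (- - om k) by ring; rewrite E; ring.
Qed.
Lemma cexp_om_1 (k : nat) : cexp (om k * 1) = 1 /\ cexp (- om k * 1) = 1.
Proof.
assert (E : cexp (om k * 1) = 1).
{ transitivity (cexp (2 * PI * Ci * IZR (Z.of_nat (S k)))); [|apply cexp_2PI]. f_equal. unfold om. rewrite <- INR_IZR_INZ, S_INR, RtoC_plus. ring. }
split; auto. replace (- om k * 1) with (- (om k * 1)) by ring. rewrite cexp_opp, E. field.
Qed.
Lemma pf_periodic (n k : nat) (x : R) : pf n k (x + 1) = pf n k x.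
Proof.
unfold pf. rewrite RtoC_plus. replace (om k * (x + 1)) with (om k * x + om k * 1) by ring.
replace (- om k * (x + 1)) with (- om k * x + - om k * 1) by ring. rewrite !cexp_add. destruct (cexp_om_1 k) as [-> ->]. ring.
Qed.
Lemma Pf_periodic (n : nat) (x : R) : Pf n (x + 1) = Pf n x.
Proof. apply CSeries_ext; intros; apply pf_periodic. Qed.
Lemma Pf_tail (n N : nat) (x : R) : (2 <= n)%nat ->
  (Cmod (Pf n x - Csum (fun k => pf n k x) N) <= Series (fun k => 2 * sqw (N + k)))%R.
Proof.
intros Hn. unfold Pf. rewrite (CSeries_split _ N) by now apply pf_summ.
match goal with |- (Cmod ?z <= _)%R => replace z with (CSeries (fun k => pf n (N + k) x)) by ring end.
apply CSeries_bound. intros; now apply pf_bound. apply ex_series_scalR. apply (ex_series_incr_n sqw N), sqw_series.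
Qed.
Lemma Pf_tail_small (eps : R) : (0 < eps)%R -> exists N0, forall N, (N0 <= N)%nat -> (Series (fun k => 2 * sqw (N + k)) < eps)%R.
Proof.
intros He. assert (L := Series_tail_lim (fun k => 2 * sqw k)%R (ex_series_scalR 2 _ sqw_series)).
apply is_lim_seq_spec in L. destruct (L (mkposreal eps He)) as [N0 H]. exists N0. intros N HN. specialize (H N HN). simpl in H.
rewrite Rminus_0_r in H. apply Rabs_lt_between in H. lra.
Qed.
Lemma ccont_Pf (n : nat) (x : R) : (2 <= n)%nat -> ccont (Pf n) x.
Proof.
intros Hn. apply (ccont_series (fun k x => pf n k x) (fun k => 2 * sqw k)%R x 1). lra.
intros k. destruct n; [lia|]. eapply cder_ccont, pf_cder. apply ex_series_scalR, sqw_series. intros; now apply pf_bound.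
Qed.

Lemma pf_2_cos (k : nat) (x : R) : pf 2 k x = RtoC (- (cos (2 * PI * (INR k + 1) * x) / (2 * PI ^ 2 * (INR k + 1) ^ 2))).
Proof.
unfold pf. assert (E : om k * x = Ci * RtoC (2 * PI * (INR k + 1) * x)) by (rewrite om_im, !RtoC_mult; ring).
replace (- om k * x) with (Ci * RtoC (- (2 * PI * (INR k + 1) * x))) by (rewrite RtoC_opp; transitivity (- (om k * x)); [rewrite E|]; ring).
rewrite E, !cexp_Ci, cos_neg, sin_neg. set (c := cos _). set (s := sin _).
replace (- om k) with (- om k) by reflexivity. rewrite om_im. assert (PP := PI_RGT_0). assert (P := pos_INR k).
set (u := (2 * PI * (INR k + 1))%R). assert (U : (0 < u)%R) by (unfold u; nra).
replace ((- (Ci * u)) ^ 2) with ((Ci * u) ^ 2) by (simpl; ring).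
replace ((Ci * u) ^ 2) with (- RtoC (u ^ 2)) by (transitivity (Ci * Ci * (u * u)); [rewrite Ci2; simpl; rewrite Rmult_1_r, RtoC_mult | simpl]; ring).
replace (/ - RtoC (u ^ 2)) with (RtoC (- / u ^ 2)) by (rewrite RtoC_opp, RtoC_inv by nra; field; apply RtoC_neq0; nra).
rewrite <- Cmult_plus_distr_l. replace ((c, s) + (c, (- s)%R)) with (RtoC (2 * c)) by (apply Ceq; simpl; ring).
rewrite <- RtoC_mult. f_equal. unfold u. field. lra.
Qed.

(** On the open interval the partial sums of the left-hand side have derivative [saw], which tends
    to 0 uniformly between x and 1/2. The endpoints follow by continuity at 0 and by periodicity. *)
Lemma fourier_base : exists K : C, forall x, (0 <= x <= 1)%R -> nbern 2 x + Pf 2 x = K.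
Proof.
exists (nbern 2 (/ 2) + Pf 2 (/ 2)).
assert (IN : forall x, (Rabs (x - / 2) < / 2)%R -> nbern 2 x + Pf 2 x = nbern 2 (/ 2) + Pf 2 (/ 2)).
{ intros x Hx. destruct (saw_bound x Hx) as [c Hc].
  set (sg := fun N x => (nbern 2 x + Rsum (fun k => - (cos (2 * PI * (INR k + 1) * x) / (2 * PI ^ 2 * (INR k + 1) ^ 2))) N)%R).
  assert (SG : forall N y, is_derive (sg N) y (saw N y)).
  { intros N y. unfold sg, saw. apply (is_derive_plus (V := R_NormedModule)). rewrite <- nbern_1. apply nbern_derive.
    assert (PP := PI_RGT_0). clear. induction N. simpl. apply (is_derive_const (V := R_NormedModule)).
    simpl Rsum. apply (is_derive_plus (V := R_NormedModule)). apply IHN. assert (P := pos_INR N). assert (PP := PI_RGT_0). auto_derive; auto. field. lra. }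
  assert (SC : forall N y, RtoC (sg N y) = nbern 2 y + Csum (fun k => pf 2 k y) N).
  { intros N y. unfold sg. rewrite RtoC_plus, RtoC_Rsum. f_equal. apply Csum_ext. intros; now rewrite pf_2_cos. }
  apply Cmod_small_eq. intros eps He.
  destruct (Pf_tail_small (eps / 3) ltac:(lra)) as [N0 HN0].
  destruct (archimed_cor1 (eps / 3 / (Rabs c + 1))) as [N1 [HN1 HN1']]. apply Rdiv_lt_0_compat; [lra|]. assert (X := Rabs_pos c); lra.
  set (N := (N0 + N1)%nat).
  assert (T1 := Pf_tail 2 N x ltac:(lia)). assert (T2 := Pf_tail 2 N (/ 2) ltac:(lia)). specialize (HN0 N ltac:(unfold N; lia)).
  assert (B := bounded_variation (sg N) (saw N) (c / (INR N + 1)) (/ 2) x).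
  specialize (B ltac:(intros t Ht; split; [apply SG | apply Hc; auto])).
  assert (B2 : (Rabs (sg N x - sg N (/ 2)) <= eps / 3)%R).
  { eapply Rle_trans; [apply B|]. assert (NN : (INR N1 <= INR N)%R) by (apply le_INR; unfold N; lia).
    assert (N1p : (0 < INR N1)%R) by (apply lt_0_INR; lia). assert (X := Rabs_pos c). assert (X2 := Rle_abs c).
    assert (/ (INR N + 1) <= eps / 3 / (Rabs c + 1))%R. eapply Rle_trans; [|left; apply HN1]. apply Rinv_le_contravar; lra.
    assert (I0 : (0 < / (INR N + 1))%R) by (apply Rinv_0_lt_compat; lra).
    assert (X3 := Rabs_pos (x - / 2)). unfold Rdiv at 1.
    assert ((Rabs c + 1) * / (INR N + 1) <= eps / 3)%R. { replace (eps / 3)%R with ((Rabs c + 1) * (eps / 3 / (Rabs c + 1)))%R by (field; lra). apply Rmult_le_compat_l; lra. }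
    assert (c * / (INR N + 1) <= (Rabs c + 1) * / (INR N + 1))%R by nra. nra. }
  replace (nbern 2 x + Pf 2 x - (nbern 2 (/ 2) + Pf 2 (/ 2))) with
   ((Pf 2 x - Csum (fun k => pf 2 k x) N) - (Pf 2 (/ 2) - Csum (fun k => pf 2 k (/ 2)%R) N) + RtoC (sg N x - sg N (/ 2))%R)
   by (rewrite RtoC_minus, !SC; ring).
  eapply Rle_trans; [apply Cmod_triangle|]. rewrite Cmod_R.
  assert (T3 := Cmod_triangle_minus (Pf 2 x - Csum (fun k => pf 2 k x) N) (Pf 2 (/ 2) - Csum (fun k => pf 2 k (/ 2)%R) N)). lra. }
assert (E01 : nbern 2 0 + Pf 2 0 = nbern 2 (/ 2) + Pf 2 (/ 2)).
{ assert (CC : ccont (fun x => nbern 2 x + Pf 2 x) 0) by (apply ccont_plus; [apply ccont_RtoC, nbern_cont | apply ccont_Pf; lia]).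
  destruct CC as [C1 C2].
  assert (LIM : forall h : R -> R, continuous h 0%R -> forall K, (forall x, (0 < x < 1)%R -> h x = K) -> h 0%R = K).
  { intros h Hh K HK. destruct (Req_dec (h 0%R) K) as [|NE]; auto. exfalso.
    apply continuity_pt_filterlim in Hh. destruct (Hh (Rabs (h 0%R - K))) as [d [Hd H]]. apply Rabs_pos_lt; lra.
    set (y := Rmin (d / 2) (/ 2)). assert (Y : (0 < y <= d / 2)%R /\ (y <= / 2)%R).
    { unfold y. split; [split|]. apply Rmin_glb_lt; lra. apply Rmin_l. apply Rmin_r. }
    specialize (H y). simpl in H. unfold R_dist in H.
    assert (X : (Rabs (h y - h 0) < Rabs (h 0 - K))%R). apply H. split. split. exact I. lra. rewrite Rminus_0_r, Rabs_pos_eq; lra.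
    rewrite (HK y) in X by lra. rewrite Rabs_minus_sym in X. lra. }
  apply Ceq; [apply (LIM (fun x => Re (nbern 2 x + Pf 2 x)) C1) | apply (LIM (fun x => Im (nbern 2 x + Pf 2 x)) C2)];
  intros x Hx; rewrite IN; auto; apply Rabs_lt_between; lra. }
intros x Hx. destruct (Req_dec x 0) as [->|H0]. auto. destruct (Req_dec x 1) as [->|H1].
rewrite nbern_mean. replace (Pf 2 1) with (Pf 2 0) by (rewrite <- (Pf_periodic 2 0); f_equal; ring). auto.
apply IN. apply Rabs_lt_between; lra.
Qed.

Lemma cder_Csum (f f' : nat -> R -> C) (n : nat) (t : R) : (forall k, cder (f k) t (f' k t)) ->
  cder (fun s => Csum (fun k => f k s) n) t (Csum (fun k => f' k t) n).
Proof.
intros H. induction n. rewrite Csum_0. apply (cder_ext (fun _ => RtoC 0)). intros; now rewrite Csum_0. apply cder_const.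
rewrite Csum_S. apply (cder_ext (fun y => Csum (fun k => f k y) n + f n y)). intros; now rewrite Csum_S. now apply cder_plus.
Qed.

(** Integrating the constant K gives the linear function K x, which takes equal values at 0 and 1
    because the polynomial and the series both do. Hence K = 0, and the sum one degree higher is
    again constant. *)
Lemma fourier_step (n : nat) (K : C) : (2 <= n)%nat -> (forall x, (0 <= x <= 1)%R -> nbern n x + Pf n x = K) ->
  K = 0 /\ exists K', forall x, (0 <= x <= 1)%R -> nbern (S n) x + Pf (S n) x = K'.
Proof.
intros Hn HK.
assert (A : forall x, (0 <= x <= 1)%R -> (nbern (S n) x + Pf (S n) x) - (nbern (S n) 0 + Pf (S n) 0) = K * x).
{ intros x Hx. apply Cmod_small_eq. intros eps He. destruct (Pf_tail_small (eps / 3) ltac:(lra)) as [N HN].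
  specialize (HN N (le_n N)). set (T := Series (fun k => 2 * sqw (N + k))%R) in *.
  assert (B := cder_increment (fun y => nbern (S n) y + Csum (fun k => pf (S n) k y) N + - K * RtoC y)
    (fun y => nbern n y + Csum (fun k => pf n k y) N + - K * 1) (fun y => T * y)%R (fun _ => T) 0 x ltac:(lra)).
  assert (CD : forall N s, cder (fun y => Csum (fun k => pf (S n) k y) N) s (Csum (fun k => pf n k s) N)).
  { intros; apply cder_Csum. intros; apply pf_cder. }
  assert (B' : (Cmod ((nbern (S n) x + Csum (fun k => pf (S n) k x) N + - K * x) - (nbern (S n) 0 + Csum (fun k => pf (S n) k 0%R) N + - K * 0)) <= T * x - T * 0)%R).
  { apply B.
    - intros s Hs. apply cder_plus. apply cder_plus. apply cder_RtoC, nbern_derive. apply CD. apply cder_scal, cder_id.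
    - intros s Hs. auto_derive; auto. ring.
    - intros s Hs. assert (T1 := Pf_tail n N s Hn). fold T in T1. rewrite Cmod_minus_sym in T1.
      replace (nbern n s + Csum (fun k => pf n k s) N + - K * 1) with (Csum (fun k => pf n k s) N - Pf n s); auto.
      rewrite <- (HK s) by lra. ring. }
  assert (T1 := Pf_tail (S n) N x ltac:(lia)). assert (T2 := Pf_tail (S n) N 0 ltac:(lia)). fold T in T1, T2.
  match goal with |- (Cmod ?z <= _)%R => replace z with
    ((Pf (S n) x - Csum (fun k => pf (S n) k x) N) - (Pf (S n) 0 - Csum (fun k => pf (S n) k 0%R) N) +
     ((nbern (S n) x + Csum (fun k => pf (S n) k x) N + - K * x) - (nbern (S n) 0 + Csum (fun k => pf (S n) k 0%R) N + - K * 0))) by ring end.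
  eapply Rle_trans; [apply Cmod_triangle|].
  assert (T3 := Cmod_triangle_minus (Pf (S n) x - Csum (fun k => pf (S n) k x) N) (Pf (S n) 0 - Csum (fun k => pf (S n) k 0%R) N)).
  assert (0 <= T)%R by (eapply Rle_trans; [apply Cmod_ge_0 | apply T1]). nra. }
assert (K0 : K = 0).
{ assert (A1 := A 1%R ltac:(lra)). destruct n; [lia|]. rewrite nbern_mean in A1. replace (Pf (S (S n)) 1) with (Pf (S (S n)) 0) in A1 by (rewrite <- (Pf_periodic _ 0); f_equal; ring).
  replace K with (K * 1) by ring. rewrite <- A1. ring. }
split; auto. exists (nbern (S n) 0 + Pf (S n) 0). intros x Hx. assert (E := A x Hx). rewrite K0 in E.
replace (nbern (S n) x + Pf (S n) x) with ((nbern (S n) x + Pf (S n) x - (nbern (S n) 0 + Pf (S n) 0)) + (nbern (S n) 0 + Pf (S n) 0)) by ring.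
rewrite E. ring.
Qed.

Lemma nbern_fourier (n : nat) (x : R) : (2 <= n)%nat -> (0 <= x <= 1)%R -> RtoC (nbern n x) = - Pf n x.
Proof.
intros Hn Hx. assert (H : forall m, exists K : C, forall x, (0 <= x <= 1)%R -> nbern (2 + m) x + Pf (2 + m) x = K).
{ induction m. apply fourier_base. destruct IHm as [K HK]. rewrite Nat.add_succ_r. apply (fourier_step (2 + m) K); auto; lia. }
destruct (H (n - 2)%nat) as [K HK]. replace (2 + (n - 2))%nat with n in HK by lia.
destruct (fourier_step n K Hn HK) as [K0 _]. assert (E := HK x Hx). rewrite K0 in E.
replace (RtoC (nbern n x)) with (nbern n x + Pf n x - Pf n x) by ring. rewrite E. ring.
Qed.

(** * Euler-Maclaurin summation *)

Lemma cder_is_RInt (F f : R -> C) (a b : R) : (a <= b)%R -> (forall t, (a <= t <= b)%R -> cder F t (f t)) ->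
  (forall t, (a <= t <= b)%R -> ccont f t) ->
  is_RInt (fun t => Re (f t)) a b (Re (F b - F a)) /\ is_RInt (fun t => Im (f t)) a b (Im (F b - F a)).
Proof.
intros Hab HF Hf. rewrite Re_minus, Im_minus.
split; [apply (is_RInt_derive (V := R_CompleteNormedModule) (fun t => Re (F t)) (fun t => Re (f t)))
  | apply (is_RInt_derive (V := R_CompleteNormedModule) (fun t => Im (F t)) (fun t => Im (f t)))]; intros t Ht; rewrite Rmin_left, Rmax_right in Ht by lra; first [exact (proj1 (HF t Ht)) | exact (proj2 (HF t Ht)) | exact (proj1 (Hf t Ht)) | exact (proj2 (Hf t Ht))].
Qed.
Lemma Pf_periodic_nat (n m : nat) (x : R) : Pf n (x + INR m) = Pf n x.
Proof.
induction m. f_equal; simpl; ring. rewrite S_INR. transitivity (Pf n (x + INR m + 1)). f_equal. ring. now rewrite Pf_periodic.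
Qed.
Lemma exp_seq_lim (K d x0 : R) : (0 < d)%R -> is_lim_seq (fun n => K * exp (- (d * (x0 + INR n))))%R 0.
Proof.
intros Hd. replace (Finite 0) with (Rbar_mult (Finite K) (Finite 0)) by (simpl; f_equal; ring).
apply is_lim_seq_scal_l. apply (is_lim_comp_seq (fun T => exp (- (d * T))) (fun n => x0 + INR n)%R p_infty 0).
now apply exp_neg_lim. exists 0%nat. intros; discriminate.
apply (is_lim_seq_plus _ _ x0 p_infty). apply is_lim_seq_const. apply is_lim_seq_INR. reflexivity.
Qed.

Section EulerMaclaurin.
Variables (H H1 H2 : R -> C) (K d x0 : R) (IH IW : C).
Hypotheses (Hd : (0 < d)%R) (HH : forall t, cder H t (H1 t)) (HH1 : forall t, cder H1 t (H2 t)) (CH2 : forall t, ccont H2 t)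
  (BH : forall t, (0 <= t)%R -> (Cmod (H t) <= K * exp (- (d * t)))%R)
  (BH1 : forall t, (0 <= t)%R -> (Cmod (H1 t) <= K * exp (- (d * t)))%R)
  (Hx : (0 < x0 <= 1)%R) (HIH : cInt H IH) (HIW : cInt (fun t => H2 t * Pf 2 (t - x0)%R) IW).
(** Between consecutive points c and c + 1 of x0 + Z this is the derivative of H' B_2 / 2 - H B_1,
    with the polynomials taken at t - c, because [Pf 2] is minus the periodic continuation of B_2 /
    2. *)
Let f (t : R) : C := - (1) * (H2 t * Pf 2 (t - x0)%R) - H t.
(** The integral of [f] from 0 to x0 + n. The numbers 1/2 and 1/12 are B_1(1) and B_2(1) / 2. The
    two last terms come from the endpoint 0, which lies in [x0 - 1, x0], by the symmetry of B_1 and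
    B_2 about 1/2. *)
Let val (n : nat) : C := - Csum (fun m => H (INR m + x0)%R) n - / 2 * H (x0 + INR n)%R + / 12 * H1 (x0 + INR n)%R - nbern 2 x0 * H1 0%R - nbern 1 x0 * H 0%R.

Lemma em_f_cont (t : R) : ccont f t.
Proof.
unfold f. apply ccont_plus. apply ccont_mult. apply ccont_const. apply ccont_mult. apply CH2.
- destruct (ccont_Pf 2 (t - x0) ltac:(lia)) as [A B]. split.
  apply (continuous_comp (fun t => t - x0)%R (fun y => Re (Pf 2 y))); auto.
  apply (ex_derive_continuous (V := R_NormedModule) (fun t => t - x0)%R). auto_derive; auto.
  apply (continuous_comp (fun t => t - x0)%R (fun y => Im (Pf 2 y))); auto.
  apply (ex_derive_continuous (V := R_NormedModule) (fun t => t - x0)%R). auto_derive; auto.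
- apply (ccont_ext (fun t => - (1) * H t)). intros; ring. apply ccont_mult. apply ccont_const. eapply cder_ccont, HH.
Qed.
Lemma em_piece (c a b : R) : (c <= a)%R -> (a <= b)%R -> (b <= c + 1)%R ->
  (forall t, Pf 2 (t - x0) = Pf 2 (t - c)) ->
  let F := fun t : R => H1 t * nbern 2 (t - c) - H t * nbern 1 (t - c) in
  is_RInt (fun t => Re (f t)) a b (Re (F b - F a)) /\ is_RInt (fun t => Im (f t)) a b (Im (F b - F a)).
Proof.
intros Hc Hab Hb HP F. apply cder_is_RInt; auto. 2: intros; apply em_f_cont.
intros t Ht.
assert (DB : forall n, cder (fun t => RtoC (nbern (S n) (t - c))) t (RtoC (nbern n (t - c)))).
{ intros n. apply cder_RtoC. evar_last. apply (is_derive_comp (nbern (S n)) (fun t => t - c)%R). apply nbern_derive. auto_derive; auto.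
  unfold scal; simpl; unfold mult; simpl; ring. }
unfold F. apply (cder_ext (fun t => H1 t * RtoC (nbern 2 (t - c)) + - (1) * (H t * RtoC (nbern 1 (t - c))))). intros; ring.
eapply cder_eq. apply cder_plus. apply cder_mult. apply HH1. apply DB. apply cder_scal. apply cder_mult. apply HH. apply DB.
unfold f. rewrite HP. replace (Pf 2 (t - c)) with (- RtoC (nbern 2 (t - c))). simpl (nbern 0 _). ring.
rewrite nbern_fourier; [ring | lia | lra].
Qed.
Lemma em_val (n : nat) : is_RInt (fun t => Re (f t)) 0 (x0 + INR n)%R (Re (val n)) /\ is_RInt (fun t => Im (f t)) 0 (x0 + INR n)%R (Im (val n)).
Proof.
induction n.
- destruct (em_piece (x0 - 1) 0 x0) as [A B]; try lra.
  { intros t. rewrite <- (Pf_periodic 2 (t - x0)). f_equal. ring. }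
  cbv beta in A, B. simpl (INR 0). rewrite Rplus_0_r.
  replace (val 0) with (H1 x0 * nbern 2 (x0 - (x0 - 1)) - H x0 * nbern 1 (x0 - (x0 - 1)) - (H1 0%R * nbern 2 (0 - (x0 - 1)) - H 0%R * nbern 1 (0 - (x0 - 1)))).
  split; auto. unfold val. simpl (INR 0). rewrite Rplus_0_r, Csum_0, !nbern_1, !nbern_2.
  replace ((x0 - (x0 - 1)) ^ 2 / 2 - (x0 - (x0 - 1)) / 2 + / 12)%R with (/ 12)%R by field.
  replace ((0 - (x0 - 1)) ^ 2 / 2 - (0 - (x0 - 1)) / 2 + / 12)%R with (x0 ^ 2 / 2 - x0 / 2 + / 12)%R by field.
  replace (x0 - (x0 - 1) - / 2)%R with (/ 2)%R by field. replace (0 - (x0 - 1) - / 2)%R with (- (x0 - / 2))%R by field.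
  rewrite RtoC_opp, !RtoC_inv by lra. ring.
- destruct IHn as [A B]. destruct (em_piece (x0 + INR n) (x0 + INR n) (x0 + INR (S n))) as [A2 B2]; try (rewrite ?S_INR; lra).
  { intros t. rewrite <- (Pf_periodic_nat 2 n (t - (x0 + INR n))). f_equal. ring. }
  cbv beta in A2, B2.
  assert (E : val (S n) = val n + (H1 (x0 + INR (S n))%R * nbern 2 (x0 + INR (S n) - (x0 + INR n)) - H (x0 + INR (S n))%R * nbern 1 (x0 + INR (S n) - (x0 + INR n)) -
    (H1 (x0 + INR n)%R * nbern 2 (x0 + INR n - (x0 + INR n)) - H (x0 + INR n)%R * nbern 1 (x0 + INR n - (x0 + INR n))))).
  { unfold val. rewrite Csum_S, !nbern_1, !nbern_2, S_INR.
    replace (x0 + (INR n + 1) - (x0 + INR n))%R with 1%R by ring. replace (x0 + INR n - (x0 + INR n))%R with 0%R by ring.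
    replace (1 ^ 2 / 2 - 1 / 2 + / 12)%R with (/ 12)%R by field. replace (0 ^ 2 / 2 - 0 / 2 + / 12)%R with (/ 12)%R by field.
    replace (1 - / 2)%R with (/ 2)%R by field. replace (0 - / 2)%R with (- / 2)%R by field. rewrite (Rplus_comm (INR n) x0).
    rewrite RtoC_opp, !RtoC_inv by lra. field. }
  rewrite E, Re_plus, Im_plus. split; eapply (is_RInt_Chasles (V := R_NormedModule)); eauto.
Qed.
Lemma euler_maclaurin : is_cseries (fun m => H (INR m + x0)%R)
  (IH + IW - nbern 2 x0 * H1 0%R - nbern 1 x0 * H 0%R).
Proof.
assert (FI : cInt f (- (1) * IW - IH)) by (apply cInt_minus; auto; apply cInt_scal; auto).
assert (LT : forall h l, rInt h l -> is_lim_seq (fun n => RInt h 0 (x0 + INR n)) l).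
{ intros h l [_ L]. apply (is_lim_comp_seq (fun T => RInt h 0 T) (fun n => x0 + INR n)%R p_infty l); auto.
  exists 0%nat; intros; discriminate. apply (is_lim_seq_plus _ _ x0 p_infty). apply is_lim_seq_const. apply is_lim_seq_INR. reflexivity. }
destruct FI as [FR FI]. apply LT in FR. apply LT in FI.
apply (is_lim_seq_ext _ (fun n => Re (val n))) in FR. 2: intros n; exact (is_RInt_unique _ _ _ _ (proj1 (em_val n))).
apply (is_lim_seq_ext _ (fun n => Im (val n))) in FI. 2: intros n; exact (is_RInt_unique _ _ _ _ (proj2 (em_val n))).
set (l := - (1) * IW - IH) in *.
apply (is_series_tail _ _ (fun n => (Rabs (Re (val n) - Re l) + Rabs (Im (val n) - Im l)) + (K * exp (- (d * (x0 + INR n))) + K * exp (- (d * (x0 + INR n)))))%R).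
- replace (Finite 0) with (Finite ((Rabs (Re l - Re l) + Rabs (Im l - Im l)) + (0 + 0)))%R by (f_equal; rewrite !Rminus_diag, !Rabs_R0; ring).
  apply (is_lim_seq_plus' _ _ (Rabs (Re l - Re l) + Rabs (Im l - Im l)) (0 + 0)).
  apply is_lim_seq_plus'; (apply (is_lim_seq_abs _ (Finite _))); apply is_lim_seq_minus'; auto; apply is_lim_seq_const.
  apply is_lim_seq_plus'; now apply exp_seq_lim.
- intros n. assert (P := pos_INR n).
  replace (IH + IW - nbern 2 x0 * H1 0%R - nbern 1 x0 * H 0%R - Csum (fun m => H (INR m + x0)%R) n) with
    ((val n - l) + (/ 2 * H (x0 + INR n)%R + - / 12 * H1 (x0 + INR n)%R)) by (unfold val, l; ring).
  eapply Rle_trans; [apply Cmod_triangle|]. apply Rplus_le_compat.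
  eapply Rle_trans; [apply Cmod_le_ReIm|]. rewrite Re_minus, Im_minus. apply Rle_refl.
  eapply Rle_trans; [apply Cmod_triangle|]. rewrite !Cmod_mult, Cmod_opp.
  assert (B1 := BH (x0 + INR n) ltac:(lra)). assert (B2 := BH1 (x0 + INR n) ltac:(lra)).
  assert (N1 := Cmod_ge_0 (H (x0 + INR n)%R)). assert (N2 := Cmod_ge_0 (H1 (x0 + INR n)%R)).
  replace (/ 2) with (RtoC (/ 2)) by (rewrite RtoC_inv; auto; lra). replace (/ 12) with (RtoC (/ 12)) by (rewrite RtoC_inv; auto; lra).
  rewrite !Cmod_RtoC_pos by lra. lra.
Qed.
End EulerMaclaurin.

(** * The theta series *)

(** The parity sign: -1 for nu = 0 (odd functions), 1 for nu = 1 (even functions). *)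
Definition sgz (nu : nat) : C := RtoC (-1) ^ S nu.
Lemma sgz_sqr (nu : nat) : sgz nu * sgz nu = 1.
Proof. unfold sgz. rewrite <- Cpow_mult_l, <- RtoC_mult. replace (-1 * -1)%R with 1%R by ring. now rewrite Cpow_1_l. Qed.

Lemma Csum_shift (F : nat -> C) (n : nat) : Csum (fun a => F (S a)) n + F 0%nat = Csum F n + F n.
Proof. induction n. rewrite !Csum_0. reflexivity. rewrite !Csum_S. rewrite <- IHn. ring. Qed.
(** Passes from the residues 1, ..., M of the summation to the residues 0, ..., M - 1 in the
    definitions of the mean and the transform. *)
Lemma Csum_cycle (F : nat -> C) (n : nat) : F n = F 0%nat -> Csum (fun a => F (S a)) n = Csum F n.
Proof.
intros E. assert (H := Csum_shift F n). rewrite E in H. replace (Csum F n) with (Csum F n + F 0%nat - F 0%nat) by ring. rewrite <- H. ring.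
Qed.
Lemma Csum_rev (F : nat -> C) (n : nat) : Csum F n = Csum (fun k => F (n - S k)%nat) n.
Proof.
induction n. reflexivity. rewrite (Csum_S (fun k => F (S n - S k)%nat)), <- (Csum_shift (fun k => F (S n - S k)%nat)).
rewrite Csum_S, IHn. f_equal. f_equal. lia.
Qed.

(** * The discrete Fourier transform: periodicity and parity *)

Definition dker (M l : nat) (n : Z) : C := cexp (- (2 * PI * Ci * INR l * IZR n / INR M)).
Lemma DFT_eq (M : nat) (g : Z -> C) (n : Z) : DFT M g n = / sqrt (INR M) * Csum (fun l => g (Z.of_nat l) * dker M l n) M.
Proof. reflexivity. Qed.
Lemma RtoC_INR_neq0 (M : nat) : (0 < M)%nat -> RtoC (INR M) <> 0.
Proof. intros H. apply RtoC_neq0. assert (T := INR_ge1 M H). lra. Qed.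
Lemma cexp_int (z : C) (n : Z) : z = 2 * PI * Ci * IZR n -> cexp z = 1.
Proof. intros ->. apply cexp_2PI. Qed.
Lemma dker_M (M : nat) (n : Z) : (0 < M)%nat -> dker M M n = 1.
Proof. intros H. apply (cexp_int _ (- n)). rewrite opp_IZR, RtoC_opp. field. now apply RtoC_INR_neq0. Qed.
Lemma dker_0 (M : nat) (n : Z) : (0 < M)%nat -> dker M 0 n = 1.
Proof. intros H. unfold dker. rewrite <- cexp_0. f_equal. simpl (INR 0). field. now apply RtoC_INR_neq0. Qed.
Lemma sqrtM (M : nat) : (0 < M)%nat -> (0 < sqrt (INR M))%R /\ RtoC (sqrt (INR M)) <> 0 /\ RtoC (sqrt (INR M)) * RtoC (sqrt (INR M)) = INR M.
Proof.
intros H. assert (T := INR_ge1 M H). assert (S := sqrt_lt_R0 (INR M) ltac:(lra)). split; auto. split. apply RtoC_neq0; lra.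
rewrite <- RtoC_mult, sqrt_sqrt; auto; lra.
Qed.
Lemma DFT_sum1 (M : nat) (g : Z -> C) (n : Z) : (0 < M)%nat -> periodic M g ->
  Csum (fun a => g (Z.of_nat (S a)) * dker M (S a) n) M = sqrt (INR M) * DFT M g n.
Proof.
intros HM Hg. rewrite (Csum_cycle (fun a => g (Z.of_nat a) * dker M a n)).
rewrite DFT_eq. field. now apply sqrtM. rewrite dker_M, dker_0 by auto. f_equal. apply (Hg 0%Z).
Qed.
Lemma mean_sum1 (M : nat) (g : Z -> C) : (0 < M)%nat -> periodic M g -> Csum (fun a => g (Z.of_nat (S a))) M = INR M * mean M g.
Proof.
intros HM Hg. rewrite (Csum_cycle (fun a => g (Z.of_nat a))). unfold mean. field. now apply RtoC_INR_neq0. apply (Hg 0%Z).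
Qed.
Definition parity (nu : nat) (g : Z -> C) : Prop := forall n : Z, g (- n)%Z = sgz nu * g n.
Lemma DFT_periodic (M : nat) (g : Z -> C) : (0 < M)%nat -> periodic M (DFT M g).
Proof.
intros HM n. rewrite !DFT_eq. f_equal. apply Csum_ext. intros l _. f_equal. unfold dker.
replace (- (2 * PI * Ci * INR l * IZR (n + Z.of_nat M) / INR M)) with (- (2 * PI * Ci * INR l * IZR n / INR M) + 2 * PI * Ci * IZR (- Z.of_nat l)).
rewrite cexp_add, cexp_2PI. ring. rewrite plus_IZR, opp_IZR, <- !INR_IZR_INZ, RtoC_plus, RtoC_opp. field. now apply RtoC_INR_neq0.
Qed.
Lemma DFT_parity (M nu : nat) (g : Z -> C) : (0 < M)%nat -> periodic M g -> parity nu g -> parity nu (DFT M g).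
Proof.
intros HM Hg Hp n. rewrite (DFT_eq M g n).
assert (E := DFT_sum1 M g (- n) HM Hg). rewrite Csum_rev in E. replace (DFT M g (- n)) with (/ sqrt (INR M) * (sqrt (INR M) * DFT M g (- n))) by (field; now apply sqrtM).
rewrite <- E, (Cmult_comm (sgz nu)), <- Cmult_assoc. f_equal. rewrite Cmult_comm, <- Csum_scal. apply Csum_ext. intros l Hl.
replace (S (M - S l)) with (M - l)%nat by lia. rewrite Nat2Z.inj_sub by lia.
replace (Z.of_nat M - Z.of_nat l)%Z with (- Z.of_nat l + Z.of_nat M)%Z by lia. rewrite Hg, Hp, <- Cmult_assoc. f_equal. f_equal.
unfold dker. replace (- (2 * PI * Ci * INR (M - l) * IZR (- n) / INR M)) with (- (2 * PI * Ci * INR l * IZR n / INR M) + 2 * PI * Ci * IZR n).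
rewrite cexp_add, cexp_2PI. ring. rewrite minus_INR, RtoC_minus, opp_IZR, RtoC_opp by lia. field. now apply RtoC_INR_neq0.
Qed.

Lemma is_series_Csum (v : nat -> nat -> C) (l : nat -> C) (n : nat) :
  (forall a, (a < n)%nat -> is_cseries (v a) (l a)) ->
  is_cseries (fun k => Csum (fun a => v a k) n) (Csum l n).
Proof.
induction n; intros H.
- destruct (summ_finite (fun _ => RtoC 0) 0 (fun _ _ => eq_refl)) as [A B]. assert (Z := CSeries_correct _ A). rewrite B in Z. exact Z.
- rewrite Csum_S. apply (is_series_extC (fun k => Csum (fun a => v a k) n + v n k)). intros; now rewrite Csum_S.
  apply (is_series_plus (K := C_AbsRing) (V := C_NormedModule)); auto.
Qed.

Lemma Jf_cder (j : nat) (ep : R) (sg : C) (t : R) :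
  cder (Jf j ep sg) t (INR j * Jf (pred j) ep sg t + 2 * Ci * ep * Jf j ep sg t + 2 * Ci * sg * Jf (S j) ep sg t).
Proof.
unfold Jf. eapply cder_eq. apply cder_mult. apply cder_mult. apply cder_pow, cder_id.
apply (cder_cexp (fun u => 2 * Ci * ep * RtoC u)), cder_scal, cder_id.
apply (cder_cexp (fun u => sg * (Ci * RtoC u ^ 2))). apply cder_scal, cder_scal, cder_pow, cder_id.
cbv beta. simpl (pred 2). simpl (INR 2). rewrite RtoC_plus. set (x := RtoC t ^ pred j). simpl (RtoC t ^ 2). simpl (RtoC t ^ S j). simpl (RtoC t ^ 1). ring.
Qed.
Lemma J_scal_spec (c : C) (j : nat) (ep : R) (sg : C) : (0 < Im sg)%R -> cInt (fun t => c * Jf j ep sg t) (c * J j ep sg).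
Proof. intros H. apply (cInt_scal c (Jf j ep sg)). now apply J_spec. Qed.
Lemma J_ibp (j : nat) (ep : R) (sg : C) : (0 < Im sg)%R ->
  INR j * J (pred j) ep sg + 2 * Ci * ep * J j ep sg + 2 * Ci * sg * J (S j) ep sg = - Jf j ep sg 0.
Proof.
intros H. destruct (J_bound_lim j ep sg H) as [g [G1 G2]].
apply (cInt_unique (fun t => INR j * Jf (pred j) ep sg t + 2 * Ci * ep * Jf j ep sg t + 2 * Ci * sg * Jf (S j) ep sg t)).
- apply cInt_plus. apply cInt_plus. apply J_scal_spec; assumption. apply J_scal_spec; assumption. apply J_scal_spec; assumption.
- apply (cInt_FTC (Jf j ep sg) _ g); auto. intros; apply Jf_cder.
  intros; apply ccont_plus; [apply ccont_plus|]; apply ccont_mult; try simple apply ccont_const; apply ccont_Jf.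
Qed.
Lemma Jf_0 (j : nat) (ep : R) (sg : C) : Jf j ep sg 0 = match j with O => 1 | _ => 0 end.
Proof.
unfold Jf. replace (2 * Ci * ep * 0) with (RtoC 0) by ring. replace (sg * (Ci * RtoC 0 ^ 2)) with (RtoC 0) by (simpl; ring).
rewrite cexp_0. destruct j; simpl; ring.
Qed.

(** [Jf1] and [Jf2] are the first and second derivatives of the summand at frequency 0. For j = 0
    the value of [pred] is multiplied by [INR 0]. *)
Definition Jf1 (j : nat) (sg : C) (t : R) : C := INR j * Jf (pred j) 0 sg t + 2 * Ci * sg * Jf (S j) 0 sg t.
Definition Jf2 (j : nat) (sg : C) (t : R) : C := INR j * Jf1 (pred j) sg t + 2 * Ci * sg * Jf1 (S j) sg t.
Lemma Jf_cder0 (j : nat) (sg : C) (t : R) : cder (Jf j 0 sg) t (Jf1 j sg t).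
Proof. eapply cder_eq. apply Jf_cder. unfold Jf1. ring. Qed.
Lemma Jf1_cder (j : nat) (sg : C) (t : R) : cder (Jf1 j sg) t (Jf2 j sg t).
Proof. unfold Jf1. eapply cder_eq. apply cder_plus; apply cder_scal, Jf_cder0. reflexivity. Qed.
Lemma Jf_exp_bound (j : nat) (sg : C) : (0 < Im sg)%R -> exists K, (0 < K)%R /\ forall ep t, (0 <= t)%R -> (Cmod (Jf j ep sg t) <= K * exp (- (1 * t)))%R.
Proof.
intros H. destruct (gauss_exp_bound (Im sg) j H) as [K [K0 HK]]. exists K. split; auto. intros ep t Ht. rewrite Cmod_Jf, Rmult_1_l by auto. auto.
Qed.
Lemma Jf1_exp_bound (j : nat) (sg : C) : (0 < Im sg)%R -> exists K, (0 < K)%R /\ forall t, (0 <= t)%R -> (Cmod (Jf1 j sg t) <= K * exp (- (1 * t)))%R.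
Proof.
intros H. destruct (Jf_exp_bound (pred j) sg H) as [A [A0 HA]]. destruct (Jf_exp_bound (S j) sg H) as [B [B0 HB]].
assert (C1 := Cmod_ge_0 (INR j)). assert (C2 := Cmod_ge_0 (2 * Ci * sg)).
exists (Cmod (INR j) * A + Cmod (2 * Ci * sg) * B + 1)%R. split. nra. intros t Ht. unfold Jf1.
eapply Rle_trans; [apply Cmod_triangle|]. rewrite (Cmod_mult (INR j)), (Cmod_mult (2 * Ci * sg)).
specialize (HA 0%R t Ht). specialize (HB 0%R t Ht). assert (E := exp_pos (- (1 * t))).
apply (Rmult_le_compat_l _ _ _ C1) in HA. apply (Rmult_le_compat_l _ _ _ C2) in HB. nra.
Qed.
Lemma Jf2_exp_bound (j : nat) (sg : C) : (0 < Im sg)%R -> exists K, (0 < K)%R /\ forall t, (0 <= t)%R -> (Cmod (Jf2 j sg t) <= K * exp (- (1 * t)))%R.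
Proof.
intros H. destruct (Jf1_exp_bound (pred j) sg H) as [A [A0 HA]]. destruct (Jf1_exp_bound (S j) sg H) as [B [B0 HB]].
assert (C1 := Cmod_ge_0 (INR j)). assert (C2 := Cmod_ge_0 (2 * Ci * sg)).
exists (Cmod (INR j) * A + Cmod (2 * Ci * sg) * B + 1)%R. split. nra. intros t Ht. unfold Jf2.
eapply Rle_trans; [apply Cmod_triangle|]. rewrite (Cmod_mult (INR j)), (Cmod_mult (2 * Ci * sg)).
specialize (HA t Ht). specialize (HB t Ht). assert (E := exp_pos (- (1 * t))).
apply (Rmult_le_compat_l _ _ _ C1) in HA. apply (Rmult_le_compat_l _ _ _ C2) in HB. nra.
Qed.
Lemma ccont_Jf2 (j : nat) (sg : C) (t : R) : ccont (Jf2 j sg) t.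
Proof.
unfold Jf2. apply ccont_plus; apply ccont_mult; try simple apply ccont_const; eapply cder_ccont, Jf1_cder.
Qed.
(** The outcome of two integrations by parts in the Fourier integral of the second derivative. With
    H = t^nu exp (i sg t^2) the boundary term is 2 i ep H(0) - H'(0), which is 2 i ep for nu = 0 and
    -1 for nu = 1. *)
Definition J2 (nu : nat) (ep : R) (sg : C) : C :=
  match nu with O => 2 * Ci * ep | _ => - (1) end + (2 * Ci * ep) ^ 2 * J nu ep sg.
(** The second derivative is a combination of the moments [Jf]; the relations [J_ibp] of orders 0, 1
    and 2 reduce it to the moment nu and the boundary terms. *)
Lemma J2_spec (nu : nat) (ep : R) (sg : C) : (nu <= 1)%nat -> (0 < Im sg)%R ->
  cInt (fun t => Jf2 nu sg t * cexp (2 * Ci * ep * t)) (J2 nu ep sg).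
Proof.
intros Hnu H. assert (JE : forall j t, Jf j ep sg t = Jf j 0 sg t * cexp (2 * Ci * ep * t)).
{ intros j t. unfold Jf. replace (2 * Ci * 0 * t) with (RtoC 0) by ring. rewrite cexp_0. ring. }
assert (I0 := J_ibp 0 ep sg H). assert (I1 := J_ibp 1 ep sg H). assert (I2 := J_ibp 2 ep sg H). rewrite Jf_0 in *. simpl pred in *.
simpl (INR 0) in I0. simpl (INR 1) in I1. simpl (INR 2) in I2. rewrite RtoC_plus in I2.
assert (E1 : 2 * Ci * sg * J 1 ep sg = - (1) - 2 * Ci * ep * J 0 ep sg) by (rewrite <- I0; ring).
assert (E2 : 2 * Ci * sg * J 2 ep sg = - J 0 ep sg - 2 * Ci * ep * J 1 ep sg).
{ transitivity (1 * J 0 ep sg + 2 * Ci * ep * J 1 ep sg + 2 * Ci * sg * J 2 ep sg - J 0 ep sg - 2 * Ci * ep * J 1 ep sg). ring. rewrite I1. ring. }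
assert (E3 : 2 * Ci * sg * J 3 ep sg = - (1 + 1) * J 1 ep sg - 2 * Ci * ep * J 2 ep sg).
{ transitivity ((1 + 1) * J 1 ep sg + 2 * Ci * ep * J 2 ep sg + 2 * Ci * sg * J 3 ep sg - (1 + 1) * J 1 ep sg - 2 * Ci * ep * J 2 ep sg). ring. rewrite I2. ring. }
destruct nu as [|[|]]; [| |lia].
- replace (J2 0 ep sg) with (2 * Ci * sg * J 0 ep sg + (2 * Ci * sg) * (2 * Ci * sg) * J 2 ep sg).
  apply (cInt_ext (fun t => 2 * Ci * sg * Jf 0 ep sg t + (2 * Ci * sg) * (2 * Ci * sg) * Jf 2 ep sg t)).
  intros t _. rewrite !JE. unfold Jf2, Jf1. simpl (INR 0). simpl (INR 1). simpl pred. ring.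
  apply cInt_plus; apply J_scal_spec; assumption.
  transitivity (2 * Ci * sg * J 0 ep sg + (2 * Ci * sg) * (2 * Ci * sg * J 2 ep sg)). ring. rewrite E2.
  transitivity (- (2 * Ci * ep) * (2 * Ci * sg * J 1 ep sg)). ring. rewrite E1. unfold J2. simpl. ring.
- replace (J2 1 ep sg) with ((1 + (1 + 1)) * 2 * Ci * sg * J 1 ep sg + (2 * Ci * sg) * (2 * Ci * sg) * J 3 ep sg).
  apply (cInt_ext (fun t => (1 + (1 + 1)) * 2 * Ci * sg * Jf 1 ep sg t + (2 * Ci * sg) * (2 * Ci * sg) * Jf 3 ep sg t)).
  intros t _. rewrite !JE. unfold Jf2, Jf1. simpl (INR 0). simpl (INR 1). simpl (INR 2). simpl pred. simpl (INR 0). rewrite RtoC_plus. ring.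
  apply cInt_plus; apply J_scal_spec; assumption.
  transitivity ((1 + (1 + 1)) * 2 * Ci * sg * J 1 ep sg + (2 * Ci * sg) * (2 * Ci * sg * J 3 ep sg)). ring. rewrite E3.
  transitivity (2 * Ci * sg * J 1 ep sg - 2 * Ci * ep * (2 * Ci * sg * J 2 ep sg)). ring. rewrite E2.
  rewrite E1. unfold J2. simpl. ring.
Qed.

Definition kk (k : nat) : R := (PI * (INR k + 1))%R.
Lemma kk_pos (k : nat) : (0 < kk k)%R.
Proof. unfold kk. assert (P := pos_INR k). assert (PP := PI_RGT_0). nra. Qed.
Lemma om_kk (k : nat) : om k = 2 * Ci * kk k.
Proof. unfold om, kk. rewrite RtoC_mult, RtoC_plus. ring. Qed.

Lemma Pf2_bound (x : R) : (Cmod (Pf 2 x) <= Series (fun k => 2 * sqw k))%R.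
Proof. apply CSeries_bound. intros; now apply pf_bound. apply ex_series_scalR, sqw_series. Qed.

(** One residue class: Euler-Maclaurin at the points m + x0, with the remainder integral expanded by
    the Fourier series of B_2. The terms are dominated by a multiple of 1/(k + 1)^2 times an
    exponential, so integration is termwise, and the shift by x0 contributes only phases. *)
Lemma theta_class (nu : nat) (sg : C) (x0 : R) : (nu <= 1)%nat -> (0 < Im sg)%R -> (0 < x0 <= 1)%R ->
  exists IW,
  is_cseries
    (fun k => / om k ^ 2 * (cexp (- om k * x0) * J2 nu (kk k) sg + cexp (om k * x0) * J2 nu (- kk k) sg)) IW /\
  is_cseries (fun m => Jf nu 0 sg (INR m + x0))
    (J nu 0 sg + IW - nbern 2 x0 * Jf1 nu sg 0 - nbern 1 x0 * Jf nu 0 sg 0).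
Proof.
intros Hnu Hs Hx.
destruct (Jf_exp_bound nu sg Hs) as [K0 [K0p HK0]]. destruct (Jf1_exp_bound nu sg Hs) as [K1 [K1p HK1]].
destruct (Jf2_exp_bound nu sg Hs) as [K2 [K2p HK2]].
set (BP := Series (fun k => 2 * sqw k)%R). assert (BP0 : (0 <= BP)%R) by (eapply Rle_trans; [apply Cmod_ge_0 | apply (Pf2_bound 0)]).
assert (PC : forall t, ccont (fun t => Pf 2 (t - x0)) t).
{ intros t. destruct (ccont_Pf 2 (t - x0) ltac:(lia)) as [A B]. split.
  apply (continuous_comp (fun t => t - x0)%R (fun y => Re (Pf 2 y))); auto.
  apply (ex_derive_continuous (V := R_NormedModule) (fun t => t - x0)%R). auto_derive; auto.
  apply (continuous_comp (fun t => t - x0)%R (fun y => Im (Pf 2 y))); auto.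
  apply (ex_derive_continuous (V := R_NormedModule) (fun t => t - x0)%R). auto_derive; auto. }
assert (DW : cInt (fun t => Jf2 nu sg t * Pf 2 (t - x0)) (Int (fun t => Jf2 nu sg t * Pf 2 (t - x0)))).
{ apply (expdom_cInt _ (K2 * BP) 1). split; [lra|split].
  intros t _. apply ccont_mult. apply ccont_Jf2. apply PC.
  intros t Ht. rewrite Cmod_mult. replace (K2 * BP * exp (- (1 * t)))%R with ((K2 * exp (- (1 * t))) * BP)%R by ring.
  apply Rmult_le_compat; try apply Cmod_ge_0. now apply HK2. apply Pf2_bound. }
set (IW := Int _) in DW. exists IW. split.
- apply (cInt_series (fun k t => Jf2 nu sg t * pf 2 k (t - x0)) _ (fun t => Jf2 nu sg t * Pf 2 (t - x0)) IW (fun k => K2 * (2 * sqw k))%R 1); auto; try lra.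
  + intros k. apply (cInt_ext (fun t => / om k ^ 2 * cexp (- om k * x0) * (Jf2 nu sg t * cexp (2 * Ci * kk k * t)) + / om k ^ 2 * cexp (om k * x0) * (Jf2 nu sg t * cexp (2 * Ci * RtoC (- kk k) * t)))).
    * intros t _. unfold pf. rewrite RtoC_minus, RtoC_opp. replace (om k * (t - x0)) with (om k * t + - om k * x0) by ring.
      replace (- om k * (t - x0)) with (- om k * t + om k * x0) by ring. rewrite !cexp_add.
      replace (2 * Ci * kk k * t) with (om k * t) by (rewrite om_kk; ring). replace (2 * Ci * - kk k * t) with (- om k * t) by (rewrite om_kk; ring).
      replace ((- om k) ^ 2) with (om k ^ 2) by (simpl; ring). ring.
    * match goal with |- cInt _ ?v => replace v with (/ om k ^ 2 * cexp (- om k * x0) * J2 nu (kk k) sg + / om k ^ 2 * cexp (om k * x0) * J2 nu (- kk k) sg) by ring end.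
      apply cInt_plus. apply (cInt_scal (/ om k ^ 2 * cexp (- om k * x0)) (fun t => Jf2 nu sg t * cexp (2 * Ci * kk k * t))). now apply J2_spec.
      apply (cInt_scal (/ om k ^ 2 * cexp (om k * x0)) (fun t => Jf2 nu sg t * cexp (2 * Ci * RtoC (- kk k) * t))). now apply J2_spec.
  + apply ex_series_scalR, ex_series_scalR, sqw_series.
  + intros k t Ht. rewrite Cmod_mult. replace (K2 * (2 * sqw k) * exp (- (1 * t)))%R with ((K2 * exp (- (1 * t))) * (2 * sqw k))%R by ring.
    apply Rmult_le_compat; try apply Cmod_ge_0. now apply HK2. now apply pf_bound.
  + intros t Ht. unfold Pf. rewrite CSeries_scal; auto. now apply pf_summ.
- apply (euler_maclaurin (Jf nu 0 sg) (Jf1 nu sg) (Jf2 nu sg) (K0 + K1) 1 x0 (J nu 0 sg) IW); auto; try lra.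
  apply Jf_cder0. apply Jf1_cder. intros; apply ccont_Jf2.
  intros t Ht. eapply Rle_trans; [now apply HK0|]. assert (E := exp_pos (- (1 * t))). nra.
  intros t Ht. eapply Rle_trans; [now apply HK1|]. assert (E := exp_pos (- (1 * t))). nra.
  now apply J_spec.
Qed.

Lemma exp_pow (x : R) (n : nat) : (exp x ^ n = exp (INR n * x))%R.
Proof. induction n. simpl. now rewrite Rmult_0_l, exp_0. rewrite S_INR. simpl. rewrite IHn, <- exp_plus. f_equal. ring. Qed.
Lemma Theta_series (M nu : nat) (g : Z -> C) (tau : C) : (0 < M)%nat -> periodic M g -> (0 < Im tau)%R ->
  summ (fun k => RtoC (INR (S k)) ^ nu * g (Z.of_nat (S k)) * cexp (Ci * PI * RtoC (INR (S k)) ^ 2 * tau / INR M)).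
Proof.
intros HM Hg Ht. destruct (periodic_bounded M g HM Hg) as [B [B0 HB]]. assert (M1 := INR_ge1 M HM). assert (PP := PI_RGT_0).
assert (BP : (0 < PI * Im tau / INR M)%R) by (apply Rdiv_lt_0_compat; nra).
destruct (gauss_exp_bound (PI * Im tau / INR M) nu BP) as [K [K0 HK]].
apply summ_le with (fun k => B * K * exp (- (1)) ^ k)%R.
- intros k. assert (P := pos_INR (S k)). rewrite !Cmod_mult, Cmod_cexp, Cmod_pow, (Cmod_RtoC_pos (INR (S k))) by auto.
  replace (Re (Ci * PI * RtoC (INR (S k)) ^ 2 * tau / INR M)) with (- (PI * Im tau / INR M * INR (S k) ^ 2))%R.
  2:{ rewrite <- RtoC_pow. unfold Cdiv. rewrite <- RtoC_inv by lra. set (u := (INR (S k) ^ 2)%R). destruct tau; simpl. field. lra. }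
  specialize (HK (INR (S k)) P). specialize (HB (Z.of_nat (S k))).
  replace (INR (S k) ^ nu * Cmod (g (Z.of_nat (S k))) * exp (- (PI * Im tau / INR M * INR (S k) ^ 2)))%R with
    (Cmod (g (Z.of_nat (S k))) * (INR (S k) ^ nu * exp (- (PI * Im tau / INR M * INR (S k) ^ 2))))%R by ring.
  rewrite Rmult_assoc. apply Rmult_le_compat; auto. apply Cmod_ge_0. apply Rmult_le_pos. now apply pow_le. left; apply exp_pos.
  eapply Rle_trans; [apply HK|]. apply Rmult_le_compat_l; [lra|]. rewrite exp_pow. apply exp_le. rewrite S_INR. lra.
- apply ex_series_scalR, ex_series_geomR. split. left; apply exp_pos. assert (E := exp_increasing (- (1)) 0 ltac:(lra)). rewrite exp_0 in E. exact E.
Qed.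

Lemma Theta_tilde_0 (M nu : nat) (g : Z -> C) : (0 < M)%nat -> periodic M g ->
  Theta_tilde M nu g 0 = - RtoC (INR M ^ nu * INR (fact nu)) * Csum (fun a => g (Z.of_nat (S a)) * RtoC (nbern (S nu) (INR (S a) / INR M))) M.
Proof.
intros HM Hg. unfold Theta_tilde. simpl (fact 0). simpl (INR 1). rewrite (Lfun_eq M) by (auto; intros E; apply (f_equal Re) in E; simpl in E; assert (P := pos_INR nu); lra).
replace (- (2 * INR 0 + INR nu)) with (- INR nu) by (simpl; ring). rewrite L_ext_value by auto.
simpl Cpow. field.
Qed.

Lemma J_0_odd (sg : C) : (0 < Im sg)%R -> 2 * Ci * sg * J 1 0 sg = - (1).
Proof. intros H. assert (I := J_ibp 0 0 sg H). rewrite Jf_0 in I. rewrite <- I. simpl. ring. Qed.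

(** The transform at 0 is a multiple of the mean, and it is odd by [DFT_parity]. *)
Lemma odd_mean (M : nat) (g : Z -> C) : (0 < M)%nat -> periodic M g -> parity 0 g -> mean M g = 0.
Proof.
intros HM Hg Hp. assert (E := DFT_parity M 0 g HM Hg Hp 0%Z).
assert (E2 : DFT M g 0%Z = / sqrt (INR M) * (INR M * mean M g)).
{ rewrite DFT_eq. f_equal. rewrite <- mean_sum1 by auto. symmetry. rewrite (Csum_cycle (fun a => g (Z.of_nat a))) by apply (Hg 0%Z).
  apply Csum_ext. intros l _. unfold dker. replace (- (2 * PI * Ci * INR l * IZR 0 / INR M)) with (RtoC 0). rewrite cexp_0; ring. field. now apply RtoC_INR_neq0. }
change (- 0)%Z with 0%Z in E. unfold sgz in E. simpl in E.
assert (N := RtoC_INR_neq0 M HM). destruct (sqrtM M HM) as [_ [N2 _]].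
assert (Z0 : DFT M g 0%Z = 0).
{ assert (2 * DFT M g 0%Z = 0). transitivity (DFT M g 0%Z + DFT M g 0%Z). ring. rewrite E at 1. ring.
  destruct (Cmult_eq0 2 (DFT M g 0%Z) H) as [A|A]; auto. exfalso. revert A. apply RtoC_neq0; lra. }
rewrite E2 in Z0. replace (mean M g) with (sqrt (INR M) * / INR M * (/ sqrt (INR M) * (INR M * mean M g))) by (field; auto). rewrite Z0. ring.
Qed.

(** Writing n = M (m + x0) leads to the quadratic coefficient PI M tau. Summed over the classes, the
    phases become the transform at k and at -k, merged by parity. The boundary terms with B_(nu+1)
    form the constant term of the formal series; the integral of the summand gives the pole for nu =
    1 and meets a zero mean for nu = 0. *)
Lemma theta_transform (M nu : nat) (g : Z -> C) (tau : C) : (0 < M)%nat -> (nu <= 1)%nat -> periodic M g -> parity nu g -> (0 < Im tau)%R ->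
  let sg := PI * INR M * tau in
  is_cseries
    (fun k => RtoC (INR M ^ nu) * sqrt (INR M) * DFT M g (Z.of_nat (S k)) * (/ om k ^ 2 * (J2 nu (kk k) sg + sgz nu * J2 nu (- kk k) sg)))
    (Theta M nu g tau + INR M * mean M g / (2 * PI * Ci * tau) - Theta_tilde M nu g 0).
Proof.
intros HM Hnu Hg Hp Ht sg. assert (M1 := INR_ge1 M HM). assert (PP := PI_RGT_0). assert (MN := RtoC_INR_neq0 M HM).
assert (Hs : (0 < Im sg)%R). { unfold sg. rewrite <- RtoC_mult, Im_mult, Re_RtoC, Im_RtoC. apply (Rmult_lt_compat_l (PI * INR M)) in Ht; nra. }
set (x0 := fun a => (INR (S a) / INR M)%R).
assert (HX : forall a, (a < M)%nat -> (0 < x0 a <= 1)%R).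
{ intros a Ha. unfold x0. assert (P := INR_S_gt0 a). assert (L : (INR (S a) <= INR M)%R) by (apply le_INR; lia). split.
  apply Rdiv_lt_0_compat; lra. apply (Rmult_le_reg_r (INR M)); [lra|]. unfold Rdiv. rewrite Rmult_assoc, Rinv_l; lra. }
set (v := fun a k => / om k ^ 2 * (cexp (- om k * x0 a) * J2 nu (kk k) sg + cexp (om k * x0 a) * J2 nu (- kk k) sg)).
assert (CH : exists IW : nat -> C, forall a, (a < M)%nat -> is_cseries (v a) (IW a) /\
  is_cseries (fun m => Jf nu 0 sg (INR m + x0 a)%R) (J nu 0 sg + IW a - nbern 2 (x0 a) * Jf1 nu sg 0%R - nbern 1 (x0 a) * Jf nu 0 sg 0%R)).
{ exists (fun a => CSeries (v a)). intros a Ha. destruct (theta_class nu sg (x0 a) Hnu Hs (HX a Ha)) as [IW [A B]]. fold (v a) in A.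
  rewrite (CSeries_unique _ _ A). split; auto. }
destruct CH as [IW HIW].
set (ga := fun a => g (Z.of_nat (S a))). set (mn := RtoC (INR M ^ nu)).
assert (TH : Theta M nu g tau = Csum (fun a => ga a * mn * (J nu 0 sg + IW a - nbern 2 (x0 a) * Jf1 nu sg 0%R - nbern 1 (x0 a) * Jf nu 0 sg 0%R)) M).
{ unfold Theta. set (f := fun k : nat => _). apply (series_regroup f M); auto.
  apply CSeries_correct. now apply Theta_series.
  intros a Ha. destruct (HIW a Ha) as [_ B]. apply (is_series_extC (fun m => ga a * mn * Jf nu 0 sg (INR m + x0 a)%R)).
  2: now apply is_series_scalC.
  intros m. unfold f, ga, mn, Jf. replace (Z.of_nat (S (m * M + a))) with (Z.of_nat (S a) + Z.of_nat (m * M))%Z by lia.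
  rewrite periodic_mul by auto.
  assert (EN : INR (S (m * M + a)) = (INR M * (INR m + x0 a))%R).
  { unfold x0. rewrite !S_INR, plus_INR, mult_INR. field. lra. }
  rewrite EN, RtoC_pow, !RtoC_mult, Cpow_mult_l. replace (2 * Ci * 0 * (INR m + x0 a)%R) with (RtoC 0) by ring. rewrite cexp_0.
  replace (Ci * PI * (INR M * (INR m + x0 a)%R) ^ 2 * tau / INR M) with (sg * (Ci * (INR m + x0 a)%R ^ 2)). ring. unfold sg. simpl. field. auto. }
assert (SV : is_cseries (fun k => Csum (fun a => ga a * mn * v a k) M) (Csum (fun a => ga a * mn * IW a) M)).
{ apply (is_series_Csum (fun a k => ga a * mn * v a k)). intros a Ha. apply is_series_scalC. exact (proj1 (HIW a Ha)). }
apply (is_series_extC _ (fun k => mn * sqrt (INR M) * DFT M g (Z.of_nat (S k)) * (/ om k ^ 2 * (J2 nu (kk k) sg + sgz nu * J2 nu (- kk k) sg)))) in SV.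
2:{ intros k.
  assert (DK : forall a, cexp (- om k * x0 a) = dker M (S a) (Z.of_nat (S k)) /\ cexp (om k * x0 a) = dker M (S a) (- Z.of_nat (S k))).
  { intros a. unfold dker, x0, om. rewrite opp_IZR, <- INR_IZR_INZ, (S_INR k), RtoC_div, RtoC_opp, RtoC_plus by lra. split; f_equal; field; auto. }
  rewrite (Csum_ext _ (fun a => mn * / om k ^ 2 * J2 nu (kk k) sg * (ga a * dker M (S a) (Z.of_nat (S k))) + mn * / om k ^ 2 * J2 nu (- kk k) sg * (ga a * dker M (S a) (- Z.of_nat (S k))))).
  rewrite Csum_plus, !Csum_scal. unfold ga. rewrite !DFT_sum1 by auto. rewrite (DFT_parity M nu g HM Hg Hp (Z.of_nat (S k))). ring.
  intros a _. unfold v. destruct (DK a) as [-> ->]. ring. }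
replace (Theta M nu g tau + INR M * mean M g / (2 * PI * Ci * tau) - Theta_tilde M nu g 0) with (Csum (fun a => ga a * mn * IW a) M); auto.
rewrite TH, Theta_tilde_0 by auto. fold mn. symmetry.
rewrite (Csum_ext _ (fun a => ga a * mn * IW a + (mn * J nu 0 sg * ga a + - mn * (Jf1 nu sg 0%R * (ga a * RtoC (nbern 2 (x0 a))) + Jf nu 0 sg 0%R * (ga a * RtoC (nbern 1 (x0 a))))))).
2: intros; ring. rewrite Csum_plus, Csum_plus, Csum_scal, Csum_scal, Csum_plus, Csum_scal, Csum_scal. unfold ga at 2. rewrite mean_sum1 by auto.
rewrite Jf_0. unfold Jf1. rewrite !Jf_0.
assert (TN : tau <> 0) by now apply Im_gt0_neq0. assert (PN : RtoC PI <> 0) by (apply RtoC_neq0; lra).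
destruct nu as [|[|]]; [| |lia].
- rewrite (odd_mean M g) by auto. unfold mn. simpl (INR 0). simpl (INR (fact 0)). simpl (INR M ^ 0)%R. rewrite Rmult_1_l. fold x0. unfold ga, x0.
  set (S1 := Csum (fun a => g (Z.of_nat (S a)) * RtoC (nbern 1 (INR (S a) / INR M))) M). field. repeat split; auto. apply Ci_neq0.
- replace (J 1 0 sg) with (- / (2 * Ci * sg)). 2:{ assert (E := J_0_odd sg Hs). assert (N := Im_gt0_neq0 sg Hs). replace (J 1 0 sg) with (2 * Ci * sg * J 1 0 sg / (2 * Ci * sg)). rewrite E. field. repeat split; auto. apply Ci_neq0. field. repeat split; auto; try apply Ci_neq0. }
  unfold mn. simpl (INR 1). simpl (INR (fact 1)). rewrite pow_1, Rmult_1_r. unfold ga, x0.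
  set (S2 := Csum (fun a => g (Z.of_nat (S a)) * RtoC (nbern 2 (INR (S a) / INR M))) M). unfold sg. simpl Init.Nat.pred. cbv iota. field. repeat split; auto. apply Ci_neq0.
Qed.

(** * The modular obstruction *)

Lemma argH_bounds (tau : C) : (0 < Im tau)%R -> (0 < argH tau < PI)%R /\ cos (argH tau) = (Re tau / Cmod tau)%R /\ sin (argH tau) = (Im tau / Cmod tau)%R.
Proof.
intros H. assert (Q := Cmod_sqr tau). assert (N := im_le_Cmod tau). rewrite Rabs_pos_eq in N by lra.
set (c := Cmod tau) in *. set (x := Re tau) in *. set (y := Im tau) in *.
assert (X : (-1 < x / c < 1)%R).
{ assert (-c < x < c)%R by (split; nra). split; apply (Rmult_lt_reg_r c); try lra; unfold Rdiv; rewrite Rmult_assoc, Rinv_l; lra. }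
unfold argH. fold x c. split; [|split].
- now apply acos_bound_lt.
- apply cos_acos; lra.
- rewrite sin_acos by lra. replace (1 - Rsqr (x / c))%R with (Rsqr (y / c)). apply sqrt_Rsqr. apply Rle_mult_inv_pos; lra.
  unfold Rsqr. transitivity ((y * y) / (c * c))%R. field; lra. replace (y * y)%R with (c * c - x * x)%R by lra. field; lra.
Qed.
Lemma cexp_logH (tau : C) : (0 < Im tau)%R -> cexp (logH tau) = tau.
Proof.
intros H. destruct (argH_bounds tau H) as [_ [A B]]. unfold logH, cexp. simpl. rewrite A, B.
assert (N := im_le_Cmod tau). rewrite Rabs_pos_eq in N by lra. rewrite exp_ln by lra.
apply Ceq; simpl; field; lra.
Qed.
Lemma cexp_iPI2 : cexp (Ci * PI / 2) = Ci.
Proof.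
replace (Ci * PI / 2) with (Ci * RtoC (PI / 2)) by (rewrite RtoC_div by lra; field). rewrite cexp_Ci, cos_PI2, sin_PI2. reflexivity.
Qed.

Lemma J_scale (j : nat) (ep c : R) (sg : C) : (0 < c)%R -> (0 < Im sg)%R -> J j (ep * c) sg = / RtoC c ^ S j * J j ep (sg / RtoC c ^ 2).
Proof.
intros Hc Hs. assert (CN : RtoC c <> 0) by (apply RtoC_neq0; lra).
assert (Hs2 : (0 < Im (sg / RtoC c ^ 2))%R).
{ rewrite <- RtoC_pow. unfold Cdiv. rewrite <- RtoC_inv by nra. rewrite Cmult_comm, Im_mult, Re_RtoC, Im_RtoC. assert (0 < / c ^ 2)%R by (apply Rinv_0_lt_compat; nra). nra. }
apply (cInt_unique (Jf j (ep * c) sg)). now apply J_spec.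
replace (/ RtoC c ^ S j * J j ep (sg / RtoC c ^ 2)) with (/ RtoC c ^ j * (J j ep (sg / RtoC c ^ 2) / RtoC c)) by (simpl; field; split; auto; now apply Cpow_nz).
apply (cInt_ext (fun t => / RtoC c ^ j * Jf j ep (sg / RtoC c ^ 2) (c * t)%R)).
- intros t _. unfold Jf. rewrite !RtoC_mult. replace (sg / RtoC c ^ 2 * (Ci * (RtoC c * RtoC t) ^ 2)) with (sg * (Ci * RtoC t ^ 2)) by (simpl; field; auto).
  replace (2 * Ci * RtoC ep * (RtoC c * RtoC t)) with (2 * Ci * (RtoC ep * RtoC c) * RtoC t) by ring. rewrite Cpow_mult_l. field. now apply Cpow_nz.
- apply (cInt_scal (/ RtoC c ^ j) (fun t => Jf j ep (sg / RtoC c ^ 2) (c * t)%R)). apply (cInt_comp_lin (Jf j ep (sg / RtoC c ^ 2))); auto. now apply J_spec.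
Qed.

(* The Borel transform [phi] has its singular points at [Ci * alp M k]. *)
Definition alp (M k : nat) : R := (PI * (INR k + 1) ^ 2 / INR M)%R.
Lemma alp_pos (M k : nat) : (0 < M)%nat -> (0 < alp M k)%R /\ (alp M 0 <= alp M k)%R.
Proof.
intros H. assert (T := INR_ge1 M H). assert (PP := PI_RGT_0). assert (P := pos_INR k). unfold alp. split.
apply Rdiv_lt_0_compat; [|lra]. apply Rmult_lt_0_compat; nra.
apply Rmult_le_compat_r. left; apply Rinv_0_lt_compat; lra. apply Rmult_le_compat_l; [lra|]. simpl (INR 0). nra.
Qed.
(** The factor left over when the k-th mode is expressed through [Lap (S nu)]; it is computed in
    [mode_Lap]. *)
Definition qc (M nu k : nat) : C := match nu with O => / (4 * kk k) | _ => 3 * Ci * INR M / (8 * RtoC (kk k) ^ 2) end.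
Definition mode (M nu k : nat) (ep : R) (tau : C) : C := RtoC (INR M ^ nu) * (/ om k ^ 2 * J2 nu (ep * kk k) (PI * INR M * tau)).

Lemma RtoC_kk_neq0 (k : nat) : RtoC (kk k) <> 0.
Proof. apply RtoC_neq0. assert (H := kk_pos k). lra. Qed.
Lemma alp_neq0 (M k : nat) : (0 < M)%nat -> RtoC (alp M k) <> 0.
Proof. intros H. apply RtoC_neq0. assert (T := alp_pos M k H). lra. Qed.
Lemma alp_kk (M k : nat) : (0 < M)%nat -> RtoC (alp M k) = RtoC (kk k) ^ 2 / (PI * INR M).
Proof.
intros HM. assert (T := INR_ge1 M HM). assert (PP := PI_RGT_0). rewrite <- RtoC_pow, <- RtoC_mult, <- RtoC_div by nra. f_equal. unfold alp, kk. field. lra.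
Qed.

(* The substitution [u = kk k * t]. *)
Lemma mode_eq (M nu k : nat) (ep : R) (tau : C) : (0 < M)%nat -> (nu <= 1)%nat -> (ep * ep = 1)%R -> (0 < Im tau)%R ->
  mode M nu k ep tau = match nu with
    | O => J 0 ep (tau / alp M k) / kk k + ep / (2 * Ci * kk k)
    | _ => INR M * (J 1 ep (tau / alp M k) + / 4) / RtoC (kk k) ^ 2 end.
Proof.
intros HM Hnu He Ht. assert (PP := PI_RGT_0). assert (T := INR_ge1 M HM). assert (KN := RtoC_kk_neq0 k).
assert (MN := RtoC_INR_neq0 M HM). assert (PN : RtoC PI <> 0) by (apply RtoC_neq0; lra).
assert (He' : RtoC ep * RtoC ep = 1) by (rewrite <- RtoC_mult, He; auto).
assert (EN : RtoC ep <> 0) by (intros E; rewrite E in He'; apply (f_equal Re) in He'; simpl in He'; lra).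
unfold mode. assert (SC := J_scale nu ep (kk k) (PI * INR M * tau) (kk_pos k)).
replace (PI * INR M * tau / RtoC (kk k) ^ 2) with (tau / alp M k) in SC by (rewrite alp_kk by auto; field; auto).
unfold J2. rewrite SC. 2: rewrite <- RtoC_mult, Im_mult, Re_RtoC, Im_RtoC; apply (Rmult_lt_compat_l (PI * INR M)) in Ht; nra.
rewrite om_kk, RtoC_mult. assert (C2 := Ci2). assert (CN := Ci_neq0).
replace ((2 * Ci * (ep * kk k)) ^ 2) with ((2 * Ci * kk k) ^ 2) by (transitivity ((RtoC ep * RtoC ep) * (2 * Ci * kk k) ^ 2); [rewrite He' | simpl]; ring).
destruct nu as [|[|]]; [| |lia].
- simpl (INR M ^ 0)%R. rewrite !Cpow_1_r. simpl Cpow. set (j := J 0 ep _). field. auto.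
- rewrite pow_1. set (j := J 1 ep _). replace (- (1)) with (Ci * Ci). simpl Cpow. field. auto.
Qed.

Lemma Im_quot_neg (tau : C) (a : R) : (0 < a)%R -> (0 < Im tau)%R -> (Im (RtoC a / tau) < 0)%R.
Proof.
intros Ha Ht. unfold Cdiv. rewrite Im_mult, Re_RtoC, Im_RtoC. destruct tau as [x y]. simpl in *.
replace (a * (- y / (x * (x * 1) + y * (y * 1))) + 0 * (x / (x * (x * 1) + y * (y * 1))))%R with (- (a * y * / (x * x + y * y)))%R by (field; nra).
assert (0 < / (x * x + y * y))%R by (apply Rinv_0_lt_compat; nra). assert (0 < a * y)%R by nra. nra.
Qed.

(** [Om_eq_Lap] gives the Gaussian integral as a multiple of s times [Lap 0]. Applying [Lap_rec] nu
    + 1 times raises the exponent and produces constants that cancel the boundary terms of [J2];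
    what remains is a pure Laplace transform. *)
Lemma mode_Lap (M nu k : nat) (ep : R) (tau e : C) : (0 < M)%nat -> (nu <= 1)%nat -> (ep * ep = 1)%R -> (0 < Im tau)%R ->
  dir e -> (0 < ep * Re e)%R -> (0 < Re (e * (alp M k / tau)))%R ->
  mode M nu k ep tau = match nu with O => RtoC ep | _ => 1 end * (qc M nu k * Lap (S nu) e (alp M k / tau)).
Proof.
intros HM Hnu He Ht De Hep Hre. rewrite mode_eq by auto.
destruct (alp_pos M k HM) as [A0 _]. assert (TN : tau <> 0) by now apply Im_gt0_neq0. assert (AN := alp_neq0 M k HM).
set (s := alp M k / tau) in *. assert (Is : (Im s < 0)%R) by now apply Im_quot_neg. assert (SN : s <> 0) by now apply Im_lt0_neq0.
replace (tau / alp M k) with (/ s) by (unfold s; field; auto).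
assert (O := Om_eq_Lap ep e s He De Hep Is Hre). unfold Om in O.
assert (He' : RtoC ep * RtoC ep = 1) by (rewrite <- RtoC_mult, He; auto).
assert (J0 : J 0 ep (/ s) = RtoC ep * Ci / 2 * (s * Lap 0 e s)).
{ rewrite <- O. transitivity (- (Ci * Ci) * (RtoC ep * RtoC ep) * J 0 ep (/ s)). rewrite Ci2, He'. ring. replace (-2) with (- (2))%R by ring. rewrite RtoC_opp. field. auto. }
assert (R0 := Lap_rec 0 e s De Hre). assert (R1 := Lap_rec 1 e s De Hre). simpl (INR 0) in R0. simpl (INR 1) in R1.
assert (E0 : s * Lap 0 e s = 1 - / 2 * Ci * Lap 1 e s) by (rewrite <- R0; ring).
assert (E1 : s * Lap 1 e s = 1 - (1 + / 2) * Ci * Lap 2 e s) by (transitivity ((1 + / 2) * Ci * Lap 2 e s + s * Lap 1 e s - (1 + / 2) * Ci * Lap 2 e s); [ring | rewrite R1; ring]).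
assert (KN := RtoC_kk_neq0 k). assert (CN := Ci_neq0). assert (C2 := Ci2).
destruct nu as [|[|]]; [| |lia].
- rewrite J0, E0. unfold qc. set (L := Lap 1 e s).
  transitivity (RtoC ep * (Ci * Ci + 1 - Ci * Ci * Ci * L / 2) / (2 * Ci * kk k)). field; auto. rewrite C2.
  transitivity (RtoC ep * (- - (1) * Ci * L / 2) / (2 * Ci * kk k)). field; auto. field; auto.
- assert (IB := J_ibp 0 ep (/ s) (Im_inv_pos s Is)). rewrite Jf_0 in IB. rewrite J0, E0 in IB. simpl (INR 0) in IB.
  assert (J1 : J 1 ep (/ s) = - / 4 * (s * Lap 1 e s)).
  { transitivity (s / (2 * Ci) * (2 * Ci * / s * J 1 ep (/ s))). field; auto.
    assert (IB2 : 2 * Ci * / s * J 1 ep (/ s) = - (1) - Ci * Ci * (RtoC ep * RtoC ep) * (1 - / 2 * Ci * Lap 1 e s)) by (rewrite <- IB; field; auto).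
    rewrite IB2, C2, He'. field; auto. }
  rewrite J1, E1. unfold qc. simpl Cpow. field. auto.
Qed.

Lemma RtoC_m1 : RtoC (-1) = - (1).
Proof. apply Ceq; simpl; ring. Qed.
(** [gauss_full] at sigma = tau / alp, where exp (-i / sigma) is the theta exponential at -1/tau and
    sigma^(-1/2) yields the power of tau. For nu = 0 the sum of both half-line integrals occurs; for
    nu = 1 the first moments are subtracted, and integration by parts brings their difference back
    to that sum with one more factor 1 / tau. *)
Lemma mode_modular (M nu k : nat) (tau : C) : (0 < M)%nat -> (nu <= 1)%nat -> (0 < Im tau)%R ->
  Ci ^ nu * powH tau (- (1 / 2) - INR nu) * (RtoC (INR (S k)) ^ nu * cexp (Ci * PI * RtoC (INR (S k)) ^ 2 * (- / tau) / INR M))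
  = sqrt (INR M) * (mode M nu k 1 tau - sgz nu * mode M nu k (-1) tau).
Proof.
intros HM Hnu Ht. rewrite !mode_eq by (auto; ring).
destruct (alp_pos M k HM) as [A0 _]. assert (TN : tau <> 0) by now apply Im_gt0_neq0. assert (AN := alp_neq0 M k HM).
assert (PP := PI_RGT_0). assert (M1 := INR_ge1 M HM). assert (KP := kk_pos k). assert (KN := RtoC_kk_neq0 k). assert (MN := RtoC_INR_neq0 M HM).
destruct (argH_bounds tau Ht) as [AB _].
(* A logarithm of tau / alp with imaginary part arg tau in (0, PI), as [gauss_full] requires; it
   fixes the branch of the square root. *)
set (z := logH tau - RtoC (ln (alp M k))).
assert (Ez : cexp z = tau / alp M k).
{ unfold z. replace (logH tau - RtoC (ln (alp M k))) with (logH tau + - RtoC (ln (alp M k))) by ring.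
  rewrite cexp_add, cexp_opp, cexp_logH, cexp_RtoC, exp_ln by auto. reflexivity. }
assert (Iz : (0 < Im z < PI)%R) by (unfold z; rewrite Im_minus, Im_RtoC; simpl; lra).
assert (G := gauss_full z Iz). rewrite Ez in G.
set (L := cexp (- (/ 2 * logH tau))). set (q := cexp (Ci * PI / 4)). set (w := cexp (- (Ci * (alp M k / tau)))).
assert (Eh : cexp (- (/ 2 * z + Ci * cexp (- z))) = L * sqrt (alp M k) * w).
{ replace (- (/ 2 * z + Ci * cexp (- z))) with (- (/ 2 * logH tau) + RtoC (/ 2 * ln (alp M k)) + - (Ci * (alp M k / tau))).
  rewrite !cexp_add. fold L w. rewrite cexp_RtoC. do 3 f_equal. rewrite <- Rpower_sqrt by auto. reflexivity.
  rewrite cexp_opp, Ez, RtoC_mult, RtoC_inv by lra. unfold z. field. auto. }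
rewrite Eh in G. fold q in G.
assert (QQ : q * q = Ci).
{ transitivity (cexp (Ci * PI / 2)); [|apply cexp_iPI2]. unfold q. rewrite <- cexp_add. f_equal. replace (RtoC 4) with (RtoC (2 + 2)) by (do 2 f_equal; ring). rewrite RtoC_plus. field. }
assert (SQ : RtoC (sqrt (INR M)) * (RtoC (sqrt PI) * RtoC (sqrt (alp M k))) = RtoC (kk k)).
{ rewrite <- !RtoC_mult. f_equal. rewrite <- !sqrt_mult by nra. replace (INR M * (PI * alp M k))%R with (kk k * kk k)%R by (unfold alp, kk; field; lra). apply sqrt_square; lra. }
assert (EX : cexp (Ci * PI * RtoC (INR (S k)) ^ 2 * (- / tau) / INR M) = w).
{ unfold w. f_equal. rewrite S_INR, RtoC_plus. unfold alp. rewrite RtoC_div, RtoC_mult, RtoC_pow, RtoC_plus by lra. field. auto. }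
rewrite EX. unfold powH.
assert (P0 : forall u, cexp ((- (1 / 2) - u) * (logH tau - Ci * PI / 2)) = L * q * cexp (- u * (logH tau - Ci * PI / 2))).
{ intros u. unfold L, q. rewrite <- !cexp_add. f_equal. replace (RtoC 4) with (RtoC (2 * 2)) by (do 2 f_equal; ring). rewrite RtoC_mult. field. }
rewrite P0. set (j0 := J 0 1 (tau / alp M k)) in *. set (j1 := J 0 (-1) (tau / alp M k)) in *.
assert (CN := Ci_neq0).
destruct nu as [|[|]]; [| |lia].
- simpl (INR 0). replace (- 0 * (logH tau - Ci * PI / 2)) with (RtoC 0) by ring. rewrite cexp_0. unfold sgz. simpl Cpow.
  transitivity (sqrt (INR M) * (j0 + j1) / kk k). 2: rewrite RtoC_m1; field; auto. rewrite G.
  transitivity ((sqrt (INR M) * (sqrt PI * sqrt (alp M k))) * (q * L * w) / kk k). rewrite SQ. field; auto. unfold Cdiv; ring.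
- assert (Is : (0 < Im (tau / alp M k))%R) by (rewrite <- Ez; now apply Im_cexp_pos).
  assert (I1 := J_ibp 0 1 _ Is). assert (I2 := J_ibp 0 (-1) _ Is). rewrite Jf_0 in I1, I2. simpl (INR 0) in I1, I2. fold j0 in I1. fold j1 in I2.
  set (k0 := J 1 1 (tau / alp M k)) in *. set (k1 := J 1 (-1) (tau / alp M k)) in *.
  assert (KD : k0 - k1 = - (alp M k / tau) * (j0 + j1)).
  { transitivity (alp M k / tau / (2 * Ci) * (2 * Ci * (tau / alp M k) * k0 - 2 * Ci * (tau / alp M k) * k1)). field; auto.
    replace (2 * Ci * (tau / alp M k) * k0) with (- (1) - 2 * Ci * 1 * j0) by (rewrite <- I1; ring).
    replace (2 * Ci * (tau / alp M k) * k1) with (- (1) - 2 * Ci * RtoC (-1) * j1) by (rewrite <- I2; ring). rewrite RtoC_m1. field; auto. }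
  unfold sgz. simpl (INR 1). rewrite !Cpow_1_r.
  replace (- (1) * (logH tau - Ci * PI / 2)) with (- logH tau + Ci * PI / 2) by ring. rewrite cexp_add, cexp_iPI2, cexp_opp, cexp_logH by auto.
  transitivity (sqrt (INR M) * (INR M * (k0 - k1)) / RtoC (kk k) ^ 2). 2: rewrite RtoC_m1; simpl Cpow; field; auto. rewrite KD, G.
  transitivity ((sqrt (INR M) * (sqrt PI * sqrt (alp M k))) * (- (INR M * alp M k) / RtoC (kk k) ^ 2) / tau * (q * L * w)).
  2: simpl Cpow; field; auto. rewrite SQ, alp_kk by auto.
  assert (KS : RtoC (kk k) = PI * INR (S k)) by (unfold kk; rewrite S_INR, RtoC_mult; auto).
  assert (PN : RtoC PI <> 0) by (apply RtoC_neq0; lra).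
  transitivity ((Ci * Ci) * (INR (S k) * (L * q * w) / tau)). field; auto. rewrite Ci2, KS. simpl Cpow. field. repeat split; auto. apply RtoC_neq0. assert (P := INR_S_gt0 k). simpl in P. lra.
Qed.

Definition Qc (M nu : nat) (g : Z -> C) (k : nat) : C := 2 * sqrt (INR M) * DFT M g (Z.of_nat (S k)) * qc M nu k.
(** In both cases of [theta_data] the matrix acts on F as the transform acts on each component, so
    the obstruction splits into statements about one periodic function and its transform. *)
Definition scalar_obstruction (sgn : C) (M nu : nat) (g : Z -> C) (tau : C) : C :=
  Theta M nu g tau + sgn * Ci ^ nu * powH tau (- (1 / 2) - INR nu) * Theta M nu (DFT M g) (- / tau)
  + INR M * mean M g / (2 * PI * Ci * tau).

Lemma scalar_obstruction_mode (sgn : C) (M nu : nat) (g : Z -> C) (tau : C) : (0 < M)%nat -> (nu <= 1)%nat -> periodic M g -> parity nu g -> (0 < Im tau)%R ->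
  is_cseries
   (fun k => sqrt (INR M) * DFT M g (Z.of_nat (S k)) * ((1 + sgn) * mode M nu k 1 tau + (1 - sgn) * (sgz nu * mode M nu k (-1) tau)))
   (scalar_obstruction sgn M nu g tau - Theta_tilde M nu g 0).
Proof.
intros HM Hnu Hg Hp Ht. assert (A := theta_transform M nu g tau HM Hnu Hg Hp Ht). cbv zeta in A.
assert (T2 : (0 < Im (- / tau))%R).
{ assert (N := Im_gt0_neq0 tau Ht). rewrite Im_opp. assert (B := Im_quot_neg tau 1 ltac:(lra) Ht). replace (1 / tau) with (/ tau) in B by (field; auto). lra. }
assert (B := CSeries_correct _ (Theta_series M nu (DFT M g) (- / tau) HM (DFT_periodic M g HM) T2)).
apply (is_series_scalC (sgn * Ci ^ nu * powH tau (- (1 / 2) - INR nu))) in B.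
assert (S := is_series_plus (K := C_AbsRing) (V := C_NormedModule) _ _ _ _ A B).
match type of S with is_series _ (plus ?a ?b) => replace (scalar_obstruction sgn M nu g tau - Theta_tilde M nu g 0) with (a + b) by (unfold scalar_obstruction, Theta; ring) end.
eapply is_series_extC; [|exact S]. clear A B S. intros k. cbv beta. match goal with |- plus ?a ?b = _ => change (plus a b) with (Cplus a b) end.
assert (XM := mode_modular M nu k tau HM Hnu Ht).
match goal with |- ?l = ?r => change (@eq C l r) end.
transitivity (sqrt (INR M) * DFT M g (Z.of_nat (Datatypes.S k)) * (RtoC (INR M ^ nu) * (/ om k ^ 2 * (J2 nu (kk k) (PI * INR M * tau) + sgz nu * J2 nu (- kk k) (PI * INR M * tau))))
 + sgn * DFT M g (Z.of_nat (Datatypes.S k)) * (Ci ^ nu * powH tau (- (1 / 2) - INR nu) * (RtoC (INR (Datatypes.S k)) ^ nu * cexp (Ci * PI * RtoC (INR (Datatypes.S k)) ^ 2 * (- / tau) / INR M)))).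
cring. rewrite XM. unfold mode. rewrite Rmult_1_l. replace (-1 * kk k)%R with (- kk k)%R by ring. cring.
Qed.

Lemma sgz_0 : sgz 0 = - (1).
Proof. unfold sgz. rewrite Cpow_1_r. apply RtoC_m1. Qed.
Lemma sgz_1 : sgz 1 = 1.
Proof. unfold sgz. rewrite RtoC_m1. simpl. ring. Qed.

(** One coefficient [Qc] serves both signs: for ep = -1 the parity sign [sgz nu] cancels the sign
    produced by [mode_Lap]. This is why G_+ and G_- are Laplace transforms of the same function. *)
Lemma scalar_obstruction_Lap (ep : R) (M nu : nat) (g : Z -> C) (tau e : C) : (0 < M)%nat -> (nu <= 1)%nat -> periodic M g -> parity nu g -> (0 < Im tau)%R ->
  (ep = 1 \/ ep = -1)%R -> dir e -> (0 < ep * Re e)%R -> (0 < Re (e * / tau))%R ->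
  is_cseries
   (fun k => Qc M nu g k * Lap (S nu) e (alp M k / tau)) (scalar_obstruction ep M nu g tau - Theta_tilde M nu g 0).
Proof.
intros HM Hnu Hg Hp Ht He De Hep Hre. eapply is_series_extC; [|apply (scalar_obstruction_mode ep M nu g tau HM Hnu Hg Hp Ht)].
intros k. cbv beta. match goal with |- ?l = ?r => change (@eq C l r) end.
assert (Hk : (0 < Re (e * (alp M k / tau)))%R).
{ replace (e * (alp M k / tau)) with (RtoC (alp M k) * (e * / tau)) by (unfold Cdiv; ring). rewrite Re_mult, Re_RtoC, Im_RtoC.
  destruct (alp_pos M k HM). nra. }
assert (XL := mode_Lap M nu k ep tau e HM Hnu ltac:(destruct He as [-> | ->]; ring) Ht De Hep Hk).
unfold Qc. destruct He as [-> | ->].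
- rewrite XL. destruct nu as [|[|]]; [| |lia]; ring.
- rewrite XL, RtoC_m1. destruct nu as [|[|]]; [rewrite sgz_0 | rewrite sgz_1 |lia]; ring.
Qed.

(** * The Borel transform *)

(** The division by [alp M k] comes from the substitution that scales the singular point of the k-th
    term from i to i alp. *)
Definition Dc (M nu : nat) (g : Z -> C) (k : nat) : C := Qc M nu g k / alp M k.
Definition phi (M nu : nat) (g : Z -> C) (xi : C) : C := CSeries (fun k => Dc M nu g k * kap (S nu) (1 + Ci * (xi / alp M k))).

Lemma Cmod_qc (M nu k : nat) : (0 < M)%nat -> (nu <= 1)%nat -> (Cmod (qc M nu k) <= INR M)%R.
Proof.
intros HM Hnu. assert (M1 := INR_ge1 M HM). assert (K1 : (1 <= kk k)%R) by (unfold kk; assert (P := pos_INR k); assert (T := PI2_1); nra).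
destruct nu as [|[|]]; [| |lia]; unfold qc.
- eapply Rle_trans; [|exact M1]. rewrite <- Rinv_1. apply Cmod_inv_le. lra. rewrite <- RtoC_mult, Cmod_RtoC_pos; lra.
- unfold Cdiv. rewrite !Cmod_mult. replace (Cmod Ci) with 1%R by (unfold Cmod; simpl; rewrite <- sqrt_1 at 1; f_equal; ring).
  rewrite (Cmod_RtoC_pos 3), (Cmod_RtoC_pos (INR M)) by lra.
  assert (H : (Cmod (/ (8 * RtoC (kk k) ^ 2)) <= / 8)%R).
  { apply Cmod_inv_le. lra. rewrite <- RtoC_pow, <- RtoC_mult, Cmod_RtoC_pos; nra. }
  assert (N := Cmod_ge_0 (/ (8 * RtoC (kk k) ^ 2))). nra.
Qed.
Lemma Dc_bound (M nu : nat) (g : Z -> C) : (0 < M)%nat -> (nu <= 1)%nat -> exists K, (0 < K)%R /\ forall k, (Cmod (Dc M nu g k) <= K * sqw k)%R.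
Proof.
intros HM Hnu. assert (M1 := INR_ge1 M HM). destruct (periodic_bounded M (DFT M g) HM (DFT_periodic M g HM)) as [B [B0 HB]].
destruct (sqrtM M HM) as [S0 _]. assert (PP := PI2_1).
exists (2 * sqrt (INR M) * (B + 1) * INR M * INR M)%R. split. repeat apply Rmult_lt_0_compat; lra.
intros k. unfold Dc, Qc, Cdiv. rewrite !Cmod_mult, (Cmod_RtoC_pos 2), (Cmod_RtoC_pos (sqrt _)) by lra.
assert (H1 := HB (Z.of_nat (S k))). assert (H2 := Cmod_qc M nu k HM Hnu).
assert (H3 : (Cmod (/ alp M k) <= INR M * sqw k)%R).
{ rewrite <- RtoC_inv by (assert (T := alp_pos M k HM); lra). assert (P := pos_INR k).
  rewrite Cmod_RtoC_pos by (left; apply Rinv_0_lt_compat, alp_pos, HM). unfold alp, sqw.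
  replace (INR M * / (INR k + 1) ^ 2)%R with (/ (1 * (INR k + 1) ^ 2 / INR M))%R by (field; lra).
  apply Rinv_le_contravar. apply Rdiv_lt_0_compat; nra. apply Rmult_le_compat_r. left; apply Rinv_0_lt_compat; lra. apply Rmult_le_compat_r; nra. }
assert (N1 := Cmod_ge_0 (DFT M g (Z.of_nat (S k)))). assert (N2 := Cmod_ge_0 (qc M nu k)). assert (N3 := Cmod_ge_0 (/ alp M k)).
replace (2 * sqrt (INR M) * (B + 1) * INR M * INR M * sqw k)%R with (2 * sqrt (INR M) * (B + 1) * INR M * (INR M * sqw k))%R by ring.
repeat apply Rmult_le_compat; auto; try lra; repeat apply Rmult_le_pos; lra.
Qed.
Lemma Dc_series (M nu : nat) (g : Z -> C) : (0 < M)%nat -> (nu <= 1)%nat -> ex_series (fun k => Cmod (Dc M nu g k)).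
Proof.
intros HM Hnu. destruct (Dc_bound M nu g HM Hnu) as [K [_ HK]]. apply ex_series_leR with (fun k => K * sqw k)%R.
intros; split; auto; apply Cmod_ge_0. apply ex_series_scalR, sqw_series.
Qed.

(** The radius allowed by the nearest singular point k = 0; it serves every term, because the other
    [alp M k] are larger. *)
Definition rad (M : nat) (eps : R) : R := (alp M 0 * (sqrt (eps / 2) * (sqrt (eps / 16) / 4)))%R.
Lemma rad_pos (M : nat) (eps : R) : (0 < M)%nat -> (0 < eps)%R -> (0 < rad M eps)%R.
Proof.
intros HM He. unfold rad. destruct (alp_pos M 0 HM). apply Rmult_lt_0_compat; auto.
apply Rmult_lt_0_compat. apply sqrt_lt_R0; lra. apply Rdiv_lt_0_compat; [|lra]. apply sqrt_lt_R0; lra.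
Qed.
Definition phiB (M nu : nat) (g : Z -> C) (eps : R) : R := Series (fun k => Cmod (Dc M nu g k) * (2 ^ S (S nu) * kapK (S nu) eps))%R.
(** Neither the radius nor the bound depends on t. Analyticity, continuity and boundedness of [phi]
    along the ray all follow from this one statement. *)
Lemma phi_wien (M nu : nat) (g : Z -> C) (eps : R) (e : C) (t : R) : (0 < M)%nat -> (nu <= 1)%nat ->
  Cmod e = 1%R -> (Im e <= 1 - eps)%R -> (0 < eps <= 1)%R -> (0 <= t)%R ->
  wien_le (phi M nu g) (t * e) (rad M eps) (phiB M nu g eps).
Proof.
intros HM Hnu He Ie Heps Ht. unfold phiB.
apply (wien_le_sum (fun k xi => Dc M nu g k * kap (S nu) (1 + Ci * (xi / alp M k)))).
- intros k. apply wien_le_scal. destruct (alp_pos M k HM) as [A0 A1]. apply wien_le_kap_scaled; auto. apply rad_pos; auto; lra.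
  unfold rad. apply Rmult_le_compat_r; auto. assert (R := rad_pos M eps HM ltac:(lra)). unfold rad in R. destruct (alp_pos M 0 HM) as [B0 _]. nra.
- apply (ex_series_ext (fun k => (2 ^ S (S nu) * kapK (S nu) eps) * Cmod (Dc M nu g k))%R). intros; apply Rmult_comm. now apply ex_series_scalR, Dc_series.
- intros; reflexivity.
Qed.

Lemma phi_bound (M nu : nat) (g : Z -> C) (eps : R) (e : C) (t : R) : (0 < M)%nat -> (nu <= 1)%nat ->
  Cmod e = 1%R -> (Im e <= 1 - eps)%R -> (0 < eps <= 1)%R -> (0 <= t)%R -> (Cmod (phi M nu g (t * e)) <= phiB M nu g eps)%R.
Proof.
intros HM Hnu He Ie Heps Ht. assert (R := rad_pos M eps HM ltac:(lra)).
apply (wien_le_bound _ _ _ _ _ (phi_wien M nu g eps e t HM Hnu He Ie Heps Ht)).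
replace (t * e - t * e) with (RtoC 0) by ring. rewrite Cmod_0. lra.
Qed.

Lemma wien_dilate (f : C -> C) (r rho : R) (a : nat -> C) (c : C) : (0 < r)%R -> (Cmod c * r <= rho)%R -> wien f 0 rho a ->
  wien (fun z => f (c * z)) 0 r (fun k => a k * c ^ k) /\ (wnorm (fun k => a k * c ^ k)%C r <= wnorm a rho)%R.
Proof.
intros Hr Hc [R0 [E F]]. assert (N := Cmod_ge_0 c).
assert (T : forall k, (0 <= Cmod (a k * c ^ k) * r ^ k <= Cmod (a k) * rho ^ k)%R).
{ intros k. split. apply (wnorm_term_ge0 (fun k => a k * c ^ k)); lra. rewrite Cmod_mult, Cmod_pow, Rmult_assoc, <- Rpow_mult_distr.
  apply Rmult_le_compat_l. apply Cmod_ge_0. apply pow_incr. split; auto. apply Rmult_le_pos; lra. }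
split. split; [|split]; auto. now apply ex_series_leR with (fun k => Cmod (a k) * rho ^ k)%R.
intros z Hz. rewrite F. apply CSeries_ext. intros k. replace (c * z - 0) with (c * (z - 0)) by ring. rewrite Cpow_mult_l. ring.
replace (c * z - 0) with (c * (z - 0)) by ring. rewrite Cmod_mult. apply Rle_trans with (Cmod c * r)%R; auto. apply Rmult_le_compat_l; auto.
apply Series_le; auto.
Qed.

Definition phi_coef (M nu : nat) (g : Z -> C) (q : nat) : C :=
  CSeries (fun k => Dc M nu g k * (RtoC (kc (S nu) q) * (- Ci / alp M k) ^ q)).
(** The k-th term is the series of (1 - w)^(-nu-3/2) at w = -i xi / alp. A quarter of the smallest
    [alp] keeps |w| <= 1/4 for all k, within the disc of [wien_le_kap_poly], and the norms are
    summable with [Dc]. *)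
Lemma phi_germ (M nu : nat) (g : Z -> C) : (0 < M)%nat -> (nu <= 1)%nat -> wien (phi M nu g) 0 (alp M 0 / 4) (phi_coef M nu g).
Proof.
intros HM Hnu. destruct (wien_le_kap_poly (S nu)) as [a [Wa [Na Ha]]]. destruct (alp_pos M 0 HM) as [A0 _].
assert (C1 : csqrt 1 = 1 /\ slit 1).
{ destruct (csqrt_unique 1 1 ltac:(ring) ltac:(simpl; lra)). auto. }
destruct C1 as [C1 SL].
assert (W : forall k, wien (fun xi => Dc M nu g k * kap (S nu) (1 + Ci * (xi / alp M k))) 0 (alp M 0 / 4) (fun q => Dc M nu g k * (RtoC (kc (S nu) q) * (- Ci / alp M k) ^ q)) /\
  (wnorm (fun q => Dc M nu g k * (RtoC (kc (S nu) q) * (- Ci / alp M k) ^ q))%C (alp M 0 / 4) <= Cmod (Dc M nu g k) * 2 ^ S (S nu))%R).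
{ intros k. destruct (alp_pos M k HM) as [Ak A1]. assert (AN := alp_neq0 M k HM).
  assert (CA : Cmod (- Ci / alp M k) = (/ alp M k)%R).
  { unfold Cdiv. rewrite Cmod_mult, Cmod_opp, <- RtoC_inv by lra. rewrite Cmod_RtoC_pos by (left; now apply Rinv_0_lt_compat).
    replace (Cmod Ci) with 1%R by (unfold Cmod; simpl; rewrite <- sqrt_1 at 1; f_equal; ring). ring. }
  destruct (wien_dilate (fun w => (/ (1 - w)) ^ S nu * Sfun w) (alp M 0 / 4) (/ 4) a (- Ci / alp M k) ltac:(lra)) as [[R1 [W1 W2]] W3]; auto.
  { rewrite CA. unfold Rdiv. rewrite <- Rmult_assoc. rewrite <- (Rmult_1_l (/ 4)) at 2. apply Rmult_le_compat_r; [lra|].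
    apply (Rmult_le_reg_l (alp M k)); auto. rewrite <- Rmult_assoc, Rinv_r, Rmult_1_l, Rmult_1_r by lra. auto. }
  assert (EQ : forall q, Cmod (Dc M nu g k * (RtoC (kc (S nu) q) * (- Ci / alp M k) ^ q)) = (Cmod (Dc M nu g k) * Cmod (a q * (- Ci / alp M k) ^ q))%R) by (intros q; rewrite Ha, Cmod_mult; auto).
  split. split; [|split]; auto.
  - apply (ex_series_ext (fun q => Cmod (Dc M nu g k) * (Cmod (a q * (- Ci / alp M k) ^ q) * (alp M 0 / 4) ^ q))%R).
    intros q. rewrite EQ. symmetry; apply Rmult_assoc. now apply ex_series_scalR.
  - intros z Hz. assert (SUM : summ (fun q => a q * (- Ci / alp M k) ^ q * (z - 0) ^ q)) by (apply (wien_summ (fun z => (/ (1 - - Ci / alp M k * z)) ^ S nu * Sfun (- Ci / alp M k * z)) 0 (alp M 0 / 4) (fun q => a q * (- Ci / alp M k) ^ q)); auto; split; auto).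
    transitivity (Dc M nu g k * CSeries (fun q => a q * (- Ci / alp M k) ^ q * (z - 0) ^ q)).
    + f_equal. rewrite <- W2 by auto.
      assert (KL := kap_local (S nu) 1 (- Ci / alp M k * z) 1 SL ltac:(lra)). rewrite C1, Cmod_1, Re_RtoC in KL.
      destruct KL as [_ KL]; [lra| |].
      { rewrite Cmod_mult, CA. replace (z - 0) with z in Hz by ring. apply Rle_trans with (/ alp M k * (alp M 0 / 4))%R. apply Rmult_le_compat_l; auto. left; now apply Rinv_0_lt_compat.
        apply (Rmult_le_reg_l (alp M k)); auto. rewrite <- Rmult_assoc, Rinv_r, Rmult_1_l by lra. lra. }
      rewrite kap_1, !Cmult_1_l in KL. rewrite <- KL. f_equal. field. auto.
    + rewrite <- CSeries_scal by auto. apply CSeries_ext. intros q. rewrite Ha. ring.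
  - unfold wnorm. rewrite (Series_ext _ (fun q => Cmod (Dc M nu g k) * (Cmod (a q * (- Ci / alp M k) ^ q) * (alp M 0 / 4) ^ q))%R).
    rewrite Series_scal_l. apply Rmult_le_compat_l. apply Cmod_ge_0. eapply Rle_trans; [exact W3|]. exact Na.
    intros q. rewrite EQ. apply Rmult_assoc. }
apply (wien_sum (fun k xi => Dc M nu g k * kap (S nu) (1 + Ci * (xi / alp M k))) (phi M nu g) 0 (alp M 0 / 4)
  (fun k q => Dc M nu g k * (RtoC (kc (S nu) q) * (- Ci / alp M k) ^ q))).
- intros k; apply W.
- apply ex_series_leR with (fun k => 2 ^ S (S nu) * Cmod (Dc M nu g k))%R. intros k. split. eapply wnorm_ge0, W. rewrite Rmult_comm. apply W.
  now apply ex_series_scalR, Dc_series.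
- intros; reflexivity.
Qed.

(** Termwise integration, by the uniform bound of the kernel along the ray and the summability of
    [Dc]; rescaling t by [alp M k] turns each term into [Lap]. *)
Lemma phi_laplace (M nu : nat) (g : Z -> C) (e s : C) : (0 < M)%nat -> (nu <= 1)%nat -> dir e -> (0 < Re (e * s))%R ->
  exists V, cInt (fun t => phi M nu g (t * e) * e * cexp (s * - (t * e))) V /\
  is_cseries (fun k => Qc M nu g k * Lap (S nu) e (alp M k * s)) V.
Proof.
intros HM Hnu De Hs. destruct (dir_eps e De) as [eps [Heps Ie]]. assert (Ce := proj1 De).
set (F := fun t => phi M nu g (t * e) * e * cexp (s * - (t * e))).
assert (HF : cInt F (Int F)).
{ apply (expdom_cInt F (phiB M nu g eps) (Re (e * s))). split; auto. split.
  - intros t Ht. unfold F. apply ccont_mult. apply ccont_mult. eapply wien_le_ccont_ray. apply phi_wien; eauto. apply ccont_const. apply ccont_lap_exp.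
  - intros t Ht. unfold F. rewrite !Cmod_mult, Cmod_lap_exp, Ce, Rmult_1_r. apply Rmult_le_compat_r. left; apply exp_pos. now apply phi_bound. }
exists (Int F). split; auto.
destruct (kap_ray_bounded (S nu) e De) as [K [K0 HK]].
apply (cInt_series (fun k t => Dc M nu g k * (kap (S nu) (1 + Ci * ((t * e) / alp M k)) * e * cexp (s * - (t * e)))) _ F _ (fun k => K * Cmod (Dc M nu g k))%R (Re (e * s))); auto.
- intros k. destruct (alp_pos M k HM) as [Ak _]. assert (AN := alp_neq0 M k HM).
  assert (Hk : (0 < Re (e * (alp M k * s)))%R).
  { replace (e * (alp M k * s)) with (RtoC (alp M k) * (e * s)) by ring. rewrite Re_mult, Re_RtoC, Im_RtoC. nra. }
  destruct (Lap_spec (S nu) e (alp M k * s) De Hk) as [LS _].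
  apply (cInt_comp_lin _ _ (/ alp M k)) in LS. 2: now apply Rinv_0_lt_compat.
  replace (Qc M nu g k * Lap (S nu) e (alp M k * s)) with (Dc M nu g k * (Lap (S nu) e (alp M k * s) / RtoC (/ alp M k))).
  2:{ unfold Dc. rewrite RtoC_inv by lra. field. auto. }
  apply cInt_scal. eapply cInt_ext; [|exact LS]. intros t _. cbv beta. unfold zray. rewrite RtoC_mult, RtoC_inv by lra.
  replace (alp M k * s * - (/ alp M k * t * e)) with (s * - (t * e)) by (field; auto). do 4 f_equal. field. auto.
- now apply ex_series_scalR, Dc_series.
- intros k t Ht. destruct (alp_pos M k HM) as [Ak _]. assert (AN := alp_neq0 M k HM).
  rewrite !Cmod_mult, Cmod_lap_exp, Ce, Rmult_1_r. replace (K * Cmod (Dc M nu g k) * exp (- (Re (e * s) * t)))%R with (Cmod (Dc M nu g k) * (K * exp (- (Re (e * s) * t))))%R by ring.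
  apply Rmult_le_compat_l. apply Cmod_ge_0. apply Rmult_le_compat_r. left; apply exp_pos.
  replace (1 + Ci * (t * e / alp M k)) with (zray e (t / alp M k)). apply HK. apply Rdiv_le_0_compat; lra.
  unfold zray. rewrite RtoC_div by lra. field. auto.
- intros t Ht. unfold F, phi. rewrite <- Cmult_assoc, Cmult_comm.
  rewrite <- CSeries_scal. apply CSeries_ext. intros k. ring.
  apply summ_le with (fun k => K * Cmod (Dc M nu g k))%R. 2: now apply ex_series_scalR, Dc_series.
  intros k. rewrite Cmod_mult, Rmult_comm. apply Rmult_le_compat_r. apply Cmod_ge_0.
  destruct (alp_pos M k HM) as [Ak _]. replace (1 + Ci * (t * e / alp M k)) with (zray e (t / alp M k)). apply HK. apply Rdiv_le_0_compat; lra.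
  unfold zray. rewrite RtoC_div by lra. field. now apply alp_neq0.
Qed.

(** Replacing B_(m+1) by its Fourier series gives the transform at -k and at k with relative sign
    (-1)^(m+1). The condition on m makes both contributions equal, hence the factor 2. *)
Lemma L_ext_fourier (M nu m : nat) (g : Z -> C) : (0 < M)%nat -> (1 <= m)%nat -> periodic M g -> parity nu g ->
  (- (1)) ^ S m = sgz nu ->
  is_cseries
   (fun k => RtoC (INR M ^ m * INR (fact m)) * (2 * sgz nu * sqrt (INR M) * DFT M g (Z.of_nat (S k)) / om k ^ S m)) (L_ext M g (- INR m)).
Proof.
intros HM Hm Hg Hp Sg. assert (M1 := INR_ge1 M HM). assert (MN := RtoC_INR_neq0 M HM).
set (x0 := fun a => (INR (S a) / INR M)%R).
assert (HX : forall a, (a < M)%nat -> (0 <= x0 a <= 1)%R).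
{ intros a Ha. unfold x0. assert (P := INR_S_gt0 a). assert (L : (INR (S a) <= INR M)%R) by (apply le_INR; lia). split.
  left; apply Rdiv_lt_0_compat; lra. apply (Rmult_le_reg_r (INR M)); [lra|]. unfold Rdiv. rewrite Rmult_assoc, Rinv_l; lra. }
rewrite L_ext_value by auto. match goal with |- is_series _ (- ?a * ?b) => replace (- a * b) with (a * (- (1) * b)) by ring end.
apply is_series_scalC. rewrite <- Csum_scal.
rewrite (Csum_ext _ (fun a => g (Z.of_nat (S a)) * Pf (S m) (x0 a))).
2:{ intros a Ha. fold (x0 a). rewrite nbern_fourier by (auto; lia). ring. }
apply (is_series_extC (fun k => Csum (fun a => g (Z.of_nat (S a)) * pf (S m) k (x0 a)) M)).
- intros k.
  assert (DK : forall a, cexp (- om k * x0 a) = dker M (S a) (Z.of_nat (S k)) /\ cexp (om k * x0 a) = dker M (S a) (- Z.of_nat (S k))).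
  { intros a. unfold dker, x0, om. rewrite opp_IZR, <- INR_IZR_INZ, (S_INR k), RtoC_div, RtoC_opp, RtoC_plus by lra. split; f_equal; field; auto. }
  assert (ON := om_neq0 k). assert (PN : om k ^ S m <> 0) by now apply Cpow_nz.
  rewrite (Csum_ext _ (fun a => / om k ^ S m * (g (Z.of_nat (S a)) * dker M (S a) (- Z.of_nat (S k))) + sgz nu / om k ^ S m * (g (Z.of_nat (S a)) * dker M (S a) (Z.of_nat (S k))))).
  rewrite Csum_plus, !Csum_scal, !DFT_sum1 by auto. rewrite (DFT_parity M nu g HM Hg Hp (Z.of_nat (S k))). field; auto.
  intros a _. unfold pf. destruct (DK a) as [-> ->]. replace (- om k) with (- (1) * om k) by ring. rewrite Cpow_mult_l, Sg.
  assert (SN : sgz nu <> 0) by (intros E; assert (Q := sgz_sqr nu); rewrite E in Q; apply (f_equal Re) in Q; simpl in Q; lra).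
  replace (/ (sgz nu * om k ^ S m)) with (sgz nu / om k ^ S m). ring.
  transitivity ((sgz nu * sgz nu) / (sgz nu * om k ^ S m)). field; auto. rewrite sgz_sqr. field; auto.
- apply (is_series_Csum (fun a k => g (Z.of_nat (S a)) * pf (S m) k (x0 a))). intros a Ha. apply is_series_scalC.
  apply CSeries_correct, pf_summ. lia.
Qed.

Lemma sgn_pow (q nu : nat) : (- (1)) ^ S (2 * S q + nu) = sgz nu.
Proof.
unfold sgz. rewrite RtoC_m1. replace (S (2 * S q + nu)) with (2 * S q + S nu)%nat by lia. rewrite Cpow_add_r, Cpow_mult_r.
replace ((- (1)) ^ 2) with (RtoC 1) by (simpl; ring). rewrite Cpow_1_l. ring.
Qed.

(** Compares the k-th Fourier term of L(-2(q+1)-nu) with the k-th term of the Taylor coefficient of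
    order q. The identity splits into the q-th power of a geometric factor and a factorial factor;
    the quotient (2q + 2 + nu)! / ((q + 1)! q!) is rewritten through [sb q], and [kc_1] or [kc_2]
    recognises the coefficient for the exponent nu + 3/2. *)
Lemma coef_identity (M nu q k : nat) (gh : C) : (0 < M)%nat -> (nu <= 1)%nat ->
  / INR (fact (S q)) * (RtoC (INR M ^ (2 * S q + nu) * INR (fact (2 * S q + nu))) * (2 * sgz nu * sqrt (INR M) * gh / om k ^ S (2 * S q + nu))) * (PI * Ci / INR M) ^ S q / INR (fact q)
  = 2 * sqrt (INR M) * gh * qc M nu k / alp M k * (RtoC (kc (S nu) q) * (- Ci / alp M k) ^ q).
Proof.
intros HM Hnu. assert (M1 := INR_ge1 M HM). assert (MN := RtoC_INR_neq0 M HM). assert (KN := RtoC_kk_neq0 k). assert (CN := Ci_neq0). assert (PP := PI_RGT_0).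
assert (PN : RtoC PI <> 0) by (apply RtoC_neq0; lra).
assert (F0 : RtoC (INR (fact q)) <> 0) by (apply RtoC_neq0; assert (F := INR_fact_pos q); lra).
assert (Q1 := RtoC_S_neq0 q).
assert (SB := sb_fact q).
assert (F2 : INR (fact (2 * S q)) = ((2 * INR q + 2) * (2 * INR q + 1) * (sb q * (INR (fact q) * INR (fact q) * 4 ^ q)))%R).
{ rewrite SB. replace (2 * S q)%nat with (S (S (2 * q))) by lia. rewrite !INR_fact_S, S_INR, mult_INR. simpl (INR 2). ring. }
assert (O2 : om k ^ 2 = - (4) * RtoC (kk k) ^ 2).
{ rewrite om_kk. transitivity (2 * 2 * (Ci * Ci) * RtoC (kk k) ^ 2). simpl; ring. rewrite Ci2. replace (RtoC 4) with (RtoC (2 * 2)) by (do 2 f_equal; ring). rewrite RtoC_mult. ring. }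
(* The geometric factor collects 4 from (2q)!, M^2 from the L-value, pi i / M from the formal series
   and the square of [om k] from the Fourier denominators. *)
assert (BASE : (RtoC 4 * (INR M * INR M) * (PI * Ci / INR M) / om k ^ 2) ^ q = (- Ci / alp M k) ^ q).
{ f_equal. rewrite O2, alp_kk by auto. simpl Cpow. field. repeat split; auto; apply RtoC_neq0; lra. }
rewrite alp_kk in * by auto.
assert (OM : om k ^ S (2 * S q + nu) = om k ^ S nu * om k ^ 2 * (om k ^ 2) ^ q).
{ rewrite <- Cpow_mult_r, <- !Cpow_add_r. f_equal. lia. }
assert (MP : RtoC (INR M ^ (2 * S q + nu)) = RtoC (INR M) ^ (2 + nu) * (RtoC (INR M) * RtoC (INR M)) ^ q).
{ rewrite <- RtoC_mult, <- !RtoC_pow, <- RtoC_mult. f_equal. rewrite Rpow_mult_distr, <- !pow_add. f_equal. lia. }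
assert (P4 : RtoC (4 ^ q) = RtoC 4 ^ q) by apply RtoC_pow.
assert (NZ : forall z : C, z <> 0 -> z ^ q <> 0) by (intros; now apply Cpow_nz).
assert (O20 : om k ^ 2 <> 0) by (apply Cpow_nz, om_neq0).
assert (Y : (RtoC 4 * (INR M * INR M) * (PI * Ci / INR M) / om k ^ 2) ^ q = RtoC 4 ^ q * (RtoC (INR M) * RtoC (INR M)) ^ q * (PI * Ci / INR M) ^ q / (om k ^ 2) ^ q).
{ unfold Cdiv. rewrite !Cpow_mult_l, !Cpow_inv by auto. reflexivity. }
rewrite Y in BASE. rewrite <- BASE. rewrite OM, RtoC_mult, MP.
set (A4 := RtoC 4 ^ q) in *. set (AM := (RtoC (INR M) * RtoC (INR M)) ^ q). set (AP := (PI * Ci / INR M) ^ q). set (AO := (om k ^ 2) ^ q) in *.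
assert (AO0 : AO <> 0) by (apply NZ; auto).
replace ((PI * Ci / INR M) ^ S q) with ((PI * Ci / INR M) * AP) by (unfold AP; simpl; ring).
rewrite (INR_fact_S q), RtoC_mult, RtoC_plus.
destruct nu as [|[|]]; [| |lia].
- replace (2 * S q + 0)%nat with (2 * S q)%nat by lia. rewrite F2, kc_1, !RtoC_mult, !RtoC_plus, P4, !RtoC_mult, O2. fold A4. rewrite sgz_0. replace (om k ^ 1) with (2 * Ci * kk k) by (rewrite om_kk; simpl; ring). unfold qc.
  replace (RtoC 4) with (RtoC (2 * 2)) by (do 2 f_equal; ring). rewrite RtoC_mult. simpl Cpow. field. repeat split; auto.
- replace (2 * S q + 1)%nat with (S (2 * S q)) by lia. rewrite INR_fact_S, F2, kc_2, mult_INR, (S_INR q). replace (INR 2) with 2%R by (simpl; ring). rewrite !RtoC_mult. rewrite RtoC_div by lra.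
  rewrite !RtoC_mult, !RtoC_plus, !RtoC_mult, ?RtoC_plus, P4, O2. fold A4. rewrite sgz_1. unfold qc.
  replace (RtoC 3) with (RtoC (2 + 1)) by (do 2 f_equal; ring). replace (RtoC 8) with (RtoC (2 * 2 * 2)) by (do 2 f_equal; ring).
  replace (RtoC 4) with (RtoC (2 * 2)) by (do 2 f_equal; ring). rewrite !RtoC_mult, !RtoC_plus.
  simpl Cpow. field. repeat split; auto.
Qed.

(** Makes the germ of [phi] at 0 the Borel transform of the formal series: the constant term is left
    out and the index shifts to [S q]. *)
Lemma phi_coef_eq (M nu q : nat) (g : Z -> C) : (0 < M)%nat -> (nu <= 1)%nat -> periodic M g -> parity nu g ->
  phi_coef M nu g q = Theta_tilde M nu g (S q) / INR (fact q).
Proof.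
intros HM Hnu Hg Hp. unfold phi_coef, Theta_tilde.
rewrite (Lfun_eq M). 2, 3: auto.
2:{ intros E. apply (f_equal Re) in E. rewrite Re_opp, <- RtoC_mult, <- RtoC_plus, !Re_RtoC in E. assert (P := pos_INR (S q)). assert (P2 := pos_INR nu). lra. }
replace (- (2 * INR (S q) + INR nu)) with (- INR (2 * S q + nu)).
2:{ rewrite plus_INR, mult_INR, RtoC_plus, RtoC_mult. replace (INR 2) with 2%R by (simpl; ring). ring. }
apply CSeries_unique.
assert (L := L_ext_fourier M nu (2 * S q + nu) g HM ltac:(lia) Hg Hp (sgn_pow q nu)).
apply (is_series_scalC (/ INR (fact (S q)) * (PI * Ci / INR M) ^ S q / INR (fact q))) in L.
match type of L with is_series _ ?v => match goal with |- is_series _ ?w => replace w with v by (unfold Cdiv; ring) end end.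
eapply is_series_extC; [|exact L]. intros k. cbv beta. unfold Dc, Qc.
match goal with |- ?l = ?r => change (@eq C l r) end. rewrite <- (coef_identity M nu q k) by auto. unfold Cdiv. ring.
Qed.

(** * The Borel-Laplace sum *)

(** [Lap_rec] carries the equality from one exponent to the next, its coefficient n + 1/2 being
    nonzero. *)
Lemma Lap_rotate (nu : nat) (e1 e2 s0 u : C) : (nu <= 1)%nat -> dir e1 -> dir e2 -> (0 < Re (e1 * s0))%R -> (0 < Re (e2 * s0))%R ->
  (0 < Re (e1 * u))%R -> (0 < Re (e2 * u))%R -> (0 <= Im u)%R -> Lap (S nu) e1 s0 = Lap (S nu) e2 s0.
Proof.
intros Hnu D1 D2 S1 S2 U1 U2 Hu. assert (CN := Ci_neq0).
assert (ST : forall n, Lap n e1 s0 = Lap n e2 s0 -> Lap (S n) e1 s0 = Lap (S n) e2 s0).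
{ intros n E. assert (R1 := Lap_rec n e1 s0 D1 S1). assert (R2 := Lap_rec n e2 s0 D2 S2).
  assert (NZ : RtoC (INR n) + / 2 <> 0) by (rewrite <- RtoC_inv, <- RtoC_plus by lra; apply RtoC_neq0; assert (P := pos_INR n); lra).
  assert (G : forall L, L = ((INR n + / 2) * Ci * L) / ((INR n + / 2) * Ci)) by (intros L; field; repeat split; auto; rewrite <- RtoC_mult, <- RtoC_plus; apply RtoC_neq0; assert (P := pos_INR n); lra).
  rewrite (G (Lap (S n) e1 s0)), (G (Lap (S n) e2 s0)). f_equal.
  transitivity (1 - s0 * Lap n e1 s0). rewrite <- R1. ring. rewrite E. rewrite <- R2. ring. }
assert (E0 := Lap_rotate0 e1 e2 s0 u D1 D2 S1 S2 U1 U2 Hu). destruct nu as [|[|]]; [| |lia]; auto.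
Qed.

(** * Directions and the surface of the logarithm *)

Definition ei (theta : R) : C := cexp (Ci * theta).
Lemma ei_eq (theta : R) : ei theta = (cos theta, sin theta).
Proof. apply cexp_Ci. Qed.
Lemma Cmod_ei (theta : R) : Cmod (ei theta) = 1%R.
Proof. unfold ei. rewrite Cmod_cexp, <- exp_0. f_equal. rewrite Re_mult, Re_Ci, Im_RtoC. ring. Qed.
Lemma ei_add (a b : R) : ei a * ei b = ei (a + b).
Proof. unfold ei. rewrite <- cexp_add, RtoC_plus. f_equal. ring. Qed.
Lemma ei_2PI (theta : R) : ei (theta - 2 * PI) = ei theta.
Proof.
rewrite !ei_eq. f_equal.
rewrite <- (cos_period (theta - 2 * PI) 1). f_equal. simpl (INR 1). ring.
rewrite <- (sin_period (theta - 2 * PI) 1). f_equal. simpl (INR 1). ring.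
Qed.
Lemma cexp_polar (z : C) : cexp z = RtoC (exp (Re z)) * ei (Im z).
Proof. rewrite ei_eq. unfold cexp. apply Ceq; simpl; ring. Qed.
Lemma Re_ei_cexp (theta : R) (zeta : C) : Re (ei theta * cexp (- zeta)) = (exp (- Re zeta) * cos (theta - Im zeta))%R.
Proof.
rewrite cexp_polar, Re_opp, Im_opp. replace (ei theta * (RtoC (exp (- Re zeta)) * ei (- Im zeta))) with (RtoC (exp (- Re zeta)) * (ei theta * ei (- Im zeta))) by ring.
rewrite ei_add, ei_eq, Re_mult, Re_RtoC, Im_RtoC. simpl. unfold Rminus. ring.
Qed.
Lemma Re_ei_cexp_pos (theta : R) (zeta : C) : (theta - PI / 2 < Im zeta < theta + PI / 2)%R -> (0 < Re (ei theta * cexp (- zeta)))%R.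
Proof.
intros H. rewrite Re_ei_cexp. apply Rmult_lt_0_compat. apply exp_pos. apply cos_gt_0; lra.
Qed.
Lemma sin_lt_1 (theta : R) : (- (3 * PI / 2) < theta < PI / 2)%R -> (sin theta < 1)%R.
Proof.
intros H. rewrite <- cos_shift. replace (PI / 2 - theta)%R with (2 * ((PI / 2 - theta) / 2))%R by field. rewrite cos_2a_sin.
assert (0 < sin ((PI / 2 - theta) / 2))%R by (apply sin_gt_0; lra). nra.
Qed.
Lemma dir_ei (theta : R) : (- (3 * PI / 2) < theta < PI / 2)%R -> dir (ei theta).
Proof. intros H. split. apply Cmod_ei. rewrite ei_eq. simpl. now apply sin_lt_1. Qed.

Lemma Lap_direction (nu : nat) (th1 th2 al : R) (zeta : C) : (nu <= 1)%nat -> (0 < al)%R ->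
  (- (3 * PI / 2) < th1 < PI / 2)%R -> (- (3 * PI / 2) < th2 < PI / 2)%R ->
  (th1 - PI / 2 < Im zeta < th1 + PI / 2)%R -> (th2 - PI / 2 < Im zeta < th2 + PI / 2)%R ->
  Lap (S nu) (ei th1) (al * cexp (- zeta)) = Lap (S nu) (ei th2) (al * cexp (- zeta)).
Proof.
intros Hnu Hal H1 H2 Z1 Z2. assert (PP := PI_RGT_0).
assert (PS : forall th, (th - PI / 2 < Im zeta < th + PI / 2)%R -> (0 < Re (ei th * (al * cexp (- zeta))))%R).
{ intros th H. replace (ei th * (al * cexp (- zeta))) with (RtoC al * (ei th * cexp (- zeta))) by ring.
  rewrite Re_mult, Re_RtoC, Im_RtoC. assert (T := Re_ei_cexp_pos th zeta H). nra. }
assert (PU : forall a, (0 <= a <= PI)%R -> (- (PI / 2) < th1 + a < PI / 2)%R -> (- (PI / 2) < th2 + a < PI / 2)%R ->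
  Lap (S nu) (ei th1) (al * cexp (- zeta)) = Lap (S nu) (ei th2) (al * cexp (- zeta))).
{ intros a Ha A1 A2. apply (Lap_rotate nu _ _ _ (ei a)); auto using dir_ei.
  rewrite ei_add, ei_eq. apply cos_gt_0; lra. rewrite ei_add, ei_eq. apply cos_gt_0; lra.
  rewrite ei_eq. apply sin_ge_0; lra. }
(* A common escape direction exp (i a) with a in [0, PI] is needed. The natural choice a = -Im zeta
   brings both angles th + a into (-PI / 2, PI / 2). When it falls outside [0, PI] the nearest
   endpoint replaces it, and the bounds -3 PI / 2 and PI / 2 on the directions keep both angles in
   that interval. *)
destruct (Rle_lt_dec (Im zeta) 0) as [A|A]; [destruct (Rle_lt_dec (- PI) (Im zeta)) as [B|B]|].
- apply (PU (- Im zeta)%R); lra.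
- apply (PU PI); lra.
- apply (PU 0%R); lra.
Qed.

Definition BL (M nu : nat) (g : Z -> C) (theta : R) (s : C) : C := Int (fun t => phi M nu g (t * ei theta) * ei theta * cexp (s * - (t * ei theta))).
Lemma BL_spec (M nu : nat) (g : Z -> C) (theta : R) (zeta : C) : (0 < M)%nat -> (nu <= 1)%nat ->
  (- (3 * PI / 2) < theta < PI / 2)%R -> (theta - PI / 2 < Im zeta < theta + PI / 2)%R ->
  cInt (fun t => phi M nu g (t * ei theta) * ei theta * cexp (cexp (- zeta) * - (t * ei theta))) (BL M nu g theta (cexp (- zeta))) /\
  is_cseries (fun k => Qc M nu g k * Lap (S nu) (ei theta) (alp M k * cexp (- zeta))) (BL M nu g theta (cexp (- zeta))).
Proof.
intros HM Hnu Ht Hz. destruct (phi_laplace M nu g (ei theta) (cexp (- zeta)) HM Hnu (dir_ei theta Ht) (Re_ei_cexp_pos theta zeta Hz)) as [V [A B]].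
unfold BL. rewrite (cInt_Int _ _ A). auto.
Qed.
Lemma BL_direction (M nu : nat) (g : Z -> C) (th1 th2 : R) (zeta : C) : (0 < M)%nat -> (nu <= 1)%nat ->
  (- (3 * PI / 2) < th1 < PI / 2)%R -> (- (3 * PI / 2) < th2 < PI / 2)%R ->
  (th1 - PI / 2 < Im zeta < th1 + PI / 2)%R -> (th2 - PI / 2 < Im zeta < th2 + PI / 2)%R ->
  BL M nu g th1 (cexp (- zeta)) = BL M nu g th2 (cexp (- zeta)).
Proof.
intros HM Hnu H1 H2 Z1 Z2. destruct (BL_spec M nu g th1 zeta HM Hnu H1 Z1) as [_ A]. destruct (BL_spec M nu g th2 zeta HM Hnu H2 Z2) as [_ B].
rewrite <- (CSeries_unique _ _ A), <- (CSeries_unique _ _ B). apply CSeries_ext. intros k. f_equal. apply Lap_direction; auto. now apply alp_pos.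
Qed.

(* A direction in which the Laplace integral converges at [zeta], chosen continuously on the whole sector. *)
Definition thz (zeta : C) : R := (- (PI / 2) + (2 / 3) * (Im zeta + PI / 2))%R.
Lemma thz_range (zeta : C) : (- (2 * PI) < Im zeta < PI)%R ->
  (- (3 * PI / 2) < thz zeta < PI / 2)%R /\ (thz zeta - PI / 2 < Im zeta < thz zeta + PI / 2)%R.
Proof. intros H. unfold thz. lra. Qed.
Definition Gext (M nu : nat) (g : Z -> C) (zeta : C) : C := Theta_tilde M nu g 0 + BL M nu g (thz zeta) (cexp (- zeta)).

Lemma Gext_eq (M nu : nat) (g : Z -> C) (theta : R) (zeta : C) : (0 < M)%nat -> (nu <= 1)%nat ->
  (- (3 * PI / 2) < theta < PI / 2)%R -> (- (2 * PI) < Im zeta < PI)%R -> (theta - PI / 2 < Im zeta < theta + PI / 2)%R ->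
  Gext M nu g zeta = Theta_tilde M nu g 0 + BL M nu g theta (cexp (- zeta)).
Proof.
intros HM Hnu Ht Hz H. destruct (thz_range zeta Hz). unfold Gext. f_equal. now apply BL_direction.
Qed.

Lemma Gext_borel_laplace (M nu : nat) (g : Z -> C) (theta : R) (zeta : C) : (0 < M)%nat -> (nu <= 1)%nat -> periodic M g -> parity nu g ->
  (- (3 * PI / 2) < theta < PI / 2)%R -> (theta - PI / 2 < Im zeta < theta + PI / 2)%R ->
  is_borel_laplace (Theta_tilde M nu g) theta zeta (Gext M nu g zeta).
Proof.
intros HM Hnu Hg Hp Ht Hz. split; auto. assert (PP := PI_RGT_0).
exists (phi M nu g), (BL M nu g theta (cexp (- zeta))). destruct (alp_pos M 0 HM) as [A0 _].
destruct (dir_eps (ei theta) (dir_ei theta Ht)) as [eps [E1 E2]]. repeat split.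
- exists (alp M 0 / 4)%R. split; [lra|]. intros xi Hxi. assert (W := wien_analytic _ _ _ _ (phi_germ M nu g HM Hnu) xi).
  replace (xi - 0) with xi in W by ring. specialize (W Hxi).
  replace (fun q => Theta_tilde M nu g (S q) / INR (fact q)) with (phi_coef M nu g); auto.
  apply functional_extensionality. intros q. now apply phi_coef_eq.
- intros t H. eapply wien_le_analytic. apply (phi_wien M nu g eps (ei theta) t); auto. apply Cmod_ei.
- apply cInt_is_RInt_gen. eapply cInt_ext; [|apply (BL_spec M nu g theta zeta); auto]. intros t _. cbv beta. fold (ei theta).
  rewrite cexp_opp. replace (- (t * ei theta) / cexp zeta) with (/ cexp zeta * - (t * ei theta)) by (unfold Cdiv; ring). ring.
- apply Gext_eq; auto. lra.
Qed.

Lemma loc_comp (F u : C -> C) (z : C) : loc F (u z) -> loc u z -> loc (fun z => F (u z)) z.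
Proof.
intros [rho [B [a [Wa Na]]]] [r [B2 W2]]. destruct (wien_le_small u z r B2 rho (proj1 Wa) W2) as [r' [Hr' W']].
exists r', (wnorm a rho). now apply (wien_comp F u z r' rho a).
Qed.
Lemma loc_cexp_opp (z : C) : loc (fun z => cexp (- z)) z.
Proof.
exists 1%R. eexists. eapply wien_le_ext; [|apply (wien_le_cexp (- (1)) z 1); lra]. intros w _. cbv beta. f_equal. ring.
Qed.
Lemma BL_loc (M nu : nat) (g : Z -> C) (theta : R) (s0 : C) : (0 < M)%nat -> (nu <= 1)%nat ->
  (- (3 * PI / 2) < theta < PI / 2)%R -> (0 < Re (ei theta * s0))%R -> loc (BL M nu g theta) s0.
Proof.
intros HM Hnu Ht Hs. destruct (dir_eps (ei theta) (dir_ei theta Ht)) as [eps [E1 E2]]. assert (CE := Cmod_ei theta).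
destruct (param_wien (fun t => phi M nu g (t * ei theta) * ei theta) (fun t => - (t * ei theta)) s0 (Re (ei theta * s0) / 2) (phiB M nu g eps) (Re (ei theta * s0) / 2)) as [W _]; try lra.
- intros t H. apply ccont_mult. eapply wien_le_ccont_ray, phi_wien; eauto. apply ccont_const.
- intros t _. apply (ccont_ext (fun t => - (1) * (RtoC t * ei theta))). intros; ring. apply ccont_mult. apply ccont_const. apply ccont_mult. apply ccont_id. apply ccont_const.
- intros t H. rewrite Cmod_mult, Cmod_opp, Cmod_mult, CE, !Rmult_1_r, Cmod_RtoC_pos by auto.
  replace (Re (s0 * - (t * ei theta)) + Re (ei theta * s0) / 2 * t)%R with (- (Re (ei theta * s0) / 2 * t))%R.
  apply Rmult_le_compat_r. left; apply exp_pos. now apply phi_bound.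
  replace (s0 * - (t * ei theta)) with (RtoC (- t) * (ei theta * s0)) by (rewrite RtoC_opp; ring). rewrite (Re_mult (RtoC (- t))), Re_RtoC, Im_RtoC. field.
- exists (Re (ei theta * s0) / 2 / 2)%R. eexists. eexists. split. exact W. apply Rle_refl.
Qed.

(** Near z the direction is frozen at its value for z, in which the integral still converges on a
    small disc; the moving direction of [Gext] is thus never differentiated. *)
Lemma Gext_analytic (M nu : nat) (g : Z -> C) : (0 < M)%nat -> (nu <= 1)%nat -> analytic_in_sector (- (2 * PI)) PI (Gext M nu g).
Proof.
intros HM Hnu z Hz. destruct (thz_range z Hz) as [T1 T2]. set (th := thz z) in *.
set (d := (Rmin (Rmin (Im z - (th - PI / 2)) (th + PI / 2 - Im z)) (Rmin (Im z + 2 * PI) (PI - Im z)))%R).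
assert (D : (0 < d)%R) by (unfold d; repeat apply Rmin_glb_lt; lra).
assert (D1 : (d <= Im z - (th - PI / 2))%R) by (unfold d; eapply Rle_trans; [apply Rmin_l|apply Rmin_l]).
assert (D2 : (d <= th + PI / 2 - Im z)%R) by (unfold d; eapply Rle_trans; [apply Rmin_l|apply Rmin_r]).
assert (D3 : (d <= Im z + 2 * PI)%R) by (unfold d; eapply Rle_trans; [apply Rmin_r|apply Rmin_l]).
assert (D4 : (d <= PI - Im z)%R) by (unfold d; eapply Rle_trans; [apply Rmin_r|apply Rmin_r]).
assert (L : loc (Gext M nu g) z).
{ apply (loc_ext (fun z => Theta_tilde M nu g 0 + BL M nu g th (cexp (- z))) _ z (d / 2)). lra.
  - intros w Hw. symmetry. assert (I := im_le_Cmod (w - z)). rewrite Im_minus in I. assert (I2 := Rle_trans _ _ _ I Hw). apply Rabs_le_between in I2. apply Gext_eq; auto; lra.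
  - apply loc_plus. apply loc_const. apply (loc_comp (BL M nu g th) (fun z => cexp (- z))). 2: apply loc_cexp_opp.
    apply BL_loc; auto. now apply Re_ei_cexp_pos. }
destruct L as [r [B W]]. now apply (wien_le_analytic _ _ _ _ W).
Qed.

(** * Gevrey asymptotics *)

Lemma pow_exp_bound (d : R) (j : nat) : (0 < d)%R -> exists K, (0 < K)%R /\ forall t, (0 <= t)%R -> (t ^ j * exp (- (d * t)) <= K * exp (- (d / 2 * t)))%R.
Proof.
intros Hd. exists (INR (fact j) * (2 / d) ^ j)%R. assert (F := INR_fact_pos j). assert (P : (0 < 2 / d)%R) by (apply Rdiv_lt_0_compat; lra).
split. apply Rmult_lt_0_compat; auto. now apply pow_lt.
intros t Ht. assert (B := pow_fact_le_exp (d / 2 * t) j ltac:(apply Rmult_le_pos; lra)).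
replace (exp (- (d * t))) with (exp (- (d / 2 * t)) * exp (- (d / 2 * t)))%R by (rewrite <- exp_plus; f_equal; field).
assert (E := exp_pos (- (d / 2 * t))). assert (EE : (exp (d / 2 * t) * exp (- (d / 2 * t)) = 1)%R) by (rewrite <- exp_plus, Rplus_opp_r; apply exp_0).
assert (X1 : (t ^ j <= INR (fact j) * (2 / d) ^ j * exp (d / 2 * t))%R).
{ replace (t ^ j)%R with (INR (fact j) * (2 / d) ^ j * ((d / 2 * t) ^ j / INR (fact j)))%R.
  apply Rmult_le_compat_l; auto. apply Rmult_le_pos. lra. left; now apply pow_lt.
  transitivity ((2 / d) ^ j * (d / 2 * t) ^ j)%R. field; lra. rewrite <- Rpow_mult_distr. f_equal. field. lra. }
apply (Rmult_le_compat_r (exp (- (d / 2 * t)))) in X1; [|lra]. rewrite Rmult_assoc, EE, Rmult_1_r in X1. nra.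
Qed.

(** The Gamma integral along a ray. Integrating the derivative of xi^j exp (-s xi) gives the
    recursion in j, with a boundary term only for j = 0. *)
Lemma monomial_laplace (e s : C) (q : nat) : Cmod e = 1%R -> (0 < Re (e * s))%R ->
  cInt (fun t => (t * e) ^ q * e * cexp (s * - (t * e))) (INR (fact q) / s ^ S q).
Proof.
intros He Hs. set (d := Re (e * s)) in *.
assert (SN : s <> 0) by (intros E; unfold d in Hs; rewrite E, Cmult_0_r in Hs; simpl in Hs; lra).
assert (BD : forall j t, (0 <= t)%R -> Cmod ((t * e) ^ j * e * cexp (s * - (t * e))) = (t ^ j * exp (- (d * t)))%R).
{ intros j t Ht. rewrite !Cmod_mult, Cmod_pow, Cmod_mult, Cmod_lap_exp, He, !Rmult_1_r, Cmod_RtoC_pos by auto. reflexivity. }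
assert (CT : forall j t, ccont (fun t => (RtoC t * e) ^ j * e * cexp (s * - (RtoC t * e))) t).
{ intros j t. apply ccont_mult. apply ccont_mult. apply ccont_pow. apply ccont_mult. apply ccont_id. apply ccont_const. apply ccont_const. apply ccont_lap_exp. }
assert (EX : forall j, cInt (fun t => (t * e) ^ j * e * cexp (s * - (t * e))) (Int (fun t => (t * e) ^ j * e * cexp (s * - (t * e))))).
{ intros j. destruct (pow_exp_bound d j Hs) as [K [K0 HK]]. apply (expdom_cInt _ K (d / 2)). split; [lra|]. split. intros; apply CT.
  intros t Ht. rewrite BD by auto. auto. }
assert (FT : forall j, cInt (fun t => INR j * ((t * e) ^ pred j * e * cexp (s * - (t * e))) - s * ((t * e) ^ j * e * cexp (s * - (t * e)))) (- ((RtoC 0 * e) ^ j * cexp (s * - (RtoC 0 * e))))).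
{ intros j. destruct (pow_exp_bound d j Hs) as [K [K0 HK]].
  apply (cInt_FTC (fun t => (RtoC t * e) ^ j * cexp (s * - (RtoC t * e))) _ (fun t => K * exp (- (d / 2 * t)))%R).
  - intros t Ht. eapply cder_eq. apply cder_mult. apply cder_pow. apply (cder_mult (fun s => RtoC s) (fun _ => e)). apply cder_id. apply cder_const. apply lap_exp_cder. cbv beta. ring.
  - intros t Ht. apply (ccont_ext (fun t => INR j * ((RtoC t * e) ^ pred j * e * cexp (s * - (RtoC t * e))) + - s * ((RtoC t * e) ^ j * e * cexp (s * - (RtoC t * e))))). intros; ring.
    apply ccont_plus; apply ccont_mult; try simple apply ccont_const; apply CT.
  - intros t Ht. rewrite Cmod_mult, Cmod_pow, Cmod_mult, Cmod_lap_exp, He, !Rmult_1_r, Cmod_RtoC_pos by auto. now apply HK.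
  - replace (Finite 0) with (Rbar_mult (Finite K) (Finite 0)) by (simpl; f_equal; ring). apply is_lim_scal_l. apply exp_neg_lim. lra. }
assert (C0 : cexp (s * - (RtoC 0 * e)) = 1) by (rewrite <- cexp_0; f_equal; ring).
induction q.
- simpl (fact 0). assert (F := FT 0%nat). rewrite C0 in F. replace (INR 1 / s ^ 1) with (- / s * - ((RtoC 0 * e) ^ 0 * 1)) by (simpl; field; auto).
  eapply cInt_ext; [|apply (cInt_scal (- / s) _ _ F)]. intros t _. cbv beta. simpl (INR 0). simpl Cpow. field. auto.
- assert (F := FT (S q)). rewrite C0 in F. simpl pred in F.
  apply (cInt_minus _ _ _ _ (cInt_scal (INR (S q)) _ _ IHq)) in F.
  apply (cInt_scal (/ s)) in F.
  replace (INR (fact (S q)) / s ^ S (S q)) with (/ s * (INR (S q) * (INR (fact q) / s ^ S q) - - ((RtoC 0 * e) ^ S q * 1))).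
  eapply cInt_ext; [|exact F]. intros t _. cbv beta. field. auto.
  rewrite INR_fact_S, S_INR, RtoC_mult. simpl Cpow. field. split; auto. apply Cpow_nz; auto.
Qed.

Lemma real_monomial_laplace (n : nat) (C0 d : R) : (0 < d)%R -> rInt (fun t => C0 * t ^ n * exp (- (d * t)))%R (C0 * (INR (fact n) / d ^ S n))%R.
Proof.
intros Hd. apply (rInt_ext (fun t => C0 * (t ^ n * exp (- (d * t))))%R). intros; ring. apply rInt_scal.
assert (H := monomial_laplace 1 d n Cmod_1 ltac:(rewrite Cmult_1_l, Re_RtoC; auto)). destruct H as [H _].
replace (RtoC (INR (fact n)) / RtoC d ^ S n) with (RtoC (INR (fact n) / d ^ S n)) in H.
2:{ rewrite RtoC_div, RtoC_pow. reflexivity. apply pow_nonzero; lra. }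
rewrite Re_RtoC in H. eapply rInt_ext; [|exact H]. intros t _. cbv beta.
replace ((t * 1) ^ n * 1 * cexp (d * - (t * 1))) with (RtoC (t ^ n * exp (- (d * t)))). apply Re_RtoC.
rewrite RtoC_mult, <- cexp_RtoC, RtoC_pow, RtoC_opp, RtoC_mult. replace (t * 1) with (RtoC t) by ring. replace (d * - t) with (- (d * t)) by ring. ring.
Qed.

(** Inside the disc the remainder is a tail of the series. Outside, (|z| / rho)^n >= 1 dominates
    both f(z) and the Taylor polynomial. One estimate therefore holds along a whole ray on which f
    is bounded, and can be integrated there. *)
Lemma wien_remainder (f : C -> C) (rho : R) (a : nat -> C) (z : C) (B : R) (n : nat) : wien f 0 rho a -> (Cmod (f z) <= B)%R ->
  (Cmod (f z - Csum (fun q => a q * z ^ q)%C n) <= (B + wnorm a rho) / rho ^ n * Cmod z ^ n)%R.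
Proof.
intros Wf HB. destruct Wf as [R0 [E F]]. assert (N := Cmod_ge_0 z). assert (B0 : (0 <= B)%R) by (eapply Rle_trans; [apply Cmod_ge_0 | apply HB]).
assert (WN : (0 <= wnorm a rho)%R) by (apply (wnorm_ge0 f 0); split; auto).
assert (T0 : forall q, (0 <= Cmod (a q) * rho ^ q)%R) by (intros; apply wnorm_term_ge0; lra).
replace ((B + wnorm a rho) / rho ^ n * Cmod z ^ n)%R with ((B + wnorm a rho) * (Cmod z / rho) ^ n)%R.
2:{ unfold Rdiv. rewrite Rpow_mult_distr, pow_inv. ring. }
set (x := (Cmod z / rho)%R). assert (X0 : (0 <= x)%R) by (apply Rdiv_le_0_compat; lra).
assert (ZX : Cmod z = (rho * x)%R) by (unfold x; field; lra).
assert (TE : forall q, Cmod (a q * z ^ q) = (Cmod (a q) * rho ^ q * x ^ q)%R) by (intros q; rewrite Cmod_mult, Cmod_pow, ZX, Rpow_mult_distr; ring).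
destruct (Rle_lt_dec x 1) as [L|L].
- assert (HZ : (Cmod (z - 0) <= rho)%R) by (replace (z - 0) with z by ring; rewrite ZX; nra).
  assert (SM : summ (fun q => a q * z ^ q)).
  { eapply summ_ext; [|apply (wien_summ f 0 rho a (z - 0)); auto; split; auto]. intros; cbv beta. f_equal. f_equal. ring. }
  rewrite F by auto. rewrite (CSeries_ext _ (fun q => a q * z ^ q)) by (intros; f_equal; f_equal; ring).
  rewrite (CSeries_split _ n SM).
  match goal with |- (Cmod ?y <= _)%R => replace y with (CSeries (fun k => a (n + k)%nat * z ^ (n + k))) by ring end.
  assert (EX : ex_series (fun k => Cmod (a (n + k)%nat) * rho ^ (n + k))%R) by (apply (ex_series_incr_n (fun q => Cmod (a q) * rho ^ q)%R n); exact E).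
  eapply Rle_trans. apply (CSeries_bound _ (fun k => x ^ n * (Cmod (a (n + k)%nat) * rho ^ (n + k)))%R).
  + intros k. rewrite TE, (pow_add x). assert (V := T0 (n + k)%nat). set (v := (Cmod (a (n + k)%nat) * rho ^ (n + k))%R) in *.
    assert (XK : (x ^ k <= 1)%R) by (rewrite <- (pow1 k); apply pow_incr; lra). assert (XN := pow_le x n X0).
    replace (v * (x ^ n * x ^ k))%R with (x ^ n * v * x ^ k)%R by ring. rewrite <- (Rmult_1_r (x ^ n * v)) at 2. apply Rmult_le_compat_l; auto. now apply Rmult_le_pos.
  + now apply ex_series_scalR.
  + rewrite Series_scal_l. rewrite Rmult_comm. apply Rmult_le_compat_r. now apply pow_le.
    apply Rle_trans with (wnorm a rho); [|lra]. unfold wnorm. destruct n. rewrite (Series_ext _ (fun k => Cmod (a k) * rho ^ k)%R) by (intros; reflexivity). lra.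
    rewrite (Series_incr_n (fun k => Cmod (a k) * rho ^ k)%R (S n)); auto; [|lia].
    assert (0 <= sum_f_R0 (fun k => Cmod (a k) * rho ^ k)%R (pred (S n)))%R by (apply cond_pos_sum; auto). lra.
- assert (XN : (1 <= x ^ n)%R) by (apply pow_R1_Rle; lra).
  eapply Rle_trans; [apply Cmod_triangle_minus|]. rewrite Rmult_plus_distr_r. apply Rplus_le_compat. nra.
  eapply Rle_trans. apply (Cmod_Csum _ (fun q => x ^ n * (Cmod (a q) * rho ^ q))%R).
  + intros q Hq. rewrite TE, Rmult_comm. apply Rmult_le_compat_r. apply T0. apply Rle_pow; lra || lia.
  + rewrite Rsum_scal, Rmult_comm. apply Rmult_le_compat_r. lra. now apply Rsum_le_Series.
Qed.

(** Uniform constants on a closed subsector: the directions [thz] fill a compact interval on which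
    sin stays below 1, and the angle between [thz zeta] and arg tau is a third of the distance of
    arg tau from the midpoint -PI / 2, hence below PI / 2. *)
Lemma subsector_bounds (a b : R) : (a <= b)%R -> (- (2 * PI) < a)%R -> (b < PI)%R -> exists eps c0, (0 < eps <= 1)%R /\ (0 < c0)%R /\
  forall zeta, (a <= Im zeta <= b)%R -> (Im (ei (thz zeta)) <= 1 - eps)%R /\ (c0 / Cmod (cexp zeta) <= Re (ei (thz zeta) * cexp (- zeta)))%R.
Proof.
intros Hab Ha Hb. assert (PP := PI_RGT_0).
set (th := fun y => (- (PI / 2) + (2 / 3) * (y + PI / 2))%R).
destruct (continuity_ab_maj sin (th a) (th b)) as [mx [H1 H2]]. unfold th; lra. intros; apply continuity_sin.
assert (SM : (sin mx < 1)%R) by (apply sin_lt_1; unfold th in H2; lra).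
set (m := Rmax (Rabs (a + PI / 2)) (Rabs (b + PI / 2))).
assert (Hm : (0 <= m < 3 * PI / 2)%R).
{ unfold m. split. eapply Rle_trans; [apply Rabs_pos | apply Rmax_l]. apply Rmax_lub_lt; apply Rabs_def1; lra. }
exists (Rmin 1 (1 - sin mx)), (cos (m / 3)). split; [split|split].
- apply Rmin_glb_lt; lra.
- apply Rmin_l.
- apply cos_gt_0; lra.
- intros zeta Hz. split.
  + rewrite ei_eq. change (Im (cos (thz zeta), sin (thz zeta))) with (sin (thz zeta)).
    assert (H3 := H1 (thz zeta)). assert (R := Rmin_r 1 (1 - sin mx)). specialize (H3 ltac:(unfold thz, th; lra)). lra.
  + rewrite Re_ei_cexp, Cmod_cexp. rewrite (exp_Ropp (Re zeta)). unfold Rdiv at 1. rewrite Rmult_comm.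
    apply Rmult_le_compat_l. left; apply Rinv_0_lt_compat, exp_pos.
    replace (thz zeta - Im zeta)%R with (- ((Im zeta + PI / 2) / 3))%R by (unfold thz; field). rewrite cos_neg.
    assert (HA : (Rabs (Im zeta + PI / 2) <= m)%R).
    { unfold m. assert (M1 := Rmax_l (Rabs (a + PI / 2)) (Rabs (b + PI / 2))). assert (M2 := Rmax_r (Rabs (a + PI / 2)) (Rabs (b + PI / 2))).
      assert (A1 := Rle_abs (- (a + PI / 2))). rewrite Rabs_Ropp in A1. assert (A2 := Rle_abs (b + PI / 2)). apply Rabs_le. lra. }
    replace (cos ((Im zeta + PI / 2) / 3)) with (cos (Rabs (Im zeta + PI / 2) / 3)).
    apply cos_decr_1; assert (R := Rabs_pos (Im zeta + PI / 2)); lra.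
    unfold Rabs. destruct (Rcase_abs (Im zeta + PI / 2)); auto. rewrite <- cos_neg. f_equal. field.
Qed.

(** Watson's lemma: [wien_remainder] bounds the remainder of [phi] by a multiple of (t / rho)^n, and
    the Laplace integral of t^n is n! / d^(n+1) with d at least c0 / |tau|. *)
Lemma Gext_gevrey (M nu : nat) (g : Z -> C) : (0 < M)%nat -> (nu <= 1)%nat -> periodic M g -> parity nu g ->
  gevrey1_in_sector (- (2 * PI)) PI (Gext M nu g) (Theta_tilde M nu g).
Proof.
intros HM Hnu Hg Hp a b Ha Hb. destruct (Rlt_le_dec b a) as [L|Hab].
{ exists 1%R, 1%R, 1%R. split; [lra|split; [lra|split; [lra|intros; lra]]]. }
destruct (subsector_bounds a b Hab Ha Hb) as [eps [c0 [Heps [Hc0 HS]]]].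
set (rho := (alp M 0 / 4)%R). assert (R0 : (0 < rho)%R) by (unfold rho; destruct (alp_pos M 0 HM); lra).
assert (PG := phi_germ M nu g HM Hnu). fold rho in PG. set (W := wnorm (phi_coef M nu g) rho).
assert (W0 : (0 <= W)%R) by (eapply wnorm_ge0; eauto).
set (B := phiB M nu g eps).
assert (HB : forall zeta t, (a <= Im zeta <= b)%R -> (0 <= t)%R -> (Cmod (phi M nu g (t * ei (thz zeta))) <= B)%R).
{ intros zeta t Hz Ht. apply phi_bound; auto. apply Cmod_ei. now apply HS. }
assert (B0 : (0 <= B)%R).
{ assert (X := HB (0, a)%R 0%R ltac:(simpl; lra) ltac:(lra)). eapply Rle_trans; [apply Cmod_ge_0 | exact X]. }
set (t0 := Cmod (Theta_tilde M nu g 0)). assert (T0 : (0 <= t0)%R) by apply Cmod_ge_0.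
assert (REM : forall n zeta, (a <= Im zeta <= b)%R ->
  (Cmod (BL M nu g (thz zeta) (cexp (- zeta)) - Csum (fun q => (Theta_tilde M nu g (S q) * cexp zeta ^ S q)%C) n) <= (B + W) / rho ^ n * (INR (fact n) * (Cmod (cexp zeta) / c0) ^ S n))%R).
{ intros n zeta Hz. destruct (thz_range zeta ltac:(lra)) as [R1 R2]. destruct (BL_spec M nu g (thz zeta) zeta HM Hnu R1 R2) as [BI _].
  destruct (HS zeta Hz) as [_ S2]. set (e := ei (thz zeta)) in *. set (s := cexp (- zeta)) in *. set (d := Re (e * s)) in *.
  assert (CE : Cmod e = 1%R) by apply Cmod_ei. assert (TP : (0 < Cmod (cexp zeta))%R) by (rewrite Cmod_cexp; apply exp_pos).
  assert (D0 : (0 < c0 / Cmod (cexp zeta))%R) by (apply Rdiv_lt_0_compat; auto). assert (Dp : (0 < d)%R) by lra.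
  assert (SI : forall q, Theta_tilde M nu g (S q) * cexp zeta ^ S q = phi_coef M nu g q * (INR (fact q) / s ^ S q)).
  { intros q. rewrite phi_coef_eq by auto. unfold s. rewrite cexp_opp. assert (CN := cexp_neq0 zeta). rewrite Cpow_inv by auto.
    assert (FN : RtoC (INR (fact q)) <> 0) by (apply RtoC_neq0; assert (F := INR_fact_pos q); lra).
    assert (PN : cexp zeta ^ S q <> 0) by now apply Cpow_nz. field. auto. }
  rewrite (Csum_ext _ _ n (fun q _ => SI q)).
  assert (CI : cInt (fun t => phi M nu g (t * e) * e * cexp (s * - (t * e)) - Csum (fun q => phi_coef M nu g q * ((t * e) ^ q * e * cexp (s * - (t * e)))) n)
    (BL M nu g (thz zeta) s - Csum (fun q => phi_coef M nu g q * (INR (fact q) / s ^ S q)) n)).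
  { apply cInt_minus; auto. apply (cInt_Csum (fun q t => phi_coef M nu g q * ((t * e) ^ q * e * cexp (s * - (t * e))))). intros q _.
    apply (cInt_scal (phi_coef M nu g q) (fun t => (t * e) ^ q * e * cexp (s * - (t * e)))). now apply monomial_laplace. }
  assert (BW : (0 <= (B + W) / rho ^ n)%R) by (apply Rdiv_le_0_compat; [lra | now apply pow_lt]).
  apply Rle_trans with ((B + W) / rho ^ n * (INR (fact n) / d ^ S n))%R.
  - apply (cInt_norm_le _ (fun t => (B + W) / rho ^ n * t ^ n * exp (- (d * t)))%R _ _) with (2 := CI). 2: now apply real_monomial_laplace.
    intros t Ht. assert (WR := wien_remainder (phi M nu g) rho (phi_coef M nu g) (t * e) B n PG (HB zeta t Hz Ht)). fold W in WR.
    rewrite Cmod_mult, CE, Rmult_1_r, Cmod_RtoC_pos in WR by auto.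
    match goal with |- (Cmod ?z <= _)%R => replace z with ((phi M nu g (t * e) - Csum (fun q => phi_coef M nu g q * (t * e) ^ q) n) * (e * cexp (s * - (t * e)))) end.
    rewrite !Cmod_mult, CE, Cmod_lap_exp, Rmult_1_l. apply Rmult_le_compat_r; [left; apply exp_pos | exact WR].
    rewrite (Csum_ext (fun q => phi_coef M nu g q * ((t * e) ^ q * e * cexp (s * - (t * e)))) (fun q => (e * cexp (s * - (t * e))) * (phi_coef M nu g q * (t * e) ^ q))) by (intros; ring).
    rewrite Csum_scal. ring.
  - apply Rmult_le_compat_l; auto. unfold Rdiv at 1. apply Rmult_le_compat_l. left; apply INR_fact_pos.
    rewrite <- pow_inv. apply pow_incr. split. left; now apply Rinv_0_lt_compat.
    replace (Cmod (cexp zeta) / c0)%R with (/ (c0 / Cmod (cexp zeta)))%R by (field; lra). now apply Rinv_le_contravar. }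
(* The base 1 / (rho c0) takes one factor from the Taylor radius and one from the opening of the
   sector. Order n + 1 uses [REM] at n, with one spare factor rho and n! <= (n + 1)!. Order 0 adds
   [t0] to [REM] at 0, with |tau| < 1. *)
exists (t0 + (B + W) / c0 + (B + W) * rho + 1)%R, (/ (rho * c0))%R, 1%R.
assert (Q1 : (0 <= (B + W) / c0)%R) by (apply Rdiv_le_0_compat; lra). assert (Q2 : (0 <= (B + W) * rho)%R) by (apply Rmult_le_pos; lra).
assert (IB : (0 < / (rho * c0))%R) by (apply Rinv_0_lt_compat; nra).
split; [lra|split; [auto|split; [lra|]]]. intros N zeta Hz H1. assert (TP : (0 < Cmod (cexp zeta))%R) by (rewrite Cmod_cexp; apply exp_pos).
destruct N as [|n].
- assert (R := REM 0%nat zeta Hz). rewrite Csum_0 in *. simpl pow in *. simpl (INR (fact 0)) in *. unfold Gext.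
  replace (Theta_tilde M nu g 0 + BL M nu g (thz zeta) (cexp (- zeta)) - 0) with (Theta_tilde M nu g 0 + (BL M nu g (thz zeta) (cexp (- zeta)) - 0)) by ring.
  eapply Rle_trans; [apply Cmod_triangle|]. fold t0.
  assert ((B + W) / 1 * (1 * (Cmod (cexp zeta) / c0 * 1)) <= (B + W) / c0)%R.
  { replace ((B + W) / 1 * (1 * (Cmod (cexp zeta) / c0 * 1)))%R with ((B + W) / c0 * Cmod (cexp zeta))%R by (field; lra). nra. }
  lra.
- assert (CS : Csum (fun p => Theta_tilde M nu g p * cexp zeta ^ p) (S n) = Csum (fun q => Theta_tilde M nu g (S q) * cexp zeta ^ S q) n + Theta_tilde M nu g 0).
  { rewrite Csum_S, <- (Csum_shift (fun p => Theta_tilde M nu g p * cexp zeta ^ p)). simpl (cexp zeta ^ 0). ring. }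
  rewrite CS. unfold Gext.
  match goal with |- (Cmod ?z <= _)%R => replace z with (BL M nu g (thz zeta) (cexp (- zeta)) - Csum (fun q => Theta_tilde M nu g (S q) * cexp zeta ^ S q) n) by ring end.
  eapply Rle_trans; [apply (REM n zeta Hz)|].
  replace ((B + W) / rho ^ n * (INR (fact n) * (Cmod (cexp zeta) / c0) ^ S n))%R with ((B + W) * rho * / (rho * c0) ^ S n * INR (fact n) * Cmod (cexp zeta) ^ S n)%R.
  2:{ unfold Rdiv. rewrite !Rpow_mult_distr, !pow_inv. simpl pow. field. repeat split; try lra; apply pow_nonzero; lra. }
  rewrite pow_inv. apply Rmult_le_compat_r. now apply pow_le; lra.
  assert (IP : (0 < / (rho * c0) ^ S n)%R) by (apply Rinv_0_lt_compat, pow_lt; nra).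
  assert (FP := INR_fact_pos n). assert (FS : (INR (fact n) <= INR (fact (S n)))%R) by (rewrite INR_fact_S; assert (P := pos_INR n); nra).
  apply Rmult_le_compat; auto; try lra. apply Rmult_le_pos; lra. apply Rmult_le_compat_r; lra.
Qed.

(** * The discrete Fourier transform and the theorem *)

Lemma Csum_single (F : nat -> C) (n i : nat) : (i < n)%nat -> (forall k, (k < n)%nat -> k <> i -> F k = 0) -> Csum F n = F i.
Proof.
induction n; intros Hi HF. lia. rewrite Csum_S. destruct (Nat.eq_dec i n) as [->|NE].
- rewrite Csum_zero. ring. intros; apply HF; lia.
- rewrite IHn, (HF n). ring. lia. auto. lia. intros; apply HF; lia.
Qed.
Lemma Csum_geom (w : C) (n : nat) : (w - 1) * Csum (fun l => w ^ l) n = w ^ n - 1.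
Proof. induction n. rewrite Csum_0. simpl; ring. rewrite Csum_S, Cmult_plus_distr_l, IHn. simpl. ring. Qed.

Lemma cexp_frac_neq1 (M r : nat) : (0 < r < M)%nat -> cexp (- (2 * PI * Ci * INR r / INR M)) <> 1.
Proof.
intros H E. assert (PP := PI_RGT_0). assert (M1 : (0 < INR r)%R) by (apply lt_0_INR; lia). assert (M2 : (INR r < INR M)%R) by (apply lt_INR; lia).
set (x := (PI * INR r / INR M)%R).
assert (X : (0 < x < PI)%R).
{ unfold x. split. apply Rdiv_lt_0_compat; nra. apply (Rmult_lt_reg_r (INR M)). lra. unfold Rdiv. rewrite Rmult_assoc, Rinv_l by lra. nra. }
replace (- (2 * PI * Ci * INR r / INR M)) with (Ci * RtoC (- (2 * x))) in E.
2:{ unfold x. rewrite RtoC_opp, RtoC_mult, RtoC_div, RtoC_mult by lra. field. apply RtoC_neq0; lra. }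
rewrite cexp_Ci, cos_neg, cos_2a_sin in E. apply (f_equal Re) in E. simpl in E. assert (S := sin_gt_0 x (proj1 X) (proj2 X)). nra.
Qed.
Lemma dker_add (M l : nat) (m n : Z) : (0 < M)%nat -> dker M l m * dker M l n = dker M l (m + n).
Proof. intros HM. unfold dker. rewrite <- cexp_add, plus_IZR, RtoC_plus. f_equal. field. now apply RtoC_INR_neq0. Qed.
Lemma dker_pow (M l : nat) (n : Z) : (0 < M)%nat -> dker M l n = dker M 1 n ^ l.
Proof. intros HM. unfold dker. rewrite cexp_pow. f_equal. simpl (INR 1). field. now apply RtoC_INR_neq0. Qed.
Lemma dker_sym (M l m : nat) : dker M l (Z.of_nat m) = dker M m (Z.of_nat l).
Proof. unfold dker. rewrite <- !INR_IZR_INZ. do 2 f_equal. unfold Cdiv. ring. Qed.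
Lemma dker_orth (M : nat) (n : Z) : (0 < M)%nat -> (n mod Z.of_nat M)%Z <> 0%Z -> Csum (fun l => dker M l n) M = 0.
Proof.
intros HM Hn. rewrite (Csum_ext _ (fun l => dker M 1 n ^ l)) by (intros; now apply dker_pow).
assert (G := Csum_geom (dker M 1 n) M). rewrite <- dker_pow, dker_M in G by auto.
assert (N1 : dker M 1 n <> 1).
{ set (r := Z.to_nat (n mod Z.of_nat M)). assert (B := Z.mod_pos_bound n (Z.of_nat M) ltac:(lia)).
  intros E. apply (cexp_frac_neq1 M r). unfold r; lia. rewrite <- E. unfold dker.
  assert (D := Z.div_mod n (Z.of_nat M) ltac:(lia)).
  transitivity (cexp (- (2 * PI * Ci * INR r / INR M)) * cexp (2 * PI * Ci * IZR (- (n / Z.of_nat M)))).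
  rewrite cexp_2PI. ring. rewrite <- cexp_add. f_equal. rewrite D at 2. rewrite plus_IZR, mult_IZR, opp_IZR, <- INR_IZR_INZ.
  replace (n mod Z.of_nat M)%Z with (Z.of_nat r) by (unfold r; lia). rewrite <- INR_IZR_INZ, RtoC_plus, RtoC_mult, RtoC_opp. simpl (INR 1). field. now apply RtoC_INR_neq0. }
replace (1 - 1) with (RtoC 0) in G by ring. destruct (Cmult_eq0 _ _ G) as [A|A]; auto. exfalso. apply N1.
replace (dker M 1 n) with (dker M 1 n - 1 + 1) by ring. rewrite A. ring.
Qed.
(** After the sums are interchanged, orthogonality of the characters leaves only the residue [a0] of
    -n. *)
Lemma DFT_DFT (M : nat) (g : Z -> C) (n : Z) : (0 < M)%nat -> periodic M g -> DFT M (DFT M g) n = g (- n)%Z.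
Proof.
intros HM Hg. destruct (sqrtM M HM) as [_ [SN SS]]. assert (MN := RtoC_INR_neq0 M HM).
rewrite DFT_eq. rewrite (Csum_ext _ (fun l => / sqrt (INR M) * Csum (fun a => g (Z.of_nat a) * dker M l (Z.of_nat a + n)) M)).
2:{ intros l _. rewrite DFT_eq, <- Cmult_assoc. f_equal. rewrite Cmult_comm, <- Csum_scal. apply Csum_ext. intros a _. rewrite <- dker_add by auto. rewrite (dker_sym M a l). ring. }
rewrite Csum_scal, Csum_swap. set (a0 := Z.to_nat ((- n) mod Z.of_nat M)). assert (B := Z.mod_pos_bound (- n) (Z.of_nat M) ltac:(lia)).
rewrite (Csum_single _ M a0).
- rewrite Csum_scal. assert (D := Z.div_mod (- n) (Z.of_nat M) ltac:(lia)).
  replace (g (Z.of_nat a0)) with (g (- n)%Z). 2: rewrite D at 1; rewrite Z.add_comm, Z.mul_comm, periodic_mulZ by auto; f_equal; unfold a0; lia.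
  rewrite (Csum_ext _ (fun l => 1)).
  2:{ intros l _. apply (cexp_int _ (Z.of_nat l * ((- n) / Z.of_nat M))). replace (Z.of_nat a0 + n)%Z with (- (Z.of_nat M * ((- n) / Z.of_nat M)))%Z by (unfold a0; lia).
      rewrite opp_IZR, !mult_IZR, <- !INR_IZR_INZ, RtoC_opp, !RtoC_mult. field. auto. }
  assert (C1 : forall m, Csum (fun _ => 1) m = INR m). { induction m. reflexivity. rewrite Csum_S, IHm, S_INR, RtoC_plus. reflexivity. }
  rewrite C1, <- SS. field. auto.
- unfold a0; lia.
- intros a Ha NE. rewrite Csum_scal, dker_orth; auto. ring. intros E. apply NE. unfold a0. apply Nat2Z.inj. rewrite Z2Nat.id by lia.
  rewrite <- (Z.mod_small (Z.of_nat a) (Z.of_nat M)) by lia.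
  replace (Z.of_nat a) with (- n + (Z.of_nat a + n))%Z by lia. rewrite Zplus_mod, E, Z.add_0_r, Z.mod_mod by lia. reflexivity.
Qed.

(** The square of the transform is the reflection, so the square of the eigenvalue is the parity
    sign, which is the square of i^(nu+1). *)
Lemma eigenvalue_parity (M nu : nat) (f : Z -> C) (lam : C) : (0 < M)%nat -> periodic M f -> parity nu f -> is_eigenvector M f lam ->
  lam = Ci ^ (nu + 1) \/ lam = - Ci ^ (nu + 1).
Proof.
intros HM Hf Hp [[n Hn] HE].
assert (E2 : DFT M (DFT M f) n = lam * (lam * f n)).
{ rewrite (DFT_eq M (DFT M f) n). rewrite (Csum_ext _ (fun l => lam * (f (Z.of_nat l) * dker M l n))).
  rewrite Csum_scal, <- (HE n), (DFT_eq M f n). ring. intros l _. rewrite HE. ring. }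
rewrite DFT_DFT, Hp in E2 by auto.
assert (Q : (lam - Ci ^ (nu + 1)) * (lam + Ci ^ (nu + 1)) = 0).
{ assert (SI : sgz nu = Ci ^ (nu + 1) * Ci ^ (nu + 1)).
  { rewrite <- Cpow_mult_l, Ci2. unfold sgz. rewrite RtoC_m1. f_equal. lia. }
  destruct (Cmult_eq0 ((lam - Ci ^ (nu + 1)) * (lam + Ci ^ (nu + 1))) (f n)); auto; [|contradiction].
  transitivity (lam * (lam * f n) - Ci ^ (nu + 1) * Ci ^ (nu + 1) * f n). ring. rewrite <- E2, SI. ring. }
destruct (Cmult_eq0 _ _ Q) as [A|A]; [left|right].
replace lam with (lam - Ci ^ (nu + 1) + Ci ^ (nu + 1)) by ring. rewrite A. ring.
replace lam with (lam + Ci ^ (nu + 1) - Ci ^ (nu + 1)) by ring. rewrite A. ring.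
Qed.

Lemma Theta_scal (M nu : nat) (g h : Z -> C) (c tau : C) : (0 < M)%nat -> periodic M g -> (0 < Im tau)%R -> (forall n, h n = c * g n) ->
  Theta M nu h tau = c * Theta M nu g tau.
Proof.
intros HM Hg Ht H. unfold Theta. rewrite <- CSeries_scal by now apply Theta_series. apply CSeries_ext. intros k. rewrite H. ring.
Qed.

(** For an eigenvector the transform of f is lam f. For a pair the transform of the second component
    is the reflection of f, that is [sgz nu] times f, which is the lower left entry of the
    matrix. *)
Lemma obstruction_scalar (M nu d j : nat) (f : Z -> C) (F : nat -> Z -> C) (J : nat -> nat -> C) : (0 < M)%nat -> periodic M f -> parity nu f ->
  theta_data M nu f d F J -> (j < d)%nat ->
  periodic M (F j) /\ parity nu (F j) /\ forall sgn tau, (0 < Im tau)%R -> obstruction sgn M nu d F J j tau = scalar_obstruction sgn M nu (F j) tau.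
Proof.
intros HM Hf Hp HD Hj.
assert (T2 : forall tau, (0 < Im tau)%R -> (0 < Im (- / tau))%R).
{ intros tau Ht. assert (N := Im_gt0_neq0 tau Ht). rewrite Im_opp. assert (B := Im_quot_neg tau 1 ltac:(lra) Ht). replace (1 / tau) with (/ tau) in B by (field; auto). lra. }
destruct HD as [lam HE | HE].
- split; [|split]; auto. intros sgn tau Ht. unfold obstruction, scalar_obstruction. rewrite Csum_S, Csum_0, Cplus_0_l.
  rewrite (Theta_scal M nu f (DFT M f) lam); auto. apply HE.
- assert (Hd := DFT_periodic M f HM). assert (Hd2 := DFT_parity M nu f HM Hf Hp).
  assert (J2 : forall sgn tau F J, obstruction sgn M nu 2 F J j tau = Theta M nu (F j) tau + sgn * Ci ^ nu * powH tau (- (1 / 2) - INR nu)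
    * (J j 0%nat * Theta M nu (F 0%nat) (- / tau) + J j 1%nat * Theta M nu (F 1%nat) (- / tau)) + INR M * mean M (F j) / (2 * PI * Ci * tau)).
  { intros. unfold obstruction. rewrite !Csum_S, Csum_0, Cplus_0_l. reflexivity. }
  destruct j as [|[|]]; [| |lia]; (split; [|split]; auto); intros sgn tau Ht; rewrite J2; unfold scalar_obstruction; cbv iota.
  + replace (0 * Theta M nu f (- / tau) + 1 * Theta M nu (DFT M f) (- / tau)) with (Theta M nu (DFT M f) (- / tau)) by ring. reflexivity.
  + rewrite (Theta_scal M nu f (DFT M (DFT M f)) (sgz nu)); auto.
    replace (RtoC (-1) ^ S nu * Theta M nu f (- / tau) + 0 * Theta M nu (DFT M f) (- / tau)) with (sgz nu * Theta M nu f (- / tau)) by (unfold sgz; ring). reflexivity.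
    intros n. rewrite DFT_DFT by auto. apply Hp.
Qed.

(** The sign of cos theta tells on which side of the singular direction the ray lies, and [ep] has
    to agree with it. *)
Lemma Gext_scalar_obstruction (M nu : nat) (g : Z -> C) (ep theta : R) (tau : C) (zeta : C) : (0 < M)%nat -> (nu <= 1)%nat -> periodic M g -> parity nu g -> (0 < Im tau)%R ->
  (ep = 1 \/ ep = -1)%R -> (0 < ep * cos theta)%R -> (- (3 * PI / 2) < theta < PI / 2)%R -> (- (2 * PI) < Im zeta < PI)%R ->
  (theta - PI / 2 < Im zeta < theta + PI / 2)%R -> cexp zeta = tau -> Gext M nu g zeta = scalar_obstruction ep M nu g tau.
Proof.
intros HM Hnu Hg Hp Ht He Hc Hth Hz Htz Et.
rewrite (Gext_eq M nu g theta) by auto. destruct (BL_spec M nu g theta zeta HM Hnu Hth Htz) as [_ S1].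
assert (TP := Re_ei_cexp_pos theta zeta Htz). rewrite cexp_opp, Et in TP, S1.
assert (S2 := scalar_obstruction_Lap ep M nu g tau (ei theta) HM Hnu Hg Hp Ht He (dir_ei theta Hth) ltac:(rewrite ei_eq; exact Hc) TP).
rewrite cexp_opp, Et. assert (U1 := CSeries_unique _ _ S1). assert (U2 := CSeries_unique _ _ S2). rewrite <- U1.
replace (scalar_obstruction ep M nu g tau) with (scalar_obstruction ep M nu g tau - Theta_tilde M nu g 0 + Theta_tilde M nu g 0) by ring. rewrite <- U2, Cplus_comm. f_equal.
Qed.

Lemma extension_plus (M nu : nat) (g : Z -> C) (G : C -> C) : (0 < M)%nat -> (nu <= 1)%nat -> periodic M g -> parity nu g ->
  (forall tau, (0 < Im tau)%R -> G tau = scalar_obstruction 1 M nu g tau) ->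
  borel_laplace_extension (- (3 * PI / 2)) (PI / 2) (- (2 * PI)) PI G (Theta_tilde M nu g).
Proof.
intros HM Hnu Hg Hp HG. assert (PP := PI_RGT_0). exists (Gext M nu g). split; [|split; [|split]].
- now apply Gext_analytic.
- intros tau Ht. rewrite HG by auto. destruct (argH_bounds tau Ht) as [AB _].
  (* Half the argument of tau is a direction in (0, PI / 2): to the right of the singular direction,
     and within a right angle of arg tau. *)
  apply (Gext_scalar_obstruction M nu g 1 (argH tau / 2)); auto; simpl; try lra. rewrite Rmult_1_l. apply cos_gt_0; lra. now apply cexp_logH.
- intros theta zeta H1 H2. now apply Gext_borel_laplace.
- now apply Gext_gevrey.
Qed.

(** One full turn backwards. It moves the directions (PI / 2, 5 PI / 2) and the sector (0, 3 PI) of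
    G_- to those of [Gext], while the underlying points and rays of the plane stay the same. *)
Definition turn : C := - (2 * PI * Ci).
Lemma Im_turn (z : C) : Im (z + turn) = (Im z - 2 * PI)%R.
Proof. unfold turn. reim. simpl. ring. Qed.
Lemma cexp_turn (z : C) : cexp (z + turn) = cexp z.
Proof. rewrite cexp_add, (cexp_int turn (-1)). ring. unfold turn. rewrite RtoC_m1. ring. Qed.

Lemma extension_minus (M nu : nat) (g : Z -> C) (G : C -> C) : (0 < M)%nat -> (nu <= 1)%nat -> periodic M g -> parity nu g ->
  (forall tau, (0 < Im tau)%R -> G tau = scalar_obstruction (- (1)) M nu g tau) ->
  borel_laplace_extension (PI / 2) (5 * PI / 2) 0 (3 * PI) G (Theta_tilde M nu g).
Proof.
intros HM Hnu Hg Hp HG. assert (PP := PI_RGT_0). exists (fun z => Gext M nu g (z + turn)). split; [|split; [|split]].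
- intros z Hz. destruct (Gext_analytic M nu g HM Hnu (z + turn)) as [a [r [R H]]]. rewrite Im_turn; lra.
  exists a, r. split; auto. intros w Hw. replace (w - z) with (w + turn - (z + turn)) by ring. apply H. replace (w + turn - (z + turn)) with (w - z) by ring. auto.
- intros tau Ht. rewrite HG, <- RtoC_m1 by auto. destruct (argH_bounds tau Ht) as [AB _].
  (* The bisector of arg tau and PI lies in (PI / 2, PI), to the left of the singular direction; 2
     PI is subtracted to reach the turned sheet. *)
  apply (Gext_scalar_obstruction M nu g (-1) (argH tau / 2 + PI / 2 - 2 * PI)); auto; rewrite ?Im_turn; simpl; try lra.
  2: rewrite cexp_turn; now apply cexp_logH.
  replace (cos (argH tau / 2 + PI / 2 - 2 * PI)) with (- sin (argH tau / 2))%R. assert (S := sin_gt_0 (argH tau / 2) ltac:(lra) ltac:(lra)). lra.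
  assert (E := f_equal Re (ei_2PI (argH tau / 2 + PI / 2))). rewrite !ei_eq in E. simpl in E. rewrite E, Rplus_comm. symmetry. rewrite sin_cos. ring.
- intros theta zeta H1 H2. destruct (Gext_borel_laplace M nu g (theta - 2 * PI) (zeta + turn) HM Hnu Hg Hp ltac:(lra) ltac:(rewrite Im_turn; lra)) as [_ [ph [I [A [B [C0 D]]]]]].
  split; auto. assert (E := ei_2PI theta). unfold ei in E. rewrite E in B, C0. rewrite cexp_turn in C0. exists ph, I. auto.
- intros a b Ha Hb. destruct (Gext_gevrey M nu g HM Hnu Hg Hp (a - 2 * PI)%R (b - 2 * PI)%R) as [A [B [r [HA [HB [Hr H]]]]]]; try lra.
  exists A, B, r. repeat split; auto. intros N zeta Hz Hc. assert (X := H N (zeta + turn)). rewrite Im_turn, cexp_turn in X. apply X; auto. lra.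
Qed.

Theorem theorem4 :
  forall (M nu : nat) (f : Z -> C),
    (0 < M)%nat ->
    periodic M f ->
    (nu = 0%nat /\ odd_fun f) \/ (nu = 1%nat /\ even_fun f) ->
    (forall lam : C, is_eigenvector M f lam ->
       lam = Ci ^ (nu + 1) \/ lam = - Ci ^ (nu + 1)) /\
    (forall (d : nat) (F : nat -> Z -> C) (J : nat -> nat -> C),
       theta_data M nu f d F J ->
       forall j : nat, (j < d)%nat ->
         (forall (tau : C) (eps : R),
            (0 < Im tau)%R -> (0 < eps)%R -> (eps < PI - argH tau)%R ->
            is_borel_laplace (Theta_tilde M nu (F j)) (PI / 2 - eps) (logH tau)
              (obstruction 1 M nu d F J j tau)) /\
         (forall (tau : C) (eps : R),
            (0 < Im tau)%R -> (0 < eps)%R -> (eps < argH tau)%R ->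
            is_borel_laplace (Theta_tilde M nu (F j)) (PI / 2 + eps) (logH tau)
              (obstruction (- (1)) M nu d F J j tau)) /\
         borel_laplace_extension (- (3 * PI / 2)) (PI / 2) (- (2 * PI)) PI
           (obstruction 1 M nu d F J j) (Theta_tilde M nu (F j)) /\
         borel_laplace_extension (PI / 2) (5 * PI / 2) 0 (3 * PI)
           (obstruction (- (1)) M nu d F J j) (Theta_tilde M nu (F j))).
Proof.
intros M nu f HM Hf Hpar. assert (PP := PI_RGT_0).
assert (Hnu : (nu <= 1)%nat) by (destruct Hpar as [[-> _]|[-> _]]; lia).
assert (Hp : parity nu f).
{ intros n. destruct Hpar as [[-> H]|[-> H]]; rewrite H; [rewrite sgz_0 | rewrite sgz_1]; ring. }
split. intros lam. now apply eigenvalue_parity.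
intros d F J HD j Hj. destruct (obstruction_scalar M nu d j f F J HM Hf Hp HD Hj) as [Fp [Fpar HO]].
assert (EP := extension_plus M nu (F j) (obstruction 1 M nu d F J j) HM Hnu Fp Fpar (HO 1)).
assert (EM := extension_minus M nu (F j) (obstruction (- (1)) M nu d F J j) HM Hnu Fp Fpar (HO (- (1)))).
split; [|split; [|split; auto]].
- intros tau eps Ht He Ha. destruct EP as [G [_ [HG [HB _]]]]. rewrite <- HG by auto. destruct (argH_bounds tau Ht) as [AB _].
  (* The bound on [eps] says that arg tau exceeds the direction PI / 2 - eps by less than a right
     angle. *)
  apply HB; simpl; lra.
- intros tau eps Ht He Ha. destruct EM as [G [_ [HG [HB _]]]]. rewrite <- HG by auto. destruct (argH_bounds tau Ht) as [AB _].
  apply HB; simpl; lra.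
Qed.
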